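(* Let $M$ be a Stein manifold of complex dimension $2$ and let $\rho\colon M\to\mathbb{R}$ be a continuous plurisubharmonic exhaustion, of class $C^\infty$ on $M_*=\{\rho>0\}$ with $d\rho\neq 0$ on $M_*$. Assume that $\rho$ is of finite type, i.e. every level hypersurface $\{\rho=c\}$, $c>0$, is of finite type; that $M_*$ is connected; and that $u=\log\rho$ satisfies $(dd^cu)^2=0$ on $M_*$. Then the extended Monge-Ampère foliation on $M_*$ is holomorphic.
   Context: Here $dd^c$ denotes a positive constant multiple of $i\partial\bar\partial$. Lower indices on functions denote derivatives in local holomorphic coordinates, e.g. $\rho_{\bar\nu}=\partial\rho/\partial\bar z^\nu$ and $\rho_{\mu\bar\nu}=\partial^2\rho/\partial z^\mu\partial\bar z^\nu$. Let $P\subset M_*$ be the open set where $dd^c\rho>0$. The complex gradient of $\rho$ on $P$ is $Z=\sum_{\mu,\nu}\rho^{\mu\bar\nu}\rho_{\bar\nu}\frac{\partial}{\partial z^\mu}$, where $(\rho^{\mu\bar\nu})$ is defined by $\sum_\nu\rho^{\mu\bar\nu}\rho_{\alpha\bar\nu}=\delta_{\alpha\mu}$. Extended Monge-Ampère foliation: under the stated hypotheses $P$ is dense in $M_*$ and $Z$ extends (uniquely) to a nowhere zero $C^\infty$ vector field of type $(1,0)$ on $M_*$, which generates an integrable complex line subbundle $\mathcal{A}$ of $T^{1,0}M_*$ (integrable meaning that the underlying distribution of real $2$-planes is Frobenius integrable). On $P$, $\mathcal{A}$ equals $\mathrm{Ann}(dd^cu)$, the bundle of $(1,0)$ vectors $V$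 with $dd^cu(V,\bar W)=0$ for all $(1,0)$ vectors $W$. The foliation of $M_*$ defined by $\mathcal{A}$, whose leaves are Riemann surfaces, is the extended Monge-Ampère foliation. It is holomorphic if near each point of $M_*$ there are holomorphic coordinates $z_1,z_2$ in which the leaves are given by $z_2=\text{const}$. Finite type (Kohn, Bloom–Graham): let $S$ be a real hypersurface in a complex manifold, $p\in S$, and let $r\colon U\to\mathbb{R}$ be a local defining function of $S$ near $p$ ($U\cap S=\{r=0\}$, $dr\ne0$ on $U\cap S$). Let $\mathcal{L}^0$ be the $C^\infty(U)$-module generated by the $(1,0)$ vector fields $W$ on $U$ with $\partial r(W)=0$ on $S$ and by their conjugates. For $k>0$ let $\mathcal{L}^k$ be the $C^\infty(U)$-module generated by these fields and their brackets of length at most $k$, i.e. generated by $\mathcal{L}^{k-1}$ and the brackets $[V,W]$ with $V\in\mathcal{L}^{k-1}$, $W\in\mathcal{L}^0$. The point $p$ is of type $m$ if $\partial r(W)=0$ at $p$ for all $W\in\mathcal{L}^k$, $k=0,\dots,m-1$, and there is $Y\in\mathcal{L}^m$ with $\partial r(Y)\neq0$ at $p$. $S$ is of finite type if each $p\in S$ is of type $m$ for some $m$ depending on $p$. *)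

(* Defs.v *)
From HB Require Import structures.
From mathcomp Require Import all_boot all_order all_algebra.
From mathcomp Require Import complex.
From mathcomp Require Import all_classical all_reals all_analysis.

Set Implicit Arguments.
Unset Strict Implicit.
Unset Printing Implicit Defensive.

Import Order.TTheory GRing.Theory Num.Theory numFieldNormedType.Exports.

Local Open Scope classical_set_scope.
Local Open Scope ring_scope.

HB.instance Definition _ (R : realType) := NormedModule.copy R[i] (R[i])^o.

Section Calculus.
Context {R : realType}.
Local Notation C := R[i].
Local Notation V := 'rV[R[i]]_2.

(* Derivatives along real directions in C^2 = R^4. The library's derive needs
   the source and target to be normed modules over the same field, whereas here
   the parameter is real and the modules are complex. *)
Definition rquot (f : V -> C) (x v : V) (t : R) : C :=
  (t^-1)%:C%C * (f (x + t%:C%C *: v) - f x).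

Definition rderivable (f : V -> C) (v x : V) : Prop :=
  cvg (rquot f x v @ 0^').

Definition rderive (f : V -> C) (v x : V) : C := lim (rquot f x v @ 0^').

Fixpoint Ck (k : nat) (D : set V) (f : V -> C) : Prop :=
  (forall x, D x -> {for x, continuous f}) /\
  if k is k'.+1 then
    forall v : V, (forall x, D x -> rderivable f v x) /\ Ck k' D (rderive f v)
  else True.

(* Meant for open D. *)
Definition smooth_on (D : set V) (f : V -> C) : Prop := forall k, Ck k D f.

(* Wirtinger derivatives d/dz^mu and d/d(conj z)^mu. *)
Definition dz (mu : 'I_2) (f : V -> C) (x : V) : C :=
  2^-1 * (rderive f (delta_mx 0 mu) x
          - 'i * rderive f ('i *: delta_mx 0 mu) x).

Definition dzb (mu : 'I_2) (f : V -> C) (x : V) : C :=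
  2^-1 * (rderive f (delta_mx 0 mu) x
          + 'i * rderive f ('i *: delta_mx 0 mu) x).

(* A complexified tangent vector sum_mu a^mu d/dz^mu + b^mu d/d(conj z)^mu is
   represented by the pair (a, b); it has type (1,0) when b = 0. *)
Definition conjv (X : V * V) : V * V :=
  (map_mx Num.conj X.2, map_mx Num.conj X.1).

Definition del (f : V -> C) (x : V) (X : V * V) : C :=
  \sum_mu X.1 0 mu * dz mu f x.

Definition vapply (X : V * V) (f : V -> C) (x : V) : C :=
  \sum_mu (X.1 0 mu * dz mu f x + X.2 0 mu * dzb mu f x).

Definition levi (f : V -> C) (x : V) : 'M[C]_2 :=
  \matrix_(mu, nu) dz mu (dzb nu f) x.

(* The 2-form i del delbar f; the positive constant in dd^c plays no role. *)
Definition ddc (f : V -> C) (x : V) (X Y : V * V) : C :=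
  'i * \sum_mu \sum_nu
         levi f x mu nu * (X.1 0 mu * Y.2 0 nu - Y.1 0 mu * X.2 0 nu).

Definition wedge2 (w w' : V * V -> V * V -> C) (X1 X2 X3 X4 : V * V) : C :=
  w X1 X2 * w' X3 X4 - w X1 X3 * w' X2 X4 + w X1 X4 * w' X2 X3
  + w X2 X3 * w' X1 X4 - w X2 X4 * w' X1 X3 + w X3 X4 * w' X1 X2.

(* Sub-mean value property on all closed discs in D; used for continuous f. *)
Definition psh_on (D : set V) (f : V -> R) : Prop :=
  forall a w : V, (forall zeta : C, `|zeta| <= 1 -> D (a + zeta *: w)) ->
    f a <= (2 * pi)^-1 *
      \int[lebesgue_measure]_(t in `[0, 2 * pi])
         f (a + (cos t +i* sin t)%C *: w).

Definition holo_on (W : normedModType C) (D : set V) (f : V -> W) : Prop :=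
  forall x, D x -> differentiable f x.

End Calculus.

Section FiniteType.
Context {R : realType}.
Local Notation C := R[i].
Local Notation V := 'rV[R[i]]_2.
Local Notation vfield := ('rV[R[i]]_2 -> 'rV[R[i]]_2 * 'rV[R[i]]_2).

Definition smooth_vfield (D : set V) (X : vfield) : Prop :=
  forall mu : 'I_2, smooth_on D (fun x => (X x).1 0 mu)
                 /\ smooth_on D (fun x => (X x).2 0 mu).

Definition bracket (X Y : vfield) : vfield := fun x =>
  (\row_mu (vapply (X x) (fun y => (Y y).1 0 mu) x
            - vapply (Y x) (fun y => (X y).1 0 mu) x),
   \row_mu (vapply (X x) (fun y => (Y y).2 0 mu) x
            - vapply (Y x) (fun y => (X y).2 0 mu) x)).

Inductive smooth_span (D : set V) (G : set vfield) : set vfield :=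
| span_gen X : G X -> smooth_span D G X
| span_zero : smooth_span D G (fun=> 0)
| span_add X Y : smooth_span D G X -> smooth_span D G Y ->
    smooth_span D G (fun x => X x + Y x)
| span_scale (f : V -> C) X : smooth_on D f -> smooth_span D G X ->
    smooth_span D G (fun x => f x *: X x).

Definition tangent10 (D : set V) (r : V -> C) : set vfield :=
  [set W | [/\ smooth_vfield D W, forall x, D x -> (W x).2 = 0
             & forall x, D x -> r x = 0 -> del r x (W x) = 0]].

Definition tangent_fields (D : set V) (r : V -> C) : set vfield :=
  smooth_span D
    (tangent10 D r `|`
     [set X | exists2 W, tangent10 D r W & X = fun x => conjv (W x)]).

Fixpoint brackets (D : set V) (r : V -> C) (k : nat) : set vfield :=
  if k is k'.+1 then
    smooth_span D
      (brackets D r k' `|`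
       [set X | exists2 Y, brackets D r k' Y &
                exists2 W, tangent_fields D r W & X = bracket Y W])
  else tangent_fields D r.

Definition of_type (D : set V) (r : V -> C) (x : V) (m : nat) : Prop :=
  (forall k, (k < m)%N ->
     forall W, brackets D r k W -> del r x (W x) = 0) /\
  exists2 Y, brackets D r m Y & del r x (Y x) != 0.

End FiniteType.

Section Surface.
Context {R : realType} {M : topologicalType}.
Local Notation C := R[i].
Local Notation V := 'rV[R[i]]_2.

(* The values of coord off dom, and of pt off the image of dom, are junk. *)
Record chart := Chart {
  dom : set M;
  coord :> M -> V;
  pt : V -> M;
  dom_open : open dom;
  im_open : open (coord @` dom);
  coordK : forall p, dom p -> pt (coord p) = p;
  coord_cts : forall p, dom p -> {for p, continuous coord};
  pt_cts : forall x, (coord @` dom) x -> {for x, continuous pt} }.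

Implicit Types (A : set chart) (phi psi : chart) (U S : set M) (p q : M).
Implicit Types (rho r : M -> R) (Z : chart -> M -> V).

Definition transition phi psi : V -> V := fun x => psi (pt phi x).

Definition compatible phi psi : Prop :=
  holo_on (phi @` (dom phi `&` dom psi)) (transition phi psi) /\
  holo_on (psi @` (dom phi `&` dom psi)) (transition psi phi).

(* A is a maximal holomorphic atlas, so that membership in A means being a
   local holomorphic coordinate system. *)
Record complex_surface A : Prop := ComplexSurface {
  surface_hausdorff : hausdorff_space M;
  surface_countable : @second_countable M;
  atlas_cover : forall p, exists2 phi, A phi & dom phi p;
  atlas_compatible : forall phi psi, A phi -> A psi -> compatible phi psi;
  atlas_maximal : forall phi,
    (forall psi, A psi -> compatible phi psi) -> A phi }.

Definition holomorphic A (f : M -> C) : Prop :=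
  forall phi, A phi -> holo_on (phi @` dom phi) (fun x => f (pt phi x)).

Definition holo_hull A (K : set M) : set M :=
  [set p | forall f, holomorphic A f ->
     forall B : C, (forall q, K q -> `|f q| <= B) -> `|f p| <= B].

Record stein A : Prop := Stein {
  stein_convex : forall K, compact K -> compact (holo_hull A K);
  stein_separated : forall p q, p <> q ->
    exists2 f, holomorphic A f & f p <> f q;
  stein_coordinates : forall p, exists phi,
    [/\ A phi, dom phi p & forall mu : 'I_2,
        exists2 f, holomorphic A f & forall q, dom phi q -> f q = phi q 0 mu] }.

Definition loc phi (g : M -> R) : V -> C := fun x => (g (pt phi x))%:C%C.

Definition smooth_fun A U (g : M -> R) : Prop :=
  forall phi, A phi -> smooth_on (phi @` (dom phi `&` U)) (loc phi g).

Definition nonzero_differential A (g : M -> R) p : Prop :=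
  forall phi, A phi -> dom phi p ->
    exists v : V, rderive (loc phi g) v (phi p) != 0.

Definition psh A rho : Prop :=
  forall phi, A phi -> psh_on (phi @` dom phi) (fun x => rho (pt phi x)).

Definition exhaustion rho : Prop :=
  forall c : R, compact [set p | rho p <= c].

Definition local_defining A S p phi U r : Prop :=
  [/\ [/\ A phi, open U, U `<=` dom phi & U p],
      smooth_fun A U r,
      forall q, U q -> (S q <-> r q = 0) &
      forall q, U q -> S q -> nonzero_differential A r q].

Definition point_of_type A S p (m : nat) : Prop :=
  exists phi U r, local_defining A S p phi U r /\
    of_type (phi @` U) (loc phi r) (phi p) m.

Definition finite_type A S : Prop :=
  forall p, S p -> exists m, point_of_type A S p m.

Definition ddc_square_zero A U (g : M -> R) : Prop :=
  forall phi, A phi -> forall p, dom phi p -> U p ->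
    forall X1 X2 X3 X4 : V * V,
      wedge2 (ddc (loc phi g) (phi p)) (ddc (loc phi g) (phi p))
             X1 X2 X3 X4 = 0.

Definition Mstar rho : set M := [set p | 0 < rho p].

(* Positivity of a real (1,1)-form w: -i w(v, conj v) > 0 for v != 0 in T^{1,0}. *)
Definition ddc_positive A (g : M -> R) p : Prop :=
  forall phi, A phi -> dom phi p -> forall v : V, v != 0 ->
    0 < - 'i * ddc (loc phi g) (phi p) (v, 0) (conjv (v, 0)).

(* rho^{mu nubar} is an entry of the transposed inverse of (rho_{mu nubar}). *)
Definition complex_gradient phi rho p : V :=
  \row_mu \sum_nu (invmx (levi (loc phi rho) (phi p)))^T mu nu
                  * dzb nu (loc phi rho) (phi p).

(* A field of (1,0) vectors on U is given by its components Z phi in each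
   coordinate system phi, transforming by the holomorphic differential. *)
Definition vector_field10 A U Z : Prop :=
  forall phi psi, A phi -> A psi ->
    forall p, U p -> dom phi p -> dom psi p ->
      Z psi p = 'd (transition phi psi) (phi p) (Z phi p).

Definition smooth_field10 A U Z : Prop :=
  vector_field10 A U Z /\
  forall phi, A phi -> forall mu : 'I_2,
    smooth_on (phi @` (dom phi `&` U)) (fun x => Z phi (pt phi x) 0 mu).

(* Z is the smooth extension to M_* of the complex gradient, whose complex
   multiples form the line bundle of the extended Monge-Ampere foliation. *)
Definition extended_gradient A rho Z : Prop :=
  smooth_field10 A (Mstar rho) Z /\
  forall p, Mstar rho p -> ddc_positive A rho p ->
    forall phi, A phi -> dom phi p -> Z phi p = complex_gradient phi rho p.

Definition tangent_curve A Z (gamma : R -> M) : Prop :=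
  continuous gamma /\
  forall t phi, A phi -> dom phi (gamma t) ->
    exists lambda : C,
      (s^-1)%:C%C *: (phi (gamma (t + s)) - phi (gamma t)) @[s --> (0 : R)^']
        --> lambda *: Z phi (gamma t).

(* The leaf through p of the foliation generated by Z, restricted to U. *)
Definition leaf A Z U p : set M :=
  [set q | exists gamma : R -> M,
     [/\ tangent_curve A Z gamma, forall t, U (gamma t),
         gamma 0 = p & gamma 1 = q]].

Definition holomorphic_foliation A U Z : Prop :=
  forall p, U p -> exists phi,
    [/\ A phi, dom phi p, dom phi `<=` U &
        forall q, dom phi q ->
          leaf A Z (dom phi) q =
          [set q' | dom phi q' /\ phi q' 0 1 = phi q 0 1]].

End Surface.

Arguments chart : clear implicits.

(* Main.v *)
Require Import Defs.
From HB Require Import structures.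
From mathcomp Require Import all_boot all_order all_algebra.
From mathcomp Require Import complex.
From mathcomp Require Import all_classical all_reals all_analysis.
From mathcomp Require Import ring lra.
Set Implicit Arguments.
Unset Strict Implicit.
Unset Printing Implicit Defensive.
Import Order.TTheory GRing.Theory Num.Theory numFieldNormedType.Exports.
Local Open Scope classical_set_scope.
Local Open Scope ring_scope.

(** On the set where dd^c rho > 0, the Monge-Ampere equation gives
    sum_mu Z^mu rho_{mu nubar} = rho_nubar and Z rho = rho. That set is dense: on an
    open set where the Levi form of the level sets vanishes, all iterated brackets of
    tangent fields remain tangent, against finite type. The two identities therefore
    hold on M_*, and differentiating them gives conj(Z) Z^mu = 0. So dbar Z is
    a rank one matrix modulo Z, with a single coefficient b; beta = |b|^2 does not
    depend on the coordinates and satisfies Z conj(Z) beta = 2 beta^2 + |w|^2 with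
    Z beta = conj(b) w, while Z u = 1. The maximum principle for
    beta (l^2 - (u - u(p))^2)^2 on the compact shell |u - u(p)| <= l gives
    beta(p) l^4 <= 6 l^2 for every l > 0, hence beta = 0. The slope s = Z^2/Z^1 is then
    holomorphic, and the Lie series sum_k (-z_1)^k/k! (d_1 + s d_2)^k z_2 is
    a holomorphic first integral, which together with z_1 straightens the leaves.

    Charts are only assumed to be complex differentiable. Goursat's theorem comes from
    the maximality of the atlas: if e is complex differentiable with small vertical
    Lipschitz constant, then (z_1, z_2 + e) is a chart, rho is smooth in it, and
    comparing the derivatives of rho in both charts shows that those of e are
    differentiable. *)

(** * Norms on C and C^2 *)

(** Two obstacles shape the proof. The first is the global geometry of the leaves, of which nothing
    is known. Where beta > 0, the identities for beta give Z conj(Z) log beta = 2 beta: along the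
    leaves beta is the density of a metric of constant negative curvature, and its vanishing is an
    Ahlfors-Schwarz argument. As Z u = 1, the function u measures the leaves, and shells around p
    exist for every l, which replaces completeness. The maximum is taken over a shell of M_*, not
    over a leaf, and beta must therefore be a function on M_*. Since Z annihilates the functions
    conj(Z^mu), Z conj(Z) is the Levi form in the direction Z, so straight complex discs suffice for
    the maximum principle. The second is regularity: Levi forms and dbar Z are compared between
    charts by differentiating the Jacobians of the transition maps, which is possible only after
    Goursat's theorem. No integral formula enters there: the Cauchy estimates come from a maximum
    principle, and they also control the Lie series. *)

Fact norm_key : unit. Proof. exact: tt. Qed.

Section ComplexPlane.
Context {R : realType}.
Local Notation C := R[i].
Local Notation V := 'rV[R[i]]_2.

(** The norms of [R[i]] and of its row vectors take values in [R[i]]. The estimates run on these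
    real-valued copies, the second being the sup norm, which [lra] can handle; they are locked so
    that conversion never unfolds them. *)
Definition nC : C -> R := locked_with norm_key (@ComplexField.Normc.normc R).
Definition nV : V -> R :=
  locked_with norm_key (fun h => Num.max (nC (h 0 0)) (nC (h 0 1))).

Lemma nVE (h : V) : nV h = Num.max (nC (h 0 0)) (nC (h 0 1)).
Proof. by rewrite /nV unlock. Qed.

Lemma nCE z : nC z = ComplexField.Normc.normc z.
Proof. by rewrite /nC unlock. Qed.

Lemma normC_nC (z : C) : `|z| = (nC z)%:C%C. Proof. by rewrite nCE. Qed.

Lemma nC_ge0 z : 0 <= nC z.
Proof. by have := normr_ge0 z; rewrite normC_nC ler0c. Qed.

Lemma nC0 : nC 0 = 0. Proof. by rewrite nCE ComplexField.Normc.normc0. Qed.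

Lemma nC_eq0 z : (nC z == 0) = (z == 0).
Proof.
apply/eqP/eqP => [|->]; last exact: nC0.
by rewrite nCE; exact: ComplexField.Normc.eq0_normc.
Qed.

Lemma nC_gt0 z : (0 < nC z) = (z != 0).
Proof. by rewrite lt_def nC_ge0 andbT nC_eq0. Qed.

Lemma nC_triangle x y : nC (x + y) <= nC x + nC y.
Proof. by rewrite !nCE le_normcD. Qed.

Lemma nCM x y : nC (x * y) = nC x * nC y.
Proof. by rewrite !nCE ComplexField.Normc.normcM. Qed.

Lemma nCN x : nC (- x) = nC x.
Proof. by rewrite !nCE normcN. Qed.

Lemma nCV x : nC x^-1 = (nC x)^-1.
Proof. by rewrite !nCE ComplexField.Normc.normcV. Qed.

Lemma nC_sub x y : nC (x - y) = nC (y - x).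
Proof. by rewrite -nCN opprB. Qed.

Lemma nC_conj x : nC x^* = nC x.
Proof. by apply: complexI; rewrite -!normC_nC norm_conjC. Qed.

Lemma nC_real (x : R) : nC x%:C%C = `|x|.
Proof. by apply: complexI; rewrite -normC_nC normc_def /= expr0n addr0 sqrtr_sqr. Qed.

Lemma nC_nat n : nC n%:R = n%:R.
Proof. by apply: complexI; rewrite -normC_nC normr_nat rmorph_nat. Qed.

Lemma nC1 : nC 1 = 1. Proof. exact: (nC_nat 1). Qed.

Lemma nCi : nC 'i = 1.
Proof. by apply: complexI; rewrite -normC_nC normCi. Qed.

Lemma nC_sqr x : (nC x ^+ 2)%:C%C = x * x^*.
Proof. by rewrite rmorphXn /= -normC_nC normCK. Qed.

Lemma Re_le_nC z : `|complex.Re z| <= nC z.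
Proof. by have := normc_ge_Re z; rewrite normC_nC lecR. Qed.

Lemma Im_le_nC z : `|complex.Im z| <= nC z.
Proof.
have := Re_le_nC ('i * z).
by rewrite nCM nCi mul1r mulrC -complexiE ReiNIm normrN.
Qed.

Lemma nC_le_ReIm z : nC z <= `|complex.Re z| + `|complex.Im z|.
Proof.
rewrite {1}(complexE z); apply: le_trans (nC_triangle _ _) _.
by rewrite nCM complexiE nCi mul1r !nC_real.
Qed.

Lemma nC_telescope a b c : nC (a - c) <= nC (a - b) + nC (b - c).
Proof. by rewrite -[a - c](subrKA b) nC_triangle. Qed.

Lemma I2_ind (P : 'I_2 -> Prop) : P 0 -> P 1 -> forall i, P i.
Proof.
move=> P0 P1 [[|[|//]] h]; first by congr P: P0; apply: val_inj.
by congr P: P1; apply: val_inj.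
Qed.

Lemma sum2 (F : 'I_2 -> C) : \sum_i F i = F 0 + F 1.
Proof.
rewrite !big_ord_recl big_ord0 addr0; congr (F _ + F _); exact: val_inj.
Qed.

Lemma rowP2 (x y : V) : x 0 0 = y 0 0 -> x 0 1 = y 0 1 -> x = y.
Proof. by move=> h0 h1; apply/rowP; elim/I2_ind. Qed.

Definition vec (a b : C) : V := \row_i (if i == 0 then a else b).

Lemma vec0 a b : vec a b 0 0 = a. Proof. by rewrite mxE eqxx. Qed.
Lemma vec1 a b : vec a b 0 1 = b. Proof. by rewrite mxE. Qed.

Definition cvec (h : V) : V := vec (h 0 0)^* (h 0 1)^*.

Lemma nV_lt (h : V) d : (nV h < d) = (nC (h 0 0) < d) && (nC (h 0 1) < d).
Proof. by rewrite nVE gt_max. Qed.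

Lemma nV_le (h : V) d : (nV h <= d) = (nC (h 0 0) <= d) && (nC (h 0 1) <= d).
Proof. by rewrite nVE ge_max. Qed.

Lemma nC0_le (h : V) : nC (h 0 0) <= nV h. Proof. by rewrite nVE le_max lexx. Qed.
Lemma nC1_le (h : V) : nC (h 0 1) <= nV h. Proof. by rewrite nVE le_max lexx orbT. Qed.

Lemma nCi_le (h : V) (i : 'I_2) : nC (h 0 i) <= nV h.
Proof. elim/I2_ind: i; [exact: nC0_le | exact: nC1_le]. Qed.

Lemma nV_ge0 (h : V) : 0 <= nV h.
Proof. exact: le_trans (nC_ge0 _) (nC0_le h). Qed.

Lemma nV_triangle (h k : V) : nV (h + k) <= nV h + nV k.
Proof.
rewrite nV_le !mxE; apply/andP; split; apply: le_trans (nC_triangle _ _) _;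
  by rewrite lerD // ?nC0_le ?nC1_le.
Qed.

Lemma nVZ (c : C) (h : V) : nV (c *: h) = nC c * nV h.
Proof. by rewrite !nVE !mxE !nCM maxr_pMr // nC_ge0. Qed.

Lemma nV0 : nV 0 = 0. Proof. by rewrite !nVE !mxE nC0 maxxx. Qed.

Lemma nVN (h : V) : nV (- h) = nV h. Proof. by rewrite !nVE !mxE !nCN. Qed.

Lemma nV_sub (x y : V) : nV (x - y) = nV (y - x).
Proof. by rewrite -nVN opprB. Qed.

Lemma nV_telescope (a b c : V) : nV (a - c) <= nV (a - b) + nV (b - c).
Proof. by rewrite -[a - c](subrKA b) nV_triangle. Qed.

Lemma normV_nV (h : V) : `|h| = (nV h)%:C%C.
Proof.
apply/le_anti/andP; split.
  rewrite [leLHS]/Num.Def.normr /= mx_normE.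
  have h0 : 0 <= (nV h)%:C%C :> C by rewrite ler0c nV_ge0.
  rewrite -[leRHS]/(NngNum h0)%:num num_le; apply/bigmax_leP; split=> [|[i j] _].
    by rewrite -num_le.
  by rewrite -num_le /= (ord1 i) normC_nC lecR nCi_le.
have coord j : (nC (h 0 j))%:C%C <= `|h|.
  rewrite -normC_nC [leRHS]/Num.Def.normr /= mx_normE.
  have h1 := normr_ge0 (h 0 j); rewrite -[leLHS]/(NngNum h1)%:num num_le.
  by apply: le_trans (le_bigmax _ _ (0, j)); rewrite -num_le.
by rewrite !nVE maxEle; case: ifP.
Qed.

Lemma posC_real (e : C) : 0 < e -> exists2 d : R, 0 < d & e = d%:C%C.
Proof.
rewrite ltcE => /andP[/eqP e0 er]; exists (complex.Re e) => //.
by apply/eqP; rewrite eq_complex /= eqxx e0 /=.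
Qed.

Lemma nbhsV_P (x : V) (P : set V) :
  nbhs x P <-> exists2 d : R, 0 < d & forall y, nV (y - x) < d -> P y.
Proof.
rewrite -[nbhs x P]/(\near x, P x) nbhs_normP; split=> [[e /= /posC_real[d d0 ->] h]|[d d0 h]].
  exists d => // y; rewrite nV_sub => yd; apply: h => /=.
  by rewrite /= normV_nV ltcR.
exists d%:C%C => /=; first by rewrite ltcR.
by move=> y; rewrite /= normV_nV ltcR nV_sub => /h.
Qed.

Lemma nbhsC_P (x : C) (P : set C) :
  nbhs x P <-> exists2 d : R, 0 < d & forall y, nC (y - x) < d -> P y.
Proof.
rewrite -[nbhs x P]/(\near x, P x) nbhs_normP; split=> [[e /= /posC_real[d d0 ->] h]|[d d0 h]].
  exists d => // y; rewrite nC_sub => yd; apply: h => /=.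
  by rewrite /= normC_nC ltcR.
exists d%:C%C => /=; first by rewrite ltcR.
by move=> y; rewrite /= normC_nC ltcR nC_sub => /h.
Qed.

Lemma openV_P (D : set V) :
  open D <-> forall x, D x -> exists2 d : R, 0 < d & forall y, nV (y - x) < d -> D y.
Proof.
rewrite openE; split=> h x /h; [by move/nbhsV_P|by move=> ?; apply/nbhsV_P].
Qed.

Lemma continuousC_P (f : V -> C) x : {for x, continuous f} <->
  forall e, 0 < e -> exists2 d : R, 0 < d & forall y, nV (y - x) < d -> nC (f y - f x) < e.
Proof.
split=> [fx e e0|h P /nbhsC_P[e e0 eP]]; last first.
  have [d d0 hd] := h e e0; apply/nbhsV_P; exists d => // y /hd; exact: eP.
have : nbhs (f x) [set z | nC (z - f x) < e] by apply/nbhsC_P; exists e.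
by move/fx/nbhsV_P.
Qed.

Lemma continuousV_P (f : V -> V) x : {for x, continuous f} <->
  forall e, 0 < e -> exists2 d : R, 0 < d & forall y, nV (y - x) < d -> nV (f y - f x) < e.
Proof.
split=> [fx e e0|h P /nbhsV_P[e e0 eP]]; last first.
  have [d d0 hd] := h e e0; apply/nbhsV_P; exists d => // y /hd; exact: eP.
have : nbhs (f x) [set z | nV (z - f x) < e] by apply/nbhsV_P; exists e.
by move/fx/nbhsV_P.
Qed.

End ComplexPlane.

(** * Differentiability in Wirtinger form *)

Fact wirtinger_key : unit. Proof. exact: tt. Qed.

Section Derivative.
Context {R : realType}.
Local Notation C := R[i].
Local Notation V := 'rV[R[i]]_2.

Definition lo (r : V -> C) : Prop := forall e : R, 0 < e ->
  exists2 d : R, 0 < d & forall h : V, nV h < d -> nC (r h) <= e * nV h.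

Definition bigO (r : V -> C) : Prop := exists2 K : R, 0 < K &
  exists2 d : R, 0 < d & forall h : V, nV h < d -> nC (r h) <= K * nV h.

Lemma lo_bigO r : lo r -> bigO r.
Proof. by move=> h; exists 1 => //; apply: h. Qed.

Lemma lo0 : lo (fun=> 0).
Proof.
by move=> e e0; exists 1 => // h _; rewrite nC0 mulr_ge0 ?nV_ge0 // ltW.
Qed.

Lemma loD r s : lo r -> lo s -> lo (fun h => r h + s h).
Proof.
move=> hr hs e e0; have e2 : 0 < e / 2 by rewrite divr_gt0.
have [d d0 hd] := hr _ e2; have [d' d0' hd'] := hs _ e2.
exists (Num.min d d'); first by rewrite lt_min d0.
move=> h; rewrite lt_min => /andP[/hd h1 /hd' h2].
apply: le_trans (nC_triangle _ _) _.
by have := nV_ge0 h; lra.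
Qed.

Lemma lo_scale (c : C) r : lo r -> lo (fun h => c * r h).
Proof.
move=> hr e e0; have c1 : 0 < nC c + 1 by rewrite ltr_wpDl // nC_ge0.
have [d d0 hd] := hr (e / (nC c + 1)) (divr_gt0 e0 c1).
exists d => // h /hd hh; rewrite nCM.
apply: le_trans (ler_wpM2l (nC_ge0 c) hh) _.
rewrite mulrA ler_wpM2r ?nV_ge0 // mulrCA ger_pMr // ler_pdivrMr // mul1r.
by rewrite lerDl.
Qed.

Lemma lo_ext r s : (exists2 d, 0 < d & forall h, nV h < d -> s h = r h) -> lo r -> lo s.
Proof.
move=> [d1 d10 hd1] hr e e0; have [d d0 hd] := hr e e0.
exists (Num.min d d1); first by rewrite lt_min d0.
by move=> h; rewrite lt_min => /andP[h1 h2]; rewrite hd1 //; apply: hd.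
Qed.

Lemma bigOD r s : bigO r -> bigO s -> bigO (fun h => r h + s h).
Proof.
move=> [K K0 [d d0 hd]] [L L0 [d' d0' hd']].
exists (K + L); first by rewrite addr_gt0.
exists (Num.min d d'); first by rewrite lt_min d0.
move=> h; rewrite lt_min => /andP[/hd h1 /hd' h2].
by apply: le_trans (nC_triangle _ _) _; rewrite mulrDl lerD.
Qed.

Lemma bigO_mul r s : bigO r -> bigO s -> lo (fun h => r h * s h).
Proof.
move=> [K K0 [d d0 hd]] [L L0 [d' d0' hd']] e e0.
have KL : 0 < K * L by rewrite mulr_gt0.
exists (Num.min (Num.min d d') (e / (K * L))).
  by rewrite !lt_min d0 d0' divr_gt0.
move=> h; rewrite !lt_min => /andP[/andP[/hd h1 /hd' h2] h3].
rewrite nCM; apply: le_trans (ler_pM (nC_ge0 _) (nC_ge0 _) h1 h2) _.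
rewrite mulrACA mulrA ler_wpM2r ?nV_ge0 // mulrC.
by rewrite -ler_pdivlMr // ltW.
Qed.

Definition rlin (a b : 'I_2 -> C) (h : V) : C :=
  a 0 * h 0 0 + a 1 * h 0 1 + (b 0 * (h 0 0)^* + b 1 * (h 0 1)^*).

(** Real differentiability, the differential being given by the coefficients [a] of the dz and [b]
    of their conjugates; [b = 0] is complex differentiability. With the coefficients as arguments
    the rules below compute them, and [wdiff_pz], [wdiff_pb] read them off. *)
Definition wdiff (f : V -> C) (x : V) (a b : 'I_2 -> C) : Prop :=
  lo (fun h => f (x + h) - f x - rlin a b h).

Lemma rlin_bound a b : exists2 K, 0 < K & forall h, nC (rlin a b h) <= K * nV h.
Proof.
exists (nC (a 0) + nC (a 1) + nC (b 0) + nC (b 1) + 1).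
  by rewrite ltr_wpDl // !addr_ge0 ?nC_ge0.
move=> h; have n0 := nV_ge0 h.
have bd c z : nC z <= nV h -> nC (c * z) <= nC c * nV h.
  by move=> hz; rewrite nCM ler_wpM2l ?nC_ge0.
have ha0 := bd (a 0) _ (nC0_le h); have ha1 := bd (a 1) _ (nC1_le h).
have hb0 : nC (b 0 * (h 0 0)^*) <= nC (b 0) * nV h by apply: bd; rewrite nC_conj nC0_le.
have hb1 : nC (b 1 * (h 0 1)^*) <= nC (b 1) * nV h by apply: bd; rewrite nC_conj nC1_le.
rewrite /rlin; apply: le_trans (nC_triangle _ _) _.
have t1 := nC_triangle (a 0 * h 0 0) (a 1 * h 0 1).
have t2 := nC_triangle (b 0 * (h 0 0)^*) (b 1 * (h 0 1)^*).
lra.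
Qed.

Lemma rlin_bigO a b : bigO (rlin a b).
Proof.
have [K K0 h] := rlin_bound a b; exists K => //; exists 1 => // k _; exact: h.
Qed.

Lemma rlinD a b h k : rlin a b (h + k) = rlin a b h + rlin a b k.
Proof. by rewrite /rlin !mxE !rmorphD /=; ring. Qed.

Lemma conjC_realc (t : R) : (t%:C%C : C)^* = t%:C%C.
Proof. by rewrite -[LHS]/(_^*)%C conjc_real. Qed.

Lemma rlinZ a b (t : R) h : rlin a b (t%:C%C *: h) = t%:C%C * rlin a b h.
Proof. by rewrite /rlin !mxE !rmorphM /= conjC_realc; ring. Qed.

Lemma wdiff_bigO f x a b : wdiff f x a b -> bigO (fun h => f (x + h) - f x).
Proof.
move=> /lo_bigO h; have := bigOD h (rlin_bigO a b).
move=> [K K0 [d d0 hd]]; exists K => //; exists d => // k /hd.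
by rewrite subrK.
Qed.

Lemma wdiff_cst (c : C) x : wdiff (fun=> c) x (fun=> 0) (fun=> 0).
Proof.
apply: lo_ext lo0; exists 1 => // h _; rewrite /rlin; ring.
Qed.

Lemma wdiff_coord i x :
  wdiff (fun y : V => y 0 i) x (fun j => (i == j)%:R) (fun=> 0).
Proof.
apply: lo_ext lo0; exists 1 => // h _; rewrite /rlin !mxE.
by elim/I2_ind: i => /=; ring.
Qed.

Lemma wdiffD f g x a b a' b' : wdiff f x a b -> wdiff g x a' b' ->
  wdiff (fun y => f y + g y) x (fun i => a i + a' i) (fun i => b i + b' i).
Proof.
move=> hf hg; apply: lo_ext (loD hf hg); exists 1 => // h _; rewrite /rlin; ring.
Qed.

Lemma wdiffM f g x a b a' b' : wdiff f x a b -> wdiff g x a' b' ->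
  wdiff (fun y => f y * g y) x (fun i => a i * g x + f x * a' i)
    (fun i => b i * g x + f x * b' i).
Proof.
move=> hf hg.
have h1 := lo_scale (g x) hf; have h2 := lo_scale (f x) hg.
have h3 := bigO_mul (wdiff_bigO hf) (wdiff_bigO hg).
apply: lo_ext (loD (loD h1 h2) h3); exists 1 => // h _; rewrite /rlin; ring.
Qed.

Lemma wdiffN f x a b : wdiff f x a b ->
  wdiff (fun y => - f y) x (fun i => - a i) (fun i => - b i).
Proof.
move=> hf; apply: lo_ext (lo_scale (-1) hf); exists 1 => // h _; rewrite /rlin; ring.
Qed.

Lemma wdiffB f g x a b a' b' : wdiff f x a b -> wdiff g x a' b' ->
  wdiff (fun y => f y - g y) x (fun i => a i - a' i) (fun i => b i - b' i).
Proof. by move=> hf hg; apply: wdiffD => //; apply: wdiffN. Qed.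

Lemma wdiff_conj f x a b : wdiff f x a b ->
  wdiff (fun y => (f y)^*) x (fun i => (b i)^*) (fun i => (a i)^*).
Proof.
move=> hf e e0; have [d d0 hd] := hf e e0; exists d => // h /hd.
rewrite -[in X in X -> _]nC_conj.
by rewrite /rlin !(rmorphB, rmorphD, rmorphM) /= !conjCK (addrC ((a 0)^* * _ + _)).
Qed.

(* The increments of f may be confined to a subset P, e.g. the reals for the
   logarithm of a positive function. *)
Lemma wdiff_post (phi : C -> C) (P : C -> Prop) (c : C) f x a b :
  (forall h, P (f (x + h) - f x)) ->
  (forall e : R, 0 < e -> exists2 d : R, 0 < d & forall k, P k -> nC k < d ->
     nC (phi (f x + k) - phi (f x) - c * k) <= e * nC k) ->
  wdiff f x a b ->
  wdiff (fun y => phi (f y)) x (fun i => c * a i) (fun i => c * b i).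
Proof.
move=> hP hphi hf.
have h1 := lo_scale c hf; have [K K0 [d d0 hd]] := wdiff_bigO hf.
suff h2 : lo (fun h => phi (f (x + h)) - phi (f x) - c * (f (x + h) - f x)).
  apply: lo_ext (loD h1 h2); exists 1 => // h _; rewrite /rlin; ring.
move=> e e0; have [d' d0' hd'] := hphi (e / K) (divr_gt0 e0 K0).
exists (Num.min d (d' / K)); first by rewrite lt_min d0 divr_gt0.
move=> h; rewrite lt_min => /andP[/hd h2 h3].
have h4 : nC (f (x + h) - f x) < d'.
  by apply: le_lt_trans h2 _; rewrite mulrC -ltr_pdivlMr.
have := hd' _ (hP h) h4; rewrite (addrC (f x)) subrK => h5.
apply: le_trans h5 _; rewrite -mulrA ler_wpM2l ?(ltW e0) //.
by rewrite mulrC ler_pdivrMr // mulrC.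
Qed.

Lemma wdiffV f x a b : f x != 0 -> wdiff f x a b ->
  wdiff (fun y => (f y)^-1) x (fun i => - (f x) ^- 2 * a i) (fun i => - (f x) ^- 2 * b i).
Proof.
move=> fx0 hf; apply: (@wdiff_post (fun z => z^-1) (fun=> True)) => // e e0.
set m := nC (f x); have m0 : 0 < m by rewrite nC_gt0.
(* The error is k^2 / ((f x)^2 (f x + k)); |k| < m / 2 gives |f x + k| > m / 2, so it is at most 2
   |k|^2 / m^3. *)
exists (Num.min (m / 2) (e * m ^+ 3 / 2)).
  by rewrite lt_min !divr_gt0 ?mulr_gt0 ?exprn_gt0.
move=> k _; rewrite lt_min => /andP[k1 k2].
have hm : m / 2 < nC (f x + k).
  have := nC_triangle (f x + k) (- k); rewrite addrK nCN -/m; lra.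
have fk0 : f x + k != 0 by rewrite -nC_gt0; apply: le_lt_trans hm; rewrite divr_ge0 // ltW.
have -> : (f x + k)^-1 - (f x)^-1 - (- (f x) ^- 2) * k = k ^+ 2 * ((f x) ^- 2 * (f x + k)^-1).
  by field; rewrite ?fx0 ?fk0.
rewrite expr2 -mulrA nCM mulrC ler_wpM2r ?nC_ge0 // !nCM !nCV nCM -/m.
rewrite mulrA ler_pdivrMr; last by apply: lt_trans hm; rewrite divr_gt0.
rewrite ler_pdivrMr ?mulr_gt0 //.
have : e * (m / 2) * (m * m) <= e * nC (f x + k) * (m * m).
  by rewrite ler_wpM2r ?mulr_ge0 ?(ltW m0) // ler_wpM2l ?(ltW e0) // ltW.
move: k2; rewrite !exprS expr0; lra.
Qed.

(** A complex differentiable inner map keeps the dz and their conjugates apart, so [a] and [b] are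
    transformed separately. *)
Lemma wdiff_comp_holo (f : V -> C) (G : V -> V) x a b (c0 c1 : 'I_2 -> C) :
  wdiff f (G x) a b ->
  wdiff (fun y => G y 0 0) x c0 (fun=> 0) -> wdiff (fun y => G y 0 1) x c1 (fun=> 0) ->
  wdiff (fun y => f (G y)) x (fun i => a 0 * c0 i + a 1 * c1 i)
    (fun i => b 0 * (c0 i)^* + b 1 * (c1 i)^*).
Proof.
move=> hf h0 h1.
have [K K0 [d d0 hd]] := wdiff_bigO h0; have [L L0 [d' d0' hd']] := wdiff_bigO h1.
have GO h : nV h < Num.min d d' -> nV (G (x + h) - G x) <= (K + L) * nV h.
  rewrite lt_min => /andP[/hd u /hd' v]; have := nV_ge0 h => n0.
  rewrite nV_le !mxE; apply/andP; split.
    by apply: le_trans u _; rewrite ler_wpM2r // lerDl ltW.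
  by apply: le_trans v _; rewrite ler_wpM2r // lerDr ltW.
have KL : 0 < K + L by rewrite addr_gt0.
have r1 : lo (fun h => f (G (x + h)) - f (G x) - rlin a b (G (x + h) - G x)).
  move=> e e0; have [d1 d10 hd1] := hf (e / (K + L)) (divr_gt0 e0 KL).
  exists (Num.min (Num.min d d') (d1 / (K + L))).
    by rewrite !lt_min d0 d0' divr_gt0.
  move=> h; rewrite lt_min => /andP[/GO u v].
  have w : nV (G (x + h) - G x) < d1.
    by apply: le_lt_trans u _; rewrite mulrC -ltr_pdivlMr.
  have := hd1 _ w; rewrite (addrC (G x)) subrK => w'.
  apply: le_trans w' _; rewrite -mulrA ler_wpM2l ?(ltW e0) //.
  by rewrite mulrC ler_pdivrMr // mulrC.
have r2 := lo_scale (a 0) h0; have r3 := lo_scale (a 1) h1.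
have r4 := lo_scale (b 0) (wdiff_conj h0); have r5 := lo_scale (b 1) (wdiff_conj h1).
apply: lo_ext (loD r1 (loD (loD r2 r3) (loD r4 r5))); exists 1 => // h _.
by rewrite /rlin !mxE !(rmorphB, rmorphD, rmorphM) /= !rmorph0; ring.
Qed.

Lemma wdiff_near f g x a b :
  (exists2 d, 0 < d & forall y, nV (y - x) < d -> f y = g y) ->
  wdiff f x a b -> wdiff g x a b.
Proof.
move=> [d d0 hd] hf; apply: lo_ext hf; exists d => // h hh.
by rewrite !hd // ?subrr ?nV0 // addrC addKr.
Qed.

Lemma wdiff_eq f x a b a' b' : wdiff f x a b ->
  (forall i, a i = a' i) -> (forall i, b i = b' i) -> wdiff f x a' b'.
Proof.
move=> hf ha hb; apply: lo_ext hf; exists 1 => // h _.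
by rewrite /rlin !ha !hb.
Qed.

Lemma wdiff_cts f x a b : wdiff f x a b -> {for x, continuous f}.
Proof.
move=> /wdiff_bigO[K K0 [d d0 hd]]; apply/continuousC_P => e e0.
exists (Num.min d (e / K)); first by rewrite lt_min d0 divr_gt0.
move=> y; rewrite lt_min => /andP[/hd]; rewrite (addrC x) subrK => h1 h2.
by apply: le_lt_trans h1 _; rewrite mulrC -ltr_pdivlMr.
Qed.

Lemma wdiff_ray f x a b (v : V) : wdiff f x a b -> forall e : R, 0 < e ->
  exists2 d : R, 0 < d & forall t : R, `|t| < d ->
    nC (f (x + t%:C%C *: v) - f x - t%:C%C * rlin a b v) <= e * `|t|.
Proof.
move=> hf e e0; have v1 : 0 < nV v + 1 by rewrite ltr_wpDl // nV_ge0.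
have [d d0 hd] := hf (e / (nV v + 1)) (divr_gt0 e0 v1).
exists (d / (nV v + 1)); first by rewrite divr_gt0.
move=> t; rewrite ltr_pdivlMr // => ht.
have h1 : nV (t%:C%C *: v) < d.
  rewrite nVZ nC_real; apply: le_lt_trans ht.
  by rewrite ler_wpM2l ?normr_ge0 // lerDl.
have := hd _ h1; rewrite rlinZ => h2; apply: le_trans h2 _.
rewrite nVZ nC_real -mulrA ler_wpM2l ?(ltW e0) // mulrC -mulrA.
rewrite ler_piMr // ler_pdivrMr // mul1r lerDl //.
Qed.

Lemma wdiff_rquot f x a b (v : V) : wdiff f x a b ->
  rquot f x v @ 0^' --> rlin a b v.
Proof.
move=> /wdiff_ray hf P /nbhsC_P[e e0 eP].
have [d d0 hd] := hf v (e / 2) (divr_gt0 e0 (ltr0n _ 2)).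
rewrite /= /nbhs /=; near=> t; apply: eP.
have t0 : t != 0 by near: t; exact: nbhs_dnbhs_neq.
have td : `|t| < d.
  near: t; apply: dnbhs0_lt; exact: d0.
have := hd t td => h.
have tC : t%:C%C != 0 :> C by rewrite -nC_eq0 nC_real normr_eq0.
have -> : rquot f x v t - rlin a b v =
  (t%:C%C)^-1 * (f (x + t%:C%C *: v) - f x - t%:C%C * rlin a b v).
  by rewrite /rquot fmorphV; field.
rewrite nCM nCV nC_real; apply: (@le_lt_trans _ _ (e / 2)); last by lra.
by rewrite mulrC ler_pdivrMr // normr_gt0.
Unshelve. all: by end_near. Qed.

Lemma wdiff_rderive f x a b (v : V) : wdiff f x a b -> rderive f v x = rlin a b v.
Proof. by move=> /wdiff_rquot h; apply: cvg_lim => //; exact: h. Qed.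

(* dz and dzb, sealed so that unification never unfolds the limits. *)
Definition pz : 'I_2 -> (V -> C) -> V -> C := locked_with wirtinger_key (@dz R).
Definition pb : 'I_2 -> (V -> C) -> V -> C := locked_with wirtinger_key (@dzb R).

Lemma pzE : pz = @dz R. Proof. exact: unlock. Qed.
Lemma pbE : pb = @dzb R. Proof. exact: unlock. Qed.

Lemma wdiff_pz f x a b mu : wdiff f x a b -> pz mu f x = a mu.
Proof.
move=> hf; rewrite pzE /dz !(wdiff_rderive _ hf) /rlin !mxE !eqxx /= .
by elim/I2_ind: mu; rewrite !rmorphM /= conjCi ?rmorph0 ?rmorph1 /=; field: (sqrCi R[i]).
Qed.

Lemma wdiff_pb f x a b mu : wdiff f x a b -> pb mu f x = b mu.
Proof.
move=> hf; rewrite pbE /dzb !(wdiff_rderive _ hf) /rlin !mxE !eqxx /= .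
by elim/I2_ind: mu; rewrite !rmorphM /= conjCi ?rmorph0 ?rmorph1 /=; field: (sqrCi R[i]).
Qed.

End Derivative.

(** * Mean value inequality, and differentiability from continuous directional derivatives *)

Section Smooth.
Context {R : realType}.
Local Notation C := R[i].
Local Notation V := 'rV[R[i]]_2.

Lemma rderivable_eps (f : V -> C) v x : rderivable f v x -> forall e : R, 0 < e ->
  exists2 d : R, 0 < d & forall t, t != 0 -> `|t| < d ->
    nC (rquot f x v t - rderive f v x) < e.
Proof.
move=> fx e e0.
have /fx : nbhs (lim (rquot f x v @ 0^')) [set z | nC (z - rderive f v x) < e].
  by apply/nbhsC_P; exists e.
rewrite /nbhs /= /nbhs /= => /nbhs_ballP[d /= d0 hd]; exists d => // t t0 td.
by apply: hd; rewrite // -ball_normE /= sub0r normrN.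
Qed.

Lemma is_derive_eps (g : R -> R) t D :
  (forall e : R, 0 < e -> exists2 d : R, 0 < d & forall s, s != 0 -> `|s| < d ->
     `|s^-1 * (g (t + s) - g t) - D| < e) -> is_derive t 1 g D.
Proof.
move=> h.
have hc : (fun s : R => s^-1 *: ((g \o shift t) (s *: 1) - g t)) @ 0^' --> D.
  apply/cvgrPdist_lt => e e0; have [d d0 hd] := h e e0.
  near=> s; rewrite distrC /= /shift /= addrC (addrC _ t).
  rewrite [s *: 1]mulr1 (addrC (- D)); apply: hd.
    by near: s; exact: nbhs_dnbhs_neq.
  by near: s; exact: dnbhs0_lt.
apply: DeriveDef; first by apply/cvg_ex; exists D.
by apply: cvg_lim => //.
Unshelve. all: by end_near. Qed.

Section MeanValue.
Variables (f : V -> C) (x v : V) (a b : R) (c : C) (e : R).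
Hypothesis ab : a <= b.
Hypothesis f_der : forall t : R, a <= t <= b ->
  rderivable f v (x + t%:C%C *: v) /\ nC (rderive f v (x + t%:C%C *: v) - c) <= e.

Let real_mvt (P : C -> R) (c' : R) :
  (forall z w, P (z + w) = P z + P w) -> (forall (t : R) z, P (t%:C%C * z) = t * P z) ->
  (forall z, `|P z| <= nC z) -> P c = c' ->
  `|P (f (x + b%:C%C *: v)) - P (f (x + a%:C%C *: v)) - (b - a) * c'| <= e * (b - a).
Proof.
move=> PD PZ PC Pc.
have PB z w : P (z - w) = P z - P w.
  by have := PD (z - w) w; rewrite subrK => ->; rewrite addrK.
pose g (t : R) := P (f (x + t%:C%C *: v)).
have dg t : t \in `[a, b] ->
    is_derive t 1 g (P (rderive f v (x + t%:C%C *: v))).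
  rewrite in_itv /= => /f_der [h1 _]; apply: is_derive_eps => e' e'0.
  have [d d0 hd] := rderivable_eps h1 e'0; exists d => // s s0 sd.
  apply: le_lt_trans (hd s s0 sd).
  rewrite /g -PB -PZ -PB /rquot; apply: le_trans (PC _) _.
  by rewrite rmorphD /= scalerDl addrA.
have cg : {within `[a, b], continuous g}.
  apply: continuous_in_subspaceT => t; rewrite inE /= => /dg [/derivable1_diffP h _].
  exact: differentiable_continuous.
have dg' t : t \in `]a, b[ -> is_derive t 1 g (P (rderive f v (x + t%:C%C *: v))).
  by move/subset_itv_oo_cc; exact: dg.
have [t tab ->] := MVT_segment ab dg' cg.
rewrite mulrC -mulrBr -Pc -PB normrM mulrC (ger0_norm (x := b - a)) ?subr_ge0 //.
rewrite ler_wpM2r ?subr_ge0 //; apply: le_trans (PC _) _.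
by move: tab; rewrite in_itv /= => /f_der[].
Qed.

(** The real mean value theorem is applied to the real and imaginary parts separately, each costing
    [e]; hence the factor 2. *)
Lemma mean_value_ineq :
  nC (f (x + b%:C%C *: v) - f (x + a%:C%C *: v) - (b - a)%:C%C * c) <= 2 * e * (b - a).
Proof.
have ReZ (t : R) (z : C) : complex.Re (t%:C%C * z) = t * complex.Re z.
  by case: z => p q /=; rewrite mul0r subr0.
have ImZ (t : R) (z : C) : complex.Im (t%:C%C * z) = t * complex.Im z.
  by case: z => p q /=; rewrite mul0r addr0.
have ReD (z w : C) : complex.Re (z + w) = complex.Re z + complex.Re w.
  by case: z w => [p q] [p' q'].
have ImD (z w : C) : complex.Im (z + w) = complex.Im z + complex.Im w.
  by case: z w => [p q] [p' q'].
have ReN (z : C) : complex.Re (- z) = - complex.Re z by case: z.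
have ImN (z : C) : complex.Im (- z) = - complex.Im z by case: z.
have h1 := real_mvt ReD ReZ (@Re_le_nC R) erefl.
have h2 := real_mvt ImD ImZ (@Im_le_nC R) erefl.
apply: le_trans (nC_le_ReIm _) _.
rewrite !ReD !ImD !ReN !ImN ReZ ImZ.
by apply: le_trans (lerD h1 h2) _; rewrite -mulrA mulr_natl mulr2n.
Qed.

End MeanValue.

Lemma mean_value_sym (f : V -> C) x v (s : R) (c : C) (e : R) :
  (forall t : R, `|t| <= `|s| ->
    rderivable f v (x + t%:C%C *: v) /\ nC (rderive f v (x + t%:C%C *: v) - c) <= e) ->
  nC (f (x + s%:C%C *: v) - f x - s%:C%C * c) <= 2 * e * `|s|.
Proof.
move=> h; have [s0|s0] := leP 0 s.
  have := @mean_value_ineq f x v 0 s c e s0.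
  rewrite scale0r addr0 subr0 (ger0_norm s0); apply=> t /andP[t0 ts].
  by apply: h; rewrite !ger0_norm.
have := @mean_value_ineq f x v s 0 c e (ltW s0).
rewrite scale0r addr0 sub0r (ltr0_norm s0) rmorphN mulNr opprK => h'.
rewrite -nCN; have -> : - (f (x + s%:C%C *: v) - f x - s%:C%C * c) =
  f x - f (x + s%:C%C *: v) + s%:C%C * c by ring.
apply: h' => t /andP[ts t0].
by apply: h; rewrite (ler0_norm t0) (ltr0_norm s0) lerN2.
Qed.

Lemma wdiff_rderivable f x a b (v : V) : wdiff f x a b -> rderivable f v x.
Proof. by move=> /wdiff_rquot h; apply/cvg_ex; exists (rlin a b v); exact: h. Qed.

Lemma wirtinger_dir (A B : C) (z : C) :
  2^-1 * (A - 'i * B) * z + 2^-1 * (A + 'i * B) * z^* =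
  (complex.Re z)%:C%C * A + (complex.Im z)%:C%C * B.
Proof.
rewrite {1 2}(complexE z) complexiE rmorphD rmorphM /= conjCi !conjC_realc.
have two : 2 != 0 :> C by [].
apply: (mulfI two); rewrite mulrDr !mulrA mulfV // !mul1r.
have := sqrCi C; rewrite expr2 => ii.
rewrite !(mulrDl, mulrDr, mulNr, mulrN) !mulrA.
ring: ii.
Qed.

Lemma rlin_dz (f : V -> C) x h :
  rlin (fun i => pz i f x) (fun i => pb i f x) h =
  (complex.Re (h 0 0))%:C%C * rderive f (delta_mx 0 0) x +
  (complex.Im (h 0 0))%:C%C * rderive f ('i *: delta_mx 0 0) x +
  ((complex.Re (h 0 1))%:C%C * rderive f (delta_mx 0 1) x +
  (complex.Im (h 0 1))%:C%C * rderive f ('i *: delta_mx 0 1) x).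
Proof.
rewrite /rlin pzE pbE /dz /dzb.
move: (rderive f (delta_mx 0 0) x) (rderive f ('i *: delta_mx 0 0) x).
move: (rderive f (delta_mx 0 1) x) (rderive f ('i *: delta_mx 0 1) x).
move: (h 0 0) (h 0 1) => z w A B D E.
rewrite -(wirtinger_dir D E z) -(wirtinger_dir A B w).
by rewrite -!addrA; congr (_ + _); rewrite addrCA.
Qed.

(** The point x + h is reached from x by four moves along the real axes, and the mean value
    inequality compares each of them with the directional derivative at x. *)
Lemma C1_wdiff (f : V -> C) (x : V) (d0 : R) : 0 < d0 ->
  (forall v y, nV (y - x) < d0 -> rderivable f v y) ->
  (forall v, {for x, continuous (rderive f v)}) ->
  wdiff f x (fun i => pz i f x) (fun i => pb i f x).
Proof.
move=> d00 fd fc e e0.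
(* Four moves, each with the factor 2 of [mean_value_sym], add up to 4 * 2 * (e / 8) = e. *)
have e8 : 0 < e / 8 by rewrite divr_gt0.
pose u (i : 'I_2) : V := delta_mx 0 i; pose w (i : 'I_2) : V := 'i *: delta_mx 0 i.
have step v : exists2 d, 0 < d & forall y (s : R), nV v <= 1 -> nV (y - x) + `|s| < d ->
   nC (f (y + s%:C%C *: v) - f y - s%:C%C * rderive f v x) <= 2 * (e / 8) * `|s|.
  have /continuousC_P /(_ _ e8) [d d'0 hd] := fc v.
  exists (Num.min d d0); first by rewrite lt_min d'0.
  move=> y s nv; rewrite lt_min => /andP[h1 h2]; apply: mean_value_sym => t ts.
  have b1 : nV (y + t%:C%C *: v - x) <= nV (y - x) + `|s|.
    rewrite addrAC; apply: le_trans (nV_triangle _ _) _; rewrite lerD2l nVZ nC_real.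
    by apply: le_trans ts; rewrite ler_piMr.
  split; first by apply: fd; exact: le_lt_trans b1 h2.
  by apply/ltW/hd; exact: le_lt_trans b1 h1.
have nu i : nV (u i) <= 1.
  by elim/I2_ind: i; rewrite nV_le /u !mxE /= ?nC0 ?nC1 ?lexx ?ler01.
have nw i : nV (w i) <= 1 by rewrite /w nVZ nCi mul1r nu.
have [d1 d10 s1] := step (u 0); have [d2 d20 s2] := step (w 0).
have [d3 d30 s3] := step (u 1); have [d4 d40 s4] := step (w 1).
(* The corners lie within 3 |h| of x and each move is at most |h| long, so points up to 4 |h| from x
   occur; 8 leaves room. *)
exists (Num.min (Num.min d1 d2) (Num.min d3 d4) / 8).
  by rewrite divr_gt0 // !lt_min d10 d20 d30 d40.
move=> h; rewrite ltr_pdivlMr // !lt_min => /andP[/andP[b1 b2] /andP[b3 b4]].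
pose p i := complex.Re (h 0 i); pose q i := complex.Im (h 0 i).
have np i : `|p i| <= nV h by apply: le_trans (Re_le_nC _) (nCi_le _ _).
have nq i : `|q i| <= nV h by apply: le_trans (Im_le_nC _) (nCi_le _ _).
have hE i : h 0 i = (p i)%:C%C + 'i * (q i)%:C%C by rewrite {1}(complexE (h 0 i)) complexiE.
pose y1 := x + (p 0)%:C%C *: u 0; pose y2 := y1 + (q 0)%:C%C *: w 0.
pose y3 := y2 + (p 1)%:C%C *: u 1.
have y4 : x + h = y3 + (q 1)%:C%C *: w 1.
  rewrite /y3 /y2 /y1 -!addrA; congr (_ + _); apply: rowP2.
    by rewrite !mxE hE /=; ring.
  by rewrite !mxE hE /=; ring.
have n0 := nV_ge0 h.
have k1 : nV (y1 - x) <= nV h.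
  rewrite /y1 (addrC x) addrK nVZ nC_real; apply: le_trans (np 0).
  by rewrite ler_piMr.
have k2 : nV (y2 - x) <= 2 * nV h.
  rewrite /y2 addrAC; apply: le_trans (nV_triangle _ _) _.
  have : nV ((q 0)%:C%C *: w 0) <= nV h.
    by rewrite nVZ nC_real; apply: le_trans (nq 0); rewrite ler_piMr.
  by move: k1; clear; lra.
have k3 : nV (y3 - x) <= 3 * nV h.
  rewrite /y3 addrAC; apply: le_trans (nV_triangle _ _) _.
  have : nV ((p 1)%:C%C *: u 1) <= nV h.
    by rewrite nVZ nC_real; apply: le_trans (np 1); rewrite ler_piMr.
  by move: k2; clear; lra.
have t1 := s1 x (p 0) (nu 0); have t2 := s2 y1 (q 0) (nw 0).
have t3 := s3 y2 (p 1) (nu 1); have t4 := s4 y3 (q 1) (nw 1).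
rewrite subrr nV0 add0r in t1; rewrite -/y1 in t1; rewrite -/y2 in t2.
rewrite -/y3 in t3; rewrite -y4 in t4.
have {}t1 : nC (f y1 - f x - (p 0)%:C%C * rderive f (u 0) x) <= 2 * (e / 8) * `|p 0|.
  by apply: t1; move: (np 0) b1 n0; clear; lra.
have {}t2 : nC (f y2 - f y1 - (q 0)%:C%C * rderive f (w 0) x) <= 2 * (e / 8) * `|q 0|.
  by apply: t2; move: (nq 0) b2 k1 n0; clear; lra.
have {}t3 : nC (f y3 - f y2 - (p 1)%:C%C * rderive f (u 1) x) <= 2 * (e / 8) * `|p 1|.
  by apply: t3; move: (np 1) b3 k2 n0; clear; lra.
have {}t4 : nC (f (x + h) - f y3 - (q 1)%:C%C * rderive f (w 1) x) <= 2 * (e / 8) * `|q 1|.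
  by apply: t4; move: (nq 1) b4 k3 n0; clear; lra.
have -> : f (x + h) - f x - rlin (fun i => pz i f x) (fun i => pb i f x) h =
  (f y1 - f x - (p 0)%:C%C * rderive f (u 0) x) +
  (f y2 - f y1 - (q 0)%:C%C * rderive f (w 0) x) +
  ((f y3 - f y2 - (p 1)%:C%C * rderive f (u 1) x) +
  (f (x + h) - f y3 - (q 1)%:C%C * rderive f (w 1) x)).
  rewrite rlin_dz -/(u 0) -/(u 1) -/(w 0) -/(w 1) -/(p 0) -/(p 1) -/(q 0) -/(q 1).
  have tele (v'1 v'2 v'3 v'4 v'0 c'1 c'2 c'3 c'4 g'1 g'2 g'3 g'4 : C) :
      v'4 - v'0 - (c'1 * g'1 + c'2 * g'2 + (c'3 * g'3 + c'4 * g'4)) =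
      (v'1 - v'0 - c'1 * g'1) + (v'2 - v'1 - c'2 * g'2) + ((v'3 - v'2 - c'3 * g'3) + (v'4 - v'3 - c'4 * g'4)).
    by ring.
  exact: (tele (f y1) (f y2) (f y3)).
have bnd (r z : R) : 0 <= z -> z <= nV h -> r <= 2 * (e / 8) * z -> r <= e / 4 * nV h.
  move=> z0 zh rz; apply: le_trans rz _.
  have -> : 2 * (e / 8) = e / 4 by field.
  by rewrite ler_wpM2l // ltW // divr_gt0.
have := bnd _ _ (normr_ge0 _) (np 0) t1; have := bnd _ _ (normr_ge0 _) (nq 0) t2.
have := bnd _ _ (normr_ge0 _) (np 1) t3; have := bnd _ _ (normr_ge0 _) (nq 1) t4.
move=> {}t4 {}t3 {}t2 {}t1.
apply: le_trans (nC_triangle _ _) _.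
apply: le_trans (lerD (nC_triangle _ _) (nC_triangle _ _)) _.
apply: le_trans (lerD (lerD t1 t2) (lerD t3 t4)) _.
by rewrite -!mulrDl; apply: ler_wpM2r => //; clear; lra.
Qed.

End Smooth.

(** * Symmetry of second derivatives *)

Section Smooth.
Context {R : realType}.
Local Notation C := R[i].
Local Notation V := 'rV[R[i]]_2.

Lemma wdiff_shift (f : V -> C) x k a b : wdiff f (x + k) a b ->
  wdiff (fun y => f (y + k)) x a b.
Proof.
by move=> hf e e0; have [d d0 hd] := hf e e0; exists d => // h; rewrite (addrAC x); exact: hd.
Qed.

Lemma nV_dir (v w : V) (t s : R) : 0 <= s -> `|t| <= s ->
  nV (t%:C%C *: v + s%:C%C *: w) <= s * (nV v + nV w).
Proof.
move=> s0 ts; apply: le_trans (nV_triangle _ _) _; rewrite !nVZ !nC_real (ger0_norm s0).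
by rewrite mulrDr lerD2r ler_wpM2r ?nV_ge0.
Qed.

Definition second_difference (f : V -> C) x v w (s : R) : C :=
  f (x + s%:C%C *: v + s%:C%C *: w) - f (x + s%:C%C *: v) - (f (x + s%:C%C *: w) - f x).

Lemma second_difference_lim (f : V -> C) x (a b : V -> 'I_2 -> C) v w al be (d0 : R) :
  0 < d0 -> (forall y, nV (y - x) < d0 -> wdiff f y (a y) (b y)) ->
  wdiff (fun y => rlin (a y) (b y) v) x al be ->
  forall e : R, 0 < e -> exists2 d : R, 0 < d & forall s : R, 0 < s -> s < d ->
    nC (second_difference f x v w s - (s ^+ 2)%:C%C * rlin al be w) <= e * s ^+ 2.
Proof.
move=> d00 hf hv e e0; set N := nV v + nV w + 1.
have N0 : 0 < N by rewrite ltr_wpDl // addr_ge0 ?nV_ge0.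
have [d1 d10 hd1] := hv (e / (4 * N)) (divr_gt0 e0 (mulr_gt0 (ltr0n _ 4) N0)).
exists (Num.min d0 d1 / N); first by rewrite divr_gt0 // lt_min d00.
move=> s s0; rewrite ltr_pdivlMr // lt_min => /andP[sd0 sd1].
pose F y := f (y + s%:C%C *: w) - f y.
have FD y : nV (y - x) < d0 -> nV (y + s%:C%C *: w - x) < d0 ->
    wdiff F y (fun i => a (y + s%:C%C *: w) i - a y i) (fun i => b (y + s%:C%C *: w) i - b y i).
  by move=> h1 h2; apply: wdiffB (wdiff_shift (hf _ h2)) (hf _ h1).
have small t : `|t| <= s -> nV (t%:C%C *: v + s%:C%C *: w) <= s * N.
  move=> /(nV_dir v w (ltW s0)) h; apply: le_trans h _.
  by rewrite ler_wpM2l ?(ltW s0) // lerDl.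
have small' t : `|t| <= s -> nV (t%:C%C *: v) <= s * N.
  move=> ts; rewrite nVZ nC_real; apply: ler_pM => //; rewrite ?nV_ge0 //.
  by rewrite /N -addrA lerDl addr_ge0 ?nV_ge0.
have := @mean_value_sym _ F x v s (s%:C%C * rlin al be w) (e / 2 * s).
have -> : F (x + s%:C%C *: v) - F x - s%:C%C * (s%:C%C * rlin al be w) =
    second_difference f x v w s - (s ^+ 2)%:C%C * rlin al be w.
  by rewrite /second_difference /F mulrA -rmorphM /= expr2.
rewrite (ger0_norm (ltW s0)) => h.
have -> : e * s ^+ 2 = 2 * (e / 2 * s) * s by field.
apply: h => t ts.
have h1 : nV (x + t%:C%C *: v - x) < d0.
  by rewrite (addrC x) addrK; apply: le_lt_trans (small' _ ts) sd0.
have h2 : nV (x + t%:C%C *: v + s%:C%C *: w - x) < d0.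
  by rewrite addrAC (addrAC x) subrr add0r; apply: le_lt_trans (small _ ts) sd0.
have FDt := FD _ h1 h2.
split; first exact: wdiff_rderivable FDt.
rewrite (wdiff_rderive _ FDt).
have k1 := hd1 _ (le_lt_trans (small' _ ts) sd1).
have k2 := hd1 _ (le_lt_trans (small _ ts) sd1).
rewrite rlinD !rlinZ in k2; rewrite !rlinZ addrA in k1 k2.
set p := rlin (a (x + t%:C%C *: v + s%:C%C *: w)) _ v in k2.
set q := rlin (a (x + t%:C%C *: v)) _ v in k1.
set r := rlin (a x) _ v in k1 k2.
have -> : rlin (fun i => a (x + t%:C%C *: v + s%:C%C *: w) i - a (x + t%:C%C *: v) i)
   (fun i => b (x + t%:C%C *: v + s%:C%C *: w) i - b (x + t%:C%C *: v) i) v = p - q.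
  by rewrite /p /q /rlin; ring.
have -> : p - q - s%:C%C * rlin al be w =
  (p - r - (t%:C%C * rlin al be v + s%:C%C * rlin al be w)) - (q - r - t%:C%C * rlin al be v).
  by move: (p) (q) (r) (rlin al be w) (rlin al be v); clear; move=> *; ring.
apply: le_trans (nC_triangle _ _) _; rewrite nCN.
apply: le_trans (lerD k2 k1) _.
rewrite -mulrDr mulrAC ler_pdivrMr ?mulr_gt0 //.
have := lerD (small _ ts) (small' _ ts) => k3.
apply: le_trans (ler_wpM2l (ltW e0) k3) _.
have -> : s * N + s * N = 2 * (s * N) by rewrite mulr_natl mulr2n.
have -> : e / 2 * s * (4 * N) = e * (2 * (s * N)) by field.
exact: lexx.
Qed.

(** The second difference divided by s^2 tends to both mixed derivatives and is symmetric in v and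
    w. The first derivatives are only required to be differentiable at the single point x, with no
    continuity of second derivatives: this is all that is available in [complex_derivative]. *)
Lemma young (f : V -> C) x (a b : V -> 'I_2 -> C) v w al be al' be' (d0 : R) :
  0 < d0 -> (forall y, nV (y - x) < d0 -> wdiff f y (a y) (b y)) ->
  wdiff (fun y => rlin (a y) (b y) v) x al be ->
  wdiff (fun y => rlin (a y) (b y) w) x al' be' ->
  rlin al be w = rlin al' be' v.
Proof.
move=> d00 hf hv hw; apply/eqP; rewrite -subr_eq0 -nC_eq0; apply/negP => /negP.
rewrite neq_lt ltNge nC_ge0 /= => k0; set k := nC _ in k0.
have k3 : 0 < k / 3 by rewrite divr_gt0.
have [d1 d10 h1] := second_difference_lim w d00 hf hv k3.
have [d2 d20 h2] := second_difference_lim v d00 hf hw k3.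
pose s := Num.min d1 d2 / 2.
have m0 : 0 < Num.min d1 d2 by rewrite lt_min d10.
have s0 : 0 < s by rewrite divr_gt0.
have : s < Num.min d1 d2 by rewrite /s ltr_pdivrMr // mulr_natr mulr2n ltrDl.
rewrite lt_min => /andP[sd1 sd2].
have {}h1 := h1 s s0 sd1; have {}h2 := h2 s s0 sd2.
have sym : second_difference f x w v s = second_difference f x v w s.
  rewrite /second_difference (addrAC x).
  by move: (f _) (f _) (f _) (f _); clear; move=> *; ring.
rewrite sym in h2.
have : nC ((s ^+ 2)%:C%C * (rlin al be w - rlin al' be' v)) <= k / 3 * s ^+ 2 + k / 3 * s ^+ 2.
  apply: le_trans (lerD h2 h1); move: (second_difference _ _ _ _ _) => D.
  have -> : (s ^+ 2)%:C%C * (rlin al be w - rlin al' be' v) =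
    (D - (s ^+ 2)%:C%C * rlin al' be' v) - (D - (s ^+ 2)%:C%C * rlin al be w).
    by move: (rlin _ _ _) (rlin _ _ _); clear; move=> *; ring.
  by apply: le_trans (nC_triangle _ _) _; rewrite nCN.
rewrite nCM nC_real ger0_norm ?sqr_ge0 // -/k -mulrDl mulrC.
rewrite ler_pM2r ?exprn_gt0 //; move: k0; clear; lra.
Qed.

End Smooth.

(** * Smooth functions *)

Section Smooth.
Context {R : realType}.
Local Notation C := R[i].
Local Notation V := 'rV[R[i]]_2.
Implicit Types (f g : V -> C) (D : set V) (x : V) (k : nat) (mu nu : 'I_2).

Definition wd f x : Prop := wdiff f x (fun i => pz i f x) (fun i => pb i f x).

Lemma wdiff_wd f x a b : wdiff f x a b -> wd f x.
Proof.
move=> hf; apply: (wdiff_eq hf) => i; first by rewrite (wdiff_pz _ hf).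
by rewrite (wdiff_pb _ hf).
Qed.

(** The Wirtinger derivatives of order up to k are differentiable. Two derivatives per coordinate
    replace the quantification of [Ck] over all directions, which makes the product and chain rules
    plain inductions. *)
Fixpoint Wk k D f : Prop := (forall x, D x -> wd f x) /\
  if k is k'.+1 then forall mu, Wk k' D (pz mu f) /\ Wk k' D (pb mu f) else True.

Definition sm D f : Prop := forall k, Wk k D f.

Lemma Wk_wd k D f x : Wk k D f -> D x -> wd f x.
Proof. by case: k => [|k] [h _]; exact: h. Qed.

Lemma Wk_pred k D f : Wk k.+1 D f -> Wk k D f.
Proof.
elim: k f => [|k IH] f [h1 h2]; first by split.
by split=> // mu; have [? ?] := h2 mu; split; apply: IH.
Qed.

Lemma open_near D x (P : V -> Prop) : open D -> D x -> (forall y, D y -> P y) ->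
  exists2 d : R, 0 < d & forall y, nV (y - x) < d -> P y.
Proof.
by move=> /openV_P oD /oD[d d0 hd] h; exists d => // y /hd; exact: h.
Qed.

Lemma wd_ext D f g x : open D -> (forall y, D y -> f y = g y) -> D x ->
  wd f x -> [/\ wd g x, forall mu, pz mu f x = pz mu g x & forall mu, pb mu f x = pb mu g x].
Proof.
move=> oD fg Dx fx; have gx := wdiff_near (open_near oD Dx fg) fx.
split; first exact: wdiff_wd gx.
  by move=> mu; rewrite (wdiff_pz _ gx).
by move=> mu; rewrite (wdiff_pb _ gx).
Qed.

Lemma Wk_ext k D f g : open D -> (forall y, D y -> f y = g y) -> Wk k D f -> Wk k D g.
Proof.
move=> oD; elim: k f g => [|k IH] f g fg [h1 h2].
  by split=> // x Dx; have [] := wd_ext oD fg Dx (h1 x Dx).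
split=> [x Dx|mu]; first by have [] := wd_ext oD fg Dx (h1 x Dx).
have [h3 h4] := h2 mu; split; [apply: IH h3|apply: IH h4] => y Dy;
  by have [] := wd_ext oD fg Dy (h1 y Dy).
Qed.

Lemma Wk_sub k D D' f : D' `<=` D -> Wk k D f -> Wk k D' f.
Proof.
move=> DD; elim: k f => [|k IH] f [h1 h2].
  by split=> // x /DD; exact: h1.
split=> [x /DD|mu]; first exact: h1.
by have [? ?] := h2 mu; split; apply: IH.
Qed.

Lemma Wk_cst k D (c : C) : open D -> Wk k D (fun=> c).
Proof.
move=> oD; elim: k c => [|k IH] c; first by split=> // x _; apply: wdiff_wd (wdiff_cst c x).
split=> [x _|mu]; first by apply: wdiff_wd (wdiff_cst c x).
by split; apply: Wk_ext oD _ (IH 0) => y _;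
  rewrite ?(wdiff_pz _ (wdiff_cst c y)) ?(wdiff_pb _ (wdiff_cst c y)).
Qed.

Lemma Wk_coord k D i : open D -> Wk k D (fun y => y 0 i).
Proof.
move=> oD; have h x := wdiff_wd (wdiff_coord i x).
case: k => [|k]; split=> // mu; split.
  by apply: Wk_ext oD _ (Wk_cst k ((i == mu)%:R) oD) => y _; rewrite (wdiff_pz _ (wdiff_coord i y)).
by apply: Wk_ext oD _ (Wk_cst k 0 oD) => y _; rewrite (wdiff_pb _ (wdiff_coord i y)).
Qed.

Lemma WkD k D f g : open D -> Wk k D f -> Wk k D g -> Wk k D (fun y => f y + g y).
Proof.
move=> oD; elim: k f g => [|k IH] f g [f1 f2] [g1 g2].
  by split=> // x Dx; apply: wdiff_wd (wdiffD (f1 x Dx) (g1 x Dx)).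
split=> [x Dx|mu]; first by apply: wdiff_wd (wdiffD (f1 x Dx) (g1 x Dx)).
have [? ?] := f2 mu; have [? ?] := g2 mu.
split; [apply: (Wk_ext (f := fun y => pz mu f y + pz mu g y))
       |apply: (Wk_ext (f := fun y => pb mu f y + pb mu g y))] => //.
- by move=> y Dy; rewrite (wdiff_pz _ (wdiffD (f1 y Dy) (g1 y Dy))).
- exact: IH.
- by move=> y Dy; rewrite (wdiff_pb _ (wdiffD (f1 y Dy) (g1 y Dy))).
- exact: IH.
Qed.

Lemma WkM k D f g : open D -> Wk k D f -> Wk k D g -> Wk k D (fun y => f y * g y).
Proof.
move=> oD; elim: k f g => [|k IH] f g hf hg; have := hf; have := hg; move=> [g1 g2] [f1 f2].
  by split=> // x Dx; apply: wdiff_wd (wdiffM (f1 x Dx) (g1 x Dx)).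
split=> [x Dx|mu]; first by apply: wdiff_wd (wdiffM (f1 x Dx) (g1 x Dx)).
have [? ?] := f2 mu; have [? ?] := g2 mu.
have ? := Wk_pred hf; have ? := Wk_pred hg.
split; [apply: (Wk_ext (f := fun y => pz mu f y * g y + f y * pz mu g y))
       |apply: (Wk_ext (f := fun y => pb mu f y * g y + f y * pb mu g y))] => //.
- by move=> y Dy; rewrite (wdiff_pz _ (wdiffM (f1 y Dy) (g1 y Dy))).
- by apply: WkD => //; apply: IH.
- by move=> y Dy; rewrite (wdiff_pb _ (wdiffM (f1 y Dy) (g1 y Dy))).
- by apply: WkD => //; apply: IH.
Qed.

Lemma Wk_conj k D f : open D -> Wk k D f -> Wk k D (fun y => (f y)^*).
Proof.
move=> oD; elim: k f => [|k IH] f [f1 f2].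
  by split=> // x Dx; apply: wdiff_wd (wdiff_conj (f1 x Dx)).
split=> [x Dx|mu]; first by apply: wdiff_wd (wdiff_conj (f1 x Dx)).
have [? ?] := f2 mu.
split; [apply: (Wk_ext (f := fun y => (pb mu f y)^*))
       |apply: (Wk_ext (f := fun y => (pz mu f y)^*))] => //.
- by move=> y Dy; rewrite (wdiff_pz _ (wdiff_conj (f1 y Dy))).
- exact: IH.
- by move=> y Dy; rewrite (wdiff_pb _ (wdiff_conj (f1 y Dy))).
- exact: IH.
Qed.

Lemma WkN k D f : open D -> Wk k D f -> Wk k D (fun y => - f y).
Proof.
move=> oD hf; apply: (Wk_ext (f := fun y => -1 * f y)) => // [y _|].
  by rewrite mulN1r.
by apply: WkM => //; apply: Wk_cst.
Qed.

Lemma WkV k D f : open D -> (forall x, D x -> f x != 0) -> Wk k D f ->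
  Wk k D (fun y => (f y)^-1).
Proof.
move=> oD f0; elim: k => [|k IH] hf; have := hf; move=> [f1 f2].
  by split=> // x Dx; apply: wdiff_wd (wdiffV (f0 x Dx) (f1 x Dx)).
split=> [x Dx|mu]; first by apply: wdiff_wd (wdiffV (f0 x Dx) (f1 x Dx)).
have [? ?] := f2 mu; have h := IH (Wk_pred hf).
have h2 : Wk k D (fun y => - ((f y)^-1 * (f y)^-1)) by apply/WkN/WkM.
split; [apply: (Wk_ext (f := fun y => - ((f y)^-1 * (f y)^-1) * pz mu f y))
       |apply: (Wk_ext (f := fun y => - ((f y)^-1 * (f y)^-1) * pb mu f y))] => //;
  try exact: WkM.
- by move=> y Dy; rewrite (wdiff_pz _ (wdiffV (f0 y Dy) (f1 y Dy))) expr2 invfM.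
- by move=> y Dy; rewrite (wdiff_pb _ (wdiffV (f0 y Dy) (f1 y Dy))) expr2 invfM.
Qed.

Lemma Wk_comp_holo k D D' f (G : V -> V) : open D' -> (forall x, D' x -> D (G x)) ->
  (forall i, sm D' (fun y => G y 0 i)) ->
  (forall i mu x, D' x -> pb mu (fun y => G y 0 i) x = 0) ->
  Wk k D f -> Wk k D' (fun y => f (G y)).
Proof.
move=> oD GD Gs Gh.
have hG i x : D' x -> wdiff (fun y => G y 0 i) x (fun mu => pz mu (fun y => G y 0 i) x) (fun=> 0).
  by move=> Dx; apply: wdiff_eq (Wk_wd (Gs i 0%N) Dx) _ _ => // mu; rewrite Gh.
pose c g mu x := pz 0 g (G x) * pz mu (fun y => G y 0 0) x + pz 1 g (G x) * pz mu (fun y => G y 0 1) x.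
pose c' g mu x := pb 0 g (G x) * (pz mu (fun y => G y 0 0) x)^* + pb 1 g (G x) * (pz mu (fun y => G y 0 1) x)^*.
have hd g x : D' x -> wd g (G x) -> wdiff (fun y => g (G y)) x (c g ^~ x) (c' g ^~ x).
  by move=> Dx gx; exact: wdiff_comp_holo gx (hG 0 x Dx) (hG 1 x Dx).
have sG i mu k' : Wk k' D' (pz mu (fun y => G y 0 i)).
  by have [_ /(_ mu)[]] := Gs i k'.+1.
elim: k f => [|k IH] f [f1 f2].
  by split=> // x Dx; apply: wdiff_wd (hd _ _ Dx (f1 _ (GD _ Dx))).
split=> [x Dx|mu]; first by apply: wdiff_wd (hd _ _ Dx (f1 _ (GD _ Dx))).
have [f20 f20'] := f2 0; have [f21 f21'] := f2 1.
split.
  apply: (Wk_ext (f := c f mu)) => // [y Dy|].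
    by rewrite (wdiff_pz _ (hd _ _ Dy (f1 _ (GD _ Dy)))).
  by apply: (WkD oD); apply: (WkM oD); [exact: (IH _ f20)|exact: sG|exact: (IH _ f21)|exact: sG].
apply: (Wk_ext (f := c' f mu)) => // [y Dy|].
  by rewrite (wdiff_pb _ (hd _ _ Dy (f1 _ (GD _ Dy)))).
by apply: (WkD oD); apply: (WkM oD); [exact: (IH _ f20')|exact: (Wk_conj oD (sG _ _ _))
  |exact: (IH _ f21')|exact: (Wk_conj oD (sG _ _ _))].
Qed.

Lemma sm_wd D f x : sm D f -> D x -> wd f x.
Proof. by move=> h; apply: Wk_wd (h 0%N). Qed.

Lemma sm_pz D f mu : sm D f -> sm D (pz mu f).
Proof. by move=> h k; have [_ /(_ mu)[]] := h k.+1. Qed.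

Lemma sm_pb D f mu : sm D f -> sm D (pb mu f).
Proof. by move=> h k; have [_ /(_ mu)[]] := h k.+1. Qed.

Lemma sm_ext D f g : open D -> (forall y, D y -> f y = g y) -> sm D f -> sm D g.
Proof. by move=> oD fg h k; apply: Wk_ext (h k). Qed.

Lemma sm_sub D D' f : D' `<=` D -> sm D f -> sm D' f.
Proof. by move=> DD h k; apply: Wk_sub (h k). Qed.

Lemma sm_cst D c : open D -> sm D (fun=> c).
Proof. by move=> oD k; apply: Wk_cst. Qed.

Lemma sm_coord D i : open D -> sm D (fun y => y 0 i).
Proof. by move=> oD k; apply: Wk_coord. Qed.

Lemma smD D f g : open D -> sm D f -> sm D g -> sm D (fun y => f y + g y).
Proof. by move=> oD hf hg k; apply: WkD. Qed.

Lemma smM D f g : open D -> sm D f -> sm D g -> sm D (fun y => f y * g y).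
Proof. by move=> oD hf hg k; apply: WkM. Qed.

Lemma smN D f : open D -> sm D f -> sm D (fun y => - f y).
Proof. by move=> oD hf k; apply: WkN. Qed.

Lemma smB D f g : open D -> sm D f -> sm D g -> sm D (fun y => f y - g y).
Proof. by move=> oD hf hg; apply: smD => //; apply: smN. Qed.

Lemma sm_conj D f : open D -> sm D f -> sm D (fun y => (f y)^*).
Proof. by move=> oD hf k; apply: Wk_conj. Qed.

Lemma smV D f : open D -> (forall x, D x -> f x != 0) -> sm D f -> sm D (fun y => (f y)^-1).
Proof. by move=> oD f0 hf k; apply: WkV. Qed.

Lemma sm_comp_holo D D' f (G : V -> V) : open D' -> (forall x, D' x -> D (G x)) ->
  (forall i, sm D' (fun y => G y 0 i)) ->
  (forall i mu x, D' x -> pb mu (fun y => G y 0 i) x = 0) ->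
  sm D f -> sm D' (fun y => f (G y)).
Proof. by move=> oD GD Gs Gh hf k; apply: Wk_comp_holo (hf k). Qed.

Lemma sm_cts D f x : sm D f -> D x -> {for x, continuous f}.
Proof. by move=> h Dx; apply: wdiff_cts (sm_wd h Dx). Qed.

(** One order is lost, since differentiability is deduced from the continuity of the next
    directional derivatives; this is harmless for smooth functions. *)
Lemma Ck_Wk k D f : open D -> Ck k.+1 D f -> Wk k D f.
Proof.
move=> oD; elim: k f => [|k IH] f [f0 f1].
  split=> // x Dx; have /openV_P/(_ x Dx)[d d0 hd] := oD.
  apply: (C1_wdiff d0) => [v y /hd|v]; first by apply (f1 v).1.
  by have [_ [h _]] := f1 v; exact: h.
have h v := IH _ (f1 v).2.
split=> [x Dx|mu].
  have /openV_P/(_ x Dx)[d d0 hd] := oD.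
  apply: (C1_wdiff d0) => [v y /hd|v]; first by apply (f1 v).1.
  by have [_ [h' _]] := f1 v; exact: h'.
by rewrite pzE pbE; split; apply: WkM (Wk_cst _ _ oD) _ => //; apply: WkD => //;
  [apply: WkN|] => //; apply: WkM (Wk_cst _ _ oD) _.
Qed.

Lemma smooth_on_sm D f : open D -> smooth_on D f -> sm D f.
Proof. by move=> oD h k; apply: Ck_Wk. Qed.

End Smooth.

(** * Second order expansions *)

Section SecondOrder.
Context {R : realType}.
Local Notation C := R[i].
Local Notation V := 'rV[R[i]]_2.
Implicit Types (f g : V -> C) (D : set V) (x : V) (v w h : V) (k : nat) (mu nu : 'I_2).

Definition df f x h : C := rlin (fun i => pz i f x) (fun i => pb i f x) h.

Definition d2f f x w v : C :=
  df (pz 0 f) x w * v 0 0 + df (pz 1 f) x w * v 0 1 +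
  (df (pb 0 f) x w * (v 0 0)^* + df (pb 1 f) x w * (v 0 1)^*).

Lemma rlin_coefD (a b a' b' : 'I_2 -> C) h :
  rlin (fun i => a i + a' i) (fun i => b i + b' i) h = rlin a b h + rlin a' b' h.
Proof. by rewrite /rlin; ring. Qed.

Lemma rlin_coefM (a b : 'I_2 -> C) (y c : C) h :
  rlin (fun i => a i * c + y * 0) (fun i => b i * c + y * 0) h = rlin a b h * c.
Proof. by rewrite /rlin; ring. Qed.

Lemma wdiff_df f x v : (forall mu, wd (pz mu f) x) -> (forall mu, wd (pb mu f) x) ->
  exists a b, wdiff (fun y => df f y v) x a b /\ forall w, rlin a b w = d2f f x w v.
Proof.
move=> hz hb.
have h1 := wdiffD (wdiffM (hz 0) (wdiff_cst (v 0 0) x)) (wdiffM (hz 1) (wdiff_cst (v 0 1) x)).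
have h2 := wdiffD (wdiffM (hb 0) (wdiff_cst (v 0 0)^* x)) (wdiffM (hb 1) (wdiff_cst (v 0 1)^* x)).
eexists; eexists; split; first exact: wdiffD h1 h2.
move=> w; rewrite rlin_coefD.
by congr (_ + _); rewrite rlin_coefD; congr (_ + _); exact: rlin_coefM.
Qed.

Lemma d2f_sym D f x v w : open D -> sm D f -> D x -> d2f f x w v = d2f f x v w.
Proof.
move=> oD hf Dx; have /openV_P/(_ x Dx)[d d0 hd] := oD.
have hz mu : wd (pz mu f) x by apply: sm_wd Dx; apply: sm_pz.
have hb mu : wd (pb mu f) x by apply: sm_wd Dx; apply: sm_pb.
have [a [b [hv <-]]] := wdiff_df v hz hb; have [a' [b' [hw <-]]] := wdiff_df w hz hb.
by apply: (young d0 _ hv hw) => y /hd Dy; exact: sm_wd hf Dy.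
Qed.

(** The values at s, t in {1, i} separate the four monomials in s, t and their conjugates. Applied
    to the real Hessian on complex lines, this turns its symmetry into that of the Wirtinger
    derivatives. *)
Lemma bilinear_sym (A A' B B' E E' F F' : C) :
  (forall s t : C, (A * s + B * s^*) * t + (E * s + F * s^*) * t^* =
                   (A' * t + B' * t^*) * s + (E' * t + F' * t^*) * s^*) ->
  [/\ A = A', B = E' & F = F'].
Proof.
move=> h; have := h 1 1; have := h 1 'i; have := h 'i 1; have := h 'i 'i.
rewrite !rmorph1 !conjCi !mulr1.
have ii : 'i * 'i = -1 :> C by rewrite -expr2 sqrCi.
have two : 2 != 0 :> C by []. have four : 4 != 0 :> C by [].
have i0 : 'i != 0 :> C by rewrite neq0Ci.
move=> h4 h3 h2 h1.
have {}h4 : - A + B + E - F = - A' + B' + E' - F'.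
  have e1 : (A * 'i + B * - 'i) * 'i + (E * 'i + F * - 'i) * - 'i = - A + B + E - F by ring: ii.
  have e2 : (A' * 'i + B' * - 'i) * 'i + (E' * 'i + F' * - 'i) * - 'i = - A' + B' + E' - F' by ring: ii.
  by rewrite -e1 -e2.
have {}h3 : A - B + E - F = A' + B' - E' - F'.
  by apply: (mulfI i0); move: h3; rewrite (_ : _ + _ = 'i * (A - B + E - F)); [move=> ->|]; ring.
have {}h2 : A + B - E - F = A' - B' + E' - F'.
  by apply: (mulfI i0); rewrite (_ : 'i * _ = (A + B) * 'i + (E + F) * - 'i); [rewrite h2|]; ring.
split.
- apply: (mulfI four).
  have -> : 4 * A = (A + B + (E + F)) - (- A + B + E - F) + (A - B + E - F) + (A + B - E - F) by ring.
  by rewrite h1 h2 h3 h4; ring.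
- apply: (mulfI four).
  have -> : 4 * B = (A + B + (E + F)) + (- A + B + E - F) - (A - B + E - F) + (A + B - E - F) by ring.
  by rewrite h1 h2 h3 h4; ring.
- apply: (mulfI four).
  have -> : 4 * F = (A + B + (E + F)) - (- A + B + E - F) - (A - B + E - F) - (A + B - E - F) by ring.
  by rewrite h1 h2 h3 h4; ring.
Qed.

Lemma rlin_line (a b : 'I_2 -> C) nu (s : C) :
  rlin a b (s *: delta_mx 0 nu) = a nu * s + b nu * s^*.
Proof.
by rewrite /rlin; elim/I2_ind: nu; rewrite !mxE /= !mulr0 !mulr1 !conjC0 !mulr0 ?addr0 ?add0r.
Qed.

Lemma dfE f x h : df f x h = rlin (fun i => pz i f x) (fun i => pb i f x) h.
Proof. by []. Qed.

Lemma d2f_line f x mu nu (s t : C) :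
  d2f f x (s *: delta_mx 0 nu) (t *: delta_mx 0 mu) =
  (pz nu (pz mu f) x * s + pb nu (pz mu f) x * s^*) * t +
  (pz nu (pb mu f) x * s + pb nu (pb mu f) x * s^*) * t^*.
Proof.
have dl g : df g x (s *: delta_mx 0 nu) = pz nu g x * s + pb nu g x * s^*.
  exact: rlin_line.
rewrite -(dl (pz mu f)) -(dl (pb mu f)) /d2f.
elim/I2_ind: mu; move: (df (pz 0 f) x _) (df (pz 1 f) x _) (df (pb 0 f) x _) (df (pb 1 f) x _) => a b c d.
  by rewrite !mxE /= mulr1 !mulr0 conjC0 !mulr0 !addr0.
by rewrite !mxE /= mulr1 !mulr0 conjC0 !mulr0 !add0r.
Qed.

Lemma schwarz D f x mu nu : open D -> sm D f -> D x ->
  [/\ pz mu (pz nu f) x = pz nu (pz mu f) x, pz mu (pb nu f) x = pb nu (pz mu f) x &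
      pb mu (pb nu f) x = pb nu (pb mu f) x].
Proof.
move=> oD hf Dx.
have H i j s t : (pz j (pz i f) x * s + pb j (pz i f) x * s^*) * t +
  (pz j (pb i f) x * s + pb j (pb i f) x * s^*) * t^* =
  (pz i (pz j f) x * t + pb i (pz j f) x * t^*) * s +
  (pz i (pb j f) x * t + pb i (pb j f) x * t^*) * s^*.
  by rewrite -!d2f_line; apply: d2f_sym hf Dx.
have [h1 _ h3] := bilinear_sym (H nu mu); have [_ h2 _] := bilinear_sym (H mu nu).
by rewrite h1 h2 h3.
Qed.

Lemma taylor2 f x h (Q : C) (e : R) :
  (forall t : R, 0 <= t <= 1 -> wd f (x + t%:C%C *: h) /\
     nC (df f (x + t%:C%C *: h) h - df f x h - t%:C%C * Q) <= e) ->
  nC (f (x + h) - f x - df f x h - Q / 2) <= 2 * e.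
Proof.
(* The segment is parametrised by the first coordinate of a dummy point of C^2, so that the rules
   for [wdiff] and the mean value inequality apply to it. *)
move=> hf; pose G (z : V) : V := x + z 0 0 *: h.
have hG i z : wdiff (fun z => G z 0 i) z (fun j => (0 == j)%:R * h 0 i) (fun=> 0).
  apply: (wdiff_near (f := fun z => x 0 i + z 0 0 * h 0 i)).
    by exists 1 => // y _; rewrite /G !mxE.
  have := wdiffD (wdiff_cst (x 0 i) z) (wdiffM (wdiff_coord 0 z) (wdiff_cst (h 0 i) z)).
  by move=> h'; apply: (wdiff_eq h') => j; rewrite ?mul0r ?mulr0 ?addr0 ?add0r.
pose k (z : V) := f (G z) - z 0 0 * df f x h - z 0 0 * z 0 0 * (Q / 2).
pose e0 : V := delta_mx 0 0.
have hk z : wd f (G z) -> rderivable k e0 z /\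
    rderive k e0 z = df f (G z) h - df f x h - z 0 0 * Q.
  move=> ft; have hz := wdiff_coord 0 z.
  have h1 := wdiff_comp_holo ft (hG 0 z) (hG 1 z).
  have h2 := wdiffM hz (wdiff_cst (df f x h) z).
  have h3 := wdiffM (wdiffM hz hz) (wdiff_cst (Q / 2) z).
  have h4 : wdiff k z _ _ := wdiffB (wdiffB h1 h2) h3.
  split; first exact: wdiff_rderivable h4.
  rewrite (wdiff_rderive _ h4) -[e0]scale1r rlin_line conjC1 !mulr1 /= (dfE f (G z)) /rlin.
  have two : 2 != 0 :> C by [].
  rewrite !rmorphM ?conjC0 ?conjC1 ?rmorph1 /=.
  move: (pz 0 f _) (pz 1 f _) (pb 0 f _) (pb 1 f _) (h 0 0) (h 0 1) (h 0 0)^* (h 0 1)^*.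
  by move: (z 0 0) (df _ _ _); clear -two; move=> *; field.
have zt (t : R) : (t%:C%C *: e0) 0 0 = t%:C%C by rewrite !mxE mulr1.
have Gt (t : R) : G (t%:C%C *: e0) = x + t%:C%C *: h by rewrite /G zt.
have kt (t : R) : k (t%:C%C *: e0) =
    f (x + t%:C%C *: h) - t%:C%C * df f x h - t%:C%C * t%:C%C * (Q / 2).
  by rewrite /k Gt zt.
have := @mean_value_ineq R k 0 e0 0 1 0 e ler01.
rewrite !add0r (kt 1) (kt 0) scale1r scale0r addr0 rmorph1 rmorph0 !mul1r !mul0r !subr0 !mulr1 ?mul1r ?mulr0 ?subr0.
rewrite [_ - _ - f x](_ : _ = f (x + h) - f x - df f x h - Q / 2); last first.
  by move: (f (x + h)) (f x) (df _ _ _) (Q / 2); clear; move=> *; ring.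
rewrite ?mulr0 ?subr0; apply=> t /hf [ft htt]; rewrite add0r; rewrite -Gt in ft.
have [? ->] := hk _ ft; split=> //; by rewrite subr0 Gt zt.
Qed.

End SecondOrder.

(** * The maximum principle and the Cauchy estimate *)

Section MaximumPrinciple.
Context {R : realType}.
Local Notation C := R[i].
Local Notation V := 'rV[R[i]]_2.
Implicit Types (f g F : V -> C) (D : set V) (x : V) (v w h k : V) (mu nu : 'I_2).

Lemma dfZ f x (t : R) h : df f x (t%:C%C *: h) = t%:C%C * df f x h.
Proof. by rewrite !dfE rlinZ. Qed.

Lemma d2fZ f x (t s : R) v w :
  d2f f x (t%:C%C *: w) (s%:C%C *: v) = t%:C%C * s%:C%C * d2f f x w v.
Proof.
rewrite /d2f !dfZ !mxE !rmorphM /= !conjC_realc.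
move: (df (pz 0 f) x w) (df (pz 1 f) x w) (df (pb 0 f) x w) (df (pb 1 f) x w).
by move=> *; ring.
Qed.

Lemma df_increment D f x : open D -> sm D f -> D x -> forall e : R, 0 < e ->
  exists2 d : R, 0 < d & forall k h, nV k < d ->
    nC (df f (x + k) h - df f x h - d2f f x k h) <= e * nV k * nV h.
Proof.
move=> oD hf Dx e e0; have e4 : 0 < e / 4 by rewrite divr_gt0.
have inc g : sm D g -> exists2 d : R, 0 < d & forall k, nV k < d ->
    nC (g (x + k) - g x - df g x k) <= e / 4 * nV k.
  by move=> hg; have [d d0 hd] := sm_wd hg Dx e4; exists d.
have [d1 d10 h1] := inc _ (sm_pz 0 hf).
have [d2 d20 h2] := inc _ (sm_pz 1 hf).
have [d3 d30 h3] := inc _ (sm_pb 0 hf).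
have [d4 d40 h4] := inc _ (sm_pb 1 hf).
exists (Num.min (Num.min d1 d2) (Num.min d3 d4)).
  by rewrite !lt_min d10 d20 d30.
move=> k h; rewrite !lt_min => /andP[/andP[/h1 {}h1 /h2 {}h2] /andP[/h3 {}h3 /h4 {}h4]].
have n0 := nV_ge0 k; have m0 := nV_ge0 h.
have bd a c : nC a <= e / 4 * nV k -> nC c <= nV h -> nC (a * c) <= e / 4 * nV k * nV h.
  by move=> ha hc; rewrite nCM ler_pM ?nC_ge0.
have c0 : nC (h 0 0)^* <= nV h by rewrite nC_conj nC0_le.
have c1 : nC (h 0 1)^* <= nV h by rewrite nC_conj nC1_le.
have := lerD (lerD (bd _ _ h1 (nC0_le h)) (bd _ _ h2 (nC1_le h))) (lerD (bd _ _ h3 c0) (bd _ _ h4 c1)).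
set S := (X in _ <= X).
have -> : S = e * nV k * nV h by rewrite /S; move: (nV k) (nV h); clear; move=> *; field.
apply: le_trans.
apply: le_trans (lerD (nC_triangle _ _) (nC_triangle _ _)).
apply: le_trans (nC_triangle _ _).
rewrite le_eqVlt; apply/orP; left; apply/eqP; congr nC.
rewrite /d2f (dfE f (x + k)) (dfE f x) /rlin.
move: (df (pz 0 f) x k) (df (pz 1 f) x k) (df (pb 0 f) x k) (df (pb 1 f) x k).
move: (h 0 0) (h 0 1) (h 0 0)^* (h 0 1)^*; clear; move=> *; ring.
Qed.

Lemma taylor_peano D f x : open D -> sm D f -> D x -> forall e : R, 0 < e ->
  exists2 d : R, 0 < d & forall h, nV h < d ->
    nC (f (x + h) - f x - df f x h - d2f f x h h / 2) <= e * nV h ^+ 2.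
Proof.
move=> oD hf Dx e e0; have e2 : 0 < e / 2 by rewrite divr_gt0.
have [d d0 hd] := df_increment oD hf Dx e2.
have /openV_P/(_ x Dx)[d' d'0 hd'] := oD.
exists (Num.min d d'); first by rewrite lt_min d0.
move=> h; rewrite lt_min => /andP[n1 n2].
have -> : e * nV h ^+ 2 = 2 * (e / 2 * nV h ^+ 2) by move: (nV h); clear; move=> *; field.
apply: taylor2 => t /andP[t0 t1].
have nt : nV (t%:C%C *: h) <= nV h.
  by rewrite nVZ nC_real ger0_norm // ler_piMl // nV_ge0.
split; first by apply: (sm_wd hf); apply: hd'; rewrite (addrC x) addrK (le_lt_trans nt).
have := hd _ h (le_lt_trans nt n1).
have -> : d2f f x (t%:C%C *: h) h = t%:C%C * d2f f x h h.
  by rewrite -{2}[h]scale1r -(rmorph1 (real_complex R)) d2fZ rmorph1 mulr1.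
move=> /le_trans; apply; rewrite expr2 mulrA ler_wpM2r ?nV_ge0 //.
by rewrite ler_wpM2l // ltW.
Qed.

Lemma max_dir D F x v (d0 : R) : open D -> sm D F -> D x -> 0 < d0 ->
  (forall t : R, `|t| < d0 -> complex.Re (F (x + t%:C%C *: v)) <= complex.Re (F x)) ->
  complex.Re (df F x v) = 0 /\ complex.Re (d2f F x v v) <= 0.
Proof.
move=> oD hF Dx d00 hmax; set L := complex.Re (df F x v); set Q := complex.Re _.
have ReD (z w : C) : complex.Re (z + w) = complex.Re z + complex.Re w.
  by case: z w => [p q] [p' q'].
have ReN (z : C) : complex.Re (- z) = - complex.Re z by case: z.
have ReZ (t : R) (z : C) : complex.Re (t%:C%C * z) = t * complex.Re z.
  by case: z => p q /=; rewrite mul0r subr0.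
have ReZ' (t : R) (z : C) : complex.Re (z * t%:C%C) = t * complex.Re z.
  by rewrite mulrC ReZ.
have key e : 0 < e -> exists2 d : R, 0 < d & forall t : R, `|t| < d ->
    t * L + t ^+ 2 * Q / 2 <= e * t ^+ 2.
  move=> e0; have N0 : 0 < (nV v + 1) ^+ 2 by rewrite exprn_gt0 // ltr_wpDl // nV_ge0.
  have [d d'0 hd] := taylor_peano oD hF Dx (divr_gt0 e0 N0).
  have M0 : 0 < nV v + 1 by rewrite ltr_wpDl // nV_ge0.
  exists (Num.min d0 (d / (nV v + 1))); first by rewrite lt_min d00 divr_gt0.
  move=> t; rewrite lt_min => /andP[/hmax h1]; rewrite ltr_pdivlMr // => h2.
  have nt : nV (t%:C%C *: v) < d.
    rewrite nVZ nC_real; apply: le_lt_trans h2.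
    by rewrite ler_wpM2l ?normr_ge0 // lerDl.
  have := hd _ nt; rewrite dfZ d2fZ => h3.
  have := le_trans (ler_norm _) (le_trans (Re_le_nC (- _)) (eq_ind_r (fun z => z <= _) h3 (nCN _))).
  have half (z : C) : z / 2 = z * (2^-1)%:C%C by rewrite fmorphV rmorph_nat.
  rewrite half ReN !ReD !ReN ReZ' -mulrA !ReZ -/L -/Q nVZ nC_real.
  have h4 : e / (nV v + 1) ^+ 2 * (`|t| * nV v) ^+ 2 <= e * t ^+ 2.
    rewrite exprMn real_normK ?num_real // mulrCA mulrC ler_wpM2r ?sqr_ge0 //.
    rewrite mulrAC ler_pdivrMr // ler_wpM2l ?(ltW e0) // ler_sqr ?nnegrE ?nV_ge0 ?(ltW M0) //.
    by rewrite lerDl.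
  move=> h5; move: (le_trans h5 h4) h1; rewrite expr2; clear; lra.
split.
  apply/eqP/negP => /negP L0.
  have [d d'0 hd] := key 1 ltr01.
  (* At t = sg(L) s the Taylor inequality gives |L| s <= s^2 (1 + |Q| / 2), while s (|Q| + 2) <=
     |L|: a contradiction. *)
  pose s := Num.min (d / 2) (`|L| / (`|Q| + 2)).
  have Q2 : 0 < `|Q| + 2 by rewrite ltr_wpDl.
  have s0 : 0 < s by rewrite lt_min !divr_gt0 ?normr_gt0.
  have s1 : s < d.
    by rewrite gt_min; apply/orP; left; rewrite ltr_pdivrMr // mulr_natr mulr2n ltrDl.
  have s2 : s * (`|Q| + 2) <= `|L| by rewrite -ler_pdivlMr // ge_min lexx orbT.
  have sg : (Num.sg L) * L = `|L| by rewrite normrEsg.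
  have := hd (Num.sg L * s).
  rewrite normrM normr_sg L0 /= !mul1r ger0_norm ?(ltW s0) // => /(_ s1).
  rewrite mulrAC sg exprMn sqr_sg L0 /= !mul1r => h.
  have : `|L| * s <= s * s * (1 + `|Q| / 2).
    have : - `|Q| <= Q by rewrite lerNl -normrN ler_norm.
    have ss : 0 <= s * s by rewrite mulr_ge0 ?ltW.
    move=> hQ; have := ler_wpM2l ss hQ; move: h; rewrite expr2; clear; lra.
  rewrite mulrC -mulrA ler_pM2l // => h'.
  have : 0 < s * (1 + `|Q| / 2) by rewrite mulr_gt0 // ltr_wpDr // divr_ge0.
  move: h' s2; clear; lra.
(* With e = Q / 4 the inequalities at t and - t add up to t^2 Q <= t^2 Q / 2. *)
rewrite leNgt; apply/negP => Q0; have [d d'0 hd] := key (Q / 4) (divr_gt0 Q0 (ltr0n _ 4)).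
have s0 : 0 < d / 2 by rewrite divr_gt0.
have s1 : d / 2 < d by rewrite ltr_pdivrMr // mulr_natr mulr2n ltrDl.
have := hd (d / 2); have := hd (- (d / 2)); rewrite normrN ger0_norm ?(ltW s0) //.
move=> /(_ s1) h1 /(_ s1) h2.
have : 0 < (d / 2) ^+ 2 * Q by rewrite mulr_gt0 // exprn_gt0.
move: h1 h2; rewrite sqrrN; move: (d / 2) => s; clear; rewrite !expr2; lra.
Qed.

End MaximumPrinciple.

Section Rules.
Context {R : realType}.
Local Notation C := R[i].
Local Notation V := 'rV[R[i]]_2.
Implicit Types (f g F : V -> C) (D : set V) (x : V) (v w h : V) (mu nu : 'I_2).

Lemma pz_cst mu (c : C) x : pz mu (fun=> c) x = 0.
Proof. by rewrite (wdiff_pz _ (wdiff_cst c x)). Qed.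

Lemma pb_cst mu (c : C) x : pb mu (fun=> c) x = 0.
Proof. by rewrite (wdiff_pb _ (wdiff_cst c x)). Qed.

Lemma pz_coord mu i x : pz mu (fun y : V => y 0 i) x = (i == mu)%:R.
Proof. by rewrite (wdiff_pz _ (wdiff_coord i x)). Qed.

Lemma pb_coord mu i x : pb mu (fun y : V => y 0 i) x = 0.
Proof. by rewrite (wdiff_pb _ (wdiff_coord i x)). Qed.

Lemma pzD mu f g x : wd f x -> wd g x ->
  pz mu (fun y => f y + g y) x = pz mu f x + pz mu g x.
Proof. by move=> hf hg; rewrite (wdiff_pz _ (wdiffD hf hg)). Qed.

Lemma pbD mu f g x : wd f x -> wd g x ->
  pb mu (fun y => f y + g y) x = pb mu f x + pb mu g x.
Proof. by move=> hf hg; rewrite (wdiff_pb _ (wdiffD hf hg)). Qed.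

Lemma pzN mu f x : wd f x -> pz mu (fun y => - f y) x = - pz mu f x.
Proof. by move=> hf; rewrite (wdiff_pz _ (wdiffN hf)). Qed.

Lemma pbN mu f x : wd f x -> pb mu (fun y => - f y) x = - pb mu f x.
Proof. by move=> hf; rewrite (wdiff_pb _ (wdiffN hf)). Qed.

Lemma pzM mu f g x : wd f x -> wd g x ->
  pz mu (fun y => f y * g y) x = pz mu f x * g x + f x * pz mu g x.
Proof. by move=> hf hg; rewrite (wdiff_pz _ (wdiffM hf hg)). Qed.

Lemma pbM mu f g x : wd f x -> wd g x ->
  pb mu (fun y => f y * g y) x = pb mu f x * g x + f x * pb mu g x.
Proof. by move=> hf hg; rewrite (wdiff_pb _ (wdiffM hf hg)). Qed.

Lemma pz_conj mu f x : wd f x -> pz mu (fun y => (f y)^*) x = (pb mu f x)^*.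
Proof. by move=> hf; rewrite (wdiff_pz _ (wdiff_conj hf)). Qed.

Lemma pb_conj mu f x : wd f x -> pb mu (fun y => (f y)^*) x = (pz mu f x)^*.
Proof. by move=> hf; rewrite (wdiff_pb _ (wdiff_conj hf)). Qed.

Lemma pzV mu f x : f x != 0 -> wd f x ->
  pz mu (fun y => (f y)^-1) x = - (f x) ^- 2 * pz mu f x.
Proof. by move=> f0 hf; rewrite (wdiff_pz _ (wdiffV f0 hf)). Qed.

Lemma pbV mu f x : f x != 0 -> wd f x ->
  pb mu (fun y => (f y)^-1) x = - (f x) ^- 2 * pb mu f x.
Proof. by move=> f0 hf; rewrite (wdiff_pb _ (wdiffV f0 hf)). Qed.

Lemma pz_ext D mu f g x : open D -> sm D f -> D x -> (forall y, D y -> f y = g y) ->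
  pz mu f x = pz mu g x.
Proof. by move=> oD hf Dx fg; have [_ ->] := wd_ext oD fg Dx (sm_wd hf Dx). Qed.

Lemma pb_ext D mu f g x : open D -> sm D f -> D x -> (forall y, D y -> f y = g y) ->
  pb mu f x = pb mu g x.
Proof. by move=> oD hf Dx fg; have [_ _ ->] := wd_ext oD fg Dx (sm_wd hf Dx). Qed.

End Rules.

Ltac sm_tac := repeat first
  [ assumption | apply: sm_cst | apply: sm_coord | apply: sm_conj | apply: smN
  | apply: smM | apply: smD | apply: sm_pz | apply: sm_pb ].
Ltac wd_tac D := apply: (@sm_wd _ D); [sm_tac | assumption].

Section MaximumPrinciple.
Context {R : realType}.
Local Notation C := R[i].
Local Notation V := 'rV[R[i]]_2.
Implicit Types (f g F : V -> C) (D : set V) (x : V) (v w h : V) (mu nu : 'I_2).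

Lemma rcD (a b : R) : (a + b)%:C%C = a%:C%C + b%:C%C :> C.
Proof. exact: rmorphD. Qed.

Lemma rcM (a b : R) : (a * b)%:C%C = a%:C%C * b%:C%C :> C.
Proof. exact: rmorphM. Qed.

Lemma cjD (a b : C) : (a + b)^* = a^* + b^*. Proof. exact: rmorphD. Qed.
Lemma cjN (a : C) : (- a)^* = - a^*. Proof. exact: rmorphN. Qed.
Lemma cjM (a b : C) : (a * b)^* = a^* * b^*. Proof. exact: rmorphM. Qed.

Definition lv f x v w : C :=
  pz 0 (pb 0 f) x * v 0 0 * (w 0 0)^* + pz 0 (pb 1 f) x * v 0 0 * (w 0 1)^* +
  (pz 1 (pb 0 f) x * v 0 1 * (w 0 0)^* + pz 1 (pb 1 f) x * v 0 1 * (w 0 1)^*).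

(** Passing from v to i v changes the sign of the (2,0) and (0,2) parts of the Hessian, so the sum
    retains only the Levi form. *)
Lemma d2f_lv D f x v : open D -> sm D f -> D x ->
  d2f f x v v + d2f f x ('i *: v) ('i *: v) = 4 * lv f x v v.
Proof.
move=> oD hf Dx; rewrite /d2f !dfE /rlin !mxE !rmorphM /= !conjCi.
have s mu nu : pb nu (pz mu f) x = pz mu (pb nu f) x.
  by have [_ -> _] := schwarz mu nu oD hf Dx.
rewrite !s /lv.
move: (pz 0 (pb 0 f) x) (pz 0 (pb 1 f) x) (pz 1 (pb 0 f) x) (pz 1 (pb 1 f) x).
move: (pz 0 (pz 0 f) x) (pz 0 (pz 1 f) x) (pz 1 (pz 0 f) x) (pz 1 (pz 1 f) x).
move: (pb 0 (pb 0 f) x) (pb 0 (pb 1 f) x) (pb 1 (pb 0 f) x) (pb 1 (pb 1 f) x).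
move: (v 0 0) (v 0 1) (v 0 0)^* (v 0 1)^*; clear.
have := sqrCi C; rewrite expr2; move: ('i : C) => j jj.
by move=> *; ring: jj.
Qed.

Lemma max_levi D F x v (d0 : R) : open D -> sm D F -> D x -> 0 < d0 ->
  (forall z : C, nC z < d0 -> complex.Re (F (x + z *: v)) <= complex.Re (F x)) ->
  [/\ complex.Re (df F x v) = 0, complex.Re (df F x ('i *: v)) = 0 &
      complex.Re (lv F x v v) <= 0].
Proof.
move=> oD hF Dx d00 h.
have [|h1 h2] := @max_dir _ D F x v d0 oD hF Dx d00.
  by move=> t td; apply: h; rewrite nC_real.
have [|h3 h4] := @max_dir _ D F x ('i *: v) d0 oD hF Dx d00.
  by move=> t td; rewrite scalerA; apply: h; rewrite nCM nCi mulr1 nC_real.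
split=> //.
have := congr1 (@complex.Re R) (d2f_lv v oD hF Dx).
have -> : complex.Re (d2f F x v v + d2f F x ('i *: v) ('i *: v)) =
    complex.Re (d2f F x v v) + complex.Re (d2f F x ('i *: v) ('i *: v)).
  by case: (d2f _ _ _ _) (d2f _ _ _ _) => [p q] [p' q'].
have -> : complex.Re (4 * lv F x v v) = 4 * complex.Re (lv F x v v).
  have -> : 4 = (4 : R)%:C%C by rewrite rmorph_nat.
  by case: (lv _ _ _ _) => p q /=; rewrite mul0r subr0.
move: h2 h4; move: (complex.Re (d2f F x v v)) (complex.Re (d2f F x ('i *: v) _)) (complex.Re (lv F x v v)).
by clear; move=> a b c; lra.
Qed.

Lemma slice_max F x v (r : R) : 0 <= r ->
  (forall z : C, nC z <= r -> {for x + z *: v, continuous F}) ->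
  exists2 z0 : C, nC z0 <= r & forall z : C, nC z <= r ->
    complex.Re (F (x + z *: v)) <= complex.Re (F (x + z0 *: v)).
Proof.
move=> r0 Fc.
pose A := [set p : R * R | p.1 ^+ 2 + p.2 ^+ 2 <= r ^+ 2].
have nA (p : R * R) : A p <-> nC (p.1 +i* p.2)%C <= r.
  rewrite -(ler_sqr (x := nC _)) ?nnegrE ?nC_ge0 //.
  suff -> : nC (p.1 +i* p.2)%C ^+ 2 = p.1 ^+ 2 + p.2 ^+ 2 by [].
  by rewrite nCE /= sqr_sqrtr // addr_ge0 ?sqr_ge0.
have cA : closed A.
  apply: (@closed_comp _ _ (fun p : R * R => p.1 * p.1 + p.2 * p.2) [set z | z <= r ^+ 2]).
    by move=> p _; apply: cvgD; apply: cvgM; first [exact: cvg_fst|exact: cvg_snd].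
  exact: closed_le.
have kA : compact A.
  apply: (subclosed_compact cA (compact_setX (@segment_compact R (- r) r) (@segment_compact R (- r) r))).
  move=> p /nA hp; rewrite /= !in_itv /= -!ler_norml; split.
    exact: le_trans (Re_le_nC _) hp.
  exact: le_trans (Im_le_nC _) hp.
pose g (p : R * R) := complex.Re (F (x + (p.1 +i* p.2)%C *: v)).
have gc : {within A, continuous g}.
  apply: continuous_in_subspaceT => p; rewrite inE => /nA hp.
  apply/cvgrPdist_lt => e e0.
  have /continuousC_P/(_ e e0)[d d0 hd] := Fc _ hp.
  have N0 : 0 < nV v + 1 by rewrite ltr_wpDl // nV_ge0.
  have d2 : 0 < d / 2 / (nV v + 1) by rewrite !divr_gt0.
  have : nbhs p (ball p (d / 2 / (nV v + 1))) by apply: nbhsx_ballx.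
  apply: filterS => q [/= q1 q2].
  have ReB (z w : C) : complex.Re z - complex.Re w = complex.Re (z - w).
    by case: z w => [? ?] [? ?].
  rewrite /g ReB; apply: le_lt_trans (Re_le_nC _) _; rewrite nC_sub; apply: hd.
  rewrite opprD addrACA subrr add0r -scalerBl nVZ.
  have : nC ((q.1 +i* q.2)%C - (p.1 +i* p.2)%C) < d / (nV v + 1).
    apply: le_lt_trans (nC_le_ReIm _) _ => /=.
    rewrite distrC (distrC q.2); have := ltrD q1 q2.
    by rewrite -mulrDl -splitr.
  rewrite ltr_pdivlMr //; apply: le_lt_trans.
  by rewrite ler_wpM2l ?nC_ge0 // lerDl.
have A0 : A !=set0 by exists 0; rewrite /A /= expr0n addr0 sqr_ge0.
have [c cA' hmax] := compact_EVT_max A0 kA gc.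
exists (c.1 +i* c.2)%C; first by apply/nA; rewrite inE in cA'.
move=> [a b] hz; apply: (hmax (a, b)); rewrite inE; exact/nA.
Qed.

Definition hol D f : Prop := sm D f /\ forall mu x, D x -> pb mu f x = 0.

Lemma hol_pz D f mu : open D -> hol D f -> hol D (pz mu f).
Proof.
move=> oD [hf hb]; split; first exact: sm_pz.
move=> nu x Dx; have [_ <- _] := schwarz mu nu oD hf Dx.
rewrite -(pz_cst mu 0 x); apply: (pz_ext mu oD _ Dx); first exact: sm_pb.
by move=> y Dy; rewrite hb.
Qed.

Lemma delta_line x mu (z : C) : (x + z *: delta_mx 0 mu) 0 mu = x 0 mu + z.
Proof. by rewrite !mxE !eqxx mulr1. Qed.

Lemma lv_line f x mu : lv f x (delta_mx 0 mu) (delta_mx 0 mu) = pz mu (pb mu f) x.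
Proof.
rewrite /lv; elim/I2_ind: mu; move: (pz 0 _ x) (pz 0 _ x) (pz 1 _ x) (pz 1 _ x) => a b c d.
  by rewrite !mxE /= !mulr1 conjC1 conjC0 ?mulr1 ?mulr0 ?mul0r ?addr0.
by rewrite !mxE /= !mulr1 conjC1 conjC0 ?mulr1 ?mulr0 ?mul0r ?add0r ?mulr1.
Qed.

(* The Cauchy estimate from the maximum principle: with P = r^2 - |y - x|^2,
   the function P^2 |f'|^2 + 3 r^2 |f|^2 is subharmonic along the disc. *)
Lemma cauchy_estimate D f x mu (r M : R) : open D -> hol D f -> 0 < r ->
  (forall z : C, nC z <= r -> D (x + z *: delta_mx 0 mu)) ->
  (forall z : C, nC z <= r -> nC (f (x + z *: delta_mx 0 mu)) <= M) ->
  r * nC (pz mu f x) <= 2 * M.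
Proof.
move=> oD hf r0 hD hM; pose e : V := delta_mx 0 mu.
have M0 : 0 <= M.
  by apply: le_trans (nC_ge0 _) (hM 0 _); rewrite nC0 ltW.
have [hg hg1] := (hol_pz mu oD hf, hol_pz mu oD (hol_pz mu oD hf)).
pose c : C := (3 * r ^+ 2)%:C%C.
pose p (y : V) := y 0 mu - x 0 mu.
pose P (y : V) := (r ^+ 2)%:C%C - p y * (p y)^*.
pose g := pz mu f; pose g1 := pz mu g.
pose F (y : V) := P y * P y * (g y * (g y)^*) + c * (f y * (f y)^*).
have sp : sm D p by rewrite /p; sm_tac.
have sP : sm D P by rewrite /P; sm_tac.
have sf : sm D f by case: hf.
have sg : sm D g by case: hg.
have sg1 : sm D g1 by case: hg1.
have sF : sm D F by rewrite /F; sm_tac.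
have zp y : D y -> pz mu p y = 1 /\ pb mu p y = 0.
  move=> Dy; rewrite /p pzD ?pbD ?pz_coord ?pb_coord ?pz_cst ?pb_cst ?eqxx; try by wd_tac D.
  by rewrite !addr0.
have zP y : D y -> pz mu P y = - (p y)^* /\ pb mu P y = - p y.
  move=> Dy; have [p1 p2] := zp _ Dy.
  rewrite /P pzD ?pbD ?pzN ?pbN ?pzM ?pbM ?pz_conj ?pb_conj ?pz_cst ?pb_cst; try by wd_tac D.
  by rewrite p1 p2 ?conjC0 ?conjC1 ?mulr0 ?mul0r ?mul1r ?mulr1 ?add0r ?addr0.
have fb y : D y -> pb mu f y = 0 by case: hf => _; exact.
have gb y : D y -> pb mu g y = 0 by case: hg => _; exact.
have g1b y : D y -> pb mu g1 y = 0 by case: hg1 => _; exact.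
pose F1 (y : V) := - 2 * P y * p y * g y * (g y)^* + P y * P y * g y * (g1 y)^* + c * f y * (g y)^*.
have FF1 y : D y -> pb mu F y = F1 y.
  move=> Dy; have [p1 p2] := zP _ Dy.
  rewrite /F pbD ?pbM ?pb_conj ?pb_cst; try by wd_tac D.
  rewrite p2 (fb _ Dy) (gb _ Dy) -/g -/g1 /F1.
  by move: (P y) (p y) (g y) (g y)^* (g1 y)^* (f y) (f y)^*; clear; move=> *; ring.
have sF1 : sm D F1 by rewrite /F1; sm_tac.
(* Once the square is completed, the derivatives of P^2 cost - 2 r^2 |g|^2, because P + |p|^2 = r^2;
   the weight 3 r^2 of |f|^2 leaves r^2 |g|^2. *)
have hlv y : D y -> pz mu (pb mu F) y =
    (nC (P y * g1 y - 2 * (p y)^* * g y) ^+ 2 + r ^+ 2 * nC (g y) ^+ 2)%:C%C.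
  move=> Dy; have [p1 p2] := zP _ Dy; have [q1 q2] := zp _ Dy.
  rewrite (pz_ext mu oD (sm_pb mu sF) Dy FF1) /F1.
  rewrite !pzD ?pzM ?pz_conj ?pz_cst; try by wd_tac D.
  rewrite p1 q1 (gb _ Dy) (g1b _ Dy) -/g -/g1.
  rewrite rcD rcM !nC_sqr.
  have Pr : (P y)^* = P y.
    by rewrite /P cjD cjN cjM conjCK conjC_realc (mulrC (p y)^*).
  have rP : (r ^+ 2)%:C%C = P y + p y * (p y)^* by rewrite /P subrK.
  rewrite [(_ * g1 y - _)^*]cjD [(- _)^*]cjN [(_ * g1 y)^*]cjM [(_ * g y)^*]cjM [(2 * _)^*]cjM Pr conjCK /c rcM rP !rmorph_nat conjC0.
  by move: (P y) (p y) (p y)^* (g y) (g y)^* (g1 y) (g1 y)^* (f y); clear; move=> *; ring.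
have [z0 z0r hmax] : exists2 z0 : C, nC z0 <= r & forall z : C, nC z <= r ->
    complex.Re (F (x + z *: e)) <= complex.Re (F (x + z0 *: e)).
  apply: slice_max (ltW r0) _ => z /hD Dz; exact: sm_cts sF Dz.
have FE y : complex.Re (F y) = complex.Re (P y) ^+ 2 * nC (g y) ^+ 2 + 3 * r ^+ 2 * nC (f y) ^+ 2.
  have PE : P y = (r ^+ 2 - nC (p y) ^+ 2)%:C%C by rewrite /P -nC_sqr -rmorphB.
  by rewrite /F PE /c -!nC_sqr -!rmorphM -rmorphD /= -expr2.
have pE (z : C) : p (x + z *: e) = z by rewrite /p delta_line addrC addKr.
have PE (z : C) : complex.Re (P (x + z *: e)) = r ^+ 2 - nC z ^+ 2.
  by rewrite /P pE -nC_sqr -rmorphB.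
(* On the boundary P vanishes; at an interior maximum the sign of the Levi form forces g = 0. Either
   way only the term in |f|^2 survives. *)
have bound : complex.Re (F (x + z0 *: e)) <= 3 * r ^+ 2 * M ^+ 2.
  have fM : nC (f (x + z0 *: e)) ^+ 2 <= M ^+ 2.
    by rewrite ler_sqr ?nnegrE ?nC_ge0 // hM.
  suff : complex.Re (P (x + z0 *: e)) ^+ 2 * nC (g (x + z0 *: e)) ^+ 2 = 0.
    rewrite FE => ->; rewrite add0r ler_wpM2l // mulr_ge0 // sqr_ge0 //.
  rewrite PE; have [->|z0n] := eqVneq (nC z0) r; first by rewrite subrr expr0n mul0r.
  have z0lt : nC z0 < r by rewrite lt_neqAle z0n.
  have [|||_ _] := @max_levi D F (x + z0 *: e) e (r - nC z0) oD sF.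
  - exact: hD.
  - by rewrite subr_gt0.
  - move=> z hz; rewrite -addrA -scalerDl; apply: hmax.
    by apply: le_trans (nC_triangle _ _) _; rewrite -lerBrDl ltW.
  rewrite lv_line hlv; last exact: hD.
  move=> /= h; have g0 : nC (g (x + z0 *: e)) ^+ 2 = 0.
    apply/eqP; rewrite eq_le sqr_ge0 andbT -(pmulr_rle0 _ (x := r ^+ 2)) ?exprn_gt0 //.
    by apply: le_trans h; rewrite lerDr sqr_ge0.
  by rewrite g0 mulr0.
have := le_trans (hmax 0 _) bound; rewrite nC0 => /(_ (ltW r0)).
rewrite FE PE scale0r addr0 nC0 expr0n subr0 => h.
have h2 : (r ^+ 2) ^+ 2 * nC (g x) ^+ 2 <= 3 * r ^+ 2 * M ^+ 2.
  by apply: le_trans h; rewrite lerDl mulr_ge0 ?sqr_ge0 // mulr_ge0 ?sqr_ge0.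
have r2 : 0 < r ^+ 2 by rewrite exprn_gt0.
(* The inequality amounts to r |g x| <= sqrt 3 M, rounded up to 2 M. *)
have h3 : (r * nC (g x)) ^+ 2 <= (2 * M) ^+ 2.
  have : r ^+ 2 * (r ^+ 2 * nC (g x) ^+ 2) <= r ^+ 2 * (3 * M ^+ 2).
    have -> : r ^+ 2 * (r ^+ 2 * nC (g x) ^+ 2) = (r ^+ 2) ^+ 2 * nC (g x) ^+ 2 by ring.
    by have -> : r ^+ 2 * (3 * M ^+ 2) = 3 * r ^+ 2 * M ^+ 2 by ring.
  rewrite ler_pM2l // => h3; rewrite !exprMn; apply: le_trans h3 _.
  by rewrite ler_wpM2r ?sqr_ge0 // -natrX ler_nat.
by move: h3; rewrite ler_sqr ?nnegrE ?mulr_ge0 ?nC_ge0 // ltW.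
Qed.

End MaximumPrinciple.

(** * Holomorphic charts *)

Lemma differentiable_linear_approx (K : numFieldType) (V W : normedModType K)
    (f : V -> W) (x : V) (L : {linear V -> W}) : continuous L ->
  (forall e : K, 0 < e -> \forall k \near (0 : V), `|f (k + x) - (f x + L k)| <= e * `|k|) ->
  differentiable f x.
Proof.
move=> Lc hL.
have Ld : f \o shift x = cst (f x) + L +o_ 0 id by apply/eqaddoP.
have dE := diff_unique Lc Ld.
by apply/diff_locallyP; split; rewrite dE.
Qed.

Section Holomorphic.
Context {R : realType}.
Local Notation C := R[i].
Local Notation V := 'rV[R[i]]_2.
Implicit Types (f : V -> V) (x : V).

Definition hdiff f x : Prop :=
  forall i, exists a, wdiff (fun y => f y 0 i) x a (fun=> 0).

Lemma row_delta (h : V) : h = h 0 0 *: delta_mx 0 0 + h 0 1 *: delta_mx 0 1.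
Proof. by apply: rowP2; rewrite !mxE /= ?mulr0 ?mulr1 ?addr0 ?add0r. Qed.

Lemma differentiable_wdiff f x i : differentiable f x ->
  wdiff (fun y => f y 0 i) x (fun mu => 'd f x (delta_mx 0 mu) 0 i) (fun=> 0).
Proof.
move=> fx e e0.
have /eqaddoP h := diff_locally fx.
have e1 : 0 < e%:C%C :> C by rewrite ltcR.
have /nbhsV_P[d d0 hd] := h _ e1; exists d => // k kd.
have := hd k; rewrite subr0 => /(_ kd) /=.
rewrite !normV_nV -rcM lecR => {}hd; apply: le_trans hd.
apply: le_trans (nCi_le _ i); rewrite le_eqVlt; apply/orP; left; apply/eqP; congr nC.
have dk : 'd f x k = k 0 0 *: 'd f x (delta_mx 0 0) + k 0 1 *: 'd f x (delta_mx 0 1).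
  by rewrite [in LHS](row_delta k) linearD !linearZ.
rewrite !mxE /= (addrC k) /rlin dk !mxE.
rewrite !mul0r !addr0 (mulrC (k 0 0)) (mulrC (k 0 1)).
by rewrite (opprD (f x 0 i)) addrA.
Qed.

Lemma hdiff_differentiable f x : hdiff f x -> differentiable f x.
Proof.
move=> hf; have [a0 h0] := hf 0; have [a1 h1] := hf 1.
pose A : 'M[C]_(2, 2) := \matrix_(mu, i) (if i == 0 then a0 mu else a1 mu).
have AE (h : V) : h *m A = vec (rlin a0 (fun=> 0) h) (rlin a1 (fun=> 0) h).
  apply: rowP2; rewrite ?vec0 ?vec1 !mxE sum2 !mxE /= /rlin !mul0r !addr0;
  by rewrite (mulrC (h 0 0)) (mulrC (h 0 1)).
pose L : {linear V -> V} := mulmxr A.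
have Ac : continuous L.
  move=> y; apply/continuousV_P => e e0.
  have [K K0 hK] := rlin_bound a0 (fun=> 0); have [K' K'0 hK'] := rlin_bound a1 (fun=> 0).
  have KL : 0 < K + K' by rewrite addr_gt0.
  exists (e / (K + K')); first by rewrite divr_gt0.
  move=> z; rewrite ltr_pdivlMr // => hz.
  rewrite -linearB [L _]AE nV_lt vec0 vec1; apply/andP; split.
    apply: le_lt_trans (hK _) _; apply: le_lt_trans hz; rewrite mulrC.
    by rewrite ler_wpM2l ?nV_ge0 // lerDl ltW.
  apply: le_lt_trans (hK' _) _; apply: le_lt_trans hz; rewrite mulrC.
  by rewrite ler_wpM2l ?nV_ge0 // lerDr ltW.
apply: (differentiable_linear_approx (L := L)) => // _ /posC_real[e e0 ->]; apply/nbhsV_P.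
have [d d0 hd] := h0 e e0; have [d' d'0 hd'] := h1 e e0.
exists (Num.min d d'); first by rewrite lt_min d0.
move=> k; rewrite subr0 lt_min => /andP[/hd k0 /hd' k1].
rewrite !normV_nV -rcM lecR [L k]AE (addrC k) nV_le.
have VD (p q r : V) j : (p - (q + r)) 0 j = p 0 j - q 0 j - r 0 j.
  by rewrite !mxE opprD addrA.
by rewrite !VD vec0 vec1 k0 k1.
Qed.

Lemma hdiff_comp f (g : V -> V) x : hdiff f (g x) -> hdiff g x -> hdiff (fun y => f (g y)) x.
Proof.
move=> hf hg i; have [a ha] := hf i; have [c0 h0] := hg 0; have [c1 h1] := hg 1.
exists (fun i => a 0 * c0 i + a 1 * c1 i).
by apply: (wdiff_eq (wdiff_comp_holo ha h0 h1)) => // j; rewrite !mul0r addr0.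
Qed.

Lemma differentiable_hdiff f x : differentiable f x <-> hdiff f x.
Proof.
split; last exact: hdiff_differentiable.
by move=> fx i; eexists; exact: differentiable_wdiff.
Qed.

Lemma hdiff_cts f x : hdiff f x -> {for x, continuous f}.
Proof. by move/differentiable_hdiff/differentiable_continuous. Qed.

End Holomorphic.

Section Charts.
Context {R : realType} {M : topologicalType}.
Local Notation C := R[i].
Local Notation V := 'rV[R[i]]_2.
Variable A : set (chart R M).
Hypothesis surfaceM : complex_surface A.

Lemma coord_nbhs (phi : chart R M) p (O : set V) : dom phi p -> open O -> O (phi p) ->
  nbhs p [set q | dom phi q /\ O (phi q)].
Proof.
move=> dp oO Op; have h1 : nbhs p (dom phi) by apply: open_nbhs_nbhs; split => //; exact: dom_open.
have h2 : nbhs p (phi @^-1` O) by apply: (coord_cts dp); apply: open_nbhs_nbhs.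
by apply: filterS2 h1 h2 => q.
Qed.

(** Compatibility only asks for complex differentiability in both directions, so every complex
    differentiable change of coordinates with such an inverse gives a chart, and maximality puts it
    in [A]. All new charts of the proof arise in this way. *)
Lemma chart_comp (phi : chart R M) (O : set V) (Psi H : V -> V) :
  A phi -> open O -> O `<=` phi @` dom phi -> open (Psi @` O) ->
  (forall x, O x -> H (Psi x) = x) -> (forall x, O x -> hdiff Psi x) ->
  (forall x, O x -> hdiff H (Psi x)) ->
  exists psi : chart R M, [/\ A psi,
    forall q, dom psi q <-> dom phi q /\ O (phi q),
    forall q, psi q = Psi (phi q) & forall y, pt psi y = pt phi (H y)].
Proof.
move=> Aphi oO Osub oPO HK dPsi dH.
pose d := [set q | dom phi q /\ O (phi q)].
pose c q := Psi (phi q); pose b y := pt phi (H y).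
have imE : c @` d = Psi @` O.
  apply/seteqP; split=> [_ [q [dq Oq] <-]|_ [x Ox <-]]; first by exists (phi q).
  by have [q dq qx] := Osub _ Ox; exists q; rewrite /d /c /= qx.
have od : open d.
  by rewrite openE => q [dq Oq]; apply: coord_nbhs.
have ic : open (c @` d) by rewrite imE.
have cK p : d p -> b (c p) = p.
  by move=> [dp Op]; rewrite /b /c HK // coordK.
have cc p : d p -> {for p, continuous c}.
  move=> [dp Op]; apply: (continuous_comp (coord_cts dp)).
  exact: hdiff_cts (dPsi _ Op).
have bc x : (c @` d) x -> {for x, continuous b}.
  rewrite imE => -[y Oy <-]; apply: (continuous_comp (hdiff_cts (dH _ Oy))).
  by apply: pt_cts; rewrite HK //; exact: Osub.
pose psi := Chart od ic cK cc bc.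
exists psi; split=> //.
apply: (atlas_maximal surfaceM) => chi Achi.
have [h1 h2] := atlas_compatible surfaceM Aphi Achi.
split=> [_ [p [[dp Op] dp'] <-]|_ [p [[dp Op] dp'] <-]]; apply/differentiable_hdiff.
  apply: (hdiff_comp (f := transition phi chi) (g := H)); last exact: dH.
  by rewrite /= /c HK //; apply/differentiable_hdiff/h1; exists p.
apply: (hdiff_comp (f := Psi) (g := transition chi phi)).
  by apply: dPsi; rewrite /transition coordK.
by apply/differentiable_hdiff/h2; exists p.
Qed.

End Charts.

(** * Inverting (z_1, z_2 + e) when e has a small vertical Lipschitz constant *)

Section GraphInverse.
Context {R : realType}.
Local Notation C := R[i].
Local Notation V := 'rV[R[i]]_2.
Implicit Types (x y h : V).

Lemma subVE x y i : (x - y) 0 i = x 0 i - y 0 i.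
Proof. by rewrite !mxE. Qed.

Lemma addVE x y i : (x + y) 0 i = x 0 i + y 0 i.
Proof. by rewrite !mxE. Qed.

Definition graph_map (e : V -> C) (x : V) : V := vec (x 0 0) (x 0 1 + e x).

Lemma graph_map0 e x : graph_map e x 0 0 = x 0 0. Proof. exact: vec0. Qed.
Lemma graph_map1 e x : graph_map e x 0 1 = x 0 1 + e x. Proof. exact: vec1. Qed.

Lemma graph_map_hdiff e x a : wdiff e x a (fun=> 0) -> hdiff (graph_map e) x.
Proof.
move=> he; elim/I2_ind; eexists.
  apply: (wdiff_near (f := fun y : V => y 0 0)); last exact: wdiff_coord.
  by exists 1 => // y _; rewrite graph_map0.
apply: (wdiff_near (f := fun y : V => y 0 1 + e y)).
  by exists 1 => // y _; rewrite graph_map1.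
by apply: (wdiff_eq (wdiffD (wdiff_coord 1 x) he)) => // j; rewrite addr0.
Qed.

Variables (e : V -> C) (x0 : V) (r : R).
Hypothesis r0 : 0 < r.
Hypothesis e_holo : forall x, nV (x - x0) < r -> exists a, wdiff e x a (fun=> 0).
Hypothesis e_lip : forall x y, nV (x - x0) < r -> nV (y - x0) < r -> x 0 0 = y 0 0 ->
  nC (e x - e y) <= 2^-1 * nC (x 0 1 - y 0 1).

Let Psi := graph_map e.

Let half_small (a b : R) : 0 <= a -> a <= 2^-1 * a -> a = 0.
Proof. by move=> a0 h; lra. Qed.

Lemma graph_map_inj x y : nV (x - x0) < r -> nV (y - x0) < r -> Psi x = Psi y -> x = y.
Proof.
move=> hx hy h; have h0 : x 0 0 = y 0 0 by rewrite -(graph_map0 e) -/Psi h graph_map0.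
have h1 : x 0 1 + e x = y 0 1 + e y by rewrite -(graph_map1 e) -/Psi h graph_map1.
apply: rowP2 => //; apply/eqP; rewrite -subr_eq0 -nC_eq0; apply/eqP.
have := e_lip hx hy h0.
have -> : e x - e y = - (x 0 1 - y 0 1) + ((x 0 1 + e x) - (y 0 1 + e y)).
  by move: (e x) (e y) (x 0 1) (y 0 1); clear; move=> *; ring.
by rewrite h1 subrr addr0 nCN => /half_small; apply; rewrite ?nC_ge0.
Qed.

(** The equation u + e(y_1, u) = y_2 is solved by minimising |q| over a compact disc: if q u0 were
    nonzero at the minimum, moving from u0 to u0 - q u0 would at least halve |q|. *)
Lemma graph_map_surj : exists2 eta : R, 0 < eta & eta <= r /\
  forall y, nV (y - Psi x0) < eta -> exists2 x, nV (x - x0) < r & Psi x = y.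
Proof.
have [a he] := e_holo (x := x0) ltac:(by rewrite subrr nV0).
have s0 : 0 < r / 16 by rewrite divr_gt0.
have /continuousC_P/(_ _ s0)[d d0 hd] := wdiff_cts he.
exists (Num.min (Num.min d r) (r / 16)); first by rewrite !lt_min d0 r0.
split; first by rewrite ge_min; apply/orP; left; rewrite ge_min lexx orbT.
move=> y; rewrite !lt_min => /andP[/andP[yd yr] y16].
have c0 : nC (y 0 0 - x0 0 0) <= nV (y - Psi x0).
  by have := nC0_le (y - Psi x0); rewrite subVE graph_map0.
have c1 : nC (y 0 1 - (x0 0 1 + e x0)) <= nV (y - Psi x0).
  by have := nC1_le (y - Psi x0); rewrite subVE graph_map1.
have z1 := le_lt_trans c0 yd; have zr := le_lt_trans c0 yr; have w1 := le_lt_trans c1 y16.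
pose pt u : V := vec (y 0 0) u.
have ptr u : nC (u - x0 0 1) < r -> nV (pt u - x0) < r.
  by move=> hu; rewrite nV_lt !subVE vec0 vec1 hu zr.
pose q u := u + e (pt u) - y 0 1.
have e1 : nC (e (pt (x0 0 1)) - e x0) < r / 16.
  by apply: hd; rewrite nV_lt !subVE vec0 vec1 subrr nC0 d0 z1.
have elip u u' : nC (u - x0 0 1) < r -> nC (u' - x0 0 1) < r ->
    nC (e (pt u) - e (pt u')) <= 2^-1 * nC (u - u').
  move=> h h'; have := e_lip (ptr _ h) (ptr _ h'); rewrite /pt !vec0 !vec1; exact.
pose F (x : V) := - (q (x 0 1) * (q (x 0 1))^*).
pose b : V := pt (x0 0 1).
have bE (z : C) : (b + z *: delta_mx 0 1) 0 1 = x0 0 1 + z.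
  by rewrite addVE /b /pt vec1 !mxE /= mulr1.
have r2 : 0 < r / 2 by rewrite divr_gt0.
have [|z0 z0r hmax] := @slice_max R F b (delta_mx 0 1) (r / 2) (ltW r2).
  move=> z zr2.
  have hu : nC (x0 0 1 + z - x0 0 1) < r.
    by rewrite addrC addKr; apply: le_lt_trans zr2 _; rewrite ltr_pdivrMr // mulr_natr mulr2n ltrDl.
  have [c hc] := e_holo (ptr _ hu).
  have hpt i : exists c', wdiff (fun x : V => pt (x 0 1) 0 i) (b + z *: delta_mx 0 1) c' (fun=> 0).
    elim/I2_ind: i; eexists.
      apply: (wdiff_near (f := fun=> y 0 0)); last exact: wdiff_cst.
      by exists 1 => // x _; rewrite /pt vec0.
    apply: (wdiff_near (f := fun x => x 0 1)); last exact: wdiff_coord.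
    by exists 1 => // x _; rewrite /pt vec1.
  have [b0 hc0] := hpt 0; have [b1 hc1] := hpt 1.
  rewrite -bE in hc.
  have h1 := wdiff_comp_holo hc hc0 hc1.
  have h2 := wdiffB (wdiffD (wdiff_coord 1 (b + z *: delta_mx 0 1)) h1)
     (wdiff_cst (y 0 1) (b + z *: delta_mx 0 1)).
  exact: wdiff_cts (wdiffN (wdiffM h2 (wdiff_conj h2))).
have FE (z : C) : complex.Re (F (b + z *: delta_mx 0 1)) = - nC (q (x0 0 1 + z)) ^+ 2.
  by rewrite /F bE -nC_sqr -rmorphN.
pose u0 := x0 0 1 + z0.
have u0r : nC (u0 - x0 0 1) <= r / 2 by rewrite /u0 addrC addKr.
have u0r' : nC (u0 - x0 0 1) < r.
  by apply: le_lt_trans u0r _; rewrite ltr_pdivrMr // mulr_natr mulr2n ltrDl.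
have x0r : nC (x0 0 1 - x0 0 1) < r by rewrite subrr nC0.
exists (pt u0); first exact: ptr.
suff q0 : q u0 = 0.
  apply: rowP2; rewrite ?graph_map0 ?graph_map1 /pt ?vec0 ?vec1 //.
  by apply/eqP; rewrite -subr_eq0; apply/eqP.
apply/eqP; rewrite -nC_eq0; apply/negP => /negP; rewrite neq_lt ltNge nC_ge0 /= => qpos.
(* The move stays in the disc: |z'| is at most r/16 + r/16 + (1/2)(r/2) < r/2, which accounts for
   the radius r/16 above. *)
pose z' := z0 - q u0.
have T1 : z' = (y 0 1 - (x0 0 1 + e x0)) - (e (pt (x0 0 1)) - e x0) - (e (pt u0) - e (pt (x0 0 1))).
  by rewrite /z' /q /u0; ring.
have z'r : nC z' <= r / 2.
  rewrite T1; apply: le_trans (nC_triangle _ _) _; rewrite nCN.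
  apply: le_trans (lerD (nC_triangle _ _) (elip _ _ u0r' x0r)) _; rewrite nCN.
  move: w1 e1 u0r r0; clear.
  by move: (nC _) (nC _) (nC _) => a b c; lra.
have u'E : x0 0 1 + z' = u0 - q u0 by rewrite /z' /u0 addrA.
have u'r : nC (u0 - q u0 - x0 0 1) < r.
  rewrite -u'E addrC addKr; apply: le_lt_trans z'r _.
  by rewrite ltr_pdivrMr // mulr_natr mulr2n ltrDl.
have qq : nC (q (u0 - q u0)) <= 2^-1 * nC (q u0).
  have -> : q (u0 - q u0) = e (pt (u0 - q u0)) - e (pt u0).
    by rewrite {1}/q; rewrite /q; ring.
  apply: le_trans (elip _ _ u'r u0r') _.
  by rewrite addrC addKr nCN.
have := hmax z' z'r; rewrite !FE -/u0 u'E lerN2 => h.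
have : nC (q (u0 - q u0)) < nC (q u0).
  by apply: le_lt_trans qq _; move: qpos; clear; move: (nC _) => a; lra.
by rewrite ltNge -ler_sqr ?nnegrE ?nC_ge0 // h.
Qed.

Lemma graph_map_inverse_hdiff (H : V -> V) x : nV (x - x0) < r ->
  (exists2 d : R, 0 < d & forall y, nV (y - Psi x) < d -> nV (H y - x0) < r /\ Psi (H y) = y) ->
  hdiff H (Psi x).
Proof.
move=> xr [d d0 hd]; have [a he] := e_holo xr.
have HP : H (Psi x) = x.
  have [h1 h2] : nV (H (Psi x) - x0) < r /\ Psi (H (Psi x)) = Psi x.
    by apply: hd; rewrite subrr nV0.
  exact: graph_map_inj.
have H0 y : nV (y - Psi x) < d -> H y 0 0 = y 0 0.
  by move=> /hd[_ h]; rewrite -{2}h graph_map0.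
(* The Lipschitz constant 1/2 excludes [a 1 = -1]: a vertical increment s would satisfy s <= s/4 +
   s/2. *)
have a1 : 1 + a 1 != 0.
  apply/eqP => a1; have e4 : 0 < 4^-1 :> R by rewrite invr_gt0.
  have [d1 d10 h1] := he _ e4.
  pose s := Num.min d1 (r - nV (x - x0)) / 2.
  have m0 : 0 < Num.min d1 (r - nV (x - x0)) by rewrite lt_min d10 subr_gt0.
  have s0 : 0 < s by rewrite divr_gt0.
  have : s < Num.min d1 (r - nV (x - x0)) by rewrite /s ltr_pdivrMr // mulr_natr mulr2n ltrDl.
  rewrite lt_min => /andP[s1 s2].
  pose k : V := vec 0 s%:C%C.
  have nk : nV k = s by rewrite nVE vec0 vec1 nC0 nC_real (gtr0_norm s0) (max_idPr (ltW s0)).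
  have h2 : nC (e (x + k) - e x) <= 2^-1 * s.
    have -> : s = nC ((x + k) 0 1 - x 0 1).
      by rewrite addVE addrC addKr vec1 nC_real gtr0_norm.
    apply: e_lip => //; last by rewrite addVE vec0 addr0.
    rewrite addrAC; apply: le_lt_trans (nV_triangle _ _) _; rewrite nk.
    by rewrite -ltrBrDl.
  have := h1 k; rewrite nk => /(_ s1).
  have -> : rlin a (fun=> 0) k = - s%:C%C.
    rewrite /rlin vec0 vec1 mulr0 !mul0r !addr0 add0r.
    by rewrite (_ : a 1 = -1) ?mulN1r //; apply/eqP; rewrite -addr_eq0 addrC a1.
  rewrite opprK => h3.
  have : nC s%:C%C <= nC (e (x + k) - e x + s%:C%C) + nC (e (x + k) - e x).
    rewrite -[nC (e (x + k) - e x)]nCN; apply: le_trans (nC_triangle _ _).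
    by rewrite addrAC subrr add0r.
  rewrite nC_real gtr0_norm // => h4.
  by move: (nC _) (nC _) h2 h3 h4 s0 => u w; clear; lra.
have [K K0 [d1 d10 h1]] := wdiff_bigO he.
(* |t| <= |k1| + |t|/2 + K |k0| for the second coordinate t of H (y + k) - x *)
have small k : nV k < Num.min (Num.min d d1) (r - nV (x - x0)) ->
    nC (H (Psi x + k) 0 1 - x 0 1) <= (2 + 2 * K) * nV k.
  rewrite !lt_min => /andP[/andP[kd kd1] kr].
  have kd' : nV (Psi x + k - Psi x) < d by rewrite addrC addKr.
  have [h2 h3] := hd _ kd'; have h4 := H0 _ kd'.
  set x' := H (Psi x + k) in h2 h3 h4 *.
  pose w : V := vec (k 0 0) 0.
  have nw : nV w <= nV k by rewrite nV_le vec0 vec1 nC0 nC0_le nV_ge0.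
  have x'0 : x' 0 0 = x 0 0 + k 0 0 by rewrite h4 addVE graph_map0.
  have xwr : nV (x + w - x0) < r.
    rewrite addrAC; apply: le_lt_trans (nV_triangle _ _) _.
    by rewrite -ltrBrDl (le_lt_trans nw).
  have l1 : nC (e x' - e (x + w)) <= 2^-1 * nC (x' 0 1 - x 0 1).
    have := e_lip h2 xwr; rewrite !addVE vec0 vec1 addr0; apply.
    exact: x'0.
  have l2 := h1 w (le_lt_trans nw kd1).
  have h5 : x' 0 1 + e x' = x 0 1 + e x + k 0 1.
    by rewrite -(graph_map1 e) -/Psi h3 addVE graph_map1.
  have -> : x' 0 1 - x 0 1 = k 0 1 - ((e x' - e (x + w)) + (e (x + w) - e x)).
    have -> : x' 0 1 = x 0 1 + e x + k 0 1 - e x' by rewrite -h5 addrK.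
    by move: (e x) (e x') (e (x + w)) (x 0 1) (k 0 1); clear; move=> *; ring.
  have t1 := nC_triangle (k 0 1) (- ((e x' - e (x + w)) + (e (x + w) - e x))).
  rewrite nCN in t1.
  have t2 := nC_triangle (e x' - e (x + w)) (e (x + w) - e x).
  have t3 : x' 0 1 - x 0 1 = k 0 1 - ((e x' - e (x + w)) + (e (x + w) - e x)).
    have -> : x' 0 1 = x 0 1 + e x + k 0 1 - e x' by rewrite -h5 addrK.
    by move: (e x) (e x') (e (x + w)) (x 0 1) (k 0 1); clear; move=> *; ring.
  rewrite -t3 in t1 *.
  have t4 := nC1_le k; have t5 := ler_wpM2l (ltW K0) nw.
  move: t1 t2 l1 l2 t4 t5; rewrite mulrDl -mulrA; move: (K * nV w) (K * nV k) (nV k).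
  by move: (nC _) (nC _) (nC _) (nC _) (nC _); clear; move=> *; lra.
pose c : 'I_2 -> C := fun i => if i == 0 then - a 0 / (1 + a 1) else (1 + a 1)^-1.
apply: I2_ind; first last.
  exists c => eps eps0.
  set m := Num.min (Num.min d d1) (r - nV (x - x0)) in small.
  have m0 : 0 < m by rewrite !lt_min d0 d10 subr_gt0.
  have n1 : 0 < nC (1 + a 1) by rewrite nC_gt0.
  pose L := 3 + 2 * K; have L0 : 0 < L by rewrite addr_gt0 // mulr_gt0.
  have [d2 d20 h2] := he (eps * nC (1 + a 1) / L) (divr_gt0 (mulr_gt0 eps0 n1) L0).
  exists (Num.min m (d2 / L)); first by rewrite lt_min m0 divr_gt0.
  move=> k; rewrite lt_min ltr_pdivlMr // => /andP[km kd2]; rewrite HP.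
  have sm := small k km.
  move: km; rewrite !lt_min => /andP[/andP[kd kd1] kr].
  have kd' : nV (Psi x + k - Psi x) < d by rewrite addrC addKr.
  have [h3 h4] := hd _ kd'; have h5 := H0 _ kd'.
  set x' := H (Psi x + k) in sm h3 h4 h5 *.
  have k0 := nV_ge0 k.
  have nx : nV (x' - x) <= L * nV k.
    rewrite nV_le !subVE h5 addVE graph_map0 addrC addKr; apply/andP; split.
      apply: le_trans (nC0_le k) _; rewrite ler_peMl // /L.
      by rewrite ler_wpDr ?ler1n // mulr_ge0 // ltW.
    by apply: le_trans sm _; rewrite ler_wpM2r // /L lerD2r ler_nat.
  have nx2 : nV (x' - x) < d2 by apply: le_lt_trans nx _; rewrite mulrC.
  have := h2 _ nx2; rewrite (addrC x) subrK => h6.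
  have h7 : x' 0 1 + e x' = x 0 1 + e x + k 0 1.
    by rewrite -(graph_map1 e) -/Psi h4 addVE graph_map1.
  have h8 : x' 0 0 = x 0 0 + k 0 0 by rewrite h5 addVE graph_map0.
  have -> : x' 0 1 - x 0 1 - rlin c (fun=> 0) k =
     - (1 + a 1)^-1 * (e x' - e x - rlin a (fun=> 0) (x' - x)).
    rewrite /rlin !subVE h8 /c /=.
    have -> : e x' = x 0 1 + e x + k 0 1 - x' 0 1 by rewrite -h7 addrAC subrr add0r.
    move: (e x) (x' 0 1) (x 0 1) (k 0 1) (k 0 0) (a 0) (a 1) a1 (x 0 0); clear.
    by move=> *; field.
  rewrite nCM nCN nCV mulrC ler_pdivrMr //.
  apply: le_trans h6 _.
  have e1 : 0 <= eps * nC (1 + a 1) / L by rewrite divr_ge0 ?mulr_ge0 ?(ltW eps0) ?nC_ge0 ?(ltW L0).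
  apply: le_trans (ler_wpM2l e1 nx) _.
  by rewrite mulrA divfK ?gt_eqF // mulrAC.
exists (fun j => (0 == j)%:R).
apply: (wdiff_near (f := fun y : V => y 0 0)); last exact: wdiff_coord.
by exists d => // y /H0.
Qed.

End GraphInverse.

(** * Graph charts, the swap of coordinates, and derivatives of complex differentiable functions *)

Section Charts.
Context {R : realType} {M : topologicalType}.
Local Notation C := R[i].
Local Notation V := 'rV[R[i]]_2.
Variable A : set (chart R M).
Hypothesis surfaceM : complex_surface A.
Implicit Types (phi psi : chart R M) (p q : M) (x y : V) (e : V -> C).

Lemma ball_open (x : V) (r : R) : open [set y | nV (y - x) < r].
Proof.
apply/openV_P => y /= hy; exists (r - nV (y - x)); first by rewrite subr_gt0.
move=> z hz; apply: le_lt_trans (nV_telescope z y x) _.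
by rewrite -ltrBrDr.
Qed.

Lemma chart_ball phi p (N : set M) : dom phi p -> nbhs p N ->
  exists2 r : R, 0 < r & forall x, nV (x - phi p) < r ->
    exists q, [/\ dom phi q, phi q = x, pt phi x = q & N q].
Proof.
move=> dp Np.
have px : (phi @` dom phi) (phi p) by exists p.
have /openV_P/(_ _ px)[r r0 hr] := @im_open R M phi.
have : nbhs (phi p) (pt phi @^-1` N) by apply: (pt_cts px); rewrite /= coordK.
move=> /nbhsV_P[d d0 hd]; exists (Num.min r d); first by rewrite lt_min r0.
move=> x; rewrite lt_min => /andP[/hr [q dq qx] /hd Nx].
exists q; split=> //; first by rewrite -qx coordK.
by move: Nx; rewrite /= -qx coordK.
Qed.

(** The domain is cut so that the image is exactly a ball: its convexity is what later joins two
    points of a plaque by a segment. *)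
Lemma graph_chart phi p e (r : R) : A phi -> dom phi p -> 0 < r ->
  (forall x, nV (x - phi p) < r -> (phi @` dom phi) x) ->
  (forall x, nV (x - phi p) < r -> exists a, wdiff e x a (fun=> 0)) ->
  (forall x y, nV (x - phi p) < r -> nV (y - phi p) < r -> x 0 0 = y 0 0 ->
     nC (e x - e y) <= 2^-1 * nC (x 0 1 - y 0 1)) ->
  exists psi (eta : R), [/\ A psi /\ dom psi p, 0 < eta,
    forall q, dom psi q -> dom phi q /\ nV (phi q - phi p) < r,
    forall q, psi q = graph_map e (phi q) &
    psi @` dom psi = [set y | nV (y - psi p) < eta]].
Proof.
move=> Aphi dp r0 hr he hl; set x0 := phi p in hr he hl *.
have [eta eta0 [_ hsurj]] := graph_map_surj r0 he hl.
set Psi := graph_map e in hsurj.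
pose O := [set x | nV (x - x0) < r /\ nV (Psi x - Psi x0) < eta].
have hPsi x : nV (x - x0) < r -> hdiff Psi x.
  by move=> /he[a ha]; exact: graph_map_hdiff ha.
have oO : open O.
  apply/openV_P => x [x1 x2].
  have /openV_P/(_ x x1)[d1 d10 h1] := @ball_open x0 r.
  have /openV_P/(_ _ x2)[d2 d20 h2] := @ball_open (Psi x0) eta.
  have /continuousV_P/(_ _ d20)[d3 d30 h3] := hdiff_cts (hPsi x x1).
  exists (Num.min d1 d3); first by rewrite lt_min d10.
  by move=> y; rewrite lt_min => /andP[y1 y3]; split; [exact: h1|apply: h2; exact: h3].
(* On the ball where [H] is used a preimage exists, so the default x0 is never chosen for want of
   one. *)
pose H y := xget x0 [set x | nV (x - x0) < r /\ Psi x = y].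
have HK y : nV (y - Psi x0) < eta -> nV (H y - x0) < r /\ Psi (H y) = y.
  move=> /hsurj[x x1 x2]; rewrite /H.
  exact: (@xgetPex _ x0 [set x | nV (x - x0) < r /\ Psi x = y] (ex_intro _ x (conj x1 x2))).
have HP x : O x -> H (Psi x) = x.
  by move=> [x1 x2]; have [h1 h2] := HK _ x2; exact: (graph_map_inj hl h1 x1).
have PO : Psi @` O = [set y | nV (y - Psi x0) < eta].
  apply/seteqP; split=> [_ [x [_ x2] <-]//|y hy].
  by have [h1 h2] := HK _ hy; exists (H y) => //; split; rewrite // h2.
have oPO : open (Psi @` O) by rewrite PO; exact: ball_open.
have HH x : O x -> hdiff H (Psi x).
  move=> [x1 x2]; apply: (graph_map_inverse_hdiff he hl x1).
  have /openV_P/(_ _ x2)[d d0 hd] := @ball_open (Psi x0) eta.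
  by exists d => // y /hd; exact: HK.
have [psi [Apsi dpsi psiE ptE]] := chart_comp surfaceM Aphi oO (fun x hx => hr x hx.1) oPO HP
   (fun x hx => hPsi x hx.1) HH.
have Op : O x0 by split; rewrite subrr nV0.
exists psi, eta; split=> //.
- by split=> //; apply/dpsi.
- by move=> q /dpsi[dq [Oq _]].
rewrite psiE -/x0 -PO; apply/seteqP; split=> [_ [q /dpsi[dq Oq] <-]|_ [x Ox <-]].
  by exists (phi q) => //; rewrite psiE.
have [q dq qx] := hr _ Ox.1; exists q; last by rewrite psiE qx.
by apply/dpsi; rewrite qx.
Qed.

Lemma swap_chart phi : A phi -> exists psi, [/\ A psi,
  forall q, dom psi q <-> dom phi q & forall q, psi q = vec (phi q 0 1) (phi q 0 0)].
Proof.
move=> Aphi; pose S (x : V) : V := vec (x 0 1) (x 0 0).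
have SS x : S (S x) = x by apply: rowP2; rewrite /S ?vec0 ?vec1.
have Sd x : hdiff S x.
  elim/I2_ind; eexists.
    apply: (wdiff_near (f := fun y : V => y 0 1)); last exact: wdiff_coord.
    by exists 1 => // y _; rewrite /S vec0.
  apply: (wdiff_near (f := fun y : V => y 0 0)); last exact: wdiff_coord.
  by exists 1 => // y _; rewrite /S vec1.
have oS : open (S @` (phi @` dom phi)).
  apply/openV_P => _ [x Dx <-]; have /openV_P/(_ _ Dx)[d d0 hd] := @im_open R M phi.
  exists d => // y hy; exists (S y) => //; apply: hd.
  by move: hy; rewrite !nV_lt !subVE /S !vec0 !vec1 andbC.
have [psi [Apsi dpsi psiE _]] := chart_comp surfaceM Aphi (@im_open R M phi)
  (fun x hx => hx) oS (fun x _ => SS x) (fun x _ => Sd x) (fun x _ => Sd (S x)).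
exists psi; split=> // q; rewrite dpsi; split=> [[]//|dq]; split=> //; by exists q.
Qed.

Lemma vec_line (v : V) (t : C) mu (a : 'I_2 -> C) :
  a 0 * (t *: delta_mx 0 mu : V) 0 0 + a 1 * (t *: delta_mx 0 mu : V) 0 1 = a mu * t.
Proof. by elim/I2_ind: mu; rewrite !mxE /= !mulr0 !mulr1 ?addr0 ?add0r. Qed.

(* A complex differentiable function whose derivative is real differentiable:
   by symmetry of second derivatives the derivative is complex differentiable. *)
Lemma complex_derivative e x (d : R) : 0 < d ->
  (forall y, nV (y - x) < d -> exists a, wdiff e y a (fun=> 0)) ->
  (forall mu, wd (pz mu e) x) -> forall mu, exists a, wdiff (pz mu e) x a (fun=> 0).
Proof.
move=> d0 he hz mu.
have he' y : nV (y - x) < d -> wdiff e y (fun i => pz i e y) (fun=> 0).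
  by move=> /he[a ha]; apply: (wdiff_eq ha) => // i; rewrite (wdiff_pz _ ha).
exists (fun i => pz i (pz mu e) x); apply: (wdiff_eq (hz mu)) => // nu.
have dv v : wdiff (fun y => rlin (fun i => pz i e y) (fun=> 0) v) x
   (fun i => pz i (pz 0 e) x * v 0 0 + pz i (pz 1 e) x * v 0 1)
   (fun i => pb i (pz 0 e) x * v 0 0 + pb i (pz 1 e) x * v 0 1).
  apply: (wdiff_near (f := fun y => pz 0 e y * v 0 0 + pz 1 e y * v 0 1)).
    by exists 1 => // y _; rewrite /rlin !mul0r !addr0.
  have := wdiffD (wdiffM (hz 0) (wdiff_cst (v 0 0) x)) (wdiffM (hz 1) (wdiff_cst (v 0 1) x)).
  by move=> h; apply: (wdiff_eq h) => i; rewrite !mulr0 !addr0.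
have key (s t : C) : (pz nu (pz mu e) x * s + pb nu (pz mu e) x * s^*) * t + (0 * s + 0 * s^*) * t^* =
  (pz mu (pz nu e) x * t + pb mu (pz nu e) x * t^*) * s + (0 * t + 0 * t^*) * s^*.
  have := young d0 he' (dv (t *: delta_mx 0 mu)) (dv (s *: delta_mx 0 nu)).
  rewrite !rlin_line.
  rewrite (vec_line 0 t mu (fun j => pz nu (pz j e) x)) (vec_line 0 t mu (fun j => pb nu (pz j e) x)).
  rewrite (vec_line 0 s nu (fun j => pz mu (pz j e) x)) (vec_line 0 s nu (fun j => pb mu (pz j e) x)).
  move: (pz nu (pz mu e) x) (pb nu (pz mu e) x) (pz mu (pz nu e) x) (pb mu (pz nu e) x).
  move: s^* t^*; clear => s' t' a b c f h; rewrite !mul0r !addr0 !mul0r !addr0.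
  have -> : (a * s + b * s') * t = a * t * s + b * t * s' by ring.
  by rewrite h; ring.
by have [_ -> _] := bilinear_sym key.
Qed.

End Charts.

(** * Goursat's theorem *)

Section Goursat.
Context {R : realType} {M : topologicalType}.
Local Notation C := R[i].
Local Notation V := 'rV[R[i]]_2.
Variables (A : set (chart R M)) (rho : M -> R).
Hypothesis surfaceM : complex_surface A.
Hypothesis rho_continuous : continuous rho.
Hypothesis rho_smooth : smooth_fun A (Mstar rho) rho.
Implicit Types (phi psi : chart R M) (p q : M) (x y : V) (e f : V -> C).

Lemma Mstar_open : open (Mstar rho).
Proof.
have -> : Mstar rho = rho @^-1` [set t | 0 < t] by [].
by apply: open_comp; [move=> p _; exact: rho_continuous | exact: open_gt].
Qed.

Lemma im_open_sub phi (U : set M) : open U -> open (phi @` (dom phi `&` U)).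
Proof.
move=> oU; apply/openV_P => _ [p [dp Up] <-].
have [r r0 hr] := chart_ball dp (open_nbhs_nbhs (conj oU Up)).
by exists r => // x /hr[q [dq <- _ Nq]]; exists q.
Qed.

Lemma loc_sm phi (g : M -> R) (U : set M) : A phi -> open U -> smooth_fun A U g ->
  sm (phi @` (dom phi `&` U)) (loc phi g).
Proof. by move=> Aphi oU hg; apply: smooth_on_sm (im_open_sub oU) (hg _ Aphi). Qed.

(* rho is smooth in the charts z and (z_1, z_2 + e), so the chain rule writes the
   derivatives of e as quotients of differentiable functions. *)
Lemma goursat_graph phi p e (r : R) : A phi -> dom phi p -> Mstar rho p ->
  pz 1 (loc phi rho) (phi p) != 0 -> 0 < r ->
  (forall x, nV (x - phi p) < r -> exists a, wdiff e x a (fun=> 0)) ->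
  (forall x y, nV (x - phi p) < r -> nV (y - phi p) < r -> x 0 0 = y 0 0 ->
     nC (e x - e y) <= 2^-1 * nC (x 0 1 - y 0 1)) ->
  forall mu, exists a, wdiff (pz mu e) (phi p) a (fun=> 0).
Proof.
move=> Aphi dp Mp f1 r0' he' hl'; set x0 := phi p in f1 he' hl' *.
have NM : nbhs p (Mstar rho) by apply: open_nbhs_nbhs; split=> //; exact: Mstar_open.
have [r1 r10 hr1] := chart_ball dp NM.
pose s := Num.min r r1; have s0 : 0 < s by rewrite lt_min r0'.
have sr x : nV (x - x0) < s -> nV (x - x0) < r by rewrite lt_min => /andP[].
have sr1 x : nV (x - x0) < s -> nV (x - x0) < r1 by rewrite lt_min => /andP[].
have he x : nV (x - x0) < s -> exists a, wdiff e x a (fun=> 0) by move=> /sr; exact: he'.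
have hl x y : nV (x - x0) < s -> nV (y - x0) < s -> x 0 0 = y 0 0 ->
    nC (e x - e y) <= 2^-1 * nC (x 0 1 - y 0 1).
  by move=> /sr h1 /sr h2; exact: hl'.
have hs x : nV (x - x0) < s -> (phi @` dom phi) x.
  by move=> /sr1/hr1[q [dq qx _ _]]; exists q.
have [psi [eta [[Apsi dpsi] eta0 hpsi psiE imE]]] := graph_chart surfaceM Aphi dp s0 hs he hl.
pose Psi := graph_map e; pose f := loc phi rho; pose g := loc psi rho.
have sf := loc_sm Aphi Mstar_open rho_smooth; have sg := loc_sm Apsi Mstar_open rho_smooth.
rewrite -/f in sf; rewrite -/g in sg.
have hPsi x : nV (x - x0) < s -> hdiff Psi x.
  by move=> /he[a ha]; exact: graph_map_hdiff ha.
have x0s : nV (x0 - x0) < s by rewrite subrr nV0.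
have /continuousV_P/(_ _ eta0)[d1 d10 hd1] := hdiff_cts (hPsi _ x0s).
pose d := Num.min d1 s; have d0 : 0 < d by rewrite lt_min d10.
have fg x : nV (x - x0) < d -> [/\ nV (x - x0) < s, f x = g (Psi x),
    (phi @` (dom phi `&` Mstar rho)) x & (psi @` (dom psi `&` Mstar rho)) (Psi x)].
  rewrite lt_min => /andP[/hd1 h1 xs].
  have : (psi @` dom psi) (Psi x) by rewrite imE /= psiE.
  move=> [q dq qx]; have [dq' qs] := hpsi _ dq.
  have qE : phi q = x by apply: (graph_map_inj hl qs xs); rewrite -psiE qx.
  have [q' [dq'' q'x ptq' Mq']] := hr1 _ (sr1 _ xs).
  have qq : q' = q by rewrite -ptq' -qE coordK.
  rewrite qq in Mq'; split=> //; [|by exists q|by exists q].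
  by rewrite /f /g /loc -qx -qE !coordK.
have der i x : nV (x - x0) < d ->
    pz i f x = pz 0 g (Psi x) * (0 == i)%:R + pz 1 g (Psi x) * ((1 == i)%:R + pz i e x).
  move=> xd; have [xs _ _ Dx'] := fg x xd; have [a ha] := he _ xs.
  have h0 : wdiff (fun y => Psi y 0 0) x (fun i => (0 == i)%:R) (fun=> 0).
    apply: (wdiff_near (f := fun y : V => y 0 0)); last exact: wdiff_coord.
    by exists 1 => // y _; rewrite graph_map0.
  have h1 : wdiff (fun y => Psi y 0 1) x (fun i => (1 == i)%:R + pz i e x) (fun=> 0).
    apply: (wdiff_near (f := fun y : V => y 0 1 + e y)).
      by exists 1 => // y _; rewrite graph_map1.
    apply: (wdiff_eq (wdiffD (wdiff_coord 1 x) ha)) => j; rewrite ?addr0 //.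
    by rewrite (wdiff_pz _ ha).
  have h2 := wdiff_comp_holo (sm_wd sg Dx') h0 h1.
  have nf : exists2 d', 0 < d' & forall y, nV (y - x) < d' -> g (Psi y) = f y.
    have /openV_P/(_ _ xd)[d' d'0 hd'] := @ball_open R x0 d.
    by exists d' => // y /hd' /fg[_ ->].
  have h3 := wdiff_near nf h2.
  by rewrite (wdiff_pz _ h3).
have x0d : nV (x0 - x0) < d by rewrite subrr nV0.
have [_ _ Dx0 Dx0'] := fg _ x0d.
(* For the index 1 the chain rule reads [pz 1 f x0 = pz 1 g (Psi x0) * (1 + pz 1 e x0)], and the
   left side is nonzero by assumption. *)
have G1 : pz 1 g (Psi x0) != 0.
  apply: contra_neq f1 => h; rewrite der //= h mulr0 mul0r addr0 //.
have wG k : wd (fun y => pz k g (Psi y)) x0.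
  have [a0 h0] := hPsi _ x0s 0; have [a1 h1] := hPsi _ x0s 1.
  exact: wdiff_wd (wdiff_comp_holo (sm_wd (sm_pz k sg) Dx0') h0 h1).
have /continuousC_P/(_ (nC (pz 1 g (Psi x0))))[|d2 d20 hd2] := wdiff_cts (wG 1).
  by rewrite nC_gt0.
apply: (complex_derivative s0) => [y /he //|mu].
(* This expression is the chain rule [der] solved for [pz mu e]. *)
have hW := wdiffB (wdiffM (wdiffB (sm_wd (sm_pz mu sf) Dx0)
   (wdiffM (wG 0) (wdiff_cst (0 == mu)%:R x0))) (@wdiffV _ (fun y => pz 1 g (Psi y)) _ _ _ G1 (wG 1))) (wdiff_cst (1 == mu)%:R x0).
apply: wdiff_wd (wdiff_near _ hW).
exists (Num.min d d2); first by rewrite lt_min d0.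
move=> y; rewrite lt_min => /andP[yd /hd2 y2]; rewrite der //.
have : pz 1 g (Psi y) != 0.
  by apply/eqP => h; move: y2; rewrite h sub0r nCN ltxx.
move: (pz 0 g (Psi y)) (pz 1 g (Psi y)) (pz mu e y) (_%:R) (_%:R); clear.
by move=> *; field.
Qed.

Lemma loc_transition phi psi p (g : M -> R) : dom phi p -> dom psi p ->
  exists2 r : R, 0 < r & forall x, nV (x - phi p) < r ->
    (phi @` (dom phi `&` dom psi)) x /\ loc psi g (transition phi psi x) = loc phi g x.
Proof.
move=> dp dp'; have N : nbhs p (dom psi) by apply: open_nbhs_nbhs; split=> //; exact: dom_open.
have [r r0 hr] := chart_ball dp N; exists r => // x /hr[q [dq <- ptq dq']].
by split; [exists q | rewrite /loc /transition !coordK].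
Qed.

Lemma transition_hdiff phi psi p : A phi -> A psi -> dom phi p -> dom psi p ->
  hdiff (transition phi psi) (phi p).
Proof.
move=> Aphi Apsi dp dp'; apply/differentiable_hdiff.
by have [h _] := atlas_compatible surfaceM Aphi Apsi; apply: h; exists p.
Qed.

Lemma pb_loc phi (g : M -> R) x mu : wd (loc phi g) x -> pb mu (loc phi g) x = (pz mu (loc phi g) x)^*.
Proof.
move=> h; rewrite -(pb_conj _ h); congr pb; apply/funext => y.
by rewrite /loc conjC_realc.
Qed.

Hypothesis drho : forall p, Mstar rho p -> nonzero_differential A rho p.

Lemma pz_neq0 phi p : A phi -> dom phi p -> Mstar rho p ->
  exists mu, pz mu (loc phi rho) (phi p) != 0.
Proof.
move=> Aphi dp Mp; have [v] := drho Mp Aphi dp.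
have h : wd (loc phi rho) (phi p).
  by apply: (sm_wd (loc_sm Aphi Mstar_open rho_smooth)); exists p.
rewrite (wdiff_rderive _ h) /rlin !pb_loc //.
have [h0|h0 _] := eqVneq (pz 0 (loc phi rho) (phi p)) 0; last by exists 0.
have [h1|h1 _] := eqVneq (pz 1 (loc phi rho) (phi p)) 0; last by exists 1.
by rewrite h0 h1 conjC0 !mul0r !addr0 eqxx.
Qed.

Lemma good_chart p : Mstar rho p ->
  exists phi, [/\ A phi, dom phi p & pz 1 (loc phi rho) (phi p) != 0].
Proof.
move=> Mp; have [phi Aphi dp] := atlas_cover surfaceM p.
have [h1|h1] := eqVneq (pz 1 (loc phi rho) (phi p)) 0; last by exists phi.
have [psi [Apsi dpsi psiE]] := swap_chart surfaceM Aphi.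
have dp' : dom psi p by apply/dpsi.
exists psi; split=> //; have [mu] := pz_neq0 Aphi dp Mp.
elim/I2_ind: mu; last by rewrite h1 eqxx.
apply: contra_neq => h2.
have [r r0 hr] := loc_transition rho dp dp'.
have wf : wd (loc phi rho) (phi p).
  by apply: (sm_wd (loc_sm Aphi Mstar_open rho_smooth)); exists p.
have wg : wd (loc psi rho) (psi p).
  by apply: (sm_wd (loc_sm Apsi Mstar_open rho_smooth)); exists p.
pose S (x : V) : V := vec (x 0 1) (x 0 0).
have S0 : wdiff (fun y => S y 0 0) (phi p) (fun i => (1 == i)%:R) (fun=> 0).
  apply: (wdiff_near (f := fun y : V => y 0 1)); last exact: wdiff_coord.
  by exists 1 => // y _; rewrite /S vec0.
have S1 : wdiff (fun y => S y 0 1) (phi p) (fun i => (0 == i)%:R) (fun=> 0).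
  apply: (wdiff_near (f := fun y : V => y 0 0)); last exact: wdiff_coord.
  by exists 1 => // y _; rewrite /S vec1.
rewrite psiE in wg; have h3 := wdiff_comp_holo wg S0 S1.
have nf : exists2 d, 0 < d & forall y, nV (y - phi p) < d -> loc psi rho (S y) = loc phi rho y.
  exists r => // y /hr[[q [dq dq'] qy]] <-.
  by rewrite /transition -qy coordK // psiE.
have h4 := wdiff_near nf h3.
by rewrite (wdiff_pz _ h4) /= mulr0 add0r mulr1 -psiE.
Qed.

Hypothesis Mstar_nonempty : Mstar rho !=set0.

(** Complex differentiability in C^2 is invariant under translation and scaling: f is moved into a
    chart around one point of M_* and multiplied by [c], which brings its vertical Lipschitz
    constant below the 1/2 that [goursat_graph] asks for. *)
Lemma goursat_lipschitz f x (r L : R) : 0 < r -> 0 <= L ->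
  (forall y, nV (y - x) < r -> exists a, wdiff f y a (fun=> 0)) ->
  (forall y y', nV (y - x) < r -> nV (y' - x) < r -> y 0 0 = y' 0 0 ->
     nC (f y - f y') <= L * nC (y 0 1 - y' 0 1)) ->
  forall mu, exists a, wdiff (pz mu f) x a (fun=> 0).
Proof.
move=> r0 L0 hf hl mu; have [p Mp] := Mstar_nonempty.
have [phi [Aphi dp h1]] := good_chart Mp; set x0 := phi p in h1.
have L1 : 0 < 2 * L + 1 by rewrite ltr_wpDl // mulr_ge0.
pose c : C := ((2 * L + 1)^-1)%:C%C.
pose e y := c * f (y + (x - x0)).
have sh y : y + (x - x0) - x = y - x0 by rewrite addrA addrAC addrK.
have de y : nV (y - x0) < r -> exists a, wdiff f (y + (x - x0)) a (fun=> 0) /\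
    wdiff e y (fun i => c * a i) (fun=> 0).
  move=> hy; have [|a ha] := hf (y + (x - x0)); first by rewrite sh.
  exists a; split=> //.
  have := wdiffM (wdiff_cst c y) (wdiff_shift ha) => h.
  by apply: (wdiff_eq h) => i; rewrite ?mul0r ?mulr0 ?addr0 ?add0r.
have [|y y' hy hy' yy|a ha] := @goursat_graph phi p e r Aphi dp Mp h1 r0 _ _ mu.
- by move=> y /de[a [_ ha]]; eexists; exact: ha.
- rewrite /e -mulrBr nCM nC_real gtr0_norm ?invr_gt0 //.
  rewrite mulrC ler_pdivrMr //.
  have := hl (y + (x - x0)) (y' + (x - x0)); rewrite !sh => /(_ hy hy').
  rewrite !addVE yy => /(_ erefl) h; apply: le_trans h _.
  rewrite opprD addrACA subrr addr0.
  by have := nC_ge0 (y 0 1 - y' 0 1); move: (nC _) => D; lra.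
exists (fun i => c^-1 * a i).
have xE : x + (x0 - x) = x0 by rewrite addrC subrK.
rewrite -[phi p]/x0 -xE in ha.
have h2 := wdiffM (wdiff_cst c^-1 x) (wdiff_shift ha).
have c0 : c != 0 by rewrite -nC_eq0 nC_real gtr0_norm ?gt_eqF // invr_gt0.
apply: (wdiff_eq (wdiff_near _ h2)) => [|i|i]; rewrite ?mul0r ?mulr0 ?addr0 ?add0r //.
exists r => // y hy.
have [|b [h3 h4]] := de (y + (x0 - x)).
  by rewrite addrA addrAC addrK.
have yE : y + (x0 - x) + (x - x0) = y by rewrite -addrA subrKA subrr addr0.
rewrite yE in h3.
by rewrite (wdiff_pz _ h4) (wdiff_pz _ h3) mulrA mulVf // mul1r.
Qed.

(** A function of z_1 alone has vertical Lipschitz constant 0, and its derivatives again depend on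
    z_1 alone; hence [goursat_lipschitz] can be iterated. *)
Lemma goursat_one_variable (k : V -> C) (s : R) :
  (forall z z' : V, z 0 0 = z' 0 0 -> k z = k z') ->
  (forall z, nV z < s -> exists a, wdiff k z a (fun=> 0)) ->
  hol [set z | nV z < s] k.
Proof.
move=> k1 hk; pose D := [set z : V | nV z < s].
have oD : open D.
  have := @ball_open R 0 s; congr open; apply/funext => z; rewrite /D /=.
  by rewrite subr0.
split; last by move=> mu z /hk[a ha]; rewrite (wdiff_pb _ ha).
move=> n; elim: n k k1 hk => [|n IH] k k1 hk.
  by split=> // z /hk[a ha]; exact: wdiff_wd ha.
split=> [z /hk[a ha]|mu]; first exact: wdiff_wd ha.
have inv (z z' v : V) : z 0 0 = z' 0 0 -> rquot k z v = rquot k z' v.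
  move=> zz; apply/funext => t; rewrite /rquot (k1 z z') // (k1 (z + _) (z' + t%:C%C *: v)) //.
  by rewrite !addVE zz.
have pzk (nu : 'I_2) (z z' : V) : z 0 0 = z' 0 0 -> pz nu k z = pz nu k z'.
  by move=> zz; rewrite pzE /dz /rderive !(inv z z').
have pk z : nV z < s -> exists a, wdiff (pz mu k) z a (fun=> 0).
  move=> zs; apply: (@goursat_lipschitz k z (s - nV z) 0) => //.
  - by rewrite subr_gt0.
  - move=> y hy; apply: hk; rewrite -[y](subrK z).
    by apply: le_lt_trans (nV_triangle _ _) _; rewrite -ltrBrDr.
  - by move=> y y' _ _ yy; rewrite (k1 y y') // subrr nC0 mul0r.
split; first exact: IH (pzk mu) pk.
apply: (Wk_ext (f := fun=> 0)) => //; last exact: Wk_cst.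
by move=> y /hk[a ha]; rewrite (wdiff_pb _ ha).
Qed.

(** On the complex line through x the function depends on one variable, so it is holomorphic and
    obeys the Cauchy estimate; working on the closed disc of radius s / 2 turns the constant 2 into
    4. *)
Lemma goursat_cauchy f x mu (s m : R) : 0 < s ->
  (forall z : C, nC z < s -> exists a, wdiff f (x + z *: delta_mx 0 mu) a (fun=> 0)) ->
  (forall z : C, nC z < s -> nC (f (x + z *: delta_mx 0 mu)) <= m) ->
  s * nC (pz mu f x) <= 4 * m.
Proof.
move=> s0 hf hm; pose G (z : V) : V := x + z 0 0 *: delta_mx 0 mu; pose k z := f (G z).
have hG (z : V) i : wdiff (fun z => G z 0 i) z
    (fun j => (0 == j)%:R * (delta_mx 0 mu : V) 0 i) (fun=> 0).
  apply: (wdiff_near (f := fun z => x 0 i + z 0 0 * (delta_mx 0 mu : V) 0 i)).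
    by exists 1 => // y _; rewrite /G !mxE.
  have := wdiffD (wdiff_cst (x 0 i) z) (wdiffM (wdiff_coord 0 z) (wdiff_cst ((delta_mx 0 mu : V) 0 i) z)).
  by move=> h'; apply: (wdiff_eq h') => j; rewrite ?mul0r ?mulr0 ?addr0 ?add0r.
have z0s (z : V) : nV z < s -> nC (z 0 0) < s by apply: le_lt_trans; exact: nC0_le.
have dk (z : V) a : wdiff f (G z) a (fun=> 0) ->
    wdiff k z (fun i => (0 == i)%:R * a mu) (fun=> 0).
  move=> ha; apply: (wdiff_eq (wdiff_comp_holo ha (hG z 0) (hG z 1))) => i; last first.
    by rewrite !mul0r addr0.
  elim/I2_ind: mu {hf hm G k hG ha}; rewrite !mxE /= ?mulr0 ?mulr1 ?addr0 ?add0r mulrC //.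
have hk : hol [set z | nV z < s] k.
  apply: goursat_one_variable => [z z' zz|z /z0s/hf[a ha]]; first by rewrite /k /G zz.
  by eexists; exact: dk ha.
have oD : open [set z : V | nV z < s].
  have := @ball_open R 0 s; congr open; apply/funext => z /=.
  by rewrite subr0.
have s2 : 0 < s / 2 by rewrite divr_gt0.
have ss : s / 2 < s by rewrite ltr_pdivrMr // mulr_natr mulr2n ltrDl.
have e1 (z : C) : nC z <= s / 2 -> nV (0 + z *: delta_mx 0 0) < s.
  move=> hz; rewrite add0r nVZ; apply: le_lt_trans ss; apply: le_trans hz.
  by rewrite ler_piMr ?nC_ge0 // nVE !mxE /= nC0 nC1 ge_max lexx ler01.
have Gz (z : C) : G (0 + z *: delta_mx 0 0) = x + z *: delta_mx 0 mu.
  by rewrite /G delta_line mxE add0r.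
have := @cauchy_estimate R [set z | nV z < s] k 0 0 (s / 2) m oD hk s2 e1.
have -> : pz 0 k 0 = pz mu f x.
  have [|a ha] := hf 0; first by rewrite nC0.
  rewrite scale0r addr0 in ha.
  have G0 : G 0 = x by rewrite /G mxE scale0r addr0.
  rewrite -{1}G0 in ha; have h := dk _ _ ha.
  by rewrite (wdiff_pz _ h); rewrite G0 in ha; rewrite (wdiff_pz _ ha) mul1r.
move=> h; have : s / 2 * nC (pz mu f x) <= 2 * m.
  apply: h => z hz; rewrite /k Gz; apply: hm; exact: le_lt_trans hz ss.
by move: (nC _) => u; lra.
Qed.

(** Local boundedness gives, through the one-variable Cauchy estimate, bounded derivatives, and
    these supply the Lipschitz constant that [goursat_lipschitz] presupposes. *)
Lemma goursat f x (r : R) : 0 < r ->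
  (forall y, nV (y - x) < r -> exists a, wdiff f y a (fun=> 0)) ->
  forall mu, exists a, wdiff (pz mu f) x a (fun=> 0).
Proof.
move=> r0 hf; have [|a0 ha0] := hf x; first by rewrite subrr nV0.
have /continuousC_P/(_ _ ltr01)[d d0 hd] := wdiff_cts ha0.
pose s := Num.min d r; have s0 : 0 < s by rewrite lt_min d0.
pose m := nC (f x) + 1.
have bm y : nV (y - x) < s -> nC (f y) <= m.
  rewrite lt_min => /andP[/hd h _]; rewrite /m addrC -lerBlDr.
  apply: le_trans (ltW h); rewrite lerBlDr; apply: le_trans (nC_triangle _ _).
  by rewrite subrK.
have hs y : nV (y - x) < s -> exists a, wdiff f y a (fun=> 0).
  by rewrite lt_min => /andP[_]; exact: hf.
have s2 : 0 < s / 2 by rewrite divr_gt0.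
have m0 : 0 <= m by rewrite addr_ge0 // nC_ge0.
have nd (mu : 'I_2) : nV (delta_mx 0 mu : V) <= 1.
  by elim/I2_ind: mu; rewrite nVE !mxE /= nC0 nC1 ge_max lexx ler01.
have pzb mu y : nV (y - x) < s / 2 -> nC (pz mu f y) <= 8 * m / s.
  move=> hy; rewrite ler_pdivlMr //.
  have near z : nC z < s / 2 -> nV (y + z *: delta_mx 0 mu - x) < s.
    move=> hz; rewrite addrAC (splitr s); apply: le_lt_trans (nV_triangle _ _) _.
    apply: ltrD => //; apply: le_lt_trans hz; rewrite nVZ ler_piMr ?nC_ge0 //.
  have := @goursat_cauchy f y mu (s / 2) m s2 (fun z hz => hs _ (near z hz)) (fun z hz => bm _ (near z hz)).
  by move: (nC _) => u; lra.
(* The Cauchy estimate on discs of radius s / 2 bounds the derivatives by 8 m / s, and the mean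
   value inequality doubles this. *)
apply: (@goursat_lipschitz f x (s / 2) (2 * (8 * m / s))) => //.
- by rewrite mulr_ge0 // divr_ge0 ?mulr_ge0 // ltW.
- move=> y hy; apply: hs; apply: lt_trans hy _.
  by rewrite ltr_pdivrMr // mulr_natr mulr2n ltrDl.
move=> y y' hy hy' yy.
pose v : V := (y 0 1 - y' 0 1) *: delta_mx 0 1.
have yE : y = y' + 1%:C%C *: v.
  by rewrite rmorph1 scale1r; apply: rowP2; rewrite addVE !mxE /= ?mulr0 ?mulr1 ?addr0 // addrC subrK.
have := @mean_value_ineq R f y' v 0 1 0 (8 * m / s * nC (y 0 1 - y' 0 1)) ler01.
rewrite -yE scale0r addr0 mulr0 !subr0 mulr1 mulrA; apply=> t /andP[t0 t1].
have conv : nV (y' + t%:C%C *: v - x) < s / 2.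
  have -> : y' + t%:C%C *: v - x = (1 - t)%:C%C *: (y' - x) + t%:C%C *: (y - x).
    rewrite yE rmorph1 scale1r; apply: rowP2; rewrite !(addVE, subVE) !mxE rmorphB rmorph1 /=;
    by move: (t%:C%C); move=> *; ring.
  apply: le_lt_trans (nV_triangle _ _) _; rewrite !nVZ !nC_real !ger0_norm ?subr_ge0 //.
  have [->|t0'] := eqVneq t 0; first by rewrite subr0 mul0r mul1r addr0.
  have tp : 0 < t by rewrite lt_neqAle eq_sym t0'.
  have h1 : t * nV (y - x) < t * (s / 2) by rewrite ltr_pM2l.
  have h2 : (1 - t) * nV (y' - x) <= (1 - t) * (s / 2).
    by rewrite ler_wpM2l ?subr_ge0 // ltW.
  by move: h1 h2; move: (nV _) (nV _) => *; lra.
have cs : nV (y' + t%:C%C *: v - x) < s.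
  by apply: lt_trans conv _; rewrite ltr_pdivrMr // mulr_natr mulr2n ltrDl.
have [a ha] := hs _ cs; split; first exact: wdiff_rderivable ha.
rewrite (wdiff_rderive _ ha) subr0 rlin_line mul0r addr0 nCM -(wdiff_pz 1 ha).
by rewrite ler_wpM2r ?nC_ge0 // pzb.
Qed.

Lemma goursat_hol D f : open D -> (forall x, D x -> exists a, wdiff f x a (fun=> 0)) -> hol D f.
Proof.
move=> oD hf; split; last by move=> mu x /hf[a ha]; rewrite (wdiff_pb _ ha).
move=> n; elim: n f hf => [|n IH] f hf.
  by split=> // x /hf[a ha]; exact: wdiff_wd ha.
split=> [x /hf[a ha]|mu]; first exact: wdiff_wd ha.
split.
  apply: IH => x Dx; have /openV_P/(_ x Dx)[d d0 hd] := oD.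
  by apply: (goursat d0) => y /hd; exact: hf.
apply: (Wk_ext (f := fun=> 0)) => //; last exact: Wk_cst.
by move=> y /hf[a ha]; rewrite (wdiff_pb _ ha).
Qed.

End Goursat.

(** * Plurisubharmonicity and the Levi form *)

Section Submean.
Context {R : realType}.
Local Notation C := R[i].
Local Notation V := 'rV[R[i]]_2.

(** The second order Taylor polynomial restricted to a circle: [ga] and [de] are the coefficients of
    cos 2t and sin 2t, and [K] is the mean. *)
Definition trig2 (K al be ga de : R) (t : R) : R :=
  K + (al * cos t + be * sin t) + (ga * (cos t * cos t - sin t * sin t) + de * (2 * (sin t * cos t))).

Lemma trig2_prim (K al be ga de t : R) :
  is_derive t 1 (fun t => K * t + (al * sin t - be * cos t) +
    (ga * (sin t * cos t) + de * (sin t * sin t))) (trig2 K al be ga de t).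
Proof.
have hs := is_derive_sin t; have hc := is_derive_cos t.
apply: is_derive_eq; rewrite /trig2 /GRing.scale /=; ring.
Qed.

Lemma trig2_cts K al be ga de : continuous (trig2 K al be ga de).
Proof.
move=> t; apply: cvgD; last apply: cvgD.
- apply: cvgD; first exact: cvg_cst.
  by apply: cvgD; apply: cvgM; try exact: cvg_cst; [exact: continuous_cos|exact: continuous_sin].
- apply: cvgM; first exact: cvg_cst.
  by apply: cvgB; apply: cvgM; first [exact: continuous_cos|exact: continuous_sin].
- apply: cvgM; first exact: cvg_cst.
  apply: cvgM; first exact: cvg_cst.
  by apply: cvgM; first [exact: continuous_cos|exact: continuous_sin].
Qed.

Lemma trig2_int K al be ga de :
  \int[lebesgue_measure]_(t in `[0, 2 * pi]) trig2 K al be ga de t = 2 * pi * K :> R.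
Proof.
have p0 : 0 < 2 * pi :> R by rewrite mulr_gt0 // pi_gt0.
pose F (t : R) := K * t + (al * sin t - be * cos t) + (ga * (sin t * cos t) + de * (sin t * sin t)).
have dF t : derivable F t 1 by have [] := trig2_prim K al be ga de t.
have cF : continuous F by move=> t; apply: differentiable_continuous; apply/derivable1_diffP.
have h := @continuous_FTC2 R (trig2 K al be ga de) F 0 (2 * pi) p0.
rewrite /Rintegral h.
- have s2 : sin (2 * pi) = 0 :> R by rewrite mulr_natl sin2pi.
  have c2 : cos (2 * pi) = 1 :> R by rewrite mulr_natl cos2pi.
  rewrite -EFinB /= /F s2 c2 sin0 cos0; ring.
- by apply: continuous_subspaceT; exact: trig2_cts.
- split; [by move=> t _; exact: dF | |].
    by apply: cvg_at_right_filter; exact: cF.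
  by apply: cvg_at_left_filter; exact: cF.
- by move=> t _; rewrite derive1E; have [_ ->] := trig2_prim K al be ga de t.
Qed.

Lemma df_rot (f : V -> C) x v (c : C) :
  df f x (c *: v) = c * (pz 0 f x * v 0 0 + pz 1 f x * v 0 1) +
    c^* * (pb 0 f x * (v 0 0)^* + pb 1 f x * (v 0 1)^*).
Proof. by rewrite dfE /rlin !mxE !cjM; ring. Qed.

Lemma d2f_rot D (f : V -> C) x v : open D -> sm D f -> D x ->
  exists S S', forall c : C, d2f f x (c *: v) (c *: v) =
    c * c * S + c^* * c^* * S' + 2 * (c * c^*) * lv f x v v.
Proof.
move=> oD hf Dx.
pose A (g : V -> C) := pz 0 g x * v 0 0 + pz 1 g x * v 0 1.
pose B (g : V -> C) := pb 0 g x * (v 0 0)^* + pb 1 g x * (v 0 1)^*.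
exists (A (pz 0 f) * v 0 0 + A (pz 1 f) * v 0 1).
exists (B (pb 0 f) * (v 0 0)^* + B (pb 1 f) * (v 0 1)^*) => c.
have s mu nu : pb nu (pz mu f) x = pz mu (pb nu f) x.
  by have [_ -> _] := schwarz mu nu oD hf Dx.
rewrite /d2f !df_rot !mxE !cjM !s /lv.
rewrite -/(A (pz 0 f)) -/(A (pz 1 f)) -/(B (pb 0 f)) -/(B (pb 1 f)).
move: (A (pz 0 f)) (A (pz 1 f)) (B (pb 0 f)) (B (pb 1 f)).
move: (pz 0 (pb 0 f) x) (pz 0 (pb 1 f) x) (pz 1 (pb 0 f) x) (pz 1 (pb 1 f) x).
by move: (v 0 0) (v 0 1) (v 0 0)^* (v 0 1)^* c^*; clear; move=> *; ring.
Qed.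

(** If the Levi form were negative at v, the Taylor polynomial plus its error bound would dominate g
    on a small circle, with a mean smaller than g x. *)
Lemma submean_levi (Dom D : set V) (g : V -> R) x v :
  open D -> D `<=` Dom -> psh_on Dom g -> sm D (fun y => (g y)%:C%C) -> D x ->
  0 <= complex.Re (lv (fun y => (g y)%:C%C) x v v).
Proof.
move=> oD DDom hg; set f := (fun y => (g y)%:C%C) => hf Dx.
set q := complex.Re _; rewrite leNgt; apply/negP => q0.
pose N := nV v + 1; have N0 : 0 < N by rewrite ltr_wpDl // nV_ge0.
(* With this choice e |v|^2 <= - q / 2, so the Taylor error is at most half of the Levi term. *)
pose e := - q / (2 * N ^+ 2).
have N2 : 0 < N ^+ 2 by rewrite exprn_gt0.
have e0 : 0 < e by rewrite divr_gt0 ?mulr_gt0 // oppr_gt0.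
have [d d0 hd] := taylor_peano oD hf Dx e0.
have /openV_P/(_ x Dx)[d' d'0 hd'] := oD.
pose r := Num.min d d' / (2 * N).
have m0 : 0 < Num.min d d' by rewrite lt_min d0.
have r0 : 0 < r by rewrite divr_gt0 ?mulr_gt0.
pose w := r%:C%C *: v.
have nw : nV w < Num.min d d'.
  rewrite nVZ nC_real gtr0_norm // /r mulrAC ltr_pdivrMr ?mulr_gt0 //.
  rewrite ltr_pM2l // /N; have := nV_ge0 v; lra.
have disc (z : C) : nC z <= 1 -> nV (z *: w) < d /\ D (x + z *: w).
  move=> z1; have : nV (z *: w) < Num.min d d'.
    by apply: le_lt_trans nw; rewrite nVZ ler_piMl // nV_ge0.
  rewrite lt_min => /andP[h1 h2]; split=> //.
  by apply: hd'; rewrite addrC addKr.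
have := hg x w; have hDom (zeta : C) : `|zeta| <= 1 -> Dom (x + zeta *: w).
  rewrite normC_nC -[1](rmorph1 (real_complex R)) lecR => /disc[_]; exact: DDom.
move=> /(_ hDom).
pose zt (t : R) : C := (cos t +i* sin t)%C.
have zt1 t : nC (zt t) = 1.
  apply/eqP; rewrite -sqrp_eq1 ?nC_ge0 // nCE /= sqr_sqrtr ?addr_ge0 ?sqr_ge0 //.
  by rewrite cos2Dsin2.
have zz t : zt t * (zt t)^* = 1 by rewrite -nC_sqr zt1 expr1n rmorph1.
have gE y : complex.Re (f y) = g y by [].
pose a1 := pz 0 f x * w 0 0 + pz 1 f x * w 0 1.
pose b1 := pb 0 f x * (w 0 0)^* + pb 1 f x * (w 0 1)^*.
have [S [S' hS]] := d2f_rot w oD hf Dx.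
pose K := g x + (complex.Re (lv f x w w) + e * nV w ^+ 2).
pose U := trig2 K (complex.Re a1 + complex.Re b1) (complex.Im b1 - complex.Im a1)
  ((complex.Re S + complex.Re S') / 2) ((complex.Im S' - complex.Im S) / 2).
have ReD (z z' : C) : complex.Re (z + z') = complex.Re z + complex.Re z'.
  by case: z z' => [? ?] [? ?].
have ReN (z : C) : complex.Re (- z) = - complex.Re z by case: z.
have upper t : g (x + zt t *: w) <= U t.
  have nz : nC (zt t) <= 1 by rewrite zt1.
  have [h1 h2] := disc _ nz.
  have := le_trans (le_trans (ler_norm _) (Re_le_nC _)) (hd _ h1).
  rewrite df_rot -/a1 -/b1 hS -mulrA zz mulr1 nVZ zt1 mul1r.
  have half (z : C) : complex.Re (z / 2) = complex.Re z / 2.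
    have -> : (2 : C)^-1 = (2^-1)%:C%C by rewrite fmorphV rmorph_nat.
    by case: z => u u' /=; rewrite mulr0 subr0.
  rewrite !ReD !ReN half !ReD.
  have l2 : complex.Re (2 * lv f x w w) = 2 * complex.Re (lv f x w w).
    by rewrite mulr_natl mulr2n ReD -mulr2n mulr_natl.
  rewrite l2 /U /trig2 /K !gE.
  move: (complex.Re (lv f x w w)) (e * _) (g _) (g x).
  rewrite /zt; move: (cos t) (sin t) (a1) (b1) (S) (S').
  clear => co si [A A'] [B B'] [P P'] [Q Q'] l E G G' /= h; move: h; lra.
have cG : {within `[0, 2 * pi], continuous (fun t => g (x + zt t *: w))}.
  apply: continuous_subspaceT => t; apply/cvgrPdist_lt => eps eps0.
  have nz : nC (zt t) <= 1 by rewrite zt1.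
  have [_ h2] := disc _ nz.
  have /continuousC_P/(_ _ eps0)[d1 d10 hd1] := sm_cts hf h2.
  have W0 : 0 < nV w + 1 by rewrite ltr_wpDl // nV_ge0.
  have d2 : 0 < d1 / (nV w + 1) / 2 by rewrite !divr_gt0.
  have /cvgrPdist_lt/(_ _ d2) hc := @continuous_cos R t.
  have /cvgrPdist_lt/(_ _ d2) hs := @continuous_sin R t.
  apply: filterS2 hc hs => u hc hs.
  have gB : g (x + zt t *: w) - g (x + zt u *: w) = complex.Re (f (x + zt t *: w) - f (x + zt u *: w)).
    by rewrite ReD ReN.
  rewrite gB; apply: le_lt_trans (Re_le_nC _) _; rewrite nC_sub; apply: hd1.
  rewrite opprD addrACA subrr add0r -scalerBl nVZ.
  have : nC (zt u - zt t) < d1 / (nV w + 1).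
    apply: le_lt_trans (nC_le_ReIm _) _ => /=.
    by rewrite distrC (distrC (sin u)) [ltRHS](splitr (d1 / (nV w + 1))) ltrD.
  rewrite ltr_pdivlMr //; apply: le_lt_trans.
  by rewrite ler_wpM2l ?nC_ge0 // lerDl.
have p0 : 0 < 2 * pi :> R by rewrite mulr_gt0 // pi_gt0.
rewrite mulrC ler_pdivlMr // => h.
have : g x * (2 * pi) <= 2 * pi * K.
  apply: le_trans h _; rewrite -(trig2_int K (complex.Re a1 + complex.Re b1) (complex.Im b1 - complex.Im a1)
    ((complex.Re S + complex.Re S') / 2) ((complex.Im S' - complex.Im S) / 2)).
  apply: le_Rintegral => //.
  - apply: continuous_compact_integrable => //; exact: segment_compact.
  - apply: continuous_compact_integrable; first exact: segment_compact.
    by apply: continuous_subspaceT; exact: trig2_cts.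
  - by move=> t _; exact: upper.
rewrite (mulrC (g x)) ler_pM2l // /K lerDl.
have -> : lv f x w w = (r ^+ 2)%:C%C * lv f x v v.
  rewrite /lv !mxE !cjM conjC_realc rmorphXn /= expr2.
  move: (pz 0 (pb 0 f) x) (pz 0 (pb 1 f) x) (pz 1 (pb 0 f) x) (pz 1 (pb 1 f) x).
  by move: (v 0 0) (v 0 1) (v 0 0)^* (v 0 1)^* r%:C%C; clear; move=> *; ring.
have -> : complex.Re ((r ^+ 2)%:C%C * lv f x v v) = r ^+ 2 * q.
  by rewrite /q; case: (lv f x v v) => u u' /=; rewrite mul0r subr0.
rewrite nVZ nC_real gtr0_norm // [(r * nV v) ^+ 2]exprMn (mulrCA e) -mulrDr pmulr_rge0 ?exprn_gt0 //.
have : e * nV v ^+ 2 <= e * N ^+ 2.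
  by rewrite ler_pM2l // ler_sqr ?nnegrE ?nV_ge0 ?(ltW N0) // lerDl.
have -> : e * N ^+ 2 = - q / 2.
  by rewrite /e; move: N2; move: (N ^+ 2) => n n0; field; rewrite gt_eqF.
by move: q0; move: (e * _) => E; clear; lra.
Qed.

End Submean.

(** * The Levi form under holomorphic maps, and a criterion for positivity *)

Section LeviForm.
Context {R : realType}.
Local Notation C := R[i].
Local Notation V := 'rV[R[i]]_2.
Implicit Types (f g : V -> C) (D : set V) (x v w : V).

Definition jac (G : V -> V) x v : V :=
  vec (pz 0 (fun y => G y 0 0) x * v 0 0 + pz 1 (fun y => G y 0 0) x * v 0 1)
      (pz 0 (fun y => G y 0 1) x * v 0 0 + pz 1 (fun y => G y 0 1) x * v 0 1).

Lemma comp_holo_pz D' D g (G : V -> V) x mu : sm D' g ->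
  (forall i, hol D (fun y => G y 0 i)) -> D x -> D' (G x) ->
  wd (fun y => g (G y)) x /\
  pz mu (fun y => g (G y)) x =
    pz 0 g (G x) * pz mu (fun y => G y 0 0) x + pz 1 g (G x) * pz mu (fun y => G y 0 1) x /\
  pb mu (fun y => g (G y)) x =
    pb 0 g (G x) * (pz mu (fun y => G y 0 0) x)^* + pb 1 g (G x) * (pz mu (fun y => G y 0 1) x)^*.
Proof.
move=> hg hG Dx DGx.
have h i : wdiff (fun y => G y 0 i) x (fun mu => pz mu (fun y => G y 0 i) x) (fun=> 0).
  have [h1 h2] := hG i; apply: (wdiff_eq (sm_wd h1 Dx)) => // j; exact: h2.
have hw := wdiff_comp_holo (sm_wd hg DGx) (h 0) (h 1).
by split; [exact: wdiff_wd hw|rewrite (wdiff_pz _ hw) (wdiff_pb _ hw)].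
Qed.

Lemma levi_comp D' D g (G : V -> V) x mu nu : open D -> open D' -> sm D' g ->
  (forall i, hol D (fun y => G y 0 i)) -> (forall y, D y -> D' (G y)) -> D x ->
  pz mu (pb nu (fun y => g (G y))) x =
   (pz 0 (pb 0 g) (G x) * pz mu (fun y => G y 0 0) x + pz 1 (pb 0 g) (G x) * pz mu (fun y => G y 0 1) x)
     * (pz nu (fun y => G y 0 0) x)^* +
   (pz 0 (pb 1 g) (G x) * pz mu (fun y => G y 0 0) x + pz 1 (pb 1 g) (G x) * pz mu (fun y => G y 0 1) x)
     * (pz nu (fun y => G y 0 1) x)^*.
Proof.
move=> oD oD' hg hG GD Dx.
have sG i : sm D (fun y => G y 0 i) by case: (hG i).
have bG i k y : D y -> pb k (fun y => G y 0 i) y = 0 by case: (hG i) => _ h; exact: h.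
have s1 k : sm D (fun y => pb k g (G y)).
  apply: (sm_comp_holo oD GD sG) (sm_pb k hg) => i j y; exact: bG.
have s2 i : sm D (pz nu (fun y => G y 0 i)) by apply: sm_pz.
have s3 : sm D (fun y => g (G y)) by apply: (sm_comp_holo oD GD sG) hg => i j y; exact: bG.
have e y : D y -> pb nu (fun y => g (G y)) y =
    pb 0 g (G y) * (pz nu (fun y => G y 0 0) y)^* + pb 1 g (G y) * (pz nu (fun y => G y 0 1) y)^*.
  by move=> Dy; have [_ [_ ->]] := comp_holo_pz nu hg hG Dy (GD _ Dy).
rewrite (pz_ext mu oD (sm_pb nu s3) Dx e).
have b2 i : pb mu (pz nu (fun y => G y 0 i)) x = 0.
  by have [_ ->] := hol_pz nu oD (hG i).
have w1 k := sm_wd (s1 k) Dx; have w2 i := sm_wd (s2 i) Dx.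
have w3 i := sm_wd (sm_conj oD (s2 i)) Dx.
have w4 k i := sm_wd (smM oD (s1 k) (sm_conj oD (s2 i))) Dx.
rewrite (pzD mu (w4 0 0) (w4 1 1)) (pzM mu (w1 0) (w3 0)) (pzM mu (w1 1) (w3 1)).
rewrite (pz_conj mu (w2 0)) (pz_conj mu (w2 1)) !b2 conjC0 !mulr0 !addr0.
by have [_ [-> _]] := comp_holo_pz mu (sm_pb 0 hg) hG Dx (GD _ Dx);
   have [_ [-> _]] := comp_holo_pz mu (sm_pb 1 hg) hG Dx (GD _ Dx).
Qed.

Lemma lv_comp D' D g (G : V -> V) x v w : open D -> open D' -> sm D' g ->
  (forall i, hol D (fun y => G y 0 i)) -> (forall y, D y -> D' (G y)) -> D x ->
  lv (fun y => g (G y)) x v w = lv g (G x) (jac G x v) (jac G x w).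
Proof.
move=> oD oD' hg hG GD Dx; rewrite /lv !(levi_comp _ _ oD oD' hg hG GD Dx) /jac !vec0 !vec1.
rewrite !cjD !cjM.
move: (pz 0 (pb 0 g) (G x)) (pz 0 (pb 1 g) (G x)) (pz 1 (pb 0 g) (G x)) (pz 1 (pb 1 g) (G x)).
move: (pz 0 (fun y => G y 0 0) x) (pz 1 (fun y => G y 0 0) x) (pz 0 (fun y => G y 0 1) x) (pz 1 (fun y => G y 0 1) x).
move=> p q r s; move: p^* q^* r^* s^* (v 0 0) (v 0 1) (w 0 0)^* (w 0 1)^*.
by clear; move=> *; ring.
Qed.

Lemma levi_herm D f x mu nu : open D -> sm D f -> (forall y, (f y)^* = f y) -> D x ->
  (pz mu (pb nu f) x)^* = pz nu (pb mu f) x.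
Proof.
move=> oD hf fr Dx.
have e k y : D y -> pb k f y = (pz k f y)^*.
  by move=> Dy; rewrite -(pb_conj k (sm_wd hf Dy)); congr pb; apply/funext => z; rewrite fr.
rewrite (pz_ext mu oD (sm_pb nu hf) Dx (e nu)) (pz_conj _ (sm_wd (sm_pz nu hf) Dx)) conjCK.
by have [_ -> _] := schwarz nu mu oD hf Dx.
Qed.

Lemma leviE f x mu nu : levi f x mu nu = pz mu (pb nu f) x.
Proof. by rewrite mxE pzE pbE. Qed.

Lemma ddc_lv f x v : - 'i * ddc f x (v, 0) (conjv (v, 0)) = lv f x v v.
Proof.
rewrite /ddc mulrA mulNr -expr2 sqrCi opprK mul1r !sum2 !leviE /lv.
move: (pz 0 (pb 0 f) x) (pz 0 (pb 1 f) x) (pz 1 (pb 0 f) x) (pz 1 (pb 1 f) x) => a b c d.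
by rewrite /= !mxE ?mulr0 ?mul0r ?subr0 !mulrA.
Qed.

(** Where del f is nonzero the vector spans its kernel, so this is the Levi form of the level set of
    f through x. *)
Definition tangential_levi f x : C :=
  lv f x (vec (pz 1 f x) (- pz 0 f x)) (vec (pz 1 f x) (- pz 0 f x)).

(** The determinant hypothesis is the Monge-Ampere equation for log f. Expanded, it says that the
    tangential Levi form equals f det L. If that is nonzero, it is positive, and a nonnegative
    Hermitian 2 x 2 matrix of positive determinant is positive definite. *)
Lemma posdef_of_tangential f x : 0 < f x ->
  (forall mu, pb mu f x = (pz mu f x)^*) ->
  (forall mu nu, (pz mu (pb nu f) x)^* = pz nu (pb mu f) x) ->
  (forall v, 0 <= lv f x v v) ->
  (f x * pz 0 (pb 0 f) x - pz 0 f x * pb 0 f x) * (f x * pz 1 (pb 1 f) x - pz 1 f x * pb 1 f x) =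
  (f x * pz 0 (pb 1 f) x - pz 0 f x * pb 1 f x) * (f x * pz 1 (pb 0 f) x - pz 1 f x * pb 0 f x) ->
  tangential_levi f x != 0 -> forall v, v != 0 -> 0 < lv f x v v.
Proof.
move=> f0 real herm nonneg ma t0 v v0.
set L00 := pz 0 (pb 0 f) x in ma *; set L01 := pz 0 (pb 1 f) x in ma *.
set L10 := pz 1 (pb 0 f) x in ma *; set L11 := pz 1 (pb 1 f) x in ma *.
have h01 : L01^* = L10 by exact: herm. have h10 : L10^* = L01 by exact: herm.
have h00 : L00^* = L00 by exact: herm.
have fn : f x != 0 by rewrite gt_eqF.
have tE : tangential_levi f x = f x * (L00 * L11 - L01 * L10).
  rewrite /tangential_levi /lv !vec0 !vec1 -/L00 -/L01 -/L10 -/L11 !cjN -!real.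
  apply: (mulfI fn); move: ma.
  move: (f x) (pz 0 f x) (pz 1 f x) (pb 0 f x) (pb 1 f x) (L00) (L01) (L10) (L11); clear.
  move=> F a b c d L00 L01 L10 L11 ma; apply/eqP; rewrite -subr_eq0.
  apply/eqP; transitivity ((F * L01 - a * d) * (F * L10 - b * c) - (F * L00 - a * c) * (F * L11 - b * d)).
    ring.
  by rewrite ma subrr.
have tp : 0 < tangential_levi f x by rewrite lt_def t0 nonneg.
have dp : 0 < L00 * L11 - L01 * L10 by move: tp; rewrite tE pmulr_rgt0.
have L00n : 0 <= L00.
  have := nonneg (vec 1 0).
  by rewrite /lv !vec0 !vec1 conjC1 conjC0 !mulr1 !mulr0 !addr0.
have L00p : 0 < L00.
  rewrite lt_def L00n andbT; apply/eqP => L0; move: dp; rewrite L0 mul0r sub0r -h01.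
  by rewrite oppr_gt0 => /lt_geF; rewrite mul_conjC_ge0.
rewrite -(pmulr_rgt0 _ L00p).
have -> : L00 * lv f x v v = (L00 * v 0 0 + L10 * v 0 1) * (L00 * v 0 0 + L10 * v 0 1)^* +
    (L00 * L11 - L01 * L10) * (v 0 1 * (v 0 1)^*).
  rewrite /lv -/L00 -/L01 -/L10 -/L11 cjD !cjM h00 h10.
  by move: (v 0 0)^* (v 0 1)^*; clear; move=> *; ring.
have [v1|v1] := eqVneq (v 0 1) 0.
  rewrite v1 mulr0 addr0 mul0r mulr0 addr0 mul_conjC_gt0 mulf_neq0 //; first by rewrite gt_eqF.
  by apply: contra_neq v0 => v00; apply: rowP2; rewrite ?v1 ?v00 !mxE.
by rewrite ltr_wpDl ?mul_conjC_ge0 // mulr_gt0 // mul_conjC_gt0.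
Qed.

End LeviForm.

(** * The derivative of the logarithm *)

Section LogDerivative.
Context {R : realType}.
Local Notation C := R[i].
Local Notation V := 'rV[R[i]]_2.

Lemma ln_increment (c : R) : 0 < c -> forall e : R, 0 < e -> exists2 d : R, 0 < d &
  forall t : R, `|t| < d -> `|ln (c + t) - ln c - c^-1 * t| <= e * `|t|.
Proof.
move=> c0 e e0; have [hd he] := is_derive1_ln c0.
have : (fun h : R => h^-1 *: ((@ln R \o shift c) (h *: 1) - ln c)) @ 0^' --> c^-1.
  by rewrite -he; exact: hd.
move=> /cvgrPdist_le/(_ e e0); rewrite /nbhs /= /nbhs /= => /nbhs_ballP[d /= d0 h].
exists d => // t td; have [->|t0] := eqVneq t 0.
  by rewrite addr0 subrr mulr0 subr0 normr0 mulr0.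
have := h t; rewrite /ball /= sub0r normrN => /(_ td t0).
rewrite /shift /= [t *: 1]mulr1 => h2.
have -> : ln (c + t) - ln c - c^-1 * t = - (t * (c^-1 - t^-1 * (ln (t + c) - ln c))).
  by rewrite (addrC t); move: (ln (c + t)) (ln c) c^-1; clear -t0 => *; field.
by rewrite normrN normrM mulrC ler_wpM2r.
Qed.

Lemma wdiff_ln (g : V -> R) x a b : 0 < g x -> wdiff (fun y => (g y)%:C%C) x a b ->
  wdiff (fun y => (ln (g y))%:C%C) x (fun i => (g x)%:C%C^-1 * a i) (fun i => (g x)%:C%C^-1 * b i).
Proof.
move=> g0 hg.
apply: (@wdiff_post R (fun z => (ln (complex.Re z))%:C%C) (fun k => k = (complex.Re k)%:C%C)
  _ (fun y => (g y)%:C%C)) hg => [h|e e0].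
  by rewrite -rmorphB.
have [d d0 hd] := ln_increment g0 e0; exists d => // k ->.
rewrite nC_real => /hd; rewrite /= -fmorphV -rmorphM -!rmorphB nC_real /=.
by rewrite /real_complex_def /=.
Qed.

End LogDerivative.

(** * The Levi form of rho and the Monge-Ampere equation in a chart *)

Section LeviGeometry.
Context {R : realType} {M : topologicalType}.
Local Notation C := R[i].
Local Notation V := 'rV[R[i]]_2.
Variables (A : set (chart R M)) (rho : M -> R).
Hypothesis surfaceM : complex_surface A.
Hypothesis rho_continuous : continuous rho.
Hypothesis rho_smooth : smooth_fun A (Mstar rho) rho.
Hypothesis drho : forall p, Mstar rho p -> nonzero_differential A rho p.
Hypothesis Mstar_nonempty : Mstar rho !=set0.
Implicit Types (phi psi : chart R M) (p q : M) (x y : V).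

Definition star phi : set V := phi @` (dom phi `&` Mstar rho).

Lemma star_open phi : open (star phi).
Proof. exact/im_open_sub/Mstar_open. Qed.

Lemma rho_sm phi : A phi -> sm (star phi) (loc phi rho).
Proof. by move=> Aphi; exact: (loc_sm Aphi (Mstar_open rho_continuous) rho_smooth). Qed.

Lemma transition_hol phi psi i : A phi -> A psi ->
  hol (phi @` (dom phi `&` dom psi)) (fun y => transition phi psi y 0 i).
Proof.
move=> Aphi Apsi; apply: (goursat_hol surfaceM rho_continuous rho_smooth drho Mstar_nonempty).
  exact/im_open_sub/dom_open.
by move=> _ [p [dp dp'] <-]; exact: (transition_hdiff surfaceM Aphi Apsi dp dp' i).
Qed.

Lemma loc_real phi (g : M -> R) y : (loc phi g y)^* = loc phi g y.
Proof. exact: conjC_realc. Qed.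

Lemma rho_herm phi x mu nu : A phi -> star phi x ->
  (pz mu (pb nu (loc phi rho)) x)^* = pz nu (pb mu (loc phi rho)) x.
Proof.
move=> Aphi sx.
exact: (levi_herm mu nu (@star_open phi) (rho_sm Aphi) (@loc_real phi rho) sx).
Qed.

Lemma rho_pb phi x mu : A phi -> star phi x ->
  pb mu (loc phi rho) x = (pz mu (loc phi rho) x)^*.
Proof. by move=> Aphi sx; apply: pb_loc; exact: sm_wd (rho_sm Aphi) sx. Qed.

Lemma star_gt0 phi x : star phi x -> 0 < loc phi rho x.
Proof. by move=> [p [dp Mp] <-]; rewrite /loc coordK // ltcR. Qed.

Lemma levi_nonneg phi x v : psh A rho -> A phi -> star phi x ->
  0 <= lv (loc phi rho) x v v.
Proof.
move=> hpsh Aphi sx.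
have sub : star phi `<=` phi @` dom phi by move=> _ [p [dp _] <-]; exists p.
have h := submean_levi v (@star_open phi) sub (hpsh _ Aphi) (rho_sm Aphi) sx.
rewrite lecE /= h andbT; apply/eqP.
have hr : (lv (loc phi rho) x v v)^* = lv (loc phi rho) x v v.
  rewrite /lv !cjD !cjM !conjCK !rho_herm //.
  by move: (v 0 0)^* (v 0 1)^* => *; ring.
move: hr; move: (lv _ _ _ _) => [a b]; rewrite -[_^*]/(_^*)%C /= => -[hb].
by move/eqP: hb; rewrite eq_sym -subr_eq0 opprK -mulr2n mulrn_eq0 /= => /eqP.
Qed.

Lemma monge_ampere_det phi x :
  ddc_square_zero A (Mstar rho) (fun p => ln (rho p)) -> A phi -> star phi x ->
  let f := loc phi rho in
  (f x * pz 0 (pb 0 f) x - pz 0 f x * pb 0 f x) * (f x * pz 1 (pb 1 f) x - pz 1 f x * pb 1 f x) =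
  (f x * pz 0 (pb 1 f) x - pz 0 f x * pb 1 f x) * (f x * pz 1 (pb 0 f) x - pz 1 f x * pb 0 f x).
Proof.
move=> ma Aphi sx f; set u := loc phi (fun p => ln (rho p)).
have sf := rho_sm Aphi; rewrite -/f in sf.
have oD := @star_open phi.
have fn y : star phi y -> f y != 0 by move=> /star_gt0 h; rewrite gt_eqF.
have du y : star phi y -> wdiff u y (fun i => (f y)^-1 * pz i f y) (fun i => (f y)^-1 * pb i f y).
  move=> sy; apply: (@wdiff_ln R (fun y => rho (pt phi y))) (sm_wd sf sy).
  by have := star_gt0 sy; rewrite ltcR.
have Lu mu nu : (f x) ^+ 2 * pz mu (pb nu u) x = f x * pz mu (pb nu f) x - pz mu f x * pb nu f x.
  have su : sm (star phi) (fun y => (f y)^-1 * pb nu f y).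
    by apply: (smM oD (smV oD fn sf)); exact: sm_pb.
  have <- : pz mu (fun y => (f y)^-1 * pb nu f y) x = pz mu (pb nu u) x.
    by apply: (pz_ext mu oD su sx) => y sy; rewrite (wdiff_pb _ (du _ sy)).
  rewrite (pzM mu (sm_wd (smV oD fn sf) sx) (sm_wd (sm_pb nu sf) sx)) (pzV mu (fn _ sx) (sm_wd sf sx)).
  move: (fn _ sx); move: (f x) (pz mu f x) (pb nu f x) (pz mu (pb nu f) x).
  by move=> *; field.
have [p [dp Mp] px] := sx.
(* On these four vectors the square of dd^c u is a nonzero multiple of the determinant of the
   complex Hessian of u. *)
have := ma _ Aphi _ dp Mp (delta_mx 0 0, 0) (0, delta_mx 0 0) (delta_mx 0 1, 0) (0, delta_mx 0 1).
rewrite px /wedge2 /ddc !sum2 !leviE -/u.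
have h2 : f x ^+ 2 != 0 by rewrite expf_neq0 // fn.
rewrite -!Lu.
move: (pz 0 (pb 0 u) x) (pz 0 (pb 1 u) x) (pz 1 (pb 0 u) x) (pz 1 (pb 1 u) x).
move: (f x ^+ 2) h2 => F F0 a b c d; rewrite !mxE /=.
have i2 := sqrCi C; rewrite expr2 in i2; move: ('i : C) i2 => j jj.
rewrite !(mulr0, mul0r, mulr1, subr0, sub0r, addr0, add0r, mulrN, mulNr, opprK, oppr0).
move=> h.
have : 2 * (a * d - b * c) = 0 by rewrite -oppr0 -h; ring: jj.
move/eqP; rewrite mulf_eq0 pnatr_eq0 /= subr_eq0 => /eqP h'.
by rewrite mulrACA h' mulrACA.
Qed.

End LeviGeometry.

(** * Levi-flat hypersurfaces and finite type *)

Section TangentialDerivative.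
Context {R : realType}.
Local Notation C := R[i].
Local Notation V := 'rV[R[i]]_2.
Implicit Types (f h : V -> C) (x v e : V).

Lemma df_expansion f x v e : wd f x -> forall eps : R, 0 < eps ->
  exists2 d : R, 0 < d & forall s t : R, 0 < t -> t < d -> `|s| <= t ->
    nC (f (x + (t%:C%C *: v + s%:C%C *: e)) - f x - (t%:C%C * df f x v + s%:C%C * df f x e)) <= eps * t.
Proof.
move=> hf eps eps0; pose N := nV v + nV e + 1.
have N0 : 0 < N by rewrite ltr_wpDl // addr_ge0 ?nV_ge0.
have [d d0 hd] := hf (eps / N) (divr_gt0 eps0 N0).
exists (d / N); first by rewrite divr_gt0.
move=> s t t0; rewrite ltr_pdivlMr // => td st.
have b : nV (t%:C%C *: v + s%:C%C *: e) <= t * N.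
  apply: le_trans (nV_triangle _ _) _; rewrite !nVZ !nC_real (gtr0_norm t0) /N !mulrDr.
  apply: le_trans (lerD (lexx _) (ler_wpM2r (nV_ge0 e) st)) _.
  by rewrite lerDl mulr1 ltW.
have := hd _ (le_lt_trans b td); rewrite -dfE.
have -> : df f x (t%:C%C *: v + s%:C%C *: e) = t%:C%C * df f x v + s%:C%C * df f x e.
  by rewrite !dfE rlinD !rlinZ.
move=> h1; apply: le_trans h1 _; rewrite mulrAC ler_pdivrMr // -mulrA.
by rewrite ler_wpM2l // ltW.
Qed.

Lemma ivt_zero (g : R -> R) (w : R) : - w <= w ->
  {within `[- w, w], continuous g} -> g (- w) <= 0 -> 0 <= g w ->
  exists2 s, s \in `[- w, w] & g s = 0.
Proof.
by move=> w0 gc g1 g2; apply: IVT => //; rewrite ge_min g1 le_max g2 orbT.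
Qed.

(** In place of the implicit function theorem, the intermediate value theorem finds for small t a
    zero of h at x + t v + s e with |s| <= eps t. There f vanishes as well, and its expansion bounds
    |df(v)| by a multiple of eps. *)
Lemma real_tangent (h f : V -> C) x v (d0 : R) : 0 < d0 ->
  (forall y, (h y)^* = h y) -> wd h x -> h x = 0 ->
  (forall y, nV (y - x) < d0 -> {for y, continuous h}) ->
  (exists mu, pz mu h x != 0) -> wd f x ->
  (forall y, nV (y - x) < d0 -> h y = 0 -> f y = 0) ->
  df h x v = 0 -> df f x v = 0.
Proof.
move=> d00 hr wh hx hc [mu hmu] wf hf hv.
(* This is the direction of the gradient of h, along which dh takes the positive value [eta]. *)
pose e : V := vec (pz 0 h x)^* (pz 1 h x)^*.
have hpb i : pb i h x = (pz i h x)^*.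
  by rewrite -(pb_conj i wh); congr pb; apply/funext => y; rewrite hr.
pose eta := 2 * (nC (pz 0 h x) ^+ 2 + nC (pz 1 h x) ^+ 2).
have he : df h x e = eta%:C%C.
  rewrite dfE /rlin !hpb /e !vec0 !vec1 !conjCK /eta rcM [(_ + nC _ ^+ 2)%:C%C]rcD !nC_sqr rmorph_nat.
  by move: (pz 0 h x) (pz 1 h x) (pz 0 h x)^* (pz 1 h x)^*; clear; move=> *; ring.
have eta0 : 0 < eta.
  rewrite mulr_gt0 //; elim/I2_ind: mu hmu => hmu.
    by rewrite ltr_pwDl ?exprn_gt0 ?nC_gt0 // sqr_ge0.
  by rewrite ltr_wpDl ?exprn_gt0 ?nC_gt0 // sqr_ge0.
have fx : f x = 0 by apply: hf => //; rewrite subrr nV0.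
suff bound eps : 0 < eps -> eps <= 1 -> nC (df f x v) <= eps * (nC (df f x e) + 1).
  apply/eqP; rewrite -nC_eq0; apply/negP => /negP; rewrite neq_lt ltNge nC_ge0 /= => k0.
  set k := nC _ in bound k0; set K := nC _ + 1 in bound.
  have K0 : 0 < K by rewrite ltr_wpDl // nC_ge0.
  pose eps := Num.min 1 (k / (2 * K)).
  have e0 : 0 < eps by rewrite lt_min ltr01 divr_gt0 ?mulr_gt0.
  have := bound eps e0; rewrite ge_min lexx => /(_ isT).
  have : eps * K <= k / 2.
    have : eps <= k / (2 * K) by rewrite ge_min lexx orbT.
    by rewrite ler_pdivlMr ?mulr_gt0 // mulrCA => h1; rewrite ler_pdivlMr // mulrC.
  by move: k0; move: (eps * K) => z; clear; lra.
move=> eps0 eps1.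
have ee : 0 < eps * eta / 2 by rewrite divr_gt0 // mulr_gt0.
have [d1 d10 h1] := df_expansion v e wh ee.
have [d2 d20 h2] := df_expansion v e wf eps0.
pose N := nV v + nV e + 1.
have N0 : 0 < N by rewrite ltr_wpDl // addr_ge0 ?nV_ge0.
pose t := Num.min (Num.min d1 d2) (d0 / N) / 2.
have m0 : 0 < Num.min (Num.min d1 d2) (d0 / N) by rewrite !lt_min d10 d20 divr_gt0.
have t0 : 0 < t by rewrite divr_gt0.
have : t < Num.min (Num.min d1 d2) (d0 / N) by rewrite /t ltr_pdivrMr // mulr_natr mulr2n ltrDl.
rewrite !lt_min ltr_pdivlMr // => /andP[/andP[td1 td2] td0].
pose pt s := x + (t%:C%C *: v + s%:C%C *: e).
have ptd s : `|s| <= t -> nV (pt s - x) < d0.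
  move=> st; rewrite /pt addrC addKr; apply: le_lt_trans td0.
  apply: le_trans (nV_triangle _ _) _; rewrite !nVZ !nC_real (gtr0_norm t0) /N !mulrDr.
  apply: le_trans (lerD (lexx _) (ler_wpM2r (nV_ge0 e) st)) _.
  by rewrite lerDl mulr1 ltW.
have hE s : h (pt s) = (complex.Re (h (pt s)))%:C%C.
  have := hr (pt s); case: (h _) => a b; rewrite -[_^*]/(_^*)%C /= => -[hb].
  congr (_ +i* _)%C; move: hb; clear; lra.
have est s : `|s| <= t -> `|complex.Re (h (pt s)) - s * eta| <= eps * eta / 2 * t.
  move=> st; have := h1 s t t0 td1 st; rewrite -/(pt s) hx subr0 hv mulr0 add0r he hE.
  by rewrite -rcM -rmorphB nC_real.
have et : eps * t <= t by rewrite ler_piMl // ltW.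
have nep : `|eps * t| <= t by rewrite gtr0_norm // mulr_gt0.
have nem : `|- (eps * t)| <= t by rewrite normrN.
have cont : {within `[- (eps * t), eps * t], continuous (fun s => complex.Re (h (pt s)))}.
  apply: continuous_in_subspaceT => s; rewrite inE /= in_itv /= => /andP[s1 s2].
  have st : `|s| <= t by rewrite ler_norml (le_trans _ s1) ?lerN2 //= (le_trans s2).
  apply/cvgrPdist_lt => c c0.
  have /continuousC_P/(_ _ c0)[d3 d30 hd3] := hc _ (ptd _ st).
  have n1 : 0 < nV e + 1 by rewrite ltr_wpDl // nV_ge0.
  have : nbhs s (ball s (d3 / (nV e + 1))) by apply: nbhsx_ballx; rewrite divr_gt0.
  apply: filterS => u; rewrite /ball /= ltr_pdivlMr // => su.
  have ReB (z z' : C) : complex.Re z - complex.Re z' = complex.Re (z - z').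
    by case: z z' => [? ?] [? ?].
  rewrite ReB; apply: le_lt_trans (Re_le_nC _) _; rewrite nC_sub; apply: hd3.
  rewrite /pt opprD addrACA subrr add0r opprD addrACA subrr add0r -scalerBl -rmorphB nVZ nC_real distrC.
  by apply: le_lt_trans su; rewrite ler_wpM2l // lerDl.
have ab : - (eps * t) <= eps * t.
  by have : 0 < eps * t := mulr_gt0 eps0 t0; move: (eps * t); clear => a; lra.
have [s sab hs] : exists2 s, s \in `[- (eps * t), eps * t] & complex.Re (h (pt s)) = 0.
  have e1 := est _ nep; have e2 := est _ nem.
  have q0 : 0 < eps * eta * t by apply: mulr_gt0 => //; apply: mulr_gt0.
  apply: ivt_zero => //.
    move: e2; rewrite ler_distl => /andP[_ h4]; apply: le_trans h4 _.
    by rewrite mulNr (mulrAC eps t) (mulrAC (eps * eta)); move: q0; clear; lra.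
  move: e1; rewrite ler_distl => /andP[h4 _]; apply: le_trans h4.
  by rewrite (mulrAC eps t) (mulrAC (eps * eta)); move: q0; clear; lra.
have st : `|s| <= eps * t by rewrite ler_norml; move: sab; rewrite in_itv.
have st' : `|s| <= t by apply: le_trans et.
have fs : f (pt s) = 0 by apply: hf; [exact: ptd | rewrite hE hs].
have := h2 s t t0 td2 st'; rewrite -/(pt s) fs fx subrr sub0r nCN => h3.
have : t * nC (df f x v) <= eps * t + eps * t * nC (df f x e).
  have -> : t * nC (df f x v) = nC (t%:C%C * df f x v) by rewrite nCM nC_real gtr0_norm.
  rewrite -[t%:C%C * _](addrK (s%:C%C * df f x e)).
  apply: le_trans (nC_triangle _ _) _; apply: lerD h3 _.
  by rewrite nCN nCM nC_real ler_wpM2r ?nC_ge0.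
have -> : eps * t + eps * t * nC (df f x e) = t * (eps * (nC (df f x e) + 1)).
  by move: (nC _); clear => ?; ring.
by rewrite ler_pM2l.
Qed.

(** The real statement, applied to v and to i v, separates the (1,0) and (0,1) parts. *)
Lemma complex_tangent (h f : V -> C) x v (d0 : R) : 0 < d0 ->
  (forall y, (h y)^* = h y) -> wd h x -> h x = 0 ->
  (forall y, nV (y - x) < d0 -> {for y, continuous h}) ->
  (exists mu, pz mu h x != 0) -> wd f x ->
  (forall y, nV (y - x) < d0 -> h y = 0 -> f y = 0) ->
  v 0 0 * pz 0 h x + v 0 1 * pz 1 h x = 0 ->
  v 0 0 * pz 0 f x + v 0 1 * pz 1 f x = 0 /\
  (v 0 0)^* * pb 0 f x + (v 0 1)^* * pb 1 f x = 0.
Proof.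
move=> d00 hr wh hx hc hmu wf hf hv.
have hpb i : pb i h x = (pz i h x)^*.
  by rewrite -(pb_conj i wh); congr pb; apply/funext => y; rewrite hr.
have hvc : (v 0 0)^* * (pz 0 h x)^* + (v 0 1)^* * (pz 1 h x)^* = 0.
  by rewrite -!cjM -cjD hv conjC0.
have t1 := @real_tangent h f x v d0 d00 hr wh hx hc hmu wf hf.
have t2 := @real_tangent h f x ('i *: v) d0 d00 hr wh hx hc hmu wf hf.
have dfv g : df g x v = (v 0 0 * pz 0 g x + v 0 1 * pz 1 g x) +
    ((v 0 0)^* * pb 0 g x + (v 0 1)^* * pb 1 g x).
  by rewrite dfE /rlin !(mulrC (v 0 _)) !(mulrC (v 0 _)^*).
have dfi g : df g x ('i *: v) = 'i * (v 0 0 * pz 0 g x + v 0 1 * pz 1 g x) -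
    'i * ((v 0 0)^* * pb 0 g x + (v 0 1)^* * pb 1 g x).
  by rewrite df_rot conjCi !(mulrC (v 0 _)) !(mulrC (v 0 _)^*) mulNr.
rewrite !dfv in t1; rewrite !dfi in t2; rewrite hv !hpb hvc !mulr0 ?addr0 ?subr0 in t1 t2.
have {}t1 := t1 erefl; have {}t2 := t2 erefl.
move: t1 t2; move: (_ + _) ((v 0 0)^* * _ + _) => P Q PQ.
rewrite -mulrBr => /eqP; rewrite mulf_eq0 (negPf (neq0Ci C)) /= subr_eq0 => /eqP E.
move: PQ; rewrite E -mulr2n => /eqP; rewrite mulrn_eq0 /= => /eqP -> //.
Qed.

End TangentialDerivative.

(** * Iterated brackets on a Levi-flat hypersurface *)

Section LeviFlat.
Context {R : realType}.
Local Notation C := R[i].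
Local Notation V := 'rV[R[i]]_2.
Local Notation vfield := ('rV[R[i]]_2 -> 'rV[R[i]]_2 * 'rV[R[i]]_2).

Lemma vapplyE (X : V * V) f (x : V) : vapply X f x =
  X.1 0 0 * pz 0 f x + X.2 0 0 * pb 0 f x + (X.1 0 1 * pz 1 f x + X.2 0 1 * pb 1 f x).
Proof. by rewrite /vapply sum2 pzE pbE. Qed.

Lemma delE f (x : V) (X : V * V) : del f x X = X.1 0 0 * pz 0 f x + X.1 0 1 * pz 1 f x.
Proof. by rewrite /del sum2 pzE. Qed.

Variables (D O : set V) (r f : V -> C).
Hypotheses (oD : open D) (oO : open O) (OD : O `<=` D).
Hypotheses (r_sm : sm D r) (f_sm : sm O f).
Hypotheses (r_real : forall y, (r y)^* = r y) (f_real : forall y, (f y)^* = f y).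
Hypothesis rf : forall y, O y -> (f y = 0 <-> r y = 0).
Hypothesis dr : forall y, O y -> r y = 0 -> exists mu, pz mu r y != 0.
Hypothesis dfn : forall y, O y -> exists mu, pz mu f y != 0.
Hypothesis flat : forall y, O y -> tangential_levi f y = 0.

(** Both type components are tangent to {f = 0}, which is more than tangency of the field itself;
    this is the property that brackets preserve when the Levi form vanishes. In the application r is
    the defining function of the finite type condition and f is rho minus a constant. *)
Definition horizontal (Y : vfield) : Prop :=
  (forall mu, sm O (fun x => (Y x).1 0 mu) /\ sm O (fun x => (Y x).2 0 mu)) /\
  forall y, O y -> f y = 0 ->
    (Y y).1 0 0 * pz 0 f y + (Y y).1 0 1 * pz 1 f y = 0 /\
    (Y y).2 0 0 * pb 0 f y + (Y y).2 0 1 * pb 1 f y = 0.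

Let near_O y : O y -> exists2 d : R, 0 < d & forall z, nV (z - y) < d -> O z.
Proof. by move/openV_P: oO => h /h. Qed.

Let f_pb y mu : O y -> pb mu f y = (pz mu f y)^*.
Proof.
move=> Oy; rewrite -(pb_conj mu (sm_wd f_sm Oy)); congr pb; apply/funext => z.
by rewrite f_real.
Qed.

Lemma tangent_r_f (y v : V) : O y -> r y = 0 ->
  v 0 0 * pz 0 r y + v 0 1 * pz 1 r y = 0 -> v 0 0 * pz 0 f y + v 0 1 * pz 1 f y = 0.
Proof.
move=> Oy ry hv; have [d d0 hd] := near_O Oy.
have [] // := @complex_tangent R r f y v d d0 r_real (sm_wd r_sm (OD Oy)) ry _ (dr Oy ry) (sm_wd f_sm Oy) _ hv.
  by move=> z /hd/OD Dz; exact: sm_cts r_sm Dz.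
by move=> z /hd Oz rz; apply/rf.
Qed.

Lemma tangent_f (y v : V) (g : V -> C) : O y -> f y = 0 -> sm O g ->
  (forall z, O z -> f z = 0 -> g z = 0) ->
  v 0 0 * pz 0 f y + v 0 1 * pz 1 f y = 0 ->
  v 0 0 * pz 0 g y + v 0 1 * pz 1 g y = 0 /\
  (v 0 0)^* * pb 0 g y + (v 0 1)^* * pb 1 g y = 0.
Proof.
move=> Oy fy sg hg hv; have [d d0 hd] := near_O Oy.
apply: (@complex_tangent R f g y v d d0 f_real (sm_wd f_sm Oy) fy _ (dfn Oy) (sm_wd sg Oy) _ hv).
  by move=> z /hd Oz; exact: sm_cts f_sm Oz.
by move=> z /hd Oz fz; apply: hg.
Qed.

Lemma horizontal_del Y x : horizontal Y -> O x -> r x = 0 -> del r x (Y x) = 0.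
Proof.
move=> [_ h] Ox rx; have fx : f x = 0 by apply/rf.
have [h1 _] := h x Ox fx; have rs := sm_sub OD r_sm.
rewrite delE; have [] // := tangent_f Ox fx rs _ h1.
by move=> z Oz; move/rf; apply.
Qed.

Lemma horizontal_apply Y x (g : V -> C) : horizontal Y -> O x -> f x = 0 -> sm O g ->
  (forall z, O z -> f z = 0 -> g z = 0) -> vapply (Y x) g x = 0.
Proof.
move=> [_ h] Ox fx sg hg; have [h1 h2] := h x Ox fx.
have [t1 _] := tangent_f Ox fx sg hg h1.
have h3 : cvec (Y x).2 0 0 * pz 0 f x + cvec (Y x).2 0 1 * pz 1 f x = 0.
  rewrite vec0 vec1 -[pz 0 f x]conjCK -[pz 1 f x]conjCK -!f_pb // -!cjM -cjD h2 conjC0 //.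
have [_ t2] := tangent_f Ox fx sg hg h3.
rewrite !vec0 !vec1 !conjCK in t2.
by rewrite vapplyE addrACA t1 t2 addr0.
Qed.

(** The tangential (1,0) vectors form a line, so a and b are multiples of the vector in
    [tangential_levi] and of its conjugate. *)
Lemma flat_zero x (a b : V) : O x ->
  a 0 0 * pz 0 f x + a 0 1 * pz 1 f x = 0 -> b 0 0 * pb 0 f x + b 0 1 * pb 1 f x = 0 ->
  a 0 0 * (b 0 0 * pz 0 (pb 0 f) x + b 0 1 * pz 0 (pb 1 f) x) +
  a 0 1 * (b 0 0 * pz 1 (pb 0 f) x + b 0 1 * pz 1 (pb 1 f) x) = 0.
Proof.
move=> Ox; have := flat Ox; rewrite /tangential_levi /lv !vec0 !vec1 !cjN -!f_pb //.
have [mu] := dfn Ox; have : (pz mu f x != 0) = (pb mu f x != 0).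
  by rewrite f_pb // conjC_eq0.
move: (pz 0 (pb 0 f) x) (pz 0 (pb 1 f) x) (pz 1 (pb 0 f) x) (pz 1 (pb 1 f) x) => L00 L01 L10 L11.
move: (a 0 0) (a 0 1) (b 0 0) (b 0 1) => a0 a1 b0 b1.
elim/I2_ind: mu.
  move: (pz 0 f x) (pz 1 f x) (pb 0 f x) (pb 1 f x) => p0 p1 q0 q1 pq p0n fl ha hb.
  have q0n : q0 != 0 by rewrite -pq.
  have -> : a0 = - a1 * p1 / p0 by apply: (mulIf p0n); rewrite divfK // mulNr; apply/eqP; rewrite -addr_eq0 ha.
  have -> : b0 = - b1 * q1 / q0 by apply: (mulIf q0n); rewrite divfK // mulNr; apply/eqP; rewrite -addr_eq0 hb.
  rewrite (_ : _ + _ = a1 * b1 / (p0 * q0) * (L00 * p1 * q1 + L01 * p1 * - q0 + (L10 * - p0 * q1 + L11 * - p0 * - q0))).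
    by rewrite fl mulr0.
  by field; rewrite p0n q0n.
move: (pz 0 f x) (pz 1 f x) (pb 0 f x) (pb 1 f x) => p0 p1 q0 q1 pq p1n fl ha hb.
have q1n : q1 != 0 by rewrite -pq.
have -> : a1 = - a0 * p0 / p1 by apply: (mulIf p1n); rewrite divfK // mulNr; apply/eqP; rewrite -addr_eq0 addrC ha.
have -> : b1 = - b0 * q0 / q1 by apply: (mulIf q1n); rewrite divfK // mulNr; apply/eqP; rewrite -addr_eq0 addrC hb.
rewrite (_ : _ + _ = a0 * b0 / (p1 * q1) * (L00 * p1 * q1 + L01 * p1 * - q0 + (L10 * - p0 * q1 + L11 * - p0 * - q0))).
  by rewrite fl mulr0.
by field; rewrite p1n q1n.
Qed.

Lemma bracket1 (X Y : vfield) (x : V) mu : (bracket X Y x).1 0 mu =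
  vapply (X x) (fun y => (Y y).1 0 mu) x - vapply (Y x) (fun y => (X y).1 0 mu) x.
Proof. by rewrite mxE. Qed.

Lemma bracket2 (X Y : vfield) (x : V) mu : (bracket X Y x).2 0 mu =
  vapply (X x) (fun y => (Y y).2 0 mu) x - vapply (Y x) (fun y => (X y).2 0 mu) x.
Proof. by rewrite mxE. Qed.

Lemma vapplyD (X : V * V) (g h : V -> C) x : wd g x -> wd h x ->
  vapply X (fun y => g y + h y) x = vapply X g x + vapply X h x.
Proof.
move=> wg wh; rewrite !vapplyE !pzD ?pbD //.
by move: (pz 0 g x) (pz 1 g x) (pz 0 h x) (pz 1 h x) (pb 0 g x) (pb 1 g x) (pb 0 h x) (pb 1 h x) => *; ring.
Qed.

Lemma vapplyM (X : V * V) (g h : V -> C) x : wd g x -> wd h x ->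
  vapply X (fun y => g y * h y) x = vapply X g x * h x + g x * vapply X h x.
Proof.
move=> wg wh; rewrite !vapplyE !pzM ?pbM //.
by move: (pz 0 g x) (pz 1 g x) (pz 0 h x) (pz 1 h x) (pb 0 g x) (pb 1 g x) (pb 0 h x) (pb 1 h x) => *; ring.
Qed.

Lemma sm_vapply (X : vfield) (g : V -> C) : horizontal X -> sm O g ->
  sm O (fun x => vapply (X x) g x).
Proof.
move=> [hX _] sg.
have sX mu : sm O (fun x => (X x).1 0 mu) by have [] := hX mu.
have sX' mu : sm O (fun x => (X x).2 0 mu) by have [] := hX mu.
apply: (sm_ext (f := fun x => (X x).1 0 0 * pz 0 g x + (X x).2 0 0 * pb 0 g x +
   ((X x).1 0 1 * pz 1 g x + (X x).2 0 1 * pb 1 g x))) => [//|x _|]; first by rewrite vapplyE.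
have sz mu := sm_pz mu sg; have sb mu := sm_pb mu sg.
by apply: (smD oO); apply: (smD oO); apply: (smM oO).
Qed.

(** The tangency of each field, differentiated along the other, expresses del f of the bracket by
    second derivatives of f. The pure ones cancel by symmetry, and the mixed ones are Levi forms of
    tangential vectors, zero by [flat_zero]. *)
Lemma horizontal_bracket X Y : horizontal X -> horizontal Y -> horizontal (bracket X Y).
Proof.
move=> hX hY; have [[sX tX] [sY tY]] := (hX, hY).
have sX1 mu : sm O (fun x => (X x).1 0 mu) by have [] := sX mu.
have sX2 mu : sm O (fun x => (X x).2 0 mu) by have [] := sX mu.
have sY1 mu : sm O (fun x => (Y x).1 0 mu) by have [] := sY mu.
have sY2 mu : sm O (fun x => (Y x).2 0 mu) by have [] := sY mu.
have sz mu := sm_pz mu f_sm; have sb mu := sm_pb mu f_sm.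
split=> [mu|x Ox fx].
  split.
    apply: (sm_ext (f := fun x => vapply (X x) (fun y => (Y y).1 0 mu) x
       - vapply (Y x) (fun y => (X y).1 0 mu) x)) => [//|x _|]; first by rewrite bracket1.
    by apply: (smB oO); apply: sm_vapply.
  apply: (sm_ext (f := fun x => vapply (X x) (fun y => (Y y).2 0 mu) x
     - vapply (Y x) (fun y => (X y).2 0 mu) x)) => [//|x _|]; first by rewrite bracket2.
  by apply: (smB oO); apply: sm_vapply.
have [tX1 tX2] := tX x Ox fx; have [tY1 tY2] := tY x Ox fx.
have fz1 := flat_zero Ox tX1 tY2; have fz2 := flat_zero Ox tY1 tX2.
have S mu nu : pb nu (pz mu f) x = pz mu (pb nu f) x.
  by have [_ -> _] := schwarz mu nu oO f_sm Ox.
have S' : pz 1 (pz 0 f) x = pz 0 (pz 1 f) x by have [-> _ _] := schwarz 1 0 oO f_sm Ox.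
have S'' : pb 1 (pb 0 f) x = pb 0 (pb 1 f) x by have [_ _ ->] := schwarz 1 0 oO f_sm Ox.
(* The pairing of W with del f vanishes on {f = 0}, hence so does its derivative along Z; the
   product rule trades derivatives of the components of W for second derivatives of f. *)
have vz (Z W : vfield) : horizontal Z -> horizontal W ->
    vapply (Z x) (fun y => (W y).1 0 0) x * pz 0 f x + vapply (Z x) (fun y => (W y).1 0 1) x * pz 1 f x =
    - ((W x).1 0 0 * vapply (Z x) (pz 0 f) x + (W x).1 0 1 * vapply (Z x) (pz 1 f) x).
  move=> hZ [sW tW].
  have w1 mu : sm O (fun x => (W x).1 0 mu) by have [] := sW mu.
  have sg : sm O (fun y => (W y).1 0 0 * pz 0 f y + (W y).1 0 1 * pz 1 f y).
    by apply: (smD oO); apply: (smM oO).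
  have := horizontal_apply hZ Ox fx sg (fun z Oz fz => (tW z Oz fz).1).
  have ww mu := sm_wd (w1 mu) Ox; have wz mu := sm_wd (sz mu) Ox.
  rewrite vapplyD; [|exact: sm_wd (smM oO (w1 0) (sz 0)) Ox|exact: sm_wd (smM oO (w1 1) (sz 1)) Ox].
  rewrite (vapplyM _ (ww 0) (wz 0)) (vapplyM _ (ww 1) (wz 1)).
  move: (vapply _ _ _) (vapply _ _ _) => p q h; apply/eqP; rewrite -addr_eq0; apply/eqP.
  by rewrite -[RHS]h; ring.
have vb (Z W : vfield) : horizontal Z -> horizontal W ->
    vapply (Z x) (fun y => (W y).2 0 0) x * pb 0 f x + vapply (Z x) (fun y => (W y).2 0 1) x * pb 1 f x =
    - ((W x).2 0 0 * vapply (Z x) (pb 0 f) x + (W x).2 0 1 * vapply (Z x) (pb 1 f) x).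
  move=> hZ [sW tW].
  have w2 mu : sm O (fun x => (W x).2 0 mu) by have [] := sW mu.
  have sg : sm O (fun y => (W y).2 0 0 * pb 0 f y + (W y).2 0 1 * pb 1 f y).
    by apply: (smD oO); apply: (smM oO).
  have := horizontal_apply hZ Ox fx sg (fun z Oz fz => (tW z Oz fz).2).
  have ww mu := sm_wd (w2 mu) Ox; have wz mu := sm_wd (sb mu) Ox.
  rewrite vapplyD; [|exact: sm_wd (smM oO (w2 0) (sb 0)) Ox|exact: sm_wd (smM oO (w2 1) (sb 1)) Ox].
  rewrite (vapplyM _ (ww 0) (wz 0)) (vapplyM _ (ww 1) (wz 1)).
  move: (vapply _ _ _) (vapply _ _ _) => p q h; apply/eqP; rewrite -addr_eq0; apply/eqP.
  by rewrite -[RHS]h; ring.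
split.
  rewrite !bracket1 !mulrBl addrACA -opprD (vz X Y hX hY) (vz Y X hY hX) !vapplyE !S S'.
  move: fz1 fz2.
  move: (pz 0 (pb 0 f) x) (pz 0 (pb 1 f) x) (pz 1 (pb 0 f) x) (pz 1 (pb 1 f) x).
  move: (pz 0 (pz 0 f) x) (pz 0 (pz 1 f) x) (pz 1 (pz 1 f) x).
  move: ((X x).1 0 0) ((X x).1 0 1) ((X x).2 0 0) ((X x).2 0 1).
  move: ((Y x).1 0 0) ((Y x).1 0 1) ((Y x).2 0 0) ((Y x).2 0 1).
  move=> y0 y1 y2 y3 x0 x1 x2 x3 a b c d e g h f1 f2.
  rewrite -[RHS](subrr 0) -{1}f1 -f2; ring.
rewrite !bracket2 !mulrBl addrACA -opprD (vb X Y hX hY) (vb Y X hY hX) !vapplyE S''.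
move: fz1 fz2.
move: (pz 0 (pb 0 f) x) (pz 0 (pb 1 f) x) (pz 1 (pb 0 f) x) (pz 1 (pb 1 f) x).
move: (pb 0 (pb 0 f) x) (pb 0 (pb 1 f) x) (pb 1 (pb 1 f) x).
move: ((X x).1 0 0) ((X x).1 0 1) ((X x).2 0 0) ((X x).2 0 1).
move: ((Y x).1 0 0) ((Y x).1 0 1) ((Y x).2 0 0) ((Y x).2 0 1).
move=> y0 y1 y2 y3 x0 x1 x2 x3 a b c d e g h f1 f2.
rewrite -[RHS](subrr 0) -{1}f2 -f1; ring.
Qed.

Lemma horizontal_span (G : set vfield) X : (forall Y, G Y -> horizontal Y) ->
  smooth_span D G X -> horizontal X.
Proof.
move=> hG; elim=> [Y /hG //| |Y Z _ [sY tY] _ [sZ tZ]|g Y sg _ [sY tY]].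
- split=> [mu|y _ _]; last by rewrite !mxE !mul0r addr0.
  by split; apply: (sm_ext (f := fun=> 0)) => // [y _|]; rewrite ?mxE //; exact: sm_cst.
- split=> [mu|y Oy fy].
    have [h1 h2] := sY mu; have [h3 h4] := sZ mu.
    by split; [apply: sm_ext (smD oO h1 h3)|apply: sm_ext (smD oO h2 h4)] => // y _; rewrite mxE.
  have [h1 h2] := tY y Oy fy; have [h3 h4] := tZ y Oy fy.
  rewrite !mxE !mulrDl; split.
    by rewrite addrACA h1 h3 addr0.
  by rewrite addrACA h2 h4 addr0.
have {}sg := sm_sub OD (smooth_on_sm oD sg).
split=> [mu|y Oy fy].
  have [h1 h2] := sY mu.
  by split; [apply: sm_ext (smM oO sg h1)|apply: sm_ext (smM oO sg h2)] => // y _; rewrite mxE.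
have [h1 h2] := tY y Oy fy.
by rewrite !mxE -!mulrA -!mulrDr h1 h2 !mulr0.
Qed.

Lemma horizontal_tangent10 W : tangent10 D r W -> horizontal W.
Proof.
move=> [sW W2 W1].
have s1 mu : sm O (fun x => (W x).1 0 mu).
  by apply: sm_sub OD _; apply: smooth_on_sm oD _; have [] := sW mu.
split=> [mu|y Oy fy].
  split=> //; apply: (sm_ext (f := fun=> 0)) => // [y Oy|]; last exact: sm_cst.
  by rewrite (W2 _ (OD Oy)) mxE.
rewrite (W2 _ (OD Oy)) !mxE !mul0r addr0; split=> //.
have ry : r y = 0 by apply/rf.
by have := W1 _ (OD Oy) ry; rewrite delE => h; apply: tangent_r_f.
Qed.

Lemma horizontal_conj W : horizontal W -> horizontal (fun x => conjv (W x)).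
Proof.
move=> [sW tW]; split=> [mu|y Oy fy].
  have [h1 h2] := sW mu.
  by split; [apply: sm_ext (sm_conj oO h2)|apply: sm_ext (sm_conj oO h1)] => // y _; rewrite mxE.
have [h1 h2] := tW y Oy fy.
rewrite !mxE; split.
  by rewrite -[pz 0 f y]conjCK -[pz 1 f y]conjCK -!f_pb // -!cjM -cjD h2 conjC0.
by rewrite !f_pb // -!cjM -cjD h1 conjC0.
Qed.

Lemma horizontal_tangent_fields X : tangent_fields D r X -> horizontal X.
Proof.
apply: horizontal_span => Y [/horizontal_tangent10 //|[W /horizontal_tangent10 hW ->]].
exact: horizontal_conj.
Qed.

Lemma horizontal_brackets k X : brackets D r k X -> horizontal X.
Proof.
elim: k X => [|k IH] X /=; first exact: horizontal_tangent_fields.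
apply: horizontal_span => Y [/IH //|[Z /IH hZ [W /horizontal_tangent_fields hW ->]]].
exact: horizontal_bracket.
Qed.

Lemma levi_flat_not_finite_type x m : O x -> r x = 0 -> ~ of_type D r x m.
Proof.
move=> Ox rx [_ [Y /horizontal_brackets hY]].
by rewrite (horizontal_del hY Ox rx) eqxx.
Qed.

End LeviFlat.

(** * Changes of charts, and density of the positive points *)

Section Density.
Context {R : realType} {M : topologicalType}.
Local Notation C := R[i].
Local Notation V := 'rV[R[i]]_2.
Variables (A : set (chart R M)) (rho : M -> R).
Hypothesis surfaceM : complex_surface A.
Hypothesis rho_continuous : continuous rho.
Hypothesis rho_smooth : smooth_fun A (Mstar rho) rho.
Hypothesis drho : forall p, Mstar rho p -> nonzero_differential A rho p.
Hypothesis Mstar_nonempty : Mstar rho !=set0.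

Implicit Types (phi psi : chart R M) (p q : M) (v w x y : V).

Definition overlap (phi psi : chart R M) : set V := phi @` (dom phi `&` (dom psi `&` Mstar rho)).

Lemma overlap_open phi psi : open (overlap phi psi).
Proof.
apply: im_open_sub; apply: openI; first exact: dom_open.
exact: Mstar_open rho_continuous.
Qed.

Lemma overlapP phi psi p : dom phi p -> dom psi p -> Mstar rho p -> overlap phi psi (phi p).
Proof. by move=> h1 h2 h3; exists p. Qed.

Lemma overlap_sub phi psi : overlap phi psi `<=` phi @` (dom phi `&` dom psi).
Proof. by move=> y [q [h1 [h2 _]] <-]; exists q. Qed.

Lemma overlap_star phi psi : overlap phi psi `<=` star rho phi.
Proof. by move=> y [q [h1 [_ h2]] <-]; exists q. Qed.

Lemma overlap_transition phi psi y : overlap phi psi y -> star rho psi (transition phi psi y).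
Proof. by move=> [q [h1 [h2 h3]] <-]; exists q; rewrite ?/transition ?coordK. Qed.

Lemma transitionE phi psi p : dom phi p -> transition phi psi (phi p) = psi p.
Proof. by move=> h; rewrite /transition coordK. Qed.

Lemma transition_overlap phi psi y : overlap phi psi y -> overlap psi phi (transition phi psi y).
Proof. by move=> [q [h1 [h2 h3]] <-]; exists q; rewrite ?/transition ?coordK. Qed.

Lemma transitionK phi psi y : overlap phi psi y -> transition psi phi (transition phi psi y) = y.
Proof. by move=> [q [h1 [h2 h3]] <-]; rewrite transitionE // transitionE. Qed.

Lemma loc_overlap phi psi (g : M -> R) y : overlap phi psi y ->
  loc psi g (transition phi psi y) = loc phi g y.
Proof. by move=> [q [h1 [h2 h3]] <-]; rewrite transitionE // /loc !coordK. Qed.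

Lemma overlap_hol phi psi i : A phi -> A psi -> hol (overlap phi psi) (fun y => transition phi psi y 0 i).
Proof.
move=> Aphi Apsi; have [h1 h2] := transition_hol surfaceM rho_continuous rho_smooth drho Mstar_nonempty i Aphi Apsi.
split; first exact: sm_sub (@overlap_sub _ _) h1.
by move=> mu x /overlap_sub; exact: h2.
Qed.

Lemma jacK phi psi p v : A phi -> A psi -> dom phi p -> dom psi p -> Mstar rho p ->
  jac (transition psi phi) (psi p) (jac (transition phi psi) (phi p) v) = v.
Proof.
move=> Aphi Apsi hphi hpsi hp.
have Dp := overlapP hphi hpsi hp; have oD := @overlap_open phi psi.
have G0 i := overlap_hol i Aphi Apsi.
have H0 i := overlap_hol i Apsi Aphi.
have E i mu := comp_holo_pz mu (proj1 (H0 i)) G0 Dp (transition_overlap Dp).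
have {}E i mu : (i == mu)%:R = pz 0 (fun y => transition psi phi y 0 i) (psi p) * pz mu (fun y => transition phi psi y 0 0) (phi p) +
    pz 1 (fun y => transition psi phi y 0 i) (psi p) * pz mu (fun y => transition phi psi y 0 1) (phi p).
  have [_ [h _]] := E i mu; rewrite transitionE // in h; rewrite -h -(pz_coord mu i (phi p)).
  apply: (pz_ext mu oD (sm_coord i oD) Dp) => y Dy; by rewrite transitionK.
have := (E 0 0, E 0 1, E 1 0, E 1 1); rewrite /= => -[[[e00 e01] e10] e11].
apply: rowP2; rewrite /jac ?vec0 ?vec1.
  rewrite -[RHS]addr0 -[v 0 0 in RHS]mul1r -(mul0r (v 0 1)) [X in _ = X * _ + _]e00 [X in _ = _ + X * _]e01.
  by move: (v 0 0) (v 0 1) (pz _ _ _) (pz _ _ _) (pz _ _ _) (pz _ _ _) (pz _ _ _) (pz _ _ _) => *; ring.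
rewrite -[RHS]add0r -[v 0 1 in RHS]mul1r -(mul0r (v 0 0)) [X in _ = X * _ + _]e10 [X in _ = _ + X * _]e11.
by move: (v 0 0) (v 0 1) (pz _ _ _) (pz _ _ _) (pz _ _ _) (pz _ _ _) (pz _ _ _) (pz _ _ _) => *; ring.
Qed.

Lemma jac0 (G : V -> V) x : jac G x 0 = 0.
Proof. by rewrite /jac; apply: rowP2; rewrite ?vec0 ?vec1 !mxE !mulr0 addr0. Qed.

Lemma lv_transition phi psi p v w : A phi -> A psi -> dom phi p -> dom psi p -> Mstar rho p ->
  lv (loc phi rho) (phi p) v w =
  lv (loc psi rho) (psi p) (jac (transition phi psi) (phi p) v) (jac (transition phi psi) (phi p) w).
Proof.
move=> Aphi Apsi hphi hpsi hp.
have Dp := overlapP hphi hpsi hp; have oD := @overlap_open phi psi.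
have sp := rho_sm rho_continuous rho_smooth Aphi.
have sq := rho_sm rho_continuous rho_smooth Apsi.
have G0 i := overlap_hol i Aphi Apsi.
rewrite -(transitionE psi hphi) -(lv_comp v w oD (@star_open _ _ _ rho_continuous psi) sq G0 (@overlap_transition phi psi) Dp).
have sD := sm_sub (@overlap_star phi psi) sp.
have P mu nu : pz mu (pb nu (loc phi rho)) (phi p) =
    pz mu (pb nu (fun y => loc psi rho (transition phi psi y))) (phi p).
  apply: (pz_ext mu oD (sm_pb nu sD) Dp) => y Dy.
  by apply: (pb_ext nu oD sD Dy) => z Dz; rewrite loc_overlap.
by rewrite /lv !P.
Qed.

(** [ddc_positive] quantifies over all charts of [A]; positivity in one of them is transported by
    the Jacobian, which is injective. *)
Lemma ddc_positive_chart phi p : A phi -> dom phi p -> Mstar rho p ->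
  (forall v, v != 0 -> 0 < lv (loc phi rho) (phi p) v v) -> ddc_positive A rho p.
Proof.
move=> Aphi hphi hp h psi Apsi hpsi v v0; rewrite ddc_lv.
rewrite (lv_transition v v Apsi Aphi hpsi hphi hp); apply: h.
apply: contra_neq v0 => h; rewrite -(jacK v Apsi Aphi hpsi hphi hp) h; exact: jac0.
Qed.

Hypothesis rho_psh : psh A rho.
Hypothesis u_monge_ampere : ddc_square_zero A (Mstar rho) (fun p => ln (rho p)).

Lemma positive_or_flat phi p : A phi -> dom phi p -> Mstar rho p ->
  ddc_positive A rho p \/ tangential_levi (loc phi rho) (phi p) = 0.
Proof.
move=> Aphi hphi hp; have sp : star rho phi (phi p) by exists p.
have [h|h] := eqVneq (tangential_levi (loc phi rho) (phi p)) 0; first by right.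
left; apply: (ddc_positive_chart Aphi hphi hp).
apply: (posdef_of_tangential (star_gt0 sp) _ _ _ _ h).
- by move=> mu; exact: (rho_pb rho_continuous rho_smooth mu Aphi sp).
- by move=> mu nu; exact: (rho_herm rho_continuous rho_smooth mu nu Aphi sp).
- by move=> v; exact: (levi_nonneg rho_continuous rho_smooth v rho_psh Aphi sp).
exact: (monge_ampere_det rho_continuous rho_smooth u_monge_ampere Aphi sp).
Qed.

Hypothesis rho_finite_type : forall c : R, 0 < c -> finite_type A [set p | rho p = c].

Lemma positive_dense p (N : set M) : Mstar rho p -> nbhs p N ->
  exists q, [/\ N q, Mstar rho q & ddc_positive A rho q].
Proof.
move=> hp Np; apply: contrapT => none.
have [m [phi [U [r [[[Aphi oU Uphi Up] rs rU dr] ty]]]]] := rho_finite_type hp (erefl (rho p)).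
set N' := N° `&` (U `&` Mstar rho).
have oN' : open N'.
  apply: openI; first exact: open_interior.
  by apply: openI => //; apply: Mstar_open rho_continuous.
have hp' : dom phi p by exact: Uphi.
have imU : phi @` U = phi @` (dom phi `&` U) by rewrite (_ : dom phi `&` U = U) //; apply/seteqP; split=> [q []//|q Uq]; split=> //; exact: Uphi.
(* The fields of the finite type condition live on [D], while flatness is known only on the smaller
   [O]; this is why horizontality is demanded on [O] alone. *)
pose D := phi @` U; pose O := phi @` (dom phi `&` N').
have oD : open D by rewrite /D imU; exact: im_open_sub.
have oO : open O by exact: im_open_sub.
have OD : O `<=` D by move=> y [q [_ [_ [Uq _]]] <-]; exists q.
have r_sm : sm D (loc phi r) by rewrite /D imU; exact: (loc_sm Aphi oU rs).
pose f := fun y : V => loc phi rho y + (- rho p)%:C%C.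
have Ostar : O `<=` star rho phi by move=> y [q [h1 [_ [_ h2]]] <-]; exists q.
have sO := sm_sub Ostar (rho_sm rho_continuous rho_smooth Aphi).
have f_sm : sm O f by apply: (smD oO) => //; exact: sm_cst.
have fpz mu y : O y -> pz mu f y = pz mu (loc phi rho) y.
  by move=> Oy; rewrite pzD ?pz_cst ?addr0 //; [exact: sm_wd sO Oy|exact: sm_wd (sm_cst _ oO) Oy].
have fpb mu y : O y -> pb mu f y = pb mu (loc phi rho) y.
  by move=> Oy; rewrite pbD ?pb_cst ?addr0 //; [exact: sm_wd sO Oy|exact: sm_wd (sm_cst _ oO) Oy].
have fpp mu nu y : O y -> pz mu (pb nu f) y = pz mu (pb nu (loc phi rho)) y.
  by move=> Oy; apply: (pz_ext mu oO (sm_pb nu f_sm) Oy) => z Oz; exact: fpb.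
have f_real y : (f y)^* = f y by rewrite /f cjD loc_real conjC_realc.
have rf y : O y -> (f y = 0 <-> loc phi r y = 0).
  move=> [q [hq [_ [Uq _]]] <-]; rewrite /f /loc coordK // -rcD.
  have -> : ((rho q + - rho p)%:C%C = 0 :> C) <-> rho q = rho p.
    split=> [/eqP|->]; last by rewrite subrr.
    by rewrite (fmorph_eq0 (real_complex R)) subr_eq0 => /eqP.
  by apply: (iff_trans (rU q Uq)); split=> [->//|/eqP]; rewrite (fmorph_eq0 (real_complex R)) => /eqP.
have drO y : O y -> loc phi r y = 0 -> exists mu, pz mu (loc phi r) y != 0.
  move=> Oy ry; have [q [hq [_ [Uq _]]] yq] := Oy.
  have Sq : [set p0 | rho p0 = rho p] q.
    apply/(rU q Uq); move: ry; rewrite -yq /loc coordK // => /eqP.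
    by rewrite (fmorph_eq0 (real_complex R)) => /eqP.
  have [v] := dr q Uq Sq phi Aphi hq; rewrite yq => hv.
  have wr := sm_wd r_sm (OD y Oy).
  apply: contrapT => nomu; move/eqP: hv; apply.
  have p0 mu : pz mu (loc phi r) y = 0.
    by apply/eqP; apply: contrapT => h; apply: nomu; exists mu; apply/negP.
  have q0 mu : pb mu (loc phi r) y = 0 by rewrite pb_loc // p0 conjC0.
  rewrite (wdiff_rderive v wr) /rlin ?sum2.
  by rewrite !p0 !q0 !mul0r !addr0.
have dfO y : O y -> exists mu, pz mu f y != 0.
  move=> Oy; have [q [hq [_ [_ hq']]] yq] := Oy.
  have [mu hmu] := pz_neq0 rho_continuous rho_smooth drho Aphi hq hq'.
  by exists mu; rewrite fpz // -yq.
have flat y : O y -> tangential_levi f y = 0.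
  move=> Oy; have [q [hq [Nq [_ hq']]] yq] := Oy.
  have <- : tangential_levi (loc phi rho) y = tangential_levi f y.
    by rewrite /tangential_levi /lv !vec0 !vec1 !fpp // !fpz.
  rewrite -yq; have [pos|//] := positive_or_flat Aphi hq hq'.
  by exfalso; apply: none; exists q; split=> //; exact: interior_subset.
have Op : O (phi p) by exists p.
have rp : loc phi r (phi p) = 0.
  by rewrite /loc coordK // (proj1 (rU p Up) erefl).
exact: (levi_flat_not_finite_type oD oO OD r_sm f_sm (loc_real phi r) f_real rf drO dfO flat Op rp ty).
Qed.

End Density.

(** * The extended complex gradient *)

Lemma det_mx22 (R : realType) (L : 'M[R[i]]_2) : \det L = L 0 0 * L 1 1 - L 0 1 * L 1 0.
Proof.
rewrite (expand_det_row _ 0) sum2 /cofactor !det_mx11 !mxE /=.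
have e (i : 'I_2) : lift i (0 : 'I_1) = if i == 0 then 1 else 0.
  by apply: val_inj; elim/I2_ind: i.
by rewrite !e /= /bump /= addn0 expr0 mul1r expr1 mulN1r mulrN.
Qed.

Section Gradient.
Context {R : realType} {M : topologicalType}.
Local Notation C := R[i].
Local Notation V := 'rV[R[i]]_2.
Variables (A : set (chart R M)) (rho : M -> R).
Hypothesis surfaceM : complex_surface A.
Hypothesis rho_continuous : continuous rho.
Hypothesis rho_smooth : smooth_fun A (Mstar rho) rho.
Hypothesis drho : forall p, Mstar rho p -> nonzero_differential A rho p.
Hypothesis Mstar_nonempty : Mstar rho !=set0.
Hypothesis rho_psh : psh A rho.
Hypothesis u_monge_ampere : ddc_square_zero A (Mstar rho) (fun p => ln (rho p)).
Hypothesis rho_finite_type : forall c : R, 0 < c -> finite_type A [set p | rho p = c].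
Variable Z : chart R M -> M -> V.
Hypothesis Z_gradient : extended_gradient A rho Z.
Implicit Types (phi psi : chart R M) (p q : M) (v w x y : V).

Lemma zero_by_density phi (g : V -> C) : A phi ->
  (forall x, star rho phi x -> {for x, continuous g}) ->
  (forall p, dom phi p -> Mstar rho p -> ddc_positive A rho p -> g (phi p) = 0) ->
  forall x, star rho phi x -> g x = 0.
Proof.
move=> Aphi cg hg x [p [hp hp'] <-]; apply/eqP; apply: contrapT => /negP gn.
have g0 : 0 < nC (g (phi p)) by rewrite lt_neqAle nC_ge0 eq_sym nC_eq0 gn.
have sp : star rho phi (phi p) by exists p.
have /continuousC_P/(_ _ g0)[d d0 hd] := cg _ sp.
have oB := @ball_open R (phi p) d.
have pB : [set y | nV (y - phi p) < d] (phi p) by rewrite /= subrr nV0.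
have [q [[hq hqd] hq' pos]] := positive_dense surfaceM rho_continuous rho_smooth drho
  Mstar_nonempty rho_psh u_monge_ampere rho_finite_type hp' (coord_nbhs hp oB pB).
by have := hd _ hqd; rewrite (hg q hq hq' pos) sub0r nCN ltxx.
Qed.

Definition zc phi (mu : 'I_2) : V -> C := fun x => Z phi (pt phi x) 0 mu.

Lemma zc_sm phi mu : A phi -> sm (star rho phi) (zc phi mu).
Proof.
move=> Aphi; have [[_ h] _] := Z_gradient.
exact: smooth_on_sm (@star_open _ _ _ rho_continuous phi) (h phi Aphi mu).
Qed.

Lemma zcE phi p mu : dom phi p -> zc phi mu (phi p) = Z phi p 0 mu.
Proof. by move=> hp; rewrite /zc coordK. Qed.

(** If the determinant vanished, the vector (L10, - L00), nonzero because L00 > 0, would be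
    isotropic for the Levi form. *)
Lemma det_levi_neq0 f x : (forall v, v != 0 -> 0 < lv f x v v) ->
  pz 0 (pb 0 f) x * pz 1 (pb 1 f) x - pz 0 (pb 1 f) x * pz 1 (pb 0 f) x != 0.
Proof.
move=> pos; apply/eqP => D0.
have h1 : 0 < lv f x (vec 1 0) (vec 1 0) by apply: pos; apply/eqP => /(congr1 (fun v : V => v 0 0)); rewrite vec0 mxE => /eqP; rewrite oner_eq0.
have l0 : pz 0 (pb 0 f) x != 0.
  by move: h1; rewrite /lv !vec0 !vec1 conjC1 conjC0 !mulr0 !mulr1 ?mul0r !addr0; move/lt0r_neq0.
have := pos (vec (pz 1 (pb 0 f) x) (- pz 0 (pb 0 f) x)).
have -> : lv f x (vec (pz 1 (pb 0 f) x) (- pz 0 (pb 0 f) x)) (vec (pz 1 (pb 0 f) x) (- pz 0 (pb 0 f) x)) = 0.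
  rewrite /lv !vec0 !vec1; move: D0.
  move: (pz 0 (pb 0 f) x) (pz 0 (pb 1 f) x) (pz 1 (pb 0 f) x) (pz 1 (pb 1 f) x) => a b c d D0.
  transitivity (- (a * d - b * c) * (- a)^*); last by rewrite D0 oppr0 mul0r.
  by move: (c^*) ((- a)^*) => *; ring.
rewrite ltxx => h; have {}h : ~~ (vec (pz 1 (pb 0 f) x) (- pz 0 (pb 0 f) x) != 0) by apply/negP => /h.
move: h; rewrite negbK => /eqP/(congr1 (fun v : V => v 0 1)); rewrite vec1 mxE => /eqP.
by rewrite oppr_eq0; apply/negP.
Qed.

Lemma positive_lv phi p v : ddc_positive A rho p -> A phi -> dom phi p -> v != 0 ->
  0 < lv (loc phi rho) (phi p) v v.
Proof. by move=> h Aphi hp v0; rewrite -ddc_lv; exact: h. Qed.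

Lemma gradient_positive phi p nu : ddc_positive A rho p -> Mstar rho p -> A phi -> dom phi p ->
  zc phi 0 (phi p) * pz 0 (pb nu (loc phi rho)) (phi p) +
  zc phi 1 (phi p) * pz 1 (pb nu (loc phi rho)) (phi p) = pb nu (loc phi rho) (phi p).
Proof.
move=> pos hp' Aphi hp; have [_ /(_ p hp' pos phi Aphi hp) E] := Z_gradient.
have dn := det_levi_neq0 (fun v => positive_lv pos Aphi hp (v := v)).
have uL : levi (loc phi rho) (phi p) \in unitmx.
  by rewrite unitmxE unitfE det_mx22 !leviE.
have EE : Z phi p = (\row_nu pb nu (loc phi rho) (phi p)) *m invmx (levi (loc phi rho) (phi p)).
  rewrite E; apply/rowP => mu; rewrite !mxE; apply: eq_bigr => k _.
  by rewrite !mxE pbE mulrC.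
have /(congr1 (fun v : V => v 0 nu)) : Z phi p *m levi (loc phi rho) (phi p) = \row_nu pb nu (loc phi rho) (phi p).
  by rewrite EE mulmxKV.
by rewrite !mxE sum2 !leviE !zcE.
Qed.

Let cts phi g : A phi -> sm (star rho phi) g -> forall x, star rho phi x -> {for x, continuous g}.
Proof. by move=> Aphi sg x hx; exact: sm_cts sg hx. Qed.

Lemma gradient_levi phi x nu : A phi -> star rho phi x ->
  zc phi 0 x * pz 0 (pb nu (loc phi rho)) x +
  zc phi 1 x * pz 1 (pb nu (loc phi rho)) x = pb nu (loc phi rho) x.
Proof.
move=> Aphi hx; apply/eqP; rewrite -subr_eq0; apply/eqP.
have oD := @star_open _ _ _ rho_continuous phi.
have sf := rho_sm rho_continuous rho_smooth Aphi.
have sz mu := zc_sm mu Aphi.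
have sb := sm_pb nu sf; have s0 := sm_pz 0 sb; have s1 := sm_pz 1 sb.
apply: (zero_by_density (g := fun x => zc phi 0 x * pz 0 (pb nu (loc phi rho)) x +
  zc phi 1 x * pz 1 (pb nu (loc phi rho)) x - pb nu (loc phi rho) x) Aphi _ _ hx).
  apply: (cts Aphi); apply: (smB oD) => //.
  by apply: (smD oD); apply: (smM oD).
by move=> p hp hp' pos; rewrite gradient_positive // subrr.
Qed.

(** At positive points, replacing rho_nubar by Z^mu rho_{mu nubar} turns the Monge-Ampere matrix
    into a rank one perturbation of rho L, of determinant rho det L (rho - Z rho). Only the last
    factor can vanish. *)
Lemma gradient_rho phi x : A phi -> star rho phi x ->
  zc phi 0 x * pz 0 (loc phi rho) x + zc phi 1 x * pz 1 (loc phi rho) x = loc phi rho x.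
Proof.
move=> Aphi hx; apply/eqP; rewrite -subr_eq0; apply/eqP.
have oD := @star_open _ _ _ rho_continuous phi.
have sf := rho_sm rho_continuous rho_smooth Aphi.
have sz mu := zc_sm mu Aphi.
have s0 := sm_pz 0 sf; have s1 := sm_pz 1 sf.
apply: (zero_by_density (g := fun x => zc phi 0 x * pz 0 (loc phi rho) x +
  zc phi 1 x * pz 1 (loc phi rho) x - loc phi rho x) Aphi _ _ hx).
  apply: (cts Aphi); apply: (smB oD) => //.
  by apply: (smD oD); apply: (smM oD).
move=> p hp hp' pos; have sp : star rho phi (phi p) by exists p.
have dn := det_levi_neq0 (fun v => positive_lv pos Aphi hp (v := v)).
have ma := monge_ampere_det rho_continuous rho_smooth u_monge_ampere Aphi sp.
rewrite /= in ma.
have g0 := gradient_levi 0 Aphi sp; have g1 := gradient_levi 1 Aphi sp.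
have f0 := star_gt0 sp.
rewrite -g0 -g1 in ma.
move: ma dn f0; rewrite lt0r => ma dn /andP[f0 _].
move: ma dn f0.
move: (zc phi 0 (phi p)) (zc phi 1 (phi p)) (loc phi rho (phi p)).
move: (pz 0 (loc phi rho) (phi p)) (pz 1 (loc phi rho) (phi p)).
move: (pz 0 (pb 0 (loc phi rho)) (phi p)) (pz 0 (pb 1 (loc phi rho)) (phi p)) (pz 1 (pb 0 (loc phi rho)) (phi p)) (pz 1 (pb 1 (loc phi rho)) (phi p)).
move=> a b c d p0 p1 z0 z1 f /eqP; rewrite -subr_eq0 => ma dn f0.
have : f * (a * d - b * c) * (z0 * p0 + z1 * p1 - f) = 0.
  by apply/eqP; rewrite -oppr_eq0; move: ma; congr (_ == 0); ring.
by move=> /eqP; rewrite !mulf_eq0 (negPf f0) (negPf dn) => /eqP.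
Qed.

Lemma gradient_levi_conj phi x mu : A phi -> star rho phi x ->
  (zc phi 0 x)^* * pz mu (pb 0 (loc phi rho)) x +
  (zc phi 1 x)^* * pz mu (pb 1 (loc phi rho)) x = pz mu (loc phi rho) x.
Proof.
move=> Aphi hx; have /(congr1 Num.conj) := gradient_levi mu Aphi hx.
rewrite cjD cjM [X in _ + X]cjM (rho_pb rho_continuous rho_smooth) // conjCK => <-.
by rewrite !(rho_herm rho_continuous rho_smooth).
Qed.

Lemma gradient_rho_conj phi x : A phi -> star rho phi x ->
  (zc phi 0 x)^* * pb 0 (loc phi rho) x + (zc phi 1 x)^* * pb 1 (loc phi rho) x = loc phi rho x.
Proof.
move=> Aphi hx; have /(congr1 Num.conj) := gradient_rho Aphi hx.
by rewrite cjD cjM [X in _ + X]cjM loc_real -!(rho_pb rho_continuous rho_smooth).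
Qed.

(** For a fixed nu: [z] and [c] are Z and its conjugate, [b] the entries of dbar Z, [w] the
    conjugates of d Z^mu / dz^nu, [L0], [L1], [P0], [P1] the first derivatives of rho_nubar and [T]
    its mixed second ones. The combination eliminates [T] and [w]. *)
Lemma gradient_antiholomorphic_algebra (z0 z1 c0 c1 w0 w1 L00 L01 L10 L11 F0 F1 L0 L1 F P0 P1
    b00 b01 b10 b11 T00 T01 T10 T11 : C) :
  F0 = z0 * L00 + z1 * L10 -> F1 = z0 * L01 + z1 * L11 -> F = z0 * L0 + z1 * L1 ->
  P0 = b00 * L0 + z0 * T00 + (b01 * L1 + z1 * T01) ->
  P1 = b10 * L0 + z0 * T10 + (b11 * L1 + z1 * T11) ->
  L0 = w0 * L00 + c0 * T00 + (w1 * L01 + c1 * T10) ->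
  L1 = w0 * L10 + c0 * T01 + (w1 * L11 + c1 * T11) ->
  F = w0 * F0 + c0 * P0 + (w1 * F1 + c1 * P1) ->
  (c0 * b00 + c1 * b10) * L0 + (c0 * b01 + c1 * b11) * L1 = 0.
Proof.
have k (a b : C) : a = b -> b - a = 0 by move=> ->; rewrite subrr.
move=> /k e0 /k e1 /k eF /k eP0 /k eP1 /k eL0 /k eL1 /k eh.
transitivity (c0 * (b00 * L0 + z0 * T00 + (b01 * L1 + z1 * T01) - P0) +
  c1 * (b10 * L0 + z0 * T10 + (b11 * L1 + z1 * T11) - P1) -
  z0 * (w0 * L00 + c0 * T00 + (w1 * L01 + c1 * T10) - L0) -
  z1 * (w0 * L10 + c0 * T01 + (w1 * L11 + c1 * T11) - L1) +
  (w0 * F0 + c0 * P0 + (w1 * F1 + c1 * P1) - F) - (z0 * L0 + z1 * L1 - F) +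
  w0 * (z0 * L00 + z1 * L10 - F0) + w1 * (z0 * L01 + z1 * L11 - F1)).
  by ring.
by rewrite e0 e1 eF eP0 eP1 eL0 eL1 eh; ring.
Qed.

(** Applying conj(Z) to Z^mu rho_{mu nubar} = rho_nubar, and d/dzbar^nu to the conjugate identities,
    produces the same third derivatives of rho. Their comparison leaves the Levi matrix applied to
    the vector conj(Z) Z^mu, and the matrix is invertible at positive points. *)
Lemma gradient_antiholomorphic phi x mu : A phi -> star rho phi x ->
  (zc phi 0 x)^* * pb 0 (zc phi mu) x + (zc phi 1 x)^* * pb 1 (zc phi mu) x = 0.
Proof.
move=> Aphi.
have oD := @star_open _ _ _ rho_continuous phi.
have sf := rho_sm rho_continuous rho_smooth Aphi.
have sz mu' := zc_sm mu' Aphi.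
have cz mu' := sm_conj oD (sz mu').
have sb nu := sm_pb nu sf; have sa mu' := sm_pz mu' sf.
have sab mu' nu := sm_pz mu' (sb nu).
move: x; apply: (zero_by_density (g := fun x => (zc phi 0 x)^* * pb 0 (zc phi mu) x +
   (zc phi 1 x)^* * pb 1 (zc phi mu) x) Aphi).
  apply: (cts Aphi); apply: (smD oD); apply: (smM oD) => //; exact: sm_pb.
move=> p hp hp' pos; have hx : star rho phi (phi p) by exists p.
have dn := det_levi_neq0 (fun v => positive_lv pos Aphi hp (v := v)).
move: (phi p) hx dn => x hx dn {p hp hp' pos}.
set f := loc phi rho in sf sb sa sab dn *.
have W1 g : sm (star rho phi) g -> wd g x by move=> sg; exact: sm_wd sg hx.
have wz mu' := W1 _ (sz mu'); have wcz mu' := W1 _ (cz mu').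
have wb nu := W1 _ (sb nu); have wab mu' nu := W1 _ (sab mu' nu).
have wM g h : wd g x -> wd h x -> wd (fun y => g y * h y) x.
  by move=> wg wh; exact: wdiff_wd (wdiffM wg wh).
have T1 k nu : pb k (zc phi 0) x * pz 0 (pb nu f) x + zc phi 0 x * pb k (pz 0 (pb nu f)) x +
   (pb k (zc phi 1) x * pz 1 (pb nu f) x + zc phi 1 x * pb k (pz 1 (pb nu f)) x) = pb k (pb nu f) x.
  rewrite -(pb_ext k oD (smD oD (smM oD (sz 0) (sab 0 nu)) (smM oD (sz 1) (sab 1 nu))) hx
     (fun y hy => gradient_levi nu Aphi hy)).
  rewrite (pbD k (wM _ _ (wz 0) (wab 0 nu)) (wM _ _ (wz 1) (wab 1 nu))).
  by rewrite (pbM k (wz 0) (wab 0 nu)) (pbM k (wz 1) (wab 1 nu)).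
have T2 nu m : (pz nu (zc phi 0) x)^* * pz m (pb 0 f) x + (zc phi 0 x)^* * pb nu (pz m (pb 0 f)) x +
   ((pz nu (zc phi 1) x)^* * pz m (pb 1 f) x + (zc phi 1 x)^* * pb nu (pz m (pb 1 f)) x) = pb nu (pz m f) x.
  rewrite -(pb_ext nu oD (smD oD (smM oD (cz 0) (sab m 0)) (smM oD (cz 1) (sab m 1))) hx
     (fun y hy => gradient_levi_conj m Aphi hy)).
  rewrite (pbD nu (wM _ _ (wcz 0) (wab m 0)) (wM _ _ (wcz 1) (wab m 1))).
  by rewrite (pbM nu (wcz 0) (wab m 0)) (pbM nu (wcz 1) (wab m 1)) !pb_conj.
have T3 nu : (pz nu (zc phi 0) x)^* * pb 0 f x + (zc phi 0 x)^* * pb nu (pb 0 f) x +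
   ((pz nu (zc phi 1) x)^* * pb 1 f x + (zc phi 1 x)^* * pb nu (pb 1 f) x) = pb nu f x.
  rewrite -[RHS](pb_ext nu oD (smD oD (smM oD (cz 0) (sb 0)) (smM oD (cz 1) (sb 1))) hx
     (fun y hy => gradient_rho_conj Aphi hy)).
  rewrite (pbD nu (wM _ _ (wcz 0) (wb 0)) (wM _ _ (wcz 1) (wb 1))).
  by rewrite (pbM nu (wcz 0) (wb 0)) (pbM nu (wcz 1) (wb 1)) !pb_conj.
have S1 m nu : pb nu (pz m f) x = pz m (pb nu f) x.
  by have [_ -> _] := schwarz m nu oD sf hx.
have S2 y k nu : star rho phi y -> pb k (pb nu f) y = pb nu (pb k f) y.
  by move=> hy; have [_ _ ->] := schwarz k nu oD sf hy.
have S3 k m nu : pb nu (pz m (pb k f)) x = pb k (pz m (pb nu f)) x.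
  have [_ <- _] := schwarz m nu oD (sb k) hx.
  have [_ <- _] := schwarz m k oD (sb nu) hx.
  by apply: (pz_ext m oD (sm_pb nu (sb k)) hx) => y hy; exact: S2.
have T2' nu m : pz m (pb nu f) x = (pz nu (zc phi 0) x)^* * pz m (pb 0 f) x + (zc phi 0 x)^* * pb 0 (pz m (pb nu f)) x +
   ((pz nu (zc phi 1) x)^* * pz m (pb 1 f) x + (zc phi 1 x)^* * pb 1 (pz m (pb nu f)) x).
  by rewrite -S1 -T2 !(S3 _ m nu).
have T3' nu : pb nu f x = (pz nu (zc phi 0) x)^* * pb 0 f x + (zc phi 0 x)^* * pb 0 (pb nu f) x +
   ((pz nu (zc phi 1) x)^* * pb 1 f x + (zc phi 1 x)^* * pb 1 (pb nu f) x).
  by rewrite -T3 -!(S2 x nu _ hx).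
have key nu := gradient_antiholomorphic_algebra (esym (gradient_levi 0 Aphi hx))
  (esym (gradient_levi 1 Aphi hx)) (esym (gradient_levi nu Aphi hx))
  (esym (T1 0 nu)) (esym (T1 1 nu)) (T2' nu 0) (T2' nu 1) (T3' nu).
have := (key 0, key 1).
move: dn; rewrite -/f.
move: (pz 0 (pb 0 f) x) (pz 0 (pb 1 f) x) (pz 1 (pb 0 f) x) (pz 1 (pb 1 f) x) => a b c d dn.
have aux (s t : C) : s * a + t * c = 0 -> s * b + t * d = 0 -> s = 0 /\ t = 0.
  move=> h1 h2; split; apply: (mulIf dn); rewrite mul0r.
    transitivity ((s * a + t * c) * d - (s * b + t * d) * c); first by ring.
    by rewrite h1 h2 !mul0r subrr.
  transitivity ((s * b + t * d) * a - (s * a + t * c) * b); first by ring.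
  by rewrite h1 h2 !mul0r subrr.
by move=> [k1 k2]; have [h0 h1] := aux _ _ k1 k2; elim/I2_ind: mu.
Qed.

Lemma gradient_neq0 phi x : A phi -> star rho phi x -> zc phi 0 x != 0 \/ zc phi 1 x != 0.
Proof.
move=> Aphi hx; have := gradient_rho Aphi hx; have [->|] := eqVneq (zc phi 0 x) 0; last by left.
have [->|] := eqVneq (zc phi 1 x) 0; last by right.
by rewrite !mul0r addr0 => h; have := star_gt0 hx; rewrite -h ltxx.
Qed.

End Gradient.

(** * The coefficient of dbar Z along the leaves *)

Lemma rcN {R : realType} (a : R) : (- a)%:C%C = - a%:C%C :> R[i].
Proof. exact: (rmorphN (real_complex R)). Qed.

Section FieldCurvature.
Context {R : realType}.
Local Notation C := R[i].
Local Notation V := 'rV[R[i]]_2.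
Variables (D : set V) (z : 'I_2 -> V -> C).
Hypothesis oD : open D.
Hypothesis z_sm : forall mu, sm D (z mu).

Definition dZ (f : V -> C) (x : V) : C := z 0 x * pz 0 f x + z 1 x * pz 1 f x.
Definition dZb (f : V -> C) (x : V) : C := (z 0 x)^* * pb 0 f x + (z 1 x)^* * pb 1 f x.

Hypothesis z_anti : forall mu x, D x -> dZb (z mu) x = 0.
Implicit Types (f g : V -> C) (x : V).

Let W f x : sm D f -> D x -> wd f x. Proof. exact: sm_wd. Qed.

Lemma dZ_sm f : sm D f -> sm D (dZ f).
Proof. by move=> sf; apply: (smD oD); apply: (smM oD) => //; exact: sm_pz. Qed.

Lemma dZb_sm f : sm D f -> sm D (dZb f).
Proof. by move=> sf; apply: (smD oD); apply: (smM oD); try exact: sm_pb; exact: sm_conj. Qed.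

Lemma dZ_ext f g x : sm D f -> D x -> (forall y, D y -> f y = g y) -> dZ f x = dZ g x.
Proof. by move=> sf Dx h; rewrite /dZ !(pz_ext _ oD sf Dx h). Qed.

Lemma dZb_ext f g x : sm D f -> D x -> (forall y, D y -> f y = g y) -> dZb f x = dZb g x.
Proof. by move=> sf Dx h; rewrite /dZb !(pb_ext _ oD sf Dx h). Qed.

Lemma dZD f g x : sm D f -> sm D g -> D x -> dZ (fun y => f y + g y) x = dZ f x + dZ g x.
Proof.
move=> sf sg Dx; have wf := W sf Dx; have wg := W sg Dx.
rewrite /dZ (pzD 0 wf wg) (pzD 1 wf wg).
by move: (pz 0 f x) (pz 1 f x) (pz 0 g x) (pz 1 g x) (z 0 x) (z 1 x) => *; ring.
Qed.

Lemma dZbD f g x : sm D f -> sm D g -> D x -> dZb (fun y => f y + g y) x = dZb f x + dZb g x.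
Proof.
move=> sf sg Dx; have wf := W sf Dx; have wg := W sg Dx.
rewrite /dZb (pbD 0 wf wg) (pbD 1 wf wg).
by move: (pb 0 f x) (pb 1 f x) (pb 0 g x) (pb 1 g x) ((z 0 x)^*) ((z 1 x)^*) => *; ring.
Qed.

Lemma dZM f g x : sm D f -> sm D g -> D x -> dZ (fun y => f y * g y) x = dZ f x * g x + f x * dZ g x.
Proof.
move=> sf sg Dx; have wf := W sf Dx; have wg := W sg Dx.
rewrite /dZ (pzM 0 wf wg) (pzM 1 wf wg).
by move: (pz 0 f x) (pz 1 f x) (pz 0 g x) (pz 1 g x) (z 0 x) (z 1 x) (f x) (g x) => *; ring.
Qed.

Lemma dZbM f g x : sm D f -> sm D g -> D x -> dZb (fun y => f y * g y) x = dZb f x * g x + f x * dZb g x.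
Proof.
move=> sf sg Dx; have wf := W sf Dx; have wg := W sg Dx.
rewrite /dZb (pbM 0 wf wg) (pbM 1 wf wg).
by move: (pb 0 f x) (pb 1 f x) (pb 0 g x) (pb 1 g x) ((z 0 x)^*) ((z 1 x)^*) (f x) (g x) => *; ring.
Qed.

Lemma dZ_cst c x : dZ (fun=> c) x = 0.
Proof. by rewrite /dZ !pz_cst !mulr0 addr0. Qed.

Lemma dZb_cst c x : dZb (fun=> c) x = 0.
Proof. by rewrite /dZb !pb_cst !mulr0 addr0. Qed.

Lemma dZN f x : sm D f -> D x -> dZ (fun y => - f y) x = - dZ f x.
Proof.
move=> sf Dx; have wf := W sf Dx.
by rewrite /dZ (pzN 0 wf) (pzN 1 wf) !mulrN -opprD.
Qed.

Lemma dZbN f x : sm D f -> D x -> dZb (fun y => - f y) x = - dZb f x.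
Proof.
move=> sf Dx; have wf := W sf Dx.
by rewrite /dZb (pbN 0 wf) (pbN 1 wf) !mulrN -opprD.
Qed.

Lemma dZ_conj f x : sm D f -> D x -> dZ (fun y => (f y)^*) x = (dZb f x)^*.
Proof.
move=> sf Dx; have wf := W sf Dx.
by rewrite /dZ (pz_conj 0 wf) (pz_conj 1 wf) /dZb cjD !cjM !conjCK.
Qed.

Lemma dZb_conj f x : sm D f -> D x -> dZb (fun y => (f y)^*) x = (dZ f x)^*.
Proof.
move=> sf Dx; have wf := W sf Dx.
by rewrite /dZb (pb_conj 0 wf) (pb_conj 1 wf) /dZ cjD !cjM.
Qed.

Lemma dZ_zconj x mu : D x -> dZ (fun y => (z mu y)^*) x = 0.
Proof. by move=> Dx; rewrite dZ_conj // z_anti // conjC0. Qed.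

(** Z annihilates the coefficients of conj(Z), so no first order term appears. The sign of Z conj(Z)
    f at a maximum can thus be read on the complex line directed by the value of Z at that point. *)
Lemma dZ_dZb f x : sm D f -> D x ->
  dZ (dZb f) x = lv f x (vec (z 0 x) (z 1 x)) (vec (z 0 x) (z 1 x)).
Proof.
move=> sf Dx; have sb nu := sm_pb nu sf; have sc nu := sm_conj oD (z_sm nu).
rewrite (dZD (smM oD (sc 0) (sb 0)) (smM oD (sc 1) (sb 1)) Dx).
rewrite (dZM (sc 0) (sb 0) Dx) (dZM (sc 1) (sb 1) Dx) !dZ_zconj // !mul0r !add0r.
rewrite /lv !vec0 !vec1 /dZ.
by move: (pz 0 (pb 0 f) x) (pz 0 (pb 1 f) x) (pz 1 (pb 0 f) x) (pz 1 (pb 1 f) x) (z 0 x) (z 1 x) => a b c d s t; move: (s^*) (t^*) => *; ring.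
Qed.

(** The two fields commute, as each annihilates the coefficients of the other. *)
Lemma dZb_dZ f x : sm D f -> D x -> dZb (dZ f) x = dZ (dZb f) x.
Proof.
move=> sf Dx; have sa nu := sm_pz nu sf.
rewrite dZ_dZb // (dZbD (smM oD (z_sm 0) (sa 0)) (smM oD (z_sm 1) (sa 1)) Dx).
rewrite (dZbM (z_sm 0) (sa 0) Dx) (dZbM (z_sm 1) (sa 1) Dx) !z_anti // !mul0r !add0r.
rewrite /lv !vec0 !vec1 /dZb.
have S mu nu : pb nu (pz mu f) x = pz mu (pb nu f) x.
  by have [_ -> _] := schwarz mu nu oD sf Dx.
rewrite !S.
by move: (pz 0 (pb 0 f) x) (pz 0 (pb 1 f) x) (pz 1 (pb 0 f) x) (pz 1 (pb 1 f) x) (z 0 x) (z 1 x) => a b c d s t; move: (s^*) (t^*) => *; ring.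
Qed.

Lemma dZ_dZb_M f g x : sm D f -> sm D g -> D x ->
  dZ (dZb (fun y => f y * g y)) x =
  dZ (dZb f) x * g x + dZb f x * dZ g x + dZ f x * dZb g x + f x * dZ (dZb g) x.
Proof.
move=> sf sg Dx; have sbf := dZb_sm sf; have sbg := dZb_sm sg.
rewrite -(dZ_ext (smD oD (smM oD sbf sg) (smM oD sf sbg)) Dx (fun y Dy => esym (dZbM sf sg Dy))).
rewrite (dZD (smM oD sbf sg) (smM oD sf sbg) Dx) (dZM sbf sg Dx) (dZM sf sbg Dx).
by rewrite !addrA.
Qed.

(* The first index of dbar Z is a vector index. With e = (- z 1, z 0), [z_anti] gives
   dbar Z = k (x) conj e; then [beltrami] is the pairing e . k, and [twist] is e . dbar Z . e,
   and [curv], the trace of dbar Z . conj (dbar Z), is |e . k|^2. *)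
Definition divz x : C := pz 0 (z 0) x + pz 1 (z 1) x.

Definition curv x : C :=
  pb 0 (z 0) x * (pb 0 (z 0) x)^* + pb 1 (z 0) x * (pb 0 (z 1) x)^* +
  (pb 0 (z 1) x * (pb 1 (z 0) x)^* + pb 1 (z 1) x * (pb 1 (z 1) x)^*).

Definition normz x : C := z 0 x * (z 0 x)^* + z 1 x * (z 1 x)^*.

Definition twist x : C :=
  z 1 x * (z 1 x * pb 0 (z 0) x - z 0 x * pb 1 (z 0) x) -
  z 0 x * (z 1 x * pb 0 (z 1) x - z 0 x * pb 1 (z 1) x).

Definition beltrami x : C := twist x / normz x.

Hypothesis z_neq0 : forall x, D x -> z 0 x != 0 \/ z 1 x != 0.

Lemma normz_gt0 x : D x -> 0 < normz x.
Proof.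
move=> Dx; rewrite /normz -!normCK.
have [h|h] := z_neq0 Dx.
  by rewrite ltr_pwDl // ?exprn_ge0 // exprn_gt0 // normr_gt0.
by rewrite ltr_pwDr // ?exprn_ge0 // exprn_gt0 // normr_gt0.
Qed.

Lemma divz_sm : sm D divz.
Proof. by apply: (smD oD); exact: sm_pz. Qed.

Lemma normz_sm : sm D normz.
Proof. by apply: (smD oD); apply: (smM oD) => //; exact: sm_conj. Qed.

Lemma twist_sm : sm D twist.
Proof.
have s mu nu := sm_pb nu (z_sm mu).
by apply: (smB oD); apply: (smM oD) => //; apply: (smB oD); apply: (smM oD).
Qed.

Lemma beltrami_sm : sm D beltrami.
Proof.
apply: (smM oD twist_sm); apply: (smV oD) normz_sm => x Dx.
exact: lt0r_neq0 (normz_gt0 Dx).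
Qed.

Lemma curv_beltrami x : D x -> curv x = beltrami x * (beltrami x)^*.
Proof.
move=> Dx; have n0 := lt0r_neq0 (normz_gt0 Dx).
have nr : (normz x)^* = normz x by rewrite /normz cjD !cjM !conjCK mulrC [X in _ + X]mulrC.
have nVr : ((normz x)^-1)^* = (normz x)^-1 by rewrite fmorphV; congr (_^-1); exact: nr.
apply: (mulIf (mulf_neq0 n0 n0)); rewrite /beltrami cjM nVr.
have -> : twist x / normz x * ((twist x)^* / normz x) * (normz x * normz x) = twist x * (twist x)^*.
  by move: n0 {nr nVr}; move: ((twist x)^*) (twist x) (normz x) => s t n n0; field.
have h0 := z_anti 0 Dx; have h1 := z_anti 1 Dx.
have g0 := congr1 Num.conj h0; have g1 := congr1 Num.conj h1.
rewrite /dZb cjD !cjM !conjCK conjC0 in g0.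
rewrite /dZb cjD !cjM !conjCK conjC0 in g1.
rewrite /dZb in h0 h1; rewrite /curv /twist /normz.
rewrite !(cjD, cjN, cjM).
move: h0 h1 g0 g1.
move: (z 0 x) (z 1 x) (pb 0 (z 0) x) (pb 1 (z 0) x) (pb 0 (z 1) x) (pb 1 (z 1) x) => z0 z1 B00 B01 B10 B11.
move: (z0^* : C) (z1^* : C) (B00^* : C) (B01^* : C) (B10^* : C) (B11^* : C) => c0 c1 E00 E01 E10 E11 h0 h1 g0 g1.
(* A row (a, b) killed by (c, d) is a multiple of (d, - c), and the multiple is read off by pairing
   with (t, - s). *)
have aux (a b c d s t : C) : c * a + d * b = 0 ->
  a * (s * c + t * d) = d * (t * a - s * b) /\ b * (s * c + t * d) = - (c * (t * a - s * b)).
  move=> h; split; apply/eqP; rewrite -subr_eq0.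
    by rewrite -(mulr0 s) -h; apply/eqP; ring.
  by rewrite -(mulr0 t) -h; apply/eqP; ring.
have [a1 a2] := aux _ _ _ _ z0 z1 h0; have [a3 a4] := aux _ _ _ _ z0 z1 h1.
have [b1 b2] := aux _ _ _ _ c0 c1 g0; have [b3 b4] := aux _ _ _ _ c0 c1 g1.
transitivity (B00 * (z0 * c0 + z1 * c1) * (E00 * (c0 * z0 + c1 * z1)) +
  B01 * (z0 * c0 + z1 * c1) * (E10 * (c0 * z0 + c1 * z1)) +
  (B10 * (z0 * c0 + z1 * c1) * (E01 * (c0 * z0 + c1 * z1)) +
   B11 * (z0 * c0 + z1 * c1) * (E11 * (c0 * z0 + c1 * z1)))); first by ring.
by rewrite a1 a2 a3 a4 b1 b2 b3 b4; ring.
Qed.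

Let sA mu nu : sm D (pz nu (z mu)). Proof. exact: sm_pz. Qed.
Let sB mu nu : sm D (pb nu (z mu)). Proof. exact: sm_pb. Qed.
Let sC mu : sm D (fun y => (z mu y)^*). Proof. exact: sm_conj. Qed.

(* Differentiating [z_anti] along d/dzbar^nu. *)
Lemma dZb_pb mu nu x : D x -> dZb (pb nu (z mu)) x =
  - ((pz nu (z 0) x)^* * pb 0 (z mu) x + (pz nu (z 1) x)^* * pb 1 (z mu) x).
Proof.
move=> Dx; have sf := dZb_sm (z_sm mu).
have := pb_ext nu oD sf Dx (fun y Dy => z_anti mu Dy); rewrite pb_cst.
rewrite (pbD nu (W (smM oD (sC 0) (sB mu 0)) Dx) (W (smM oD (sC 1) (sB mu 1)) Dx)).
rewrite (pbM nu (W (sC 0) Dx) (W (sB mu 0) Dx)) (pbM nu (W (sC 1) Dx) (W (sB mu 1) Dx)).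
rewrite !pb_conj; [|exact: W Dx|exact: W Dx].
have S k : pb nu (pb k (z mu)) x = pb k (pb nu (z mu)) x.
  by have [_ _ ->] := schwarz nu k oD (z_sm mu) Dx.
rewrite !S /dZb; move: ((pz nu (z 0) x)^* * _) ((pz nu (z 1) x)^* * _) => p q.
by rewrite addrACA => /eqP; rewrite addrC addr_eq0 => /eqP.
Qed.

(** Differentiate [z_anti] along d/dz^mu and sum over mu: the second derivatives form conj(Z) of the
    divergence, and what remains is the trace of dbar Z times its conjugate. *)
Lemma dZb_divz x : D x -> dZb divz x = - curv x.
Proof.
move=> Dx; have aux mu : dZb (pz mu (z mu)) x =
    - ((pb mu (z 0) x)^* * pb 0 (z mu) x + (pb mu (z 1) x)^* * pb 1 (z mu) x).
  have sf := dZb_sm (z_sm mu).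
  have := pz_ext mu oD sf Dx (fun y Dy => z_anti mu Dy); rewrite pz_cst.
  rewrite (pzD mu (W (smM oD (sC 0) (sB mu 0)) Dx) (W (smM oD (sC 1) (sB mu 1)) Dx)).
  rewrite (pzM mu (W (sC 0) Dx) (W (sB mu 0) Dx)) (pzM mu (W (sC 1) Dx) (W (sB mu 1) Dx)).
  rewrite !pz_conj; [|exact: W Dx|exact: W Dx].
  have S k : pz mu (pb k (z mu)) x = pb k (pz mu (z mu)) x.
    by have [_ -> _] := schwarz mu k oD (z_sm mu) Dx.
  rewrite !S /dZb; move: ((pb mu (z 0) x)^* * _) ((pb mu (z 1) x)^* * _) => p q.
  by rewrite addrACA => /eqP; rewrite addrC addr_eq0 => /eqP.
rewrite (dZbD (sA 0 0) (sA 1 1) Dx) !aux /curv.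
move: (pb 0 (z 0) x) (pb 1 (z 0) x) (pb 0 (z 1) x) (pb 1 (z 1) x) => a b c d.
by move: (a^* : C) (b^* : C) (c^* : C) (d^* : C) => *; ring.
Qed.

Lemma beltrami_twist x : D x -> beltrami x * normz x = twist x.
Proof. by move=> Dx; rewrite /beltrami divfK // lt0r_neq0 // normz_gt0. Qed.

Lemma dZb_zconj mu x : D x -> dZb (fun y => (z mu y)^*) x =
  (z 0 x)^* * (pz 0 (z mu) x)^* + (z 1 x)^* * (pz 1 (z mu) x)^*.
Proof. by move=> Dx; rewrite dZb_conj // /dZ cjD !cjM. Qed.

Lemma dZb_normz x : D x -> dZb normz x =
  z 0 x * ((z 0 x)^* * (pz 0 (z 0) x)^* + (z 1 x)^* * (pz 1 (z 0) x)^*) +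
  z 1 x * ((z 0 x)^* * (pz 0 (z 1) x)^* + (z 1 x)^* * (pz 1 (z 1) x)^*).
Proof.
move=> Dx; rewrite (dZbD (smM oD (z_sm 0) (sC 0)) (smM oD (z_sm 1) (sC 1)) Dx).
by rewrite (dZbM (z_sm 0) (sC 0) Dx) (dZbM (z_sm 1) (sC 1) Dx) !z_anti // !mul0r !add0r !dZb_zconj.
Qed.

Lemma dZb_twist x : D x -> dZb twist x =
  z 1 x * (z 1 x * dZb (pb 0 (z 0)) x - z 0 x * dZb (pb 1 (z 0)) x) -
  z 0 x * (z 1 x * dZb (pb 0 (z 1)) x - z 0 x * dZb (pb 1 (z 1)) x).
Proof.
move=> Dx; have sk mu : sm D (fun y => z 1 y * pb 0 (z mu) y - z 0 y * pb 1 (z mu) y).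
  by apply: (smB oD); apply: (smM oD).
have dk mu : dZb (fun y => z 1 y * pb 0 (z mu) y - z 0 y * pb 1 (z mu) y) x =
    z 1 x * dZb (pb 0 (z mu)) x - z 0 x * dZb (pb 1 (z mu)) x.
  rewrite (dZbD (smM oD (z_sm 1) (sB mu 0)) (smN oD (smM oD (z_sm 0) (sB mu 1))) Dx).
  rewrite (dZbN (smM oD (z_sm 0) (sB mu 1)) Dx) (dZbM (z_sm 1) (sB mu 0) Dx) (dZbM (z_sm 0) (sB mu 1) Dx).
  by rewrite !z_anti // !mul0r !add0r.
rewrite (dZbD (smM oD (z_sm 1) (sk 0)) (smN oD (smM oD (z_sm 0) (sk 1))) Dx).
rewrite (dZbN (smM oD (z_sm 0) (sk 1)) Dx) (dZbM (z_sm 1) (sk 0) Dx) (dZbM (z_sm 0) (sk 1) Dx).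
by rewrite !z_anti // !mul0r !add0r !dk.
Qed.

(** In beltrami * normz = twist, the conjugate Jacobian of Z enters through its diagonal entries
    along e on one side and along Z on the other. As e is orthogonal to Z and of the same length,
    the two add up to its trace, the conjugate divergence. *)
Lemma dZb_beltrami x : D x -> dZb beltrami x = - (divz x)^* * beltrami x.
Proof.
move=> Dx; have n0 := lt0r_neq0 (normz_gt0 Dx).
have := dZb_ext (smM oD beltrami_sm normz_sm) Dx (fun y Dy => beltrami_twist Dy).
rewrite (dZbM beltrami_sm normz_sm Dx) dZb_normz // dZb_twist // !dZb_pb //.
have h0 := z_anti 0 Dx; have h1 := z_anti 1 Dx.
move: (beltrami_twist Dx) n0; move: (dZb beltrami x : C) => db.
rewrite /dZb /divz in h0 h1 *; rewrite cjD /twist /normz.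
move: (beltrami x : C) => b; move: h0 h1.
move: (z 0 x) (z 1 x) (pb 0 (z 0) x) (pb 1 (z 0) x) (pb 0 (z 1) x) (pb 1 (z 1) x) => z0 z1 B00 B01 B10 B11.
move: (pz 0 (z 0) x) (pz 1 (z 0) x) (pz 0 (z 1) x) (pz 1 (z 1) x) => A00 A01 A10 A11.
move: (z0^* : C) (z1^* : C) (A00^* : C) (A01^* : C) (A10^* : C) (A11^* : C) => c0 c1 E00 E01 E10 E11 h0 h1 bn n0 E.
have hPQ : c0 * (z1 * B00 - z0 * B10) + c1 * (z1 * B01 - z0 * B11) = 0.
  transitivity (z1 * (c0 * B00 + c1 * B01) - z0 * (c0 * B10 + c1 * B11)); first by ring.
  by rewrite h0 h1 !mulr0 subrr.
have hP : z1 * B00 - z0 * B10 = c1 * b.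
  apply: (mulIf n0); rewrite -mulrA bn; apply/eqP; rewrite -subr_eq0; apply/eqP.
  by rewrite -[RHS](mulr0 z0) -hPQ; ring.
have hQ : z1 * B01 - z0 * B11 = - c0 * b.
  apply: (mulIf n0); rewrite -mulrA bn; apply/eqP; rewrite -subr_eq0; apply/eqP.
  by rewrite -[RHS](mulr0 z1) -hPQ; ring.
apply: (mulIf n0); move/eqP: E; rewrite -subr_eq0 => /eqP E.
apply/eqP; rewrite -subr_eq0; apply/eqP; rewrite -[RHS]E.
transitivity (db * (z0 * c0 + z1 * c1) + b * (z0 * (c0 * E00 + c1 * E01) + z1 * (c0 * E10 + c1 * E11)) -
   (- E00 * z1 * (c1 * b) - E10 * z1 * (- c0 * b) + E01 * z0 * (c1 * b) + E11 * z0 * (- c0 * b))).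
  by ring.
by rewrite -hP -hQ; ring.
Qed.

Let sb := beltrami_sm.
Let sbc := sm_conj oD beltrami_sm.
Let sdc := sm_conj oD divz_sm.

Lemma dZ_dZb_beltrami x : D x -> dZ (dZb beltrami) x =
  beltrami x * (beltrami x)^* * beltrami x - (divz x)^* * dZ beltrami x.
Proof.
move=> Dx; rewrite (dZ_ext (dZb_sm sb) Dx dZb_beltrami).
rewrite (dZM (smN oD sdc) sb Dx) (dZN sdc Dx) (dZ_conj divz_sm Dx) dZb_divz // cjN opprK.
rewrite curv_beltrami // cjM conjCK.
by move: (dZ beltrami x) (beltrami x) (divz x) => p q r; move: (q^* : C) (r^* : C) => *; ring.
Qed.

Lemma dZ_dZb_conj f x : sm D f -> D x ->
  dZ (dZb (fun y => (f y)^*)) x = (dZ (dZb f) x)^*.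
Proof.
move=> sf Dx; rewrite (dZ_ext (dZb_sm (sm_conj oD sf)) Dx (fun y Dy => dZb_conj sf Dy)).
by rewrite (dZ_conj (dZ_sm sf) Dx) dZb_dZ.
Qed.

Section Maximum.
Variables (u : V -> C) (c l : R).
Hypothesis u_sm : sm D u.
Hypothesis u_real : forall y, (u y)^* = u y.
Hypothesis dZu : forall y, D y -> dZ u y = 1.

Definition barrier y : C := (l ^+ 2)%:C%C - (u y - c%:C%C) * (u y - c%:C%C).
(** The square of the barrier makes this the ratio of two metric densities along the leaf, as in
    Ahlfors's lemma. The product is tested rather than its logarithm because beta may have zeros. *)
Definition tested y : C := beltrami y * (beltrami y)^* * (barrier y * barrier y).

Let dZbu y : D y -> dZb u y = 1.
Proof.
move=> Dy; rewrite -[LHS]conjCK -dZ_conj // -[RHS]conjC1; congr (_^*).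
by rewrite -(dZu Dy); congr dZ; apply/funext => w; rewrite u_real.
Qed.

Let s_sm : sm D (fun y => u y - c%:C%C).
Proof. by apply: (smB oD) => //; exact: sm_cst. Qed.

Let dZs y : D y -> dZ (fun y => u y - c%:C%C) y = 1.
Proof. by move=> Dy; rewrite (dZD u_sm (sm_cst _ oD) Dy) dZ_cst addr0 dZu. Qed.

Let dZbs y : D y -> dZb (fun y => u y - c%:C%C) y = 1.
Proof. by move=> Dy; rewrite (dZbD u_sm (sm_cst _ oD) Dy) dZb_cst addr0 dZbu. Qed.

Lemma barrier_sm : sm D barrier.
Proof. by apply: (smB oD); [exact: sm_cst|exact: smM]. Qed.

Lemma dZ_barrier y : D y -> dZ barrier y = - ((u y - c%:C%C) + (u y - c%:C%C)).
Proof.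
move=> Dy; rewrite (dZD (sm_cst _ oD) (smN oD (smM oD s_sm s_sm)) Dy) dZ_cst add0r.
by rewrite (dZN (smM oD s_sm s_sm) Dy) (dZM s_sm s_sm Dy) dZs // mul1r mulr1.
Qed.

Lemma dZb_barrier y : D y -> dZb barrier y = - ((u y - c%:C%C) + (u y - c%:C%C)).
Proof.
move=> Dy; rewrite (dZbD (sm_cst _ oD) (smN oD (smM oD s_sm s_sm)) Dy) dZb_cst add0r.
by rewrite (dZbN (smM oD s_sm s_sm) Dy) (dZbM s_sm s_sm Dy) dZbs // mul1r mulr1.
Qed.

Lemma dZ_dZb_barrier y : D y -> dZ (dZb barrier) y = - 2.
Proof.
move=> Dy; rewrite (dZ_ext (dZb_sm barrier_sm) Dy dZb_barrier).
rewrite (dZN (smD oD s_sm s_sm) Dy) (dZD s_sm s_sm Dy) dZs //.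
Qed.

Lemma tested_sm : sm D tested.
Proof. by apply: (smM oD); apply: (smM oD) => //; exact: barrier_sm. Qed.

(* At a maximum of [tested], with w = dZ b - divz * b, the first order condition
   reads g w = -2 g' b and turns the Levi form into 2 beta (beta g^2 - g'^2 - 2 g). *)
Lemma curvature_at_maximum x (d0 : R) : D x -> 0 < d0 -> beltrami x != 0 -> barrier x != 0 ->
  (forall t : C, nC t < d0 ->
     complex.Re (tested (x + t *: vec (z 0 x) (z 1 x))) <= complex.Re (tested x)) ->
  complex.Re (2 * (beltrami x * (beltrami x)^*) *
   (beltrami x * (beltrami x)^* * (barrier x * barrier x) -
    4 * ((u x - c%:C%C) * (u x - c%:C%C)) - 2 * barrier x)) <= 0.
Proof.
move=> Dx d0p b0 g0 hmax; have [r1 r2 r3] := max_levi oD tested_sm Dx d0p hmax.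
have sg := barrier_sm; have sgg := smM oD sg sg; have sbb := smM oD sb sbc.
have gr y : (barrier y)^* = barrier y.
  by rewrite /barrier cjD cjN !cjM !cjD u_real cjN !conjC_realc.
have tr y : (tested y)^* = tested y.
  rewrite /tested; move: (beltrami y) (barrier y) (gr y) => b g gg.
  by rewrite !cjM gg conjCK [_^* * _]mulrC.
have T0 : dZ tested x = 0.
  have Tb : dZb tested x = (dZ tested x)^*.
    by rewrite -(dZb_conj tested_sm Dx); congr dZb; apply/funext => y; rewrite tr.
  have e1 : df tested x (vec (z 0 x) (z 1 x)) = dZ tested x + dZb tested x.
    rewrite dfE /rlin !vec0 !vec1 /dZ /dZb.
    by rewrite ![_ * z _ x]mulrC ![_ * (z _ x)^*]mulrC.
  have e2 : df tested x ('i *: vec (z 0 x) (z 1 x)) = 'i * (dZ tested x - dZb tested x).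
    rewrite dfE /rlin ![('i *: _ : V) _ _]mxE !vec0 !vec1 !cjM conjCi /dZ /dZb.
    move: (z 0 x) (z 1 x) => z0 z1; move: (z0^* : C) (z1^* : C) ('i : C) => *; ring.
  move: r1 r2; rewrite e1 e2 Tb; case: (dZ tested x) => a b /=.
  rewrite !(mul0r, mul1r, add0r, subr0, sub0r) opprK => h1 h2.
  have -> : a = 0 by lra.
  have -> : b = 0 by lra.
  by [].
move: r3; rewrite -dZ_dZb //; last exact: tested_sm.
rewrite (dZ_dZb_M sbb sgg Dx) (dZ_dZb_M sb sbc Dx) (dZ_dZb_M sg sg Dx).
rewrite (dZ_dZb_conj sb Dx) dZ_dZb_beltrami // dZ_dZb_barrier //.
rewrite (dZM sbb sgg Dx) (dZM sg sg Dx) (dZM sb sbc Dx) (dZ_conj sb Dx) in T0.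
rewrite (dZM sg sg Dx) (dZbM sg sg Dx) (dZbM sb sbc Dx) (dZM sb sbc Dx) (dZ_conj sb Dx) (dZb_conj sb Dx).
rewrite dZb_beltrami // in T0 *; rewrite dZ_barrier // in T0 *; rewrite dZb_barrier //.
move: T0 (gr x) b0 g0.
have : (u x - c%:C%C)^* = u x - c%:C%C by rewrite cjD cjN u_real conjC_realc.
move: (u x - c%:C%C) => s.
move: (dZ beltrami x) (beltrami x) (divz x) (barrier x) => q b a g; rewrite !(cjD, cjN, cjM, conjCK).
move=> sr T0 gg b0 g0.
have K : (q - a * b) * g - 4 * b * s = 0.
  have bc0 : b^* != 0 by rewrite conjC_eq0.
  apply: (mulfI bc0); apply: (mulfI g0); rewrite !mulr0 -[RHS]T0.
  by move: (b^* : C) => *; ring.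
have Kc : (q^* - a^* * b^*) * g - 4 * b^* * s = 0.
  move/(congr1 Num.conj): K; rewrite conjC0 => K.
  rewrite -[RHS]K !(cjD, cjN, cjM) sr gg conjC1.
  by move: (q^* : C) (a^* : C) (b^* : C) => *; ring.
move=> h; move: h; congr (complex.Re _ <= 0).
apply/eqP; rewrite -subr_eq0; apply/eqP.
(* The two sides differ exactly by the squared modulus of the expression in [K], which is zero. *)
transitivity (((q - a * b) * g - 4 * b * s) * ((q^* - a^* * b^*) * g - 4 * b^* * s)).
  by move: (q^* : C) (a^* : C) (b^* : C) => *; ring.
by rewrite K mul0r.
Qed.

Lemma curvature_bound x (d0 ur : R) : D x -> 0 < d0 -> u x = ur%:C%C -> `|ur - c| < l ->
  (forall t : C, nC t < d0 ->
     complex.Re (tested (x + t *: vec (z 0 x) (z 1 x))) <= complex.Re (tested x)) ->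
  complex.Re (tested x) <= 6 * l ^+ 2.
Proof.
move=> Dx d0p hu hl hmax.
have l0 : 0 < l by apply: le_lt_trans hl.
have [b0|b0] := eqVneq (beltrami x) 0.
  by rewrite /tested b0 !mul0r /= mulr_ge0 // sqr_ge0.
pose s := ur - c; pose g := l ^+ 2 - s ^+ 2.
have sl : s ^+ 2 < l ^+ 2.
  by rewrite -real_normK ?num_real // ltr_pXn2r // ?nnegrE // ltW.
have gE : barrier x = g%:C%C by rewrite /barrier hu /g -!rcN -!rcD -rcM -rcN -rcD expr2.
have g0 : 0 < g by rewrite subr_gt0.
have := curvature_at_maximum Dx d0p b0 _ hmax.
rewrite gE hu -rcN -rcD -/s -!nC_sqr.
have -> : (2 : C) = (2 : R)%:C%C by rewrite (rmorph_nat (real_complex R) 2).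
have -> : (4 : C) = (4 : R)%:C%C by rewrite (rmorph_nat (real_complex R) 4).
rewrite -!rcM -!rcN -!rcD -rcM /tested gE -!nC_sqr -!rcM /=.
have n0 : 0 < nC (beltrami x) ^+ 2 by rewrite exprn_gt0 // lt0r nC_ge0 nC_eq0 b0.
move: n0; move: (nC (beltrami x) ^+ 2) => n n0 h.
have {}h : 2 * n * (n * (g * g) - 4 * (s * s) - 2 * g) <= 0.
  by apply: h; rewrite (fmorph_eq0 (real_complex R)) gt_eqF.
have {}h : n * (g * g) - 4 * (s * s) - 2 * g <= 0.
  by rewrite pmulr_rle0 // in h; rewrite mulr_gt0.
have : n * (g * g) <= 4 * (s * s) + 2 * g by move: h; rewrite -addrA -opprD subr_le0.
(* Here 4 s^2 + 2 g = 2 l^2 + 2 s^2 < 4 l^2, which is within the bound. *)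
move/le_trans; apply; rewrite /g -expr2.
by move: (s ^+ 2) (l ^+ 2) (sqr_ge0 s) sl => *; lra.
Qed.

End Maximum.

End FieldCurvature.

(** * The global function beta and its vanishing *)

Section Curvature.
Context {R : realType} {M : topologicalType}.
Local Notation C := R[i].
Local Notation V := 'rV[R[i]]_2.
Variables (A : set (chart R M)) (rho : M -> R).
Hypothesis surfaceM : complex_surface A.
Hypothesis rho_continuous : continuous rho.
Hypothesis rho_smooth : smooth_fun A (Mstar rho) rho.
Hypothesis drho : forall p, Mstar rho p -> nonzero_differential A rho p.
Hypothesis Mstar_nonempty : Mstar rho !=set0.
Hypothesis rho_psh : psh A rho.
Hypothesis u_monge_ampere : ddc_square_zero A (Mstar rho) (fun p => ln (rho p)).
Hypothesis rho_finite_type : forall c : R, 0 < c -> finite_type A [set p | rho p = c].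
Variable Z : chart R M -> M -> V.
Hypothesis Z_gradient : extended_gradient A rho Z.
Implicit Types (phi psi : chart R M) (p q : M) (v w x y : V).

Local Notation star := (star rho).
Local Notation zc := (zc Z).

Let zsm phi mu : A phi -> sm (star phi) (zc phi mu).
Proof. by move=> Aphi; exact: (zc_sm rho_continuous Z_gradient). Qed.

Let zanti phi (Aphi : A phi) mu x : star phi x -> dZb (zc phi) (zc phi mu) x = 0.
Proof.
exact: (gradient_antiholomorphic surfaceM rho_continuous rho_smooth drho Mstar_nonempty
  rho_psh u_monge_ampere rho_finite_type Z_gradient mu Aphi).
Qed.

Let zneq phi (Aphi : A phi) x : star phi x -> zc phi 0 x != 0 \/ zc phi 1 x != 0.
Proof.
exact: (gradient_neq0 surfaceM rho_continuous rho_smooth drho Mstar_nonempty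
  rho_psh u_monge_ampere rho_finite_type Z_gradient Aphi).
Qed.

Let sopen phi : open (star phi). Proof. exact: star_open. Qed.

Lemma field_transition phi psi y i : A phi -> A psi -> overlap rho phi psi y ->
  zc psi i (transition phi psi y) =
  pz 0 (fun w => transition phi psi w 0 i) y * zc phi 0 y +
  pz 1 (fun w => transition phi psi w 0 i) y * zc phi 1 y.
Proof.
move=> Aphi Apsi [q [hq [hq' sq]] <-].
have [[hZ _] _] := Z_gradient.
rewrite transitionE // !zcE // (hZ phi psi Aphi Apsi q sq hq hq').
have dif : differentiable (transition phi psi) (phi q).
  by apply/differentiable_hdiff; exact: (transition_hdiff surfaceM).
have w := differentiable_wdiff i dif.
rewrite (wdiff_pz 0 w) (wdiff_pz 1 w).
by rewrite [X in 'd _ _ X](row_delta (Z phi q)) linearD !linearZ !mxE mulrC [X in _ + X]mulrC.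
Qed.

(** The Jacobian of a transition map is holomorphic, so d/dzbar does not see it and dbar Z
    transforms as a tensor. *)
Lemma dzb_field_transition phi psi x i nu : A phi -> A psi -> overlap rho phi psi x ->
  pb 0 (zc psi i) (transition phi psi x) * (pz nu (fun w => transition phi psi w 0 0) x)^* +
  pb 1 (zc psi i) (transition phi psi x) * (pz nu (fun w => transition phi psi w 0 1) x)^* =
  pz 0 (fun w => transition phi psi w 0 i) x * pb nu (zc phi 0) x +
  pz 1 (fun w => transition phi psi w 0 i) x * pb nu (zc phi 1) x.
Proof.
move=> Aphi Apsi Ox; have oO := @overlap_open _ _ _ rho_continuous phi psi.
have ht j := overlap_hol surfaceM rho_continuous rho_smooth drho Mstar_nonempty j Aphi Apsi.
have [_ [_ <-]] := comp_holo_pz nu (zsm i Apsi) ht Ox (overlap_transition Ox).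
have sz k := sm_sub (@overlap_star _ _ rho phi psi) (zsm k Aphi).
have hp m := hol_pz m oO (ht i).
have sp m := proj1 (hp m).
rewrite -(pb_ext nu oO (smD oO (smM oO (sp 0) (sz 0)) (smM oO (sp 1) (sz 1))) Ox
  (fun y Oy => esym (field_transition i Aphi Apsi Oy))).
have W g : sm (overlap rho phi psi) g -> wd g x by move=> sg; exact: sm_wd sg Ox.
rewrite (pbD nu (W _ (smM oO (sp 0) (sz 0))) (W _ (smM oO (sp 1) (sz 1)))).
rewrite (pbM nu (W _ (sp 0)) (W _ (sz 0))) (pbM nu (W _ (sp 1)) (W _ (sz 1))).
by rewrite !(proj2 (hp _) nu x Ox) !mul0r !add0r.
Qed.

Definition dzb_mx (z : 'I_2 -> V -> C) x : 'M[C]_2 := \matrix_(mu, nu) pb nu (z mu) x.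

Lemma curv_trace z x : curv z x = \tr (dzb_mx z x *m map_mx Num.conj (dzb_mx z x)).
Proof.
rewrite /mxtrace sum2 !mxE !sum2 !mxE /curv.
by move: (pb 0 (z 0) x) (pb 1 (z 0) x) (pb 0 (z 1) x) (pb 1 (z 1) x) => *; rewrite addrA.
Qed.

(** dbar Z maps conjugate vectors to vectors, so it has no invariant trace by itself; its product
    with its conjugate is an endomorphism, and changing charts conjugates this product by the
    Jacobian. *)
Lemma curv_transition phi psi p : A phi -> A psi -> dom phi p -> dom psi p -> Mstar rho p ->
  curv (zc phi) (phi p) = curv (zc psi) (psi p).
Proof.
move=> Aphi Apsi hp hq sp; have Ox := overlapP hp hq sp.
pose J := \matrix_(i < 2, m < 2) pz m (fun w => transition phi psi w 0 i) (phi p).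
pose K := \matrix_(i < 2, m < 2) pz m (fun w => transition psi phi w 0 i) (psi p).
set X := dzb_mx (zc phi) (phi p); set Y := dzb_mx (zc psi) (psi p).
have JE : Y *m map_mx Num.conj J = J *m X.
  apply/matrixP => i nu; rewrite !mxE !sum2 !mxE.
  by rewrite -(dzb_field_transition i nu Aphi Apsi Ox) transitionE.
have KJ : K *m J = 1%:M.
  have h v := jacK surfaceM rho_continuous rho_smooth drho Mstar_nonempty v Aphi Apsi hp hq sp.
  apply/matrixP => i m; rewrite !mxE sum2 !mxE.
  have := congr1 (fun v : V => v 0 i) (h (delta_mx 0 m)).
  rewrite [RHS]mxE eqxx /= => <-; rewrite /jac; elim/I2_ind: i; elim/I2_ind: m; rewrite ?vec0 ?vec1 !mxE /=;
  by rewrite ?(mulr0, mulr1, addr0, add0r).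
have JJE : J *m (X *m map_mx Num.conj X) = (Y *m map_mx Num.conj Y) *m J.
  rewrite mulmxA -JE -mulmxA -map_mxM -JE map_mxM -map_mx_comp.
  rewrite (_ : map_mx (Num.conj \o Num.conj) J = J) ?mulmxA //.
  by apply/matrixP => i m; rewrite mxE /= conjCK.
rewrite !curv_trace -/X -/Y -[X *m _]mul1mx -KJ -mulmxA JJE mxtrace_mulC -[_ *m J *m K]mulmxA.
by rewrite (mulmx1C KJ) mulmx1.
Qed.

Definition chart_at p : chart R M := s2val (cid2 (atlas_cover surfaceM p)).

(** Maximising over a shell of M_* requires a function of the point alone; by [curv_transition] the
    chosen chart does not affect its values on M_*. *)
Definition curvature p : R := complex.Re (curv (zc (chart_at p)) (chart_at p p)).

Let zbel phi (Aphi : A phi) x : star phi x ->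
  curv (zc phi) x = beltrami (zc phi) x * (beltrami (zc phi) x)^*.
Proof.
by move=> hx; exact: (curv_beltrami (zanti Aphi) (zneq Aphi) hx).
Qed.

Lemma curvature_chart phi p : A phi -> dom phi p -> Mstar rho p ->
  beltrami (zc phi) (phi p) * (beltrami (zc phi) (phi p))^* = (curvature p)%:C%C.
Proof.
move=> Aphi hp sp; have hx : star phi (phi p) by exists p.
have Ac : A (chart_at p) by exact: s2valP (cid2 (atlas_cover surfaceM p)).
have hc : dom (chart_at p) p by exact: s2valP' (cid2 (atlas_cover surfaceM p)).
rewrite /curvature (curv_transition Ac Aphi hc hp sp) zbel //.
by rewrite -nC_sqr.
Qed.

Lemma ln_rho_wdiff phi x : A phi -> star phi x ->
  wdiff (loc phi (fun p => ln (rho p))) x (fun i => (loc phi rho x)^-1 * pz i (loc phi rho) x)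
    (fun i => (loc phi rho x)^-1 * pb i (loc phi rho) x).
Proof.
move=> Aphi hx; have sr := rho_sm rho_continuous rho_smooth Aphi.
apply: (wdiff_ln (g := fun y => rho (pt phi y))) (sm_wd sr hx).
by have := star_gt0 hx; rewrite /loc ltcR.
Qed.

Lemma ln_rho_sm phi : A phi -> sm (star phi) (loc phi (fun p => ln (rho p))).
Proof.
move=> Aphi; have sr := rho_sm rho_continuous rho_smooth Aphi; have oD := @sopen phi.
have sV : sm (star phi) (fun y => (loc phi rho y)^-1).
  by apply: (smV oD) sr => x /star_gt0; exact: lt0r_neq0.
case=> [|k]; first by split=> // x hx; exact: wdiff_wd (ln_rho_wdiff Aphi hx).
split=> [x hx|mu]; first exact: wdiff_wd (ln_rho_wdiff Aphi hx).
split.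
  apply: (Wk_ext (f := fun y => (loc phi rho y)^-1 * pz mu (loc phi rho) y) oD).
    by move=> y hy; rewrite (wdiff_pz _ (ln_rho_wdiff Aphi hy)).
  exact: (smM oD sV (sm_pz mu sr) k).
apply: (Wk_ext (f := fun y => (loc phi rho y)^-1 * pb mu (loc phi rho) y) oD).
  by move=> y hy; rewrite (wdiff_pb _ (ln_rho_wdiff Aphi hy)).
exact: (smM oD sV (sm_pb mu sr) k).
Qed.

Lemma dZ_ln_rho phi x : A phi -> star phi x -> dZ (zc phi) (loc phi (fun p => ln (rho p))) x = 1.
Proof.
move=> Aphi hx; have w := ln_rho_wdiff Aphi hx.
rewrite /dZ (wdiff_pz 0 w) (wdiff_pz 1 w).
have E := gradient_rho surfaceM rho_continuous rho_smooth drho Mstar_nonempty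
  rho_psh u_monge_ampere rho_finite_type Z_gradient Aphi hx.
rewrite mulrCA [X in _ + X]mulrCA -mulrDr E mulVf //.
exact: lt0r_neq0 (star_gt0 hx).
Qed.

Definition tested_on_M (c l : R) p : R :=
  curvature p * ((l ^+ 2 - (ln (rho p) - c) ^+ 2) * (l ^+ 2 - (ln (rho p) - c) ^+ 2)).

Lemma tested_chart phi c l p : A phi -> dom phi p -> Mstar rho p ->
  tested (zc phi) (loc phi (fun p => ln (rho p))) c l (phi p) = (tested_on_M c l p)%:C%C.
Proof.
move=> Aphi hp sp; rewrite /tested curvature_chart // /tested_on_M.
rewrite [X in X * X](_ : _ = (l ^+ 2 - (ln (rho p) - c) ^+ 2)%:C%C) -?rcM //.
by rewrite /barrier /loc coordK // -rcN -rcD -rcM -rcN -rcD expr2.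
Qed.

Lemma tested_cts c l p : Mstar rho p -> {for p, continuous (tested_on_M c l)}.
Proof.
move=> sp; have [phi Aphi hp] := atlas_cover surfaceM p.
have hx : star phi (phi p) by exists p.
have st := tested_sm (@sopen phi) (fun mu => zsm mu Aphi) (zneq Aphi) c l (ln_rho_sm Aphi).
have /continuousC_P ct := sm_cts st hx.
apply/cvgrPdist_lt => e e0; have [d d0 hd] := ct e e0.
have oB := @ball_open R (phi p) d.
have pB : [set y | nV (y - phi p) < d] (phi p) by rewrite /= subrr nV0.
have n1 := coord_nbhs hp oB pB.
have n2 : nbhs p (Mstar rho) by apply: open_nbhs_nbhs; split=> //; exact: Mstar_open.
near=> q.
have [hq /hd] : dom phi q /\ nV (phi q - phi p) < d by near: q; exact: n1.
have sq : Mstar rho q by near: q; exact: n2.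
by rewrite !tested_chart // -rcN -rcD nC_real distrC.
Unshelve. all: by end_near.
Qed.

Hypothesis rho_exhaustion : exhaustion rho.

(** The lower bound on log rho keeps the shell away from {rho = 0}, so it is closed in M, not just
    in M_*, and lies in a compact sublevel set. *)
Lemma annulus_compact (c l : R) : compact [set p | Mstar rho p /\ `|ln (rho p) - c| <= l].
Proof.
have -> : [set p | Mstar rho p /\ `|ln (rho p) - c| <= l] =
    rho @^-1` `[expR (c - l), expR (c + l)]%classic.
  apply/seteqP; split=> p /=; rewrite in_itv /= ler_distl.
    by move=> [sp /andP[h1 h2]]; rewrite -[rho p]lnK ?posrE // !ler_expR h1.
  move=> /andP[h1 h2]; have sp : 0 < rho p by apply: lt_le_trans h1; exact: expR_gt0.
  by split=> //; move: h1 h2; rewrite -{1 2}[rho p]lnK ?posrE // !ler_expR => -> ->.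
apply: (subclosed_compact _ (rho_exhaustion (c := expR (c + l)))).
  by apply: preimage_closed; [move=> p _; exact: rho_continuous|exact: itv_closed].
by move=> p /=; rewrite in_itv /= => /andP[].
Qed.

Lemma curvature_estimate p l : Mstar rho p -> 0 < l -> curvature p * l ^+ 4 <= 6 * l ^+ 2.
Proof.
move=> sp l0; set c := ln (rho p); pose F := tested_on_M c l.
have Fp : F p = curvature p * l ^+ 4.
  by rewrite /F /tested_on_M subrr expr0n subr0 -exprD.
have [|//] := ltP (6 * l ^+ 2) (curvature p * l ^+ 4); rewrite -Fp => big.
pose K := [set p | Mstar rho p /\ `|ln (rho p) - c| <= l].
have Kp : K p by split=> //; rewrite subrr normr0 ltW.
have cF : {within K, continuous F}.
  by apply: continuous_in_subspaceT => q; rewrite inE => -[sq _]; exact: tested_cts.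
have [q] := compact_EVT_max (ex_intro _ p Kp) (annulus_compact (c := c) (l := l)) cF.
rewrite inE => -[sq hq] hmax.
have Fq : 6 * l ^+ 2 < F q by apply: lt_le_trans big (hmax p _); rewrite inE.
(* [F] vanishes where |u - c| = l, so the maximum lies in the open shell, and a whole disc around it
   can be compared with it. *)
have hql : `|ln (rho q) - c| < l.
  rewrite lt_neqAle hq andbT; apply: contraTneq Fq => h.
  by rewrite -leNgt /F /tested_on_M -(real_normK (num_real (_ - c))) h subrr !mulr0 mulr_ge0 // sqr_ge0.
have [phi Aphi hphi] := atlas_cover surfaceM q.
have hx : star phi (phi q) by exists q.
have cln : {for q, continuous (fun q => ln (rho q))}.
  by apply: continuous_comp; [exact: rho_continuous|exact: continuous_ln].
have nq : nbhs q (Mstar rho `&` [set q' | `|ln (rho q') - c| < l]).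
  apply: filterI; first by apply: open_nbhs_nbhs; split=> //; exact: Mstar_open.
  have l1 : 0 < l - `|ln (rho q) - c| by rewrite subr_gt0.
  have /cvgrPdist_lt/(_ _ l1) h := cln.
  near=> q'; have h' : `|ln (rho q) - ln (rho q')| < l - `|ln (rho q) - c| by near: q'.
  rewrite /= (_ : _ - c = (ln (rho q) - c) - (ln (rho q) - ln (rho q'))); last by ring.
  by apply: le_lt_trans (ler_normB _ _) _; rewrite -ltrBrDl.
have [r r0 hr] := chart_ball hphi nq.
pose v : V := vec (zc phi 0 (phi q)) (zc phi 1 (phi q)).
(* Discs of radius r / (|v| + 1) in the direction v stay in the coordinate ball, hence in the
   shell. *)
have v0 : 0 < nV v + 1 by rewrite ltr_wpDl // nV_ge0.
have := curvature_bound (@sopen phi) (fun mu => zsm mu Aphi) (zanti Aphi) (zneq Aphi)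
  (ln_rho_sm Aphi) (loc_real phi _) (fun y hy => dZ_ln_rho Aphi hy) hx (divr_gt0 r0 v0) _ hql.
rewrite tested_chart // => h; have : F q <= 6 * l ^+ 2.
  apply: h => [|t ht]; first by rewrite /loc coordK.
  have [|q' [h1 h2 h3 [h4 h5]]] := hr (phi q + t *: v).
    rewrite addrC addKr nVZ; move: ht; rewrite ltr_pdivlMr // mulrDr mulr1.
    by apply: le_lt_trans; rewrite lerDl nC_ge0.
  rewrite -h2 tested_chart //; apply: hmax; rewrite inE; split=> //; exact: ltW.
by rewrite leNgt Fq.
Unshelve. all: by end_near.
Qed.

Lemma curvature_eq0 p : Mstar rho p -> curvature p = 0.
Proof.
move=> sp; have [phi Aphi hp] := atlas_cover surfaceM p.
have c0 : 0 <= curvature p by rewrite -lecR -(curvature_chart Aphi hp sp) -nC_sqr lecR sqr_ge0.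
apply/eqP; rewrite eq_le c0 andbT leNgt; apply/negP => cp.
(* For this l the left side equals 7 l^2, beyond the bound 6 l^2. *)
have h := curvature_estimate sp (l := Num.sqrt (7 / curvature p)).
have l0 : 0 < Num.sqrt (7 / curvature p) by rewrite sqrtr_gt0 divr_gt0.
have {h} := h l0; rewrite -[4%N]/(2 * 2)%N exprM sqr_sqrtr; last by rewrite ltW // divr_gt0.
have e : curvature p * (7 / curvature p) = 7 by rewrite mulrC divfK // gt_eqF.
rewrite expr2 mulrA e; rewrite ler_pM2r ?divr_gt0 //.
by rewrite ler_nat.
Qed.

Lemma beltrami_eq0 phi x : A phi -> star phi x -> beltrami (zc phi) x = 0.
Proof.
move=> Aphi [p [hp sp] <-]; have := curvature_chart Aphi hp sp.
by rewrite curvature_eq0 // => /eqP; rewrite mulf_eq0 conjC_eq0 orbb => /eqP.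
Qed.

End Curvature.

(** * Convergence and first integrals *)

Section Weierstrass.
Context {R : realType}.
Local Notation C := R[i].
Local Notation V := 'rV[R[i]]_2.
Local Notation q := (2^-1 : R).

Lemma half_pow_gt0 n : 0 < q ^+ n. Proof. by rewrite exprn_gt0 // invr_gt0. Qed.

Lemma half_pow_small (K e : R) : 0 < e -> exists n, forall m, (n <= m)%N -> K * q ^+ m < e.
Proof.
move=> e0; have K1 : 0 < `|K| + 1 by rewrite ltr_wpDl.
have h0 : 0 <= (`|K| + 1) / e by rewrite ltW // divr_gt0.
exists (Num.Def.archi_bound ((`|K| + 1) / e)) => m hm.
have h1 : (`|K| + 1) / e < 2 ^+ m.
  apply: lt_trans (archi_boundP h0) _; rewrite -natrX ltr_nat.
  by apply: leq_ltn_trans hm _; exact: ltn_expl.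
apply: (@le_lt_trans _ _ ((`|K| + 1) * q ^+ m)).
  rewrite ler_pM2r ?half_pow_gt0 //; apply: le_trans (ler_norm _) _; by rewrite lerDl.
by rewrite exprVn ltr_pdivrMr ?exprn_gt0 // mulrC -ltr_pdivrMr.
Qed.

Lemma half_pow_le m n : (n <= m)%N -> q ^+ m <= q ^+ n.
Proof. by move=> h; rewrite ler_wiXn2l // ?invr_ge0 // invf_le1 // ler1n. Qed.

(** The intervals of radius 2 c q^n around u n meet pairwise; the supremum of their left endpoints
    lies in all of them. *)
Lemma real_geometric_limit (u : nat -> R) (c : R) :
  (forall n, `|u n.+1 - u n| <= c * q ^+ n) ->
  exists l : R, forall n, `|l - u n| <= 2 * c * q ^+ n.
Proof.
move=> h; have c0 : 0 <= c.
  by have := le_trans (normr_ge0 _) (h 0%N); rewrite expr0 mulr1.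
have h' n k : `|u (n + k)%N - u n| <= 2 * c * q ^+ n - 2 * c * q ^+ (n + k).
  elim: k => [|k IH]; first by rewrite addn0 !subrr normr0.
  have := h (n + k)%N; rewrite addnS => h1.
  rewrite -(subrKA (u (n + k)%N)); apply: le_trans (ler_normD _ _) _.
  have e : q ^+ (n + k).+1 = q ^+ (n + k) / 2 by rewrite exprS mulrC.
  rewrite e; move: h1 IH; move: (`|_|) (`|_|) (q ^+ n) (q ^+ (n + k)) => a b s t h1 h2.
  by nra.
have h2 n m : u n - 2 * c * q ^+ n <= u m + 2 * c * q ^+ m.
  have [/subnKC nm|/ltnW/subnKC mn] := leqP n m.
    have := h' n (m - n)%N; rewrite nm ler_distl => /andP[h1 _].
    have := mulr_ge0 (mulr_ge0 (ler0n R 2) c0) (ltW (half_pow_gt0 m)).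
    by move: h1; move: (2 * c * q ^+ n) (2 * c * q ^+ m) (u n) (u m) => *; lra.
  have := h' m (n - m)%N; rewrite mn ler_distl => /andP[_ h1].
  have := mulr_ge0 (mulr_ge0 (ler0n R 2) c0) (ltW (half_pow_gt0 n)).
  by move: h1; move: (2 * c * q ^+ n) (2 * c * q ^+ m) (u n) (u m) => *; lra.
pose S := [set u n - 2 * c * q ^+ n | n in [set: nat]].
have S0 : S !=set0 by exists (u 0%N - 2 * c * q ^+ 0), 0%N.
have Sub m : ubound S (u m + 2 * c * q ^+ m) by move=> _ [n _ <-]; exact: h2.
exists (sup S) => n; rewrite ler_distl; apply/andP; split.
  by apply: ub_le_sup; [exists (u 0%N + 2 * c * q ^+ 0); exact: Sub|exists n].
exact: ge_sup (Sub n).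
Qed.

Lemma geometric_limit (u : nat -> C) (c : R) :
  (forall n, nC (u n.+1 - u n) <= c * q ^+ n) ->
  exists l : C, forall n, nC (l - u n) <= 4 * c * q ^+ n.
Proof.
move=> h; have reB (a b : C) : complex.Re (a - b) = complex.Re a - complex.Re b by case: a b => ? ? [].
have imB (a b : C) : complex.Im (a - b) = complex.Im a - complex.Im b by case: a b => ? ? [].
have [n|l1 h1] := @real_geometric_limit (fun n => complex.Re (u n)) c.
  by rewrite -reB; apply: le_trans (Re_le_nC _) (h n).
have [n|l2 h2] := @real_geometric_limit (fun n => complex.Im (u n)) c.
  by rewrite -imB; apply: le_trans (Im_le_nC _) (h n).
exists (l1 +i* l2)%C => n; apply: le_trans (nC_le_ReIm _) _; rewrite reB imB /=.
apply: le_trans (lerD (h1 n) (h2 n)) _; rewrite -mulrDl -mulrDl.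
by rewrite (_ : 2 + 2 = 4 :> R) //; rewrite -natrD.
Qed.

Lemma lipschitz_of_derivatives (f : V -> C) x y (K : R) :
  (forall t : R, 0 <= t <= 1 -> wd f (x + t%:C%C *: (y - x)) /\
     forall mu, pb mu f (x + t%:C%C *: (y - x)) = 0 /\
                nC (pz mu f (x + t%:C%C *: (y - x))) <= K) ->
  nC (f y - f x) <= 4 * K * nV (y - x).
Proof.
move=> h; have der (t : R) : 0 <= t <= 1 -> rderivable f (y - x) (x + t%:C%C *: (y - x)) /\
    nC (rderive f (y - x) (x + t%:C%C *: (y - x)) - 0) <= 2 * K * nV (y - x).
  move=> ht; have [w hp] := h t ht; split; first exact: wdiff_rderivable w.
  rewrite subr0 (wdiff_rderive _ w) /rlin.
  have [b0 p0] := hp 0; have [b1 p1] := hp 1.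
  rewrite b0 b1 !mul0r !addr0.
  apply: le_trans (nC_triangle _ _) _; rewrite !nCM.
  have h0 := ler_pM (nC_ge0 _) (nC_ge0 _) p0 (nC0_le (y - x)).
  have h1 := ler_pM (nC_ge0 _) (nC_ge0 _) p1 (nC1_le (y - x)).
  by apply: le_trans (lerD h0 h1) _; rewrite -mulrA mulr_natl mulr2n.
have := mean_value_ineq ler01 der.
have -> : x + (1 : R)%:C%C *: (y - x) = y by rewrite scale1r addrC subrK.
have -> : x + (0 : R)%:C%C *: (y - x) = x by rewrite scale0r addr0.
rewrite mulr0 subr0 subr0 mulr1.
by move/le_trans; apply; rewrite !mulrA -natrM.
Qed.

(** The Cauchy estimate makes the derivatives converge geometrically too. The increments of F m - F
    n are then O(q^n) |y - x| uniformly in m; this passes to the limit in m and transfers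
    differentiability from F n to f. *)
Lemma weierstrass (F : nat -> V -> C) x0 (r c : R) : 0 < r ->
  (forall n, hol [set x | nV (x - x0) < r] (F n)) ->
  (forall n x, nV (x - x0) < r -> nC (F n.+1 x - F n x) <= c * q ^+ n) ->
  exists f : V -> C,
    (forall n x, nV (x - x0) < r -> nC (f x - F n x) <= 4 * c * q ^+ n) /\
    exists K : R, forall x, nV (x - x0) < r / 2 -> exists a,
      wdiff f x a (fun=> 0) /\ forall n mu, nC (a mu - pz mu (F n) x) <= K * q ^+ n.
Proof.
move=> r0 hF hc; have oB := @ball_open R x0 r.
have c0 : 0 <= c.
  have := hc 0%N x0; rewrite subrr nV0 expr0 mulr1 => /(_ r0).
  exact: le_trans (nC_ge0 _).
have ex x : exists l, nV (x - x0) < r -> forall n, nC (l - F n x) <= 4 * c * q ^+ n.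
  have [xr|xr] := pselect (nV (x - x0) < r); last by exists 0.
  have [l hl] := geometric_limit (fun n => hc n x xr).
  by exists l.
have [f hf] := choice ex; exists f; split=> [n x xr|]; first exact: hf.
(* This is the Cauchy estimate, with its constant 2, on discs of radius r / 4, which stay in the
   ball when x is in the half ball. *)
pose c' := 8 * c / r.
have hd n x mu : nV (x - x0) < r / 2 -> nC (pz mu (F n.+1) x - pz mu (F n) x) <= c' * q ^+ n.
  move=> xr.
  have xr' : nV (x - x0) < r.
    by apply: lt_trans xr _; move: r0; clear; lra.
  have hD := hF n; have hD1 := hF n.+1.
  have hB : hol [set x | nV (x - x0) < r] (fun y => F n.+1 y - F n y).
    split; first by apply: (smB oB); [exact: (proj1 hD1)|exact: (proj1 hD)].
    move=> nu y yr; have w1 := sm_wd (proj1 hD1) yr; have w := sm_wd (proj1 hD) yr.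
    rewrite (pbD nu w1 (wdiff_wd (wdiffN w))) (pbN nu w) (proj2 hD1) // (proj2 hD) //.
    by rewrite subrr.
  have line z : nC z <= r / 4 -> nV (x + z *: delta_mx 0 mu - x0) < r.
    move=> hz; rewrite addrAC; apply: le_lt_trans (nV_triangle _ _) _.
    rewrite nVZ; have -> : nV (delta_mx 0 mu : V) = 1.
      by rewrite nVE !mxE; elim/I2_ind: mu; rewrite /= nC0 nC1; [apply: max_l|apply: max_r]; exact: ler01.
    by move: xr hz; move: (nV _) (nC _) => *; lra.
  have := cauchy_estimate oB hB (divr_gt0 r0 (ltr0n _ 4)) line (fun z hz => hc n _ (line z hz)).
  have w1 := sm_wd (proj1 hD1) xr'; have w := sm_wd (proj1 hD) xr'.
  rewrite (pzD mu w1 (wdiff_wd (wdiffN w))) (pzN mu w) /c'.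
  move: (nC _) (q ^+ n) => p s h.
  rewrite mulrAC ler_pdivlMr // -(ler_pM2r (x := 4^-1)) ?invr_gt0 //.
  by move: h; rewrite mulrAC [X in X <= _](_ : _ = p * r / 4); [lra|ring].
have exd x : exists a : 'I_2 -> C, nV (x - x0) < r / 2 ->
    forall n mu, nC (a mu - pz mu (F n) x) <= 4 * c' * q ^+ n.
  have [xr|xr] := pselect (nV (x - x0) < r / 2); last by exists (fun=> 0).
  have [a0 h0] := geometric_limit (fun n => hd n x 0 xr).
  have [a1 h1] := geometric_limit (fun n => hd n x 1 xr).
  by exists (fun mu => if mu == 0 then a0 else a1) => _ n; elim/I2_ind.
exists (4 * c') => x xr; have [a ha] := exd x; exists a; split; last by move=> *; exact: ha.
have c'0 : 0 <= c' by rewrite divr_ge0 // ?mulr_ge0 // ltW.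
have [d d0 hd'] : exists2 d : R, 0 < d & forall y, nV (y - x) < d -> nV (y - x0) < r / 2.
  have /openV_P/(_ x xr) := @ball_open R x0 (r / 2); exact.
have dF n m y : (n <= m)%N -> nV (y - x) < d ->
    nC ((F m y - F n y) - (F m x - F n x)) <= 32 * c' * q ^+ n * nV (y - x).
  move=> nm hy.
  have L (t : R) : 0 <= t <= 1 -> nV (x + t%:C%C *: (y - x) - x) < d.
    move=> /andP[t0 t1]; rewrite addrC addKr nVZ nC_real ger0_norm //.
    by apply: le_lt_trans hy; rewrite ler_piMl // nV_ge0.
  have half (w : V) : nV (w - x0) < r / 2 -> nV (w - x0) < r.
    by move/lt_trans; apply; move: r0; clear; lra.
  have := @lipschitz_of_derivatives (fun y => F m y - F n y) x y (8 * c' * q ^+ n).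
  rewrite (_ : 4 * (8 * c' * q ^+ n) = 32 * c' * q ^+ n); last by ring.
  apply=> t ht; have wr := hd' _ (L t ht); have wr' := half _ wr.
  move: (x + _) wr wr' => w wr wr'.
  have w1 := sm_wd (proj1 (hF m)) wr'; have w2 := sm_wd (proj1 (hF n)) wr'.
  split; first exact: wdiff_wd (wdiffD w1 (wdiffN w2)).
  move=> mu; rewrite (pbD mu w1 (wdiff_wd (wdiffN w2))) (pbN mu w2) (proj2 (hF m)) // (proj2 (hF n)) //.
  rewrite subrr; split=> //.
  rewrite (pzD mu w1 (wdiff_wd (wdiffN w2))) (pzN mu w2).
  have [b hb] := exd w; apply: le_trans (nC_telescope _ (b mu) _) _.
  rewrite nC_sub; apply: le_trans (lerD (hb wr m mu) (hb wr n mu)) _.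
  have := ler_wpM2l c'0 (half_pow_le nm); move: (q ^+ m) (q ^+ n) => s t'; clear; nra.
have df n y : nV (y - x) < d ->
    nC ((f y - F n y) - (f x - F n x)) <= 32 * c' * q ^+ n * nV (y - x).
  move=> hy; apply/ler_addgt0Pr => e e0.
  have [N hN] := half_pow_small (8 * c) e0.
  have := dF n (maxn n N) y (leq_maxl _ _) hy; have {hN} := hN (maxn n N) (leq_maxr _ _).
  move: (maxn n N) => m he hm.
  have half (w : V) : nV (w - x0) < r / 2 -> nV (w - x0) < r.
    by move/lt_trans; apply; move: r0; clear; lra.
  have hy' := hf y (half _ (hd' _ hy)) m; have hx' := hf x (half _ xr) m.
  rewrite (_ : _ - _ = ((F m y - F n y) - (F m x - F n x)) + ((f y - F m y) - (f x - F m x))); last by ring.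
  apply: le_trans (nC_triangle _ _) (lerD hm _).
  apply: le_trans (nC_triangle _ _) _; rewrite nCN; apply: le_trans (lerD hy' hx') _.
  by apply: ltW; move: he; rewrite -mulrDl -mulrDl -natrD.
move=> e e0; have e2 : 0 < e / 2 by rewrite divr_gt0.
(* The constant 40 collects 32 c' from the increments of f - F n and 8 c' from the difference of the
   two differentials; the other e / 2 is spent on F n itself. *)
have [n /(_ n (leqnn n)) hn] := half_pow_small (40 * c') e2.
have wn : wd (F n) x.
  by apply: sm_wd (proj1 (hF n)) _; rewrite /=; apply: lt_trans xr _; move: r0; clear; lra.
have [d1 d10 hd1] := wn _ e2.
exists (Num.min d d1); first by rewrite lt_min d0.
move=> h; rewrite lt_min => /andP[h1 h2].
have xh : x + h - x = h by rewrite addrC addKr.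
have := df n (x + h); rewrite xh => /(_ h1) k1.
have k2 := hd1 h h2.
have k3 : nC (rlin (fun i => pz i (F n) x) (fun i => pb i (F n) x) h - rlin a (fun=> 0) h) <= 8 * c' * q ^+ n * nV h.
  have xr' : nV (x - x0) < r by apply: lt_trans xr _; move: r0; clear; lra.
  rewrite /rlin !(proj2 (hF n)) // !mul0r.
  rewrite (_ : _ - _ = - ((a 0 - pz 0 (F n) x) * h 0 0) - (a 1 - pz 1 (F n) x) * h 0 1); last by ring.
  apply: le_trans (nC_triangle _ _) _; rewrite !nCN !nCM.
  have p0 := ler_pM (nC_ge0 _) (nC_ge0 _) (ha xr n 0) (nC0_le h).
  have p1 := ler_pM (nC_ge0 _) (nC_ge0 _) (ha xr n 1) (nC1_le h).
  by apply: le_trans (lerD p0 p1) _; rewrite -mulrDl -mulrDl -mulrDl -natrD.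
have -> : f (x + h) - f x - rlin a (fun=> 0) h = ((f (x + h) - F n (x + h)) - (f x - F n x)) +
  ((F n (x + h) - F n x - rlin (fun i => pz i (F n) x) (fun i => pb i (F n) x) h) +
   (rlin (fun i => pz i (F n) x) (fun i => pb i (F n) x) h - rlin a (fun=> 0) h)) by ring.
apply: le_trans (nC_triangle _ _) _; apply: le_trans (lerD (lexx _) (nC_triangle _ _)) _.
apply: le_trans (lerD k1 (lerD k2 k3)) _.
rewrite -!mulrDl ler_wpM2r ?nV_ge0 //.
by move: hn; move: (q ^+ n) => s; clear; lra.
Qed.

End Weierstrass.

(** * A holomorphic first integral of d_1 + s d_2 by its Lie series *)

Section FirstIntegral.
Context {R : realType}.
Local Notation C := R[i].
Local Notation V := 'rV[R[i]]_2.
Local Notation q := (2^-1 : R).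

Lemma holD (D : set V) (f g : V -> C) : open D -> hol D f -> hol D g -> hol D (fun x => f x + g x).
Proof.
move=> oD [sf hf] [sg hg]; split=> [|mu x Dx]; first exact: smD.
by rewrite (pbD mu (sm_wd sf Dx) (sm_wd sg Dx)) hf // hg // addr0.
Qed.

Lemma holM (D : set V) (f g : V -> C) : open D -> hol D f -> hol D g -> hol D (fun x => f x * g x).
Proof.
move=> oD [sf hf] [sg hg]; split=> [|mu x Dx]; first exact: smM.
by rewrite (pbM mu (sm_wd sf Dx) (sm_wd sg Dx)) hf // hg // mul0r mulr0 addr0.
Qed.

Lemma hol_cst (D : set V) (c : C) : open D -> hol D (fun=> c).
Proof. by move=> oD; split=> [|mu x Dx]; [exact: sm_cst|exact: pb_cst]. Qed.

Lemma hol_coord (D : set V) i : open D -> hol D (fun x => x 0 i).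
Proof. by move=> oD; split=> [|mu x Dx]; [exact: sm_coord|exact: pb_coord]. Qed.

(** An elementary form of Stirling's bound, by induction from (1 + 1/n)^n <= e. It converts the
    growth (K n)^n of the iterates into n!, which the Taylor factors compensate. *)
Lemma natrX_le_fact n : n%:R ^+ n <= expR 1 ^+ n * (n`!)%:R :> R.
Proof.
elim: n => [|n IH]; first by rewrite !expr0 mul1r.
have [->|n0] := posnP n.
  by rewrite !expr1 mulr1; apply: le_trans (expR_ge1Dx 1); rewrite lerDl.
have nR : 0 < n%:R :> R by rewrite ltr0n.
have h : (n.+1%:R / n%:R) ^+ n <= expR 1 :> R.
  have -> : expR 1 = expR (n%:R^-1) ^+ n :> R by rewrite -expRM_natl mulfV // gt_eqF.
  apply: lerXn2r; rewrite ?nnegrE ?expR_ge0 // ?divr_ge0 //.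
  by apply: le_trans (expR_ge1Dx _); rewrite -addn1 natrD mulrDl mulfV ?gt_eqF // mul1r.
rewrite exprS factS natrM [expR 1 ^+ _]exprSr.
have -> : n.+1%:R ^+ n = n%:R ^+ n * (n.+1%:R / n%:R) ^+ n :> R.
  by rewrite -exprMn [n%:R * _]mulrC divfK // gt_eqF.
have := ler_pM (exprn_ge0 n (ltW nR)) (exprn_ge0 n (divr_ge0 (ler0n R n.+1) (ltW nR))) IH h.
move/(ler_wpM2l (ler0n R n.+1)); move/le_trans; apply.
by rewrite le_eqVlt; apply/orP; left; apply/eqP; ring.
Qed.

Variables (x0 : V) (R0 S : R) (s : V -> C).
Hypothesis R0_gt0 : 0 < R0.
Local Notation D := [set x : V | nV (x - x0) < R0].
Hypothesis s_hol : hol D s.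
Hypothesis s_bound : forall x, D x -> nC (s x) <= S.

Let oD : open D. Proof. exact: ball_open. Qed.
Let D0 : D x0. Proof. by rewrite /= subrr nV0. Qed.
Let S0 : 0 <= S. Proof. exact: le_trans (nC_ge0 _) (s_bound D0). Qed.

Fixpoint lie_iterate n : V -> C :=
  if n is n'.+1 then fun x => pz 0 (lie_iterate n') x + s x * pz 1 (lie_iterate n') x
  else fun x => x 0 1 - x0 0 1.

Lemma lie_iterate_hol n : hol D (lie_iterate n).
Proof.
elim: n => [|n IH] /=; first by apply: (holD oD); [exact: hol_coord|exact: hol_cst].
by apply: (holD oD); [|apply: (holM oD) => //]; exact: hol_pz.
Qed.

Let r := R0 / 2.
Let r0 : 0 < r. Proof. by rewrite divr_gt0. Qed.
Let rR0 : r < R0. Proof. by rewrite /r; move: R0_gt0; lra. Qed.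

(* Each application of the vector field costs one Cauchy estimate on a disc of
   radius [d]; splitting r/2 into n steps bounds the n-th iterate by (K n)^n. *)
Lemma lie_iterate_shrink k x (d : R) : 0 < d -> k%:R * d <= r ->
  nV (x - x0) <= r - k%:R * d -> nC (lie_iterate k x) <= r * (2 * (1 + S) / d) ^+ k.
Proof.
move=> d0; elim: k x => [|k IH] x hk hx.
  rewrite expr0 mulr1 /=; move: hx; rewrite mul0r subr0 => hx.
  by apply: le_trans hx; rewrite -subVE nC1_le.
have kd : k%:R * d <= r by apply: le_trans hk; rewrite ler_pM2r // ler_nat.
have step (z : C) mu : nC z <= d -> nV (x + z *: delta_mx 0 mu - x0) <= r - k%:R * d.
  move=> hz; rewrite addrAC; apply: le_trans (nV_triangle _ _) _.
  rewrite nVZ (_ : nV (delta_mx 0 mu : V) = 1); last first.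
    by rewrite nVE !mxE; elim/I2_ind: mu; rewrite /= nC0 nC1; [apply: max_l|apply: max_r]; exact: ler01.
  rewrite mulr1; apply: le_trans (lerD hx hz) _.
  by rewrite -addn1 natrD mulrDl mul1r opprD addrA subrK.
have inD (z : C) mu : nC z <= d -> D (x + z *: delta_mx 0 mu).
  move=> /step-/(_ mu) h; apply: le_lt_trans h _; apply: le_lt_trans rR0.
  by rewrite gerBl mulr_ge0 // ltW.
have ce mu := cauchy_estimate oD (lie_iterate_hol k) d0 (inD ^~ mu) (fun z hz => IH _ kd (step z mu hz)).
have Dx : D x by have := inD 0 0; rewrite scale0r addr0 nC0; apply; exact: ltW.
have sx := s_bound Dx.
rewrite exprSr mulrA /=.
apply: le_trans (nC_triangle _ _) _; rewrite nCM.
have h0 : nC (pz 0 (lie_iterate k) x) <= 2 * (r * (2 * (1 + S) / d) ^+ k) / d by rewrite ler_pdivlMr // mulrC; exact: ce.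
have h1 : nC (pz 1 (lie_iterate k) x) <= 2 * (r * (2 * (1 + S) / d) ^+ k) / d by rewrite ler_pdivlMr // mulrC; exact: ce.
have h2 := ler_pM (nC_ge0 _) (nC_ge0 _) sx h1.
apply: le_trans (lerD h0 h2) _.
by rewrite le_eqVlt; apply/orP; left; apply/eqP; ring.
Qed.

Let K := 4 * (1 + S) * expR 1 / r.
Let K0 : 0 < K.
Proof. by rewrite divr_gt0 // mulr_gt0 ?expR_gt0 // mulr_gt0 // ltr_wpDr. Qed.

Lemma lie_iterate_bound n x : nV (x - x0) <= r / 2 -> nC (lie_iterate n x) <= r * K ^+ n * (n`!)%:R.
Proof.
case: n => [|n] hx.
  rewrite expr0 !mulr1 /= -subVE; apply: le_trans (nC1_le (x - x0)) _.
  by apply: le_trans hx _; move: r0; lra.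
have n0 : 0 < n.+1%:R :> R by rewrite ltr0n.
have nd : n.+1%:R * (r / (2 * n.+1%:R)) = r / 2 by field; rewrite gt_eqF // gt_eqF.
(* These n + 1 discs use up half of r and leave the ball of radius r / 2 for x. *)
have := @lie_iterate_shrink n.+1 x (r / (2 * n.+1%:R)).
rewrite nd => h; apply: le_trans (h _ _ _) _.
- by rewrite divr_gt0 // mulr_gt0.
- by move: r0; lra.
- by apply: le_trans hx _; move: r0; lra.
have [k ek k0] : exists2 k, k = 4 * (1 + S) / r & 0 <= k.
  by exists (4 * (1 + S) / r); rewrite // divr_ge0 ?mulr_ge0 ?addr_ge0 // ltW.
have -> : 2 * (1 + S) / (r / (2 * n.+1%:R)) = k * n.+1%:R.
  by rewrite ek; field; rewrite !gt_eqF.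
have -> : K = k * expR 1 by rewrite ek /K; ring.
rewrite !exprMn.
apply: (le_trans (ler_wpM2l (ltW r0) (ler_wpM2l (exprn_ge0 n.+1 k0) (natrX_le_fact n.+1)))).
by rewrite le_eqVlt; apply/orP; left; apply/eqP; ring.
Qed.

Fixpoint taylor_factor n : V -> C :=
  if n is n'.+1 then fun x => taylor_factor n' x * (n'.+1%:R^-1 * - (x 0 0 - x0 0 0))
  else fun=> 1.

Let tlin_hol (c : C) : hol D (fun x => c * - (x 0 0 - x0 0 0)).
Proof.
apply: (holM oD); first exact: hol_cst.
have -> : (fun x : V => - (x 0 0 - x0 0 0)) = (fun x => - 1 * x 0 0 + x0 0 0).
  by apply/funext => x; ring.
by apply: (holD oD); [apply: (holM oD)|]; try exact: hol_cst; exact: hol_coord.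
Qed.

Lemma taylor_factor_hol n : hol D (taylor_factor n).
Proof. by elim: n => [|n IH] /=; [exact: hol_cst|apply: (holM oD)]. Qed.

Let pz_tlin (c : C) mu x : D x ->
  pz mu (fun x : V => c * - (x 0 0 - x0 0 0)) x = - c * (0 == mu :> 'I_2)%:R.
Proof.
move=> Dx; have wc (d : C) : wd (fun=> d) x by exact: sm_wd (sm_cst d oD) Dx.
have wx := sm_wd (sm_coord 0 oD) Dx.
have -> : (fun x : V => c * - (x 0 0 - x0 0 0)) = (fun x => - c * x 0 0 + c * x0 0 0).
  by apply/funext => y; ring.
rewrite (pzD mu (wdiff_wd (wdiffM (wc _) wx)) (wc _)) (pzM mu (wc _) wx) !pz_cst pz_coord.
by rewrite mul0r add0r addr0.
Qed.

Lemma pz_taylor_factor n x : D x ->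
  pz 0 (taylor_factor n.+1) x = - taylor_factor n x /\ pz 1 (taylor_factor n) x = 0.
Proof.
move=> Dx; have wt m := sm_wd (proj1 (taylor_factor_hol m)) Dx.
have wl (c : C) := sm_wd (proj1 (tlin_hol c)) Dx.
have h1 m : pz 1 (taylor_factor m) x = 0.
  elim: m => [|m IH] /=; first exact: pz_cst.
  by rewrite (pzM 1 (wt m) (wl _)) IH pz_tlin // mulr0 mul0r mulr0 addr0.
split=> //; elim: n => [|n IH] /=.
  by rewrite (pzM 0 (wt 0%N) (wl _)) pz_cst pz_tlin // mul0r add0r mul1r invr1 mulr1.
rewrite (pzM 0 (wt n.+1) (wl _)) IH pz_tlin //= .
have n1 : n.+1%:R != 0 :> C by rewrite pnatr_eq0.
have n2 : n.+2%:R != 0 :> C by rewrite pnatr_eq0.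
move: (taylor_factor n x) (x 0 0) (x0 0 0) => *; rewrite mulr1.
have e : n.+2%:R = n.+1%:R + 1 :> C by rewrite -natr1.
by rewrite e in n2 *; move: n2 n1; move: (n.+1%:R : C) => N n2 n1; field; rewrite n1.
Qed.

Lemma taylor_factor_bound n x rho : nV (x - x0) <= rho ->
  nC (taylor_factor n x) * (n`!)%:R <= rho ^+ n.
Proof.
move=> hx; elim: n => [|n IH] /=; first by rewrite nC1 !mulr1.
rewrite !nCM nCN nCV nC_nat factS natrM exprSr.
have n1 : n.+1%:R != 0 :> R by rewrite pnatr_eq0.
have -> : nC (taylor_factor n x) * (n.+1%:R^-1 * nC (x 0 0 - x0 0 0)) * (n.+1%:R * (n`!)%:R) =
   nC (taylor_factor n x) * (n`!)%:R * nC (x 0 0 - x0 0 0).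
  by move: n1; move: (n.+1%:R) ((n`!)%:R) (nC _) (nC _) => N f a b n1; field.
apply: ler_pM => //; rewrite ?mulr_ge0 ?nC_ge0 //.
by rewrite -subVE; apply: le_trans (nC0_le _) hx.
Qed.

(** With X = d_1 + s d_2 one has X z_1 = 1, so flowing back to the slice z_1 = x0_1 takes the time
    x0_1 - z_1. The full series is z_2 - x0_2 evaluated after that flow, which is why it is constant
    along X. *)
Fixpoint partial_integral n : V -> C :=
  if n is n'.+1 then fun x => partial_integral n' x + taylor_factor n' x * lie_iterate n' x
  else fun=> 0.

Lemma partial_integral_hol n : hol D (partial_integral n).
Proof.
elim: n => [|n IH] /=; first exact: hol_cst.
by apply: (holD oD) => //; apply: (holM oD); [exact: taylor_factor_hol|exact: lie_iterate_hol].
Qed.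

(** d_1 + s d_2 sends each Taylor factor to minus the preceding one, so the sum telescopes to one
    term, which tends to zero. *)
Lemma partial_integral_derivative n x : D x ->
  pz 0 (partial_integral n.+1) x + s x * pz 1 (partial_integral n.+1) x =
  taylor_factor n x * lie_iterate n.+1 x.
Proof.
move=> Dx; have wt m := sm_wd (proj1 (taylor_factor_hol m)) Dx.
have wl m := sm_wd (proj1 (lie_iterate_hol m)) Dx.
have wp m := sm_wd (proj1 (partial_integral_hol m)) Dx.
have E m : pz 0 (partial_integral m.+1) x + s x * pz 1 (partial_integral m.+1) x =
    pz 0 (partial_integral m) x + s x * pz 1 (partial_integral m) x +
    (pz 0 (taylor_factor m) x * lie_iterate m x + taylor_factor m x * lie_iterate m.+1 x).
  rewrite /= (pzD 0 (wp m) (wdiff_wd (wdiffM (wt m) (wl m)))) (pzD 1 (wp m) (wdiff_wd (wdiffM (wt m) (wl m)))).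
  rewrite (pzM 0 (wt m) (wl m)) (pzM 1 (wt m) (wl m)) (proj2 (pz_taylor_factor m Dx)).
  by move: (pz 0 _ x) (pz 1 _ x) (pz 0 _ x) (pz 0 _ x) (pz 1 _ x) => *; ring.
elim: n => [|n IH]; rewrite E.
  by rewrite !pz_cst mul0r mulr0 !add0r.
by rewrite IH (proj1 (pz_taylor_factor n Dx)) mulNr addrA subrr add0r.
Qed.

(** All factors of positive order vanish at x0. The value 1 makes the first integral a coordinate
    transverse to the leaves. *)
Lemma partial_integral_center n : pz 1 (partial_integral n.+1) x0 = 1.
Proof.
have wt m := sm_wd (proj1 (taylor_factor_hol m)) D0.
have wl m := sm_wd (proj1 (lie_iterate_hol m)) D0.
have wp m := sm_wd (proj1 (partial_integral_hol m)) D0.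
have E m : pz 1 (partial_integral m.+1) x0 = pz 1 (partial_integral m) x0 + taylor_factor m x0 * pz 1 (lie_iterate m) x0.
  rewrite /= (pzD 1 (wp m) (wdiff_wd (wdiffM (wt m) (wl m)))) (pzM 1 (wt m) (wl m)).
  by rewrite (proj2 (pz_taylor_factor m D0)) mul0r add0r.
elim: n => [|n IH]; rewrite E.
  rewrite pz_cst add0r mul1r /= (pzD 1 (sm_wd (sm_coord 1 oD) D0) (sm_wd (sm_cst _ oD) D0)).
  by rewrite pz_coord pz_cst addr0.
by rewrite IH /= subrr oppr0 !mulr0 mul0r addr0.
Qed.

Lemma first_integral : exists (f : V -> C) (rho : R), [/\ 0 < rho, rho <= R0,
  forall x, nV (x - x0) < rho -> exists a, wdiff f x a (fun=> 0) /\ a 0 + s x * a 1 = 0 &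
  pz 1 f x0 = 1].
Proof.
(* Then (rho K)^n <= q^n q^n: one factor gives geometric convergence, the other absorbs the n + 1
   that the iterate of order n + 1 brings into [termX]. *)
pose rho := Num.min (r / 2) ((4 * K)^-1).
have rho0 : 0 < rho by rewrite lt_min divr_gt0 //= invr_gt0 mulr_gt0.
have rhoK : rho * K <= 4^-1.
  rewrite -ler_pdivlMr // (_ : 4^-1 / K = (4 * K)^-1); last by move: (K) => k; rewrite invfM.
  by rewrite /rho ge_min lexx orbT.
have rho_r : rho <= r / 2 by rewrite /rho ge_min lexx.
have DR x : nV (x - x0) < rho -> D x.
  by move=> h; rewrite /=; apply: lt_trans h _; apply: le_lt_trans rho_r _; move: r0 rR0; lra.
have q2 n : (rho * K) ^+ n <= q ^+ n * q ^+ n.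
  have h1 : rho * K <= q * q by apply: le_trans rhoK _; rewrite -invfM -natrM.
  have h2 : 0 <= rho * K by rewrite ltW // mulr_gt0.
  by rewrite -exprMn; apply: lerXn2r => //; rewrite nnegrE // (le_trans h2).
have term n x : nV (x - x0) < rho -> nC (taylor_factor n x * lie_iterate n x) <= r * q ^+ n.
  move=> hx; rewrite nCM.
  have h1 := taylor_factor_bound n (ltW hx).
  have h2 := lie_iterate_bound n (ltW (lt_le_trans hx rho_r)).
  have h3 := ler_pM (mulr_ge0 (nC_ge0 _) (ler0n R n`!)) (ltW (exprn_gt0 n K0)) h1 (lexx (K ^+ n)).
  rewrite -exprMn in h3; have {}h3 := le_trans h3 (q2 n).
  have q1 : q ^+ n <= 1 by rewrite exprn_ile1 // ?invr_ge0 // invf_le1 // ler1n.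
  apply: le_trans (ler_wpM2l (nC_ge0 _) h2) _.
  have -> : nC (taylor_factor n x) * (r * K ^+ n * (n`!)%:R) = r * (nC (taylor_factor n x) * (n`!)%:R * K ^+ n).
    by move: (nC _) (r) (K ^+ n) => *; ring.
  apply: (ler_wpM2l (ltW r0)); apply: le_trans h3 _; rewrite -[X in _ <= X]mulr1.
  by apply: ler_wpM2l => //; rewrite ltW // half_pow_gt0.
have termX n x : nV (x - x0) < rho -> nC (taylor_factor n x * lie_iterate n.+1 x) <= r * K * q ^+ n.
  move=> hx; rewrite nCM.
  have h1 := taylor_factor_bound n (ltW hx).
  have h2 := lie_iterate_bound n.+1 (ltW (lt_le_trans hx rho_r)).
  have h3 := ler_pM (mulr_ge0 (nC_ge0 _) (ler0n R n`!)) (ltW (exprn_gt0 n K0)) h1 (lexx (K ^+ n)).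
  rewrite -exprMn in h3; have {}h3 := le_trans h3 (q2 n).
  have q1 : n.+1%:R * q ^+ n <= 1.
    by rewrite exprVn ler_pdivrMr ?exprn_gt0 // mul1r -natrX ler_nat ltn_expl.
  apply: le_trans (ler_wpM2l (nC_ge0 _) h2) _.
  rewrite factS natrM exprS.
  have -> : nC (taylor_factor n x) * (r * (K * K ^+ n) * (n.+1%:R * (n`!)%:R)) =
      r * K * (n.+1%:R * (nC (taylor_factor n x) * (n`!)%:R * K ^+ n)).
    by move: (nC _) (r) (K ^+ n) (K) => *; ring.
  apply: (ler_wpM2l (ltW (mulr_gt0 r0 K0))); apply: le_trans (ler_wpM2l (ler0n _ _) h3) _.
  by rewrite mulrA -[X in _ <= X]mul1r; apply: ler_wpM2r => //; rewrite ltW // half_pow_gt0.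
have oB := @ball_open R x0 rho.
have hF n : hol [set x | nV (x - x0) < rho] (partial_integral n).
  have [h1 h2] := partial_integral_hol n; split; first by apply: sm_sub h1 => x /DR.
  by move=> mu x /DR; exact: h2.
have [n x hx|f [hf [K' hK]]] := weierstrass rho0 hF (c := r).
  by rewrite /= addrC addKr; exact: term.
(* [weierstrass] provides the derivatives of the limit on the half ball. *)
exists f, (rho / 2); split.
- by rewrite divr_gt0.
- by move: rho0 rho_r r0 rR0; move: (rho) => *; lra.
- move=> x hx; have [a [wa ha]] := hK x hx; exists a; split=> //.
  have hx' : nV (x - x0) < rho by apply: lt_trans hx _; move: rho0; move: (rho) => *; lra.
  apply/eqP; rewrite -nC_eq0 eq_le nC_ge0 andbT.
  apply/ler_addgt0Pr => e e0; rewrite add0r.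
  have [n hn] := half_pow_small (K' * (1 + S) + 2 * (r * K)) e0.
  have E := partial_integral_derivative n (DR _ hx').
  have -> : a 0 + s x * a 1 = (a 0 - pz 0 (partial_integral n.+1) x) +
     s x * (a 1 - pz 1 (partial_integral n.+1) x) + taylor_factor n x * lie_iterate n.+1 x.
    by rewrite -E; ring.
  apply: le_trans (nC_triangle _ _) _; apply: le_trans (lerD (nC_triangle _ _) (termX n x hx')) _.
  rewrite nCM; have h0 := ha n.+1 0; have h1 := ha n.+1 1.
  have h2 := ler_pM (nC_ge0 _) (nC_ge0 _) (s_bound (DR _ hx')) h1.
  have {hn} := ltW (hn n.+1 (leqnSn n)) => hn.
  apply: le_trans (lerD (lerD h0 h2) (lexx _)) _.
  have -> : q ^+ n = 2 * q ^+ n.+1 by rewrite exprS mulrA mulfV ?mul1r.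
  apply: le_trans hn; rewrite le_eqVlt; apply/orP; left; apply/eqP.
  by move: (r) (K) (q ^+ n.+1) => *; ring.
have [a [wa ha]] := hK x0 (ltac:(by rewrite subrr nV0 divr_gt0)).
rewrite (wdiff_pz 1 wa); apply/eqP; rewrite -subr_eq0 -nC_eq0 eq_le nC_ge0 andbT.
apply/ler_addgt0Pr => e e0; rewrite add0r.
have [n hn] := half_pow_small K' e0.
have := ha n.+1 1; rewrite partial_integral_center => h.
by apply: le_trans h _; apply: ltW; apply: hn.
Qed.

End FirstIntegral.

(** * Straightening the leaves *)

Section Straightening.
Context {R : realType} {M : topologicalType}.
Local Notation C := R[i].
Local Notation V := 'rV[R[i]]_2.
Variables (A : set (chart R M)) (rho : M -> R).
Hypothesis surfaceM : complex_surface A.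
Hypothesis rho_continuous : continuous rho.
Hypothesis rho_smooth : smooth_fun A (Mstar rho) rho.
Hypothesis drho : forall p, Mstar rho p -> nonzero_differential A rho p.
Hypothesis Mstar_nonempty : Mstar rho !=set0.
Hypothesis rho_psh : psh A rho.
Hypothesis u_monge_ampere : ddc_square_zero A (Mstar rho) (fun p => ln (rho p)).
Hypothesis rho_finite_type : forall c : R, 0 < c -> finite_type A [set p | rho p = c].
Variable Z : chart R M -> M -> V.
Hypothesis Z_gradient : extended_gradient A rho Z.
Implicit Types (phi psi : chart R M) (p q : M) (v w x y : V).

Local Notation star := (star rho).
Local Notation zc := (zc Z).

Let zsm phi mu : A phi -> sm (star phi) (zc phi mu).
Proof. by move=> Aphi; exact: (zc_sm rho_continuous Z_gradient). Qed.

Let zanti phi (Aphi : A phi) mu x : star phi x -> dZb (zc phi) (zc phi mu) x = 0.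
Proof.
exact: (gradient_antiholomorphic surfaceM rho_continuous rho_smooth drho Mstar_nonempty
  rho_psh u_monge_ampere rho_finite_type Z_gradient mu Aphi).
Qed.

Let zneq phi (Aphi : A phi) x : star phi x -> zc phi 0 x != 0 \/ zc phi 1 x != 0.
Proof.
exact: (gradient_neq0 surfaceM rho_continuous rho_smooth drho Mstar_nonempty
  rho_psh u_monge_ampere rho_finite_type Z_gradient Aphi).
Qed.

Let sopen phi : open (star phi). Proof. exact: star_open. Qed.

Hypothesis rho_exhaustion : exhaustion rho.

(** With e = (- Z^2, Z^1), the row e . dbar Z pairs to zero with conj(Z) by [zanti] and with e by
    [beltrami_eq0]. These two vectors form a basis, so the row vanishes, which is the claim. *)
Lemma dzb_slope phi x nu : A phi -> star phi x ->
  pb nu (zc phi 1) x * zc phi 0 x = zc phi 1 x * pb nu (zc phi 0) x.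
Proof.
move=> Aphi hx; have n0 := lt0r_neq0 (normz_gt0 (zneq Aphi) hx).
have := beltrami_eq0 surfaceM rho_continuous rho_smooth drho Mstar_nonempty
  rho_psh u_monge_ampere rho_finite_type Z_gradient rho_exhaustion Aphi hx.
rewrite /beltrami => /eqP; rewrite mulf_eq0 invr_eq0 (negPf n0) orbF => /eqP.
have h0 := zanti Aphi 0 hx; have h1 := zanti Aphi 1 hx.
move: n0 h0 h1; rewrite /twist /normz /dZb.
have -> : pb nu (zc phi 1) x = if nu == 0 then pb 0 (zc phi 1) x else pb 1 (zc phi 1) x by elim/I2_ind: nu.
have -> : pb nu (zc phi 0) x = if nu == 0 then pb 0 (zc phi 0) x else pb 1 (zc phi 0) x by elim/I2_ind: nu.
move: (pb 0 (zc phi 0) x) (pb 1 (zc phi 0) x) (pb 0 (zc phi 1) x) (pb 1 (zc phi 1) x) => B00 B01 B10 B11.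
move: (zc phi 0 x) (zc phi 1 x) => z0 z1; move: (z0^* : C) (z1^* : C) => c0 c1 n0 h0 h1 tw.
have P0 : (z1 * B00 - z0 * B10) = 0.
  apply: (mulIf n0); rewrite mul0r.
  transitivity (c1 * (z1 * (z1 * B00 - z0 * B01) - z0 * (z1 * B10 - z0 * B11)) +
    z0 * z1 * (c0 * B00 + c1 * B01) - z0 * z0 * (c0 * B10 + c1 * B11)); first by ring.
  by rewrite tw h0 h1 !mulr0 addr0 subr0.
have P1 : (z1 * B01 - z0 * B11) = 0.
  apply: (mulIf n0); rewrite mul0r.
  transitivity (- c0 * (z1 * (z1 * B00 - z0 * B01) - z0 * (z1 * B10 - z0 * B11)) +
    z1 * z1 * (c0 * B00 + c1 * B01) - z0 * z1 * (c0 * B10 + c1 * B11)); first by ring.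
  by rewrite tw h0 h1 !mulr0 addr0 subr0.
case: (nu == 0); apply/eqP; rewrite eq_sym -subr_eq0; apply/eqP; [rewrite -[RHS]P0|rewrite -[RHS]P1]; ring.
Qed.

Lemma slope_hol phi (D : set V) : A phi -> open D -> D `<=` star phi ->
  (forall x, D x -> zc phi 0 x != 0) -> hol D (fun x => zc phi 1 x * (zc phi 0 x)^-1).
Proof.
move=> Aphi oD Dstar nz.
have s0 := sm_sub Dstar (zsm 0 Aphi); have s1 := sm_sub Dstar (zsm 1 Aphi).
have sV := smV oD nz s0.
split=> [|mu x Dx]; first exact: smM.
rewrite (pbM mu (sm_wd s1 Dx) (sm_wd sV Dx)) (pbV mu (nz x Dx) (sm_wd s0 Dx)).
have := dzb_slope mu Aphi (Dstar x Dx); have := nz x Dx.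
move: (pb mu (zc phi 1) x) (pb mu (zc phi 0) x) (zc phi 0 x) (zc phi 1 x) => b1 b0 z0 z1 n0 h.
transitivity ((b1 * z0 - z1 * b0) / z0 ^+ 2); first by field.
by rewrite h subrr mul0r.
Qed.

Lemma field_in_chart phi psi p (g : V -> C) a i : A phi -> A psi -> dom phi p -> dom psi p ->
  Mstar rho p -> wdiff g (phi p) a (fun=> 0) ->
  (forall q, dom phi q -> dom psi q -> psi q 0 i = g (phi q)) ->
  zc psi i (psi p) = a 0 * zc phi 0 (phi p) + a 1 * zc phi 1 (phi p).
Proof.
move=> Aphi Apsi hp hq sp wg hg.
have Ox := overlapP hp hq sp; have oO := @overlap_open _ _ _ rho_continuous phi psi.
have /openV_P/(_ _ Ox)[d d0 hd] := oO.
have w : wdiff (fun y => transition phi psi y 0 i) (phi p) a (fun=> 0).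
  apply: wdiff_near wg; exists d => // y /hd[q [h1 [h2 _]] <-].
  by rewrite transitionE // hg.
rewrite -(transitionE psi hp) (field_transition surfaceM Z_gradient i Aphi Apsi Ox).
by rewrite (wdiff_pz 0 w) (wdiff_pz 1 w).
Qed.

Lemma transverse_chart p : Mstar rho p ->
  exists phi, [/\ A phi, dom phi p & zc phi 0 (phi p) != 0].
Proof.
move=> sp; have [phi Aphi hp] := atlas_cover surfaceM p.
have hx : star phi (phi p) by exists p.
have [h|h] := zneq Aphi hx; first by exists phi.
have [psi [Apsi dpsi epsi]] := swap_chart surfaceM Aphi.
have hq : dom psi p by apply/dpsi.
exists psi; split=> //.
rewrite (field_in_chart (a := fun mu => (1 == mu)%:R) (i := 0) Aphi Apsi hp hq sp (wdiff_coord 1 (phi p))).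
  by rewrite /= mul0r add0r mul1r.
by move=> q _ hq'; rewrite epsi vec0.
Qed.

Lemma lipschitz_vertical (e : V -> C) x y : x 0 0 = y 0 0 ->
  (forall t : R, 0 <= t <= 1 -> wd e (x + t%:C%C *: (y - x)) /\
     pb 1 e (x + t%:C%C *: (y - x)) = 0 /\ nC (pz 1 e (x + t%:C%C *: (y - x))) <= 4^-1) ->
  nC (e x - e y) <= 2^-1 * nC (x 0 1 - y 0 1).
Proof.
move=> xy h; have v0 : (y - x) 0 0 = 0 by rewrite subVE xy subrr.
have der (t : R) : 0 <= t <= 1 -> rderivable e (y - x) (x + t%:C%C *: (y - x)) /\
    nC (rderive e (y - x) (x + t%:C%C *: (y - x)) - 0) <= 4^-1 * nC (x 0 1 - y 0 1).
  move=> ht; have [w [b1 p1]] := h t ht; split; first exact: wdiff_rderivable w.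
  rewrite subr0 (wdiff_rderive _ w) /rlin v0 b1 conjC0 !mulr0 mul0r !addr0 add0r nCM.
  by rewrite subVE (nC_sub (y 0 1)); apply: ler_wpM2r => //; exact: nC_ge0.
have := mean_value_ineq ler01 der.
have -> : x + (1 : R)%:C%C *: (y - x) = y by rewrite scale1r addrC subrK.
have -> : x + (0 : R)%:C%C *: (y - x) = x by rewrite scale0r addr0.
rewrite mulr0 subr0 subr0 mulr1 nC_sub mulrA.
by rewrite (_ : 2 * 4^-1 = 2^-1 :> R) //; field.
Qed.

(** For e = f - z_2, with f a first integral, the graph map is (z_1, f). As d_2 f = 1 at x0, d_2 e
    is small nearby, and [graph_chart] puts this map in the atlas. *)
Lemma straight_chart p : Mstar rho p -> exists psi (eta : R),
  [/\ [/\ A psi, dom psi p & dom psi `<=` Mstar rho], 0 < eta,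
      psi @` dom psi = [set y | nV (y - psi p) < eta] &
      forall q, dom psi q -> zc psi 1 (psi q) = 0 /\ zc psi 0 (psi q) != 0].
Proof.
move=> sp; have [phi [Aphi hp z0]] := transverse_chart sp.
set x0 := phi p; have hx : star phi x0 by exists p.
have zs mu x : star phi x -> {for x, continuous (zc phi mu)} by exact: sm_cts (zsm mu Aphi).
have ncz : 0 < nC (zc phi 0 x0) by rewrite nC_gt0.
have /openV_P/(_ _ hx)[d1 d10 hd1] := @sopen phi.
have /continuousC_P/(_ _ ncz)[d2 d20 hd2] := zs 0 x0 hx.
have nz x : nV (x - x0) < d2 -> zc phi 0 x != 0.
  by move=> /hd2 h; apply: contraTneq h => ->; rewrite sub0r nCN ltxx.
pose s x := zc phi 1 x * (zc phi 0 x)^-1.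
pose d := Num.min d1 d2; have d0 : 0 < d by rewrite lt_min d10.
have dd1 x : nV (x - x0) < d -> star phi x by rewrite lt_min => /andP[/hd1].
have dd2 x : nV (x - x0) < d -> zc phi 0 x != 0 by rewrite lt_min => /andP[_ /nz].
have s_hol := slope_hol Aphi (@ball_open R x0 d) dd1 dd2.
have sx0 : {for x0, continuous s} by apply: (sm_cts (proj1 s_hol)); rewrite /= subrr nV0.
have /continuousC_P/(_ 1 ltr01)[d3 d30 hd3] := sx0.
pose R0 := Num.min d d3; have R00 : 0 < R0 by rewrite lt_min d0.
have R0d x : nV (x - x0) < R0 -> nV (x - x0) < d by rewrite lt_min => /andP[].
have s_hol' : hol [set x | nV (x - x0) < R0] s.
  have [h1 h2] := s_hol; split; first by apply: sm_sub h1 => x /R0d.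
  by move=> mu x /R0d; exact: h2.
have s_bound x : nV (x - x0) < R0 -> nC (s x) <= nC (s x0) + 1.
  rewrite lt_min => /andP[_ /hd3 h]; rewrite -(subrK (s x0) (s x)) addrC.
  by apply: le_trans (nC_triangle _ _) _; rewrite lerD2l ltW.
have [f [r [r0 rR0 hf fc]]] := first_integral R00 s_hol' s_bound.
have oB := @ball_open R x0 r.
(* [first_integral] gives complex differentiability only; Goursat's theorem makes the derivative of
   e continuous, hence small near x0. *)
have f_hol : hol [set x | nV (x - x0) < r] f.
  apply: (goursat_hol surfaceM rho_continuous rho_smooth drho Mstar_nonempty oB).
  by move=> x /hf[a [wa _]]; exists a.
pose e x := f x - x 0 1.
have e_wd x : nV (x - x0) < r -> exists a, wdiff e x a (fun=> 0) /\ a 0 + 1 * (s x * (a 1 + 1)) = 0.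
  move=> /hf[a [wa ha]]; exists (fun i => a i - (1 == i)%:R); split.
    by apply: (wdiff_eq (wdiffD wa (wdiffN (wdiff_coord 1 x)))) => // i; rewrite oppr0 addr0.
  by rewrite /= subr0 subrK mul1r.
have e_sm : sm [set x | nV (x - x0) < r] e.
  by apply: (smB oB) (proj1 f_hol) _; exact: sm_coord.
have x0r : [set x | nV (x - x0) < r] x0 by rewrite /= subrr nV0.
have e1 : pz 1 e x0 = 0.
  have w1 := sm_wd (proj1 f_hol) x0r; have w2 := wdiff_coord 1 x0.
  by rewrite (wdiff_pz 1 (wdiffD w1 (wdiffN w2))) /= fc subrr.
(* The mean value inequality doubles 1/4 to the Lipschitz constant 1/2 that [graph_chart]
   requires. *)
have c4 : 0 < 4^-1 :> R by rewrite invr_gt0.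
have /continuousC_P/(_ _ c4)[d4 d40 hd4] := sm_cts (sm_pz 1 e_sm) x0r.
have [d5 d50 hd5] := chart_ball hp (filterT : nbhs p setT).
pose r' := Num.min (Num.min r d4) d5.
have r'0 : 0 < r' by rewrite !lt_min r0 d40.
have r'P x : nV (x - x0) < r' -> [/\ nV (x - x0) < r, nV (x - x0) < d4 & nV (x - x0) < d5].
  by rewrite !lt_min => /andP[/andP[-> ->] ->].
have convex x y (t : R) : 0 <= t <= 1 -> nV (x - x0) < r' -> nV (y - x0) < r' ->
    nV (x + t%:C%C *: (y - x) - x0) < r'.
  move=> /andP[t0 t1] hx' hy'.
  have -> : x + t%:C%C *: (y - x) - x0 = (1 - t)%:C%C *: (x - x0) + t%:C%C *: (y - x0).
    by apply/rowP => i; rewrite !mxE rcD rcN; ring.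
  apply: le_lt_trans (nV_triangle _ _) _; rewrite !nVZ !nC_real !ger0_norm ?subr_ge0 //.
  have t1' : 0 <= 1 - t by rewrite subr_ge0.
  have mr : Num.max (nV (x - x0)) (nV (y - x0)) < r' by rewrite gt_max hx'.
  apply: le_lt_trans mr; set m := Num.max _ _.
  have h1 : nV (x - x0) <= m by rewrite le_max lexx.
  have h2 : nV (y - x0) <= m by rewrite le_max lexx orbT.
  apply: le_trans (lerD (ler_wpM2l t1' h1) (ler_wpM2l t0 h2)) _.
  by rewrite -mulrDl subrK mul1r.
have lip x y : nV (x - x0) < r' -> nV (y - x0) < r' -> x 0 0 = y 0 0 ->
    nC (e x - e y) <= 2^-1 * nC (x 0 1 - y 0 1).
  move=> hx' hy' xy; apply: (lipschitz_vertical xy) => t ht.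
  have [k1 k2 k3] := r'P _ (convex x y t ht hx' hy').
  have [a [wa _]] := e_wd _ k1.
  split; first exact: wdiff_wd wa; rewrite (wdiff_pb 1 wa); split=> //.
  by apply: ltW; have := hd4 _ k2; rewrite e1 subr0.
have img x : nV (x - x0) < r' -> (phi @` dom phi) x.
  by move=> /r'P[_ _ /hd5[q [h1 h2 _ _]]]; exists q.
have ew x : nV (x - x0) < r' -> exists a, wdiff e x a (fun=> 0).
  by move=> /r'P[/e_wd[a [wa _]] _ _]; exists a.
have [psi [eta [[Apsi hq] eta0 hsub hpsi him]]] := graph_chart surfaceM Aphi hp r'0 img ew lip.
have inM q : dom psi q -> Mstar rho q.
  move=> /hsub[hq1 /r'P[k1 _ _]]; have := dd1 _ (R0d _ (lt_le_trans k1 rR0)).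
  by move=> [q' [h1 h2] eq]; rewrite -(coordK hq1) -eq coordK.
exists psi, eta; split=> // q hq'; have [hq1 /r'P[k1 _ _]] := hsub q hq'.
have sq := inM q hq'.
have F0 : zc psi 0 (psi q) = zc phi 0 (phi q).
  rewrite (field_in_chart (a := fun mu => (0 == mu)%:R) (i := 0) Aphi Apsi hq1 hq' sq (wdiff_coord 0 (phi q))).
    by rewrite /= mul1r mul0r addr0.
  by move=> q' _ _; rewrite hpsi graph_map0.
have [a [wa ha]] := hf _ k1.
(* In the new chart the second component of Z is Z f, that is [zc phi 0] times a 0 + s a 1, which
   vanishes for a first integral. *)
have F1 : zc psi 1 (psi q) = a 0 * zc phi 0 (phi q) + a 1 * zc phi 1 (phi q).
  apply: (field_in_chart (i := 1) Aphi Apsi hq1 hq' sq wa) => q' _ _.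
  by rewrite hpsi graph_map1 /e addrC subrK.
have nzq := dd2 _ (R0d _ (lt_le_trans k1 rR0)).
rewrite F0 F1; split=> //; move: ha nzq; rewrite /s.
move: (a 0) (a 1) (zc phi 0 (phi q)) (zc phi 1 (phi q)) => a0 a1 y0 y1 ha ny.
by rewrite -[RHS](mul0r y0) -ha; field.
Qed.

End Straightening.

(** * The leaves inside a straight chart *)

Section Leaves.
Context {R : realType} {M : topologicalType}.
Local Notation C := R[i].
Local Notation V := 'rV[R[i]]_2.
Variables (A : set (chart R M)) (U : set M) (Z : chart R M -> M -> V).
Hypothesis surfaceM : complex_surface A.
Hypothesis Z_field : vector_field10 A U Z.
Implicit Types (phi psi : chart R M) (p q : M).

Lemma derivable_eps (f : R -> R) (t : R) : derivable f t 1 -> forall e : R, 0 < e ->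
  exists2 d : R, 0 < d & forall s, `|s| < d -> `|f (t + s) - f t - s * 'D_1 f t| <= e * `|s|.
Proof.
move=> df e e0; have : h^-1 *: (f (h *: 1 + t) - f t) @[h --> 0^'] --> 'D_1 f t by exact: df.
move/cvgrPdist_lt => /(_ e e0) /= h.
have [d /= d0 hd] := h; exists d => // s sd.
have [->|s0] := eqVneq s 0; first by rewrite addr0 subrr mul0r subr0 normr0 mulr0.
have := hd s; rewrite /= sub0r normrN => /(_ sd s0).
rewrite /GRing.scale /= mulr1 (addrC s) => k.
rewrite (_ : _ - _ - _ = - s * ('D_1 f t - s^-1 * (f (t + s) - f t))); last by field.
by rewrite normrM normrN [e * _]mulrC; apply: ler_wpM2l => //; exact: ltW.
Qed.

(** A tangent curve is parametrised by all of R and must never leave the chart, so a segment cannot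
    be traversed affinely. The square of sin(pi t / 2) goes from 0 to 1 and stays in between at all
    times. *)
Lemma interpolation : exists tau tau' : R -> R, [/\ tau 0 = 0, tau 1 = 1,
  forall t, 0 <= tau t <= 1 &
  forall t (e : R), 0 < e -> exists2 d : R, 0 < d & forall s, `|s| < d ->
    `|tau (t + s) - tau t - s * tau' t| <= e * `|s|].
Proof.
pose tau (t : R) : R := sin (pi / 2 * t) * sin (pi / 2 * t).
exists tau, (fun t => 'D_1 tau t); split.
- by rewrite /tau mulr0 sin0 mulr0.
- by rewrite /tau mulr1 sin_pihalf mulr1.
- move=> t; rewrite /tau -expr2 sqr_ge0 /= .
  by have := cos2Dsin2 (pi / 2 * t); have := sqr_ge0 (cos (pi / 2 * t)); lra.
move=> t; apply: derivable_eps; rewrite /tau.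
have d1 : derivable (fun t : R => sin (pi / 2 * t)) t 1.
  have l : is_derive t 1 (fun t : R => pi / 2 * t) (pi / 2).
    have := is_deriveM (is_derive_cst (pi / 2 : R) t 1) (is_derive_id t (1 : R)).
    by rewrite /GRing.scale /= mulr0 addr0 mulr1.
  by have [] := is_derive1_comp (f := @sin R) (g := fun t => pi / 2 * t) (is_derive_sin _) l.
exact: derivableM.
Qed.

Lemma rvelocity_eps phi (gamma : R -> M) t (w : V) :
  (s^-1)%:C%C *: (phi (gamma (t + s)) - phi (gamma t)) @[s --> (0 : R)^'] --> w <->
  forall e : R, 0 < e -> exists2 d : R, 0 < d & forall s, s != 0 -> `|s| < d ->
    nV ((s^-1)%:C%C *: (phi (gamma (t + s)) - phi (gamma t)) - w) < e.
Proof.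
split=> [h e e0|h P /nbhsV_P[e e0 eP]].
  have : nbhs w [set y | nV (y - w) < e] by apply/nbhsV_P; exists e.
  move/h => [d /= d0 hd]; exists d => // s s0 sd.
  by apply: hd => //=; rewrite sub0r normrN.
have [d d0 hd] := h e e0; exists d => // s /=; rewrite sub0r normrN => sd s0.
by apply: eP; exact: hd.
Qed.

Lemma wdiff_along (g : V -> C) (x w : V) a (D : R -> R) (k : R) : wdiff g x a (fun=> 0) ->
  (forall e : R, 0 < e -> exists2 d : R, 0 < d & forall s, `|s| < d -> `|D s - s * k| <= e * `|s|) ->
  forall e : R, 0 < e -> exists2 d : R, 0 < d & forall s, s != 0 -> `|s| < d ->
    nC ((s^-1)%:C%C * (g (x + (D s)%:C%C *: w) - g x) - k%:C%C * rlin a (fun=> 0) w) < e.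
Proof.
move=> wd hD e e0; set l := rlin a (fun=> 0) w.
have lD (r : R) : rlin a (fun=> 0) (r%:C%C *: w) = r%:C%C * l.
  by rewrite /l /rlin !mul0r !addr0 !mxE; ring.
pose N := nC l + nV w * (1 + `|k|) + 1.
have N1 : 0 < N.
  by rewrite ltr_wpDl // addr_ge0 ?nC_ge0 // mulr_ge0 ?nV_ge0 // addr_ge0.
have eN : 0 < e / N by rewrite divr_gt0.
have k0 : 0 < (1 + `|k|) * (nV w + 1) by rewrite mulr_gt0 // ltr_wpDl // nV_ge0.
have [d1 d10 hd1] := wd _ eN; have [d2 d20 hd2] := hD _ eN; have [d3 d30 hd3] := hD 1 ltr01.
exists (Num.min (Num.min d2 d3) (d1 / ((1 + `|k|) * (nV w + 1)))).
  by rewrite !lt_min d20 d30 divr_gt0.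
move=> s s0; rewrite !lt_min => /andP[/andP[/hd2 h2 /hd3 h3]]; rewrite ltr_pdivlMr // => h4.
have sp : 0 < `|s| by rewrite normr_gt0.
have Dle : `|D s| <= (1 + `|k|) * `|s|.
  rewrite -(subrK (s * k) (D s)); apply: le_trans (ler_normD _ _) _.
  by rewrite mulrDl normrM [`|s| * _]mulrC; apply: lerD.
have Dw : nV ((D s)%:C%C *: w) <= (1 + `|k|) * `|s| * nV w.
  by rewrite nVZ nC_real; apply: ler_wpM2r => //; exact: nV_ge0.
have small : (1 + `|k|) * `|s| * nV w < d1.
  apply: le_lt_trans h4; rewrite -subr_ge0 [X in 0 <= X](_ : _ = (1 + `|k|) * `|s|); last by ring.
  by rewrite mulr_ge0 // addr_ge0.
have := hd1 _ (le_lt_trans Dw small); rewrite lD => h1.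
have {}h1 := le_trans h1 (ler_wpM2l (ltW eN) Dw).
have -> : (s^-1)%:C%C * (g (x + (D s)%:C%C *: w) - g x) - k%:C%C * l =
   (s^-1)%:C%C * (g (x + (D s)%:C%C *: w) - g x - (D s)%:C%C * l) + (s^-1 * (D s - s * k))%:C%C * l.
  have sk : s^-1 * (D s - s * k) = s^-1 * D s - k by field.
  by rewrite sk rcD rcN rcM; move: (g _) (g _) => *; ring.
apply: le_lt_trans (nC_triangle _ _) _; rewrite !nCM !nC_real normrM normfV.
have sV : 0 <= `|s|^-1 by rewrite invr_ge0.
have b1 : `|s|^-1 * nC (g (x + (D s)%:C%C *: w) - g x - (D s)%:C%C * l) <= e / N * (nV w * (1 + `|k|)).
  apply: le_trans (ler_wpM2l sV h1) _.
  by rewrite le_eqVlt; apply/orP; left; apply/eqP; field; rewrite !gt_eqF.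
have b2 : `|s|^-1 * `|D s - s * k| * nC l <= e / N * nC l.
  apply: ler_wpM2r; first exact: nC_ge0.
  by rewrite mulrC ler_pdivrMr.
apply: le_lt_trans (lerD b1 b2) _; rewrite -mulrDr mulrAC ltr_pdivrMr // ltr_pM2l //.
by rewrite /N addrC ltrDl.
Qed.

Variables (psi : chart R M) (eta : R) (p0 : M).
Hypotheses (Apsi : A psi) (psiU : dom psi `<=` U).
Hypothesis psi_image : psi @` dom psi = [set y | nV (y - psi p0) < eta].
Hypothesis Z_straight : forall q, dom psi q -> Z psi q 0 1 = 0 /\ Z psi q 0 0 != 0.

(** The velocity is a multiple of Z, whose second component is zero, so the second coordinate has
    derivative zero at every time. *)
Lemma leaf_sub q q' : leaf A Z (dom psi) q q' -> dom psi q' /\ psi q' 0 1 = psi q 0 1.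
Proof.
move=> [gamma [[_ tan] indom <- <-]]; split; first exact: indom.
pose g t := psi (gamma t) 0 1.
have ge (t e : R) : 0 < e -> exists2 d : R, 0 < d & forall s, s != 0 -> `|s| < d ->
    nC ((s^-1)%:C%C * (g (t + s) - g t)) < e.
  move=> e0; have [l /rvelocity_eps/(_ e e0)[d d0 hd]] := tan t psi Apsi (indom t).
  exists d => // s s0 sd; have := hd s s0 sd; rewrite nV_lt => /andP[_].
  by rewrite !mxE (proj1 (Z_straight (indom t))) mulr0 subr0.
have reM (r : R) (z : C) : complex.Re (r%:C%C * z) = r * complex.Re z.
  by case: z => a b /=; rewrite mul0r subr0.
have imM (r : R) (z : C) : complex.Im (r%:C%C * z) = r * complex.Im z.
  by case: z => a b /=; rewrite mul0r addr0.
have reB (a b : C) : complex.Re (a - b) = complex.Re a - complex.Re b by case: a b => ? ? [].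
have imB (a b : C) : complex.Im (a - b) = complex.Im a - complex.Im b by case: a b => ? ? [].
have r0 (t : R) : is_derive t 1 (fun t => complex.Re (g t)) 0.
  apply: is_derive_eps => e e0; have [d d0 hd] := ge t e e0; exists d => // s s0 sd.
  by rewrite subr0 -reB -reM; apply: le_lt_trans (Re_le_nC _) (hd s s0 sd).
have i0 (t : R) : is_derive t 1 (fun t => complex.Im (g t)) 0.
  apply: is_derive_eps => e e0; have [d d0 hd] := ge t e e0; exists d => // s s0 sd.
  by rewrite subr0 -imB -imM; apply: le_lt_trans (Im_le_nC _) (hd s s0 sd).
have hr := @is_derive_0_is_cst R (fun t => complex.Re (g t)) 1 0 r0.
have hi := @is_derive_0_is_cst R (fun t => complex.Im (g t)) 1 0 i0.
move: hr hi; rewrite -/(g 1) -/(g 0); case: (g 1) (g 0) => a b [c d] /= -> -> //.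
Qed.

(** The image of psi is a ball, so the segment between two points of a plaque stays in the plaque;
    traversed through [interpolation], it is tangent to Z because Z has a nonzero first component
    there. *)
Lemma leaf_sup q q' : dom psi q -> dom psi q' -> psi q' 0 1 = psi q 0 1 ->
  leaf A Z (dom psi) q q'.
Proof.
move=> hq hq' eqq; have [tau [tau' [tau0 tau1 tau01 dtau]]] := interpolation.
pose w : V := psi q' - psi q.
have w1 : w 0 1 = 0 by rewrite subVE eqq subrr.
pose c t : V := psi q + (tau t)%:C%C *: w.
have cin t : (psi @` dom psi) (c t).
  have [/andP[t0 t1]] := tau01 t.
  have qin : nV (psi q - psi p0) < eta.
    by have : (psi @` dom psi) (psi q) by [exists q]; rewrite psi_image.
  have qin' : nV (psi q' - psi p0) < eta.
    by have : (psi @` dom psi) (psi q') by [exists q']; rewrite psi_image.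
  rewrite psi_image /=.
  have -> : c t - psi p0 = (1 - tau t)%:C%C *: (psi q - psi p0) + (tau t)%:C%C *: (psi q' - psi p0).
    by apply/rowP => i; rewrite !mxE rcD rcN; ring.
  apply: le_lt_trans (nV_triangle _ _) _; rewrite !nVZ !nC_real !ger0_norm ?subr_ge0 //.
  have t1' : 0 <= 1 - tau t by rewrite subr_ge0.
  have mr : Num.max (nV (psi q - psi p0)) (nV (psi q' - psi p0)) < eta by rewrite gt_max qin.
  apply: le_lt_trans mr; set m := Num.max _ _.
  have h1 : nV (psi q - psi p0) <= m by rewrite le_max lexx.
  have h2 : nV (psi q' - psi p0) <= m by rewrite le_max lexx orbT.
  apply: le_trans (lerD (ler_wpM2l t1' h1) (ler_wpM2l t0 h2)) _.
  by rewrite -mulrDl subrK mul1r.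
pose gamma t := pt psi (c t).
have gdom t : dom psi (gamma t) /\ psi (gamma t) = c t.
  by have [q1 h1 h2] := cin t; rewrite /gamma -h2 coordK.
have cE t s : c (t + s) = c t + (tau (t + s) - tau t)%:C%C *: w.
  by apply/rowP => i; rewrite !mxE rcD rcN; move: (w 0 i) => z; ring.
have ctau (t e : R) : 0 < e -> exists2 d : R, 0 < d & forall s, `|s| < d ->
    `|tau (t + s) - tau t| < e.
  move=> e0; have [d d0 hd] := dtau t 1 ltr01.
  have k0 : 0 < 1 + `|tau' t| by rewrite ltr_pwDl.
  exists (Num.min d (e / (1 + `|tau' t|))); first by rewrite lt_min d0 divr_gt0.
  move=> s; rewrite lt_min => /andP[/hd h1]; rewrite ltr_pdivlMr // => h2.
  rewrite -(subrK (s * tau' t) (_ - _)); apply: le_lt_trans (ler_normD _ _) _.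
  by apply: le_lt_trans h2; rewrite mulrDr mulr1 normrM; apply: lerD => //; rewrite -[`|s|]mul1r.
have ccts : continuous (c : R -> V).
  move=> t P /nbhsV_P[e e0 eP].
  have k0 : 0 < nV w + 1 by rewrite ltr_wpDl // nV_ge0.
  have [d d0 hd] := ctau t (e / (nV w + 1)) (divr_gt0 e0 k0).
  exists d => //= s sd; apply: eP.
  have -> : s = t + (s - t) by rewrite addrC subrK.
  rewrite cE addrC addKr nVZ nC_real.
  have := hd (s - t); rewrite distrC => /(_ sd); rewrite ltr_pdivlMr // => h.
  by apply: le_lt_trans h; rewrite mulrDr mulr1 lerDl.
exists gamma; split.
- split=> [t|t phi Aphi hphi].
    by apply: continuous_comp; [exact: ccts|apply: pt_cts; exact: cin].
  have [hg eg] := gdom t; have [z1 z0] := Z_straight hg.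
  (* The velocity in psi is tau' w with w along the first axis, and this factor turns Z into it; in
     any other chart both sides are transformed by the differential of the transition map. *)
  exists ((tau' t)%:C%C * w 0 0 / Z psi (gamma t) 0 0).
  have dif : differentiable (transition psi phi) (psi (gamma t)).
    by apply/differentiable_hdiff; exact: (transition_hdiff surfaceM).
  have ZE : ((tau' t)%:C%C * w 0 0 / Z psi (gamma t) 0 0) *: Z phi (gamma t) =
     'd (transition psi phi) (psi (gamma t)) ((tau' t)%:C%C *: w).
    rewrite (Z_field Apsi Aphi (psiU hg) hg hphi) -linearZ; congr ('d _ _ _).
    by apply: rowP2; rewrite [LHS]mxE [RHS]mxE ?z1 ?w1 ?mulr0 // mulfVK.
  apply/rvelocity_eps => e e0; rewrite ZE eg linearZ.
  set L := 'd (transition psi phi) (c t) w.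
  have comp i : exists2 d : R, 0 < d & forall s, s != 0 -> `|s| < d ->
      nC ((s^-1)%:C%C * (phi (gamma (t + s)) 0 i - phi (gamma t) 0 i) - (tau' t)%:C%C * L 0 i) < e.
    have wd := differentiable_wdiff i dif; rewrite eg in wd.
    have [d d0 hd] := @wdiff_along _ _ w _ _ _ wd (dtau t) _ e0; exists d => // s s0 /(hd s s0).
    rewrite -cE /transition -/(gamma _) -/(gamma _); congr (nC (_ - _ * _) < _).
    rewrite /L [in RHS](row_delta w) linearD !linearZ [RHS]mxE [X in _ = X + _]mxE [X in _ = _ + X]mxE.
    by rewrite /rlin !mul0r !addr0 mulrC [X in _ + X]mulrC.
  have [d1 d10 hd1] := comp 0; have [d2 d20 hd2] := comp 1.
  exists (Num.min d1 d2); first by rewrite lt_min d10.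
  move=> s s0; rewrite lt_min => /andP[s1 s2]; rewrite nV_lt.
  have h1 := hd1 s s0 s1; have h2 := hd2 s s0 s2.
  by move: h1 h2; rewrite !mxE => -> ->.
- by move=> t; have [] := gdom t.
- by rewrite /gamma /c tau0 scale0r addr0 coordK.
by rewrite /gamma /c tau1 scale1r /w addrC subrK coordK.
Qed.

End Leaves.

Unset Implicit Arguments.

Theorem theorem2p3 (R : realType) (M : topologicalType)
    (A : set (chart R M)) (rho : M -> R)
    (surfaceM : complex_surface A) (steinM : stein A)
    (rho_continuous : continuous rho)
    (rho_psh : psh A rho)
    (rho_exhaustion : exhaustion rho)
    (rho_smooth : smooth_fun A (Mstar rho) rho)
    (drho_neq0 : forall p, Mstar rho p -> nonzero_differential A rho p)
    (rho_finite_type :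
       forall c : R, 0 < c -> finite_type A [set p | rho p = c])
    (Mstar_connected : connected (Mstar rho))
    (u_monge_ampere :
       ddc_square_zero A (Mstar rho) (fun p => ln (rho p)))
    (Z : chart R M -> M -> 'rV[R[i]]_2)
    (Z_gradient : extended_gradient A rho Z) :
  holomorphic_foliation A (Mstar rho) Z.
Proof.
(* The point p itself provides the chart of M_* on which Goursat's theorem rests. *)
move=> p sp; have Mne : Mstar rho !=set0 by exists p.
have [psi [eta [[Apsi hp sub] _ him hz]]] := straight_chart surfaceM rho_continuous rho_smooth
  drho_neq0 Mne rho_psh u_monge_ampere rho_finite_type Z_gradient rho_exhaustion sp.
have [[Z_field _] _] := Z_gradient.
have straight q : dom psi q -> Z psi q 0 1 = 0 /\ Z psi q 0 0 != 0.
  by move=> hq; rewrite -!zcE //; exact: hz.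
exists psi; split=> // q hq; apply/seteqP; split=> [q'|q' [hq' eqq]].
  exact: (leaf_sub Apsi straight).
exact: (leaf_sup surfaceM Z_field Apsi sub him straight).
Qed.
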